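(* Let $\mathcal X_\infty$ be the infinite Ginibre ensemble and let $U$ be an open subset of $\mathbb D$ which satisfies either (a) there exists a sequence of open sets $U_n$ with $\overline U\subset U_n\subseteq\mathbb D$ for all $n$ such that the balayage measures on $\partial U_n$ converge weakly to the balayage measure on $\partial U$; or (b) the exterior ball condition: there exists $\epsilon>0$ such that for every $z\in\partial U$ there is $\eta\in U^c$ with $B(\eta,\epsilon)\subset U^c$ and $|z-\eta|=\epsilon$. Then $$\lim_{r\to\infty}\frac1{r^4}\log\mathbf P\big[\mathcal X_\infty(rU)=0\big]=R_\emptyset-R_U.$$
   Context: $\mathcal X_\infty$ is the determinantal point process on $\mathbb C$ with kernel $\mathbb K(z,w)=\frac1\pi e^{z\overline w-\frac12|z|^2-\frac12|w|^2}$ w.r.t. Lebesgue measure $m$. $\mathcal X(A)$ is the number of points in $A$; $rU=\{rz:z\in U\}$; $\mathbb D$ open unit disk; $U^c=\mathbb C\setminus U$. For $E\subseteq\mathbb C$, $\mathcal P(E)$ is the set of compactly supported Borel probability measures supported in $E$; $R_\mu=\iint\log\frac1{|z-w|}d\mu(z)d\mu(w)+\int|z|^2d\mu(z)$, $R_U=\inf_{\mu\in\mathcal P(U^c)}R_\mu$, $R_\emptyset=\inf_{\mu\in\mathcal P(\mathbb C)}R_\mu$ $(=3/4)$. A Borel set $B$ is polar if $\iint\log\frac1{|z-w|}d\mu d\mu=+\infty$ for every compactly supported probability $\mu$ supported in $B$. For a bounded open $V$, the balayage measure on $\partial V$ is the unique positive Borel measure $\nu$ on $\partial V$ with $\nu(B)=0$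 for all Borel polar $B$ and $\int\log\frac1{|z-w|}d\nu(w)=\frac1\pi\int_V\log\frac1{|z-w|}dm(w)$ for all $z\in\mathbb C\setminus V$ outside a Borel polar set. *)

(* Defs.v *)
From HB Require Import structures.
From mathcomp Require Import all_boot all_order all_algebra.
From mathcomp Require Import all_classical all_reals all_analysis measurable_realfun.
From mathcomp Require Import complex.
Set Implicit Arguments. Unset Strict Implicit. Unset Printing Implicit Defensive.
Import Order.TTheory GRing.Theory Num.Theory.
Import numFieldNormedType.Exports.
Local Open Scope classical_set_scope.
Local Open Scope ring_scope.

Section Ginibre.
Variable R : realType.

(* The complex plane C is modelled as R * R (Borel sigma-algebra = product
   of the Borel sigma-algebras of R).  cpx turns a point into a complex number. *)
Definition cpx (p : R * R) : R[i] := Complex p.1 p.2.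

Definition cdist (z w : R * R) : R :=
  Num.sqrt ((z.1 - w.1) ^+ 2 + (z.2 - w.2) ^+ 2).
Definition sqmod (z : R * R) : R := z.1 ^+ 2 + z.2 ^+ 2.

Definition leb2 := ((@lebesgue_measure R) \x (@lebesgue_measure R))%E.

(* Ginibre kernel K(z,w) = 1/pi * exp(z conj(w) - |z|^2/2 - |w|^2/2),
   with exp of a complex number written out as e^{Re}(cos Im + i sin Im). *)
Definition ginibreK (z w : R * R) : R[i] :=
  let u := cpx z * conjc (cpx w) in
  let a := complex.Re u - sqmod z / 2 - sqmod w / 2 in
  let b := complex.Im u in
  (Complex (pi^-1 * expR a) 0 * Complex (cos b) (sin b))%R.

(* det [K(x_i, x_j)]_{i,j<k} (real since the matrix is Hermitian). *)
Definition ginibre_corr (k : nat) (x : 'I_k -> R * R) : R :=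
  complex.Re (\det (\matrix_(i < k, j < k) ginibreK (x i) (x j))).

Definition tcons (k : nat) (x : R * R) (y : 'I_k -> R * R) : 'I_k.+1 -> R * R :=
  fun i => match unlift ord0 i with Some j => y j | None => x end.

(* iterated integral  int_{A_0} ... int_{A_{k-1}} F(x_0,...,x_{k-1}) dm(x_{k-1})...dm(x_0)
   (for nonnegative F this is the integral over A_0 x ... x A_{k-1} w.r.t. m^k). *)
Fixpoint iint (k : nat) : (('I_k -> R * R) -> \bar R) -> ('I_k -> set (R * R)) -> \bar R :=
  match k with
  | 0 => fun F _ => F (fun _ => (0, 0))
  | k'.+1 => fun F A =>
      (\int[leb2]_(x in A ord0) iint (fun y => F (tcons x y)) (fun i => A (lift ord0 i)))%E
  end.

Definition bounded2 (A : set (R * R)) : Prop :=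
  exists M : R, forall x, A x -> sqmod x <= M.

Definition npts (S : set (R * R)) (A : set (R * R)) : \bar R :=
  (\esum_(x in S `&` A) 1)%E.

(* A (simple) point process on C given as a random locally finite configuration
   S : Omega -> set C, which is determinantal with the Ginibre kernel K w.r.t.
   Lebesgue measure: for pairwise disjoint bounded Borel sets A_1..A_k,
   E[prod_i X(A_i)] = int_{A_1 x ... x A_k} det[K(x_i,x_j)] dm^k. *)
Definition is_infinite_ginibre (d : measure_display) (Omega : measurableType d)
    (P : probability Omega R) (S : Omega -> set (R * R)) : Prop :=
  [/\ (forall w A, bounded2 A -> finite_set (S w `&` A)),
      (forall A, measurable A -> measurable_fun [set: Omega] (fun w => npts (S w) A : \bar R)) &
      (forall (k : nat) (A : 'I_k -> set (R * R)),
          (forall i, measurable (A i)) -> (forall i, bounded2 (A i)) ->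
          (forall i j, i != j -> A i `&` A j = set0) ->
          (\int[P]_w (\prod_(i < k) npts (S w) (A i)))%E
            = iint (fun x => (ginibre_corr x)%:E) A)].

Definition loginv (z w : R * R) : \bar R :=
  if z == w then +oo%E else (- ln (cdist z w))%:E.

Definition cpt_supported_in (mu : probability (R * R)%type R) (E : set (R * R)) : Prop :=
  exists K, [/\ compact K, K `<=` E & mu (~` K) = 0%E].

Definition log_energy (mu : probability (R * R)%type R) : \bar R :=
  (\int[mu]_z \int[mu]_w loginv z w)%E.

Definition Rmu (mu : probability (R * R)%type R) : \bar R :=
  (log_energy mu + \int[mu]_z (sqmod z)%:E)%E.

Definition RU (U : set (R * R)) : \bar R :=
  ereal_inf [set Rmu mu | mu in [set mu | cpt_supported_in mu (~` U)]].
Definition Rempty : \bar R :=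
  ereal_inf [set Rmu mu | mu in [set mu | cpt_supported_in mu setT]].

Definition polar (B : set (R * R)) : Prop :=
  forall mu : probability (R * R)%type R, cpt_supported_in mu B -> log_energy mu = +oo%E.

Definition bdry (V : set (R * R)) : set (R * R) := closure V `\` interior V.

Definition is_balayage (V : set (R * R)) (nu : {measure set (R * R) -> \bar R}) : Prop :=
  [/\ nu (~` bdry V) = 0%E,
      (forall B, measurable B -> polar B -> nu B = 0%E) &
      exists B, [/\ measurable B, polar B &
        forall z, ~ V z -> ~ B z ->
          (\int[nu]_w loginv z w)%E
          = ((pi^-1)%:E * \int[leb2]_(w in V) loginv z w)%E]].

Definition weak_cvg (nu : nat -> {measure set (R * R) -> \bar R})
    (nu0 : {measure set (R * R) -> \bar R}) : Prop :=
  forall f : R * R -> R, continuous f -> (exists M, forall x, `|f x| <= M) ->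
    ((fun n => \int[nu n]_x (f x)%:E)%E @ \oo --> (\int[nu0]_x (f x)%:E)%E).

Definition unit_disk : set (R * R) := [set z | sqmod z < 1].

Definition scale_set (r : R) (U : set (R * R)) : set (R * R) :=
  [set (r * z.1, r * z.2) | z in U].

Definition open_ball2 (c : R * R) (e : R) : set (R * R) := [set z | cdist c z < e].

Definition elog (x : \bar R) : \bar R :=
  if x == 0%E then -oo%E else (ln (fine x))%:E.

End Ginibre.

(* Main.v *)
Require Import Defs.
From HB Require Import structures.
From mathcomp Require Import all_boot all_order all_algebra fingroup perm.
From mathcomp Require Import all_classical all_reals all_analysis measurable_realfun.
From mathcomp Require Import complex ring lra zify.
Set Implicit Arguments. Unset Strict Implicit. Unset Printing Implicit Defensive.
Import Order.TTheory GRing.Theory Num.Theory.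
Import numFieldNormedType.Exports.
Local Open Scope classical_set_scope.
Local Open Scope ring_scope.

(** Let [phi_k] be the orthonormal functions [z^k e^(-|z|^2/2) / sqrt (pi k!)] and [M_N(A)] the
    Gram matrix of [phi_0, ..., phi_(N-1)] on [A]. Inclusion-exclusion over a fine grid and the
    determinantal structure show that the void probability of [A] is the limit of
    [det (I - M_N(A))], the Gram determinant on the complement of [A]; for [A = rU] with [U] in the
    unit disk, [n] slightly larger than [r^2] already gives it up to a factor 2.
    Such a determinant is bounded below by the squared Vandermonde determinant of any [n] points
    having small disks around them in the complement (mean value property), and above by the
    maximum over all points of the complement (Lagrange interpolation at near-Fekete points), up to
    factors [e^(o(n^2))]. Dividing by the same bounds for [U] empty, where the determinant is 1,
    eliminates the normalisation and leaves the difference of the two minimal energies.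
    A weak limit of discrete configurations bounds the discrete energies below by [RU U]. For the
    converse, points drawn greedily from a nearly optimal measure are moved to circles inside the
    complement. Exterior balls provide room for these circles. In the balayage case, the uniform
    measure on the disk outside [U_n] plus the balayage from [U_n] is the equilibrium measure of
    the complement of [U_n] (its potential is constant off [U_n] and the logarithmic kernel is
    positive definite), its energy depends only on the second moments, and it lives at positive
    distance from [U]. *)

(** * Planar Lebesgue measure *)

(** The speed [r ^+ 4] is the square of the number of points that matter, about [r ^+ 2]. Pair
    energies are of order [n ^+ 2], so every error only has to be [e^(o(n^2))]: factors such as
    [n ^+ n], or a constant per point, are free. The two halves of the limit are not symmetric. A
    limit of configurations avoiding an open set avoids it too, and the kernel is lower
    semicontinuous; this gives the upper bound on the void probability for every open [U] in the
    disk. The lower bound wants points surrounded by disks of the complement, whereas a nearly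
    optimal measure may sit on the boundary of [U]; (a) and (b) are two ways out. Energies are
    computed with [kk], the logarithmic kernel plus a quadratic term. It is nonnegative, so double
    integrals always make sense in [\bar R], and Tonelli, Fatou and monotone convergence apply even
    to measures of infinite energy. Contour integrals are replaced by averages over finitely many
    rotations: Cauchy's estimate, the mean value property, orthogonality and the circular mean of
    the kernel all come from unimodular [w] with [w ^+ n = -1]. *)

Section Plane.
Variable R : realType.
Local Notation TR := (measurableTypeR R).
Local Notation mu := (@lebesgue_measure R).
Local Notation leb2 := (@leb2 R).

(* [leb2] lives on the product of two copies of [measurableTypeR R], whose
   display differs from that of [R * R]; [L2] is the same measure on [R * R]. *)
Definition L2 (A : set (R * R)) : \bar R := leb2 A.
Let L20 : L2 set0 = 0%E. Proof. exact: (measure0 leb2). Qed.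
Let L2_ge0 A : (0 <= L2 A)%E. Proof. exact: (measure_ge0 leb2). Qed.
Let L2_sadd : semi_sigma_additive L2.
Proof. by move=> F mF tF mU; exact: (@measure_semi_sigma_additive _ _ _ leb2 F mF tF mU). Qed.
HB.instance Definition _ := isMeasure.Build _ _ _ L2 L20 L2_ge0 L2_sadd.

Lemma measurable_id_leb2 :
  measurable_fun (setT : set (TR * TR)) (idfun : (TR * TR)%type -> (R * R)%type).
Proof. exact: (@measurable_id _ (TR * TR)%type setT). Qed.

Lemma L2E A : L2 A = leb2 A. Proof. by []. Qed.

Lemma L2_int (A : set (R * R)) (f : R * R -> \bar R) : measurable A ->
  measurable_fun A f -> (forall x, A x -> 0 <= f x)%E ->
  (\int[leb2]_(x in A) f x = \int[L2]_(x in A) f x)%E.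
Proof.
move=> mA mf f0; have /= <- := @ge0_integral_pushforward _ _ _ _ _ _ measurable_id_leb2 leb2 A f mA mf; last first.
  by move=> x; rewrite inE; exact: f0.
pose f' : {mfun (TR * TR)%type >-> (R * R)%type} :=
  HB.pack (idfun : (TR * TR)%type -> (R * R)%type) (isMeasurableFun.Build _ _ _ _ _ measurable_id_leb2).
exact: (@eq_measure_integral _ _ _ _ (pushforward leb2 f') L2).
Qed.

Lemma L2_sigma_finite : sigma_finite setT L2.
Proof.
have /sigma_finiteP[F [TF ndF Foo]] := sigma_finiteT mu.
exists (fun n => F n `*` F n).
  apply/esym/seteqP; split=> // -[x y] _; have : setT x by [].
  rewrite [X in X x]TF => -[n _ Fnx]; have : setT y by [].
  rewrite [X in X y]TF => -[k _ Fky]; exists (maxn n k) => //; split => /=.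
  - by move: x Fnx; exact/subsetPset/ndF/leq_maxl.
  - by move: y Fky; exact/subsetPset/ndF/leq_maxr.
move=> k; have [mFk Fkoo] := Foo k; split; first exact: measurableX.
rewrite L2E /Defs.leb2 product_measure1E //.
by rewrite lte_mul_pinfty // ge0_fin_numE.
Qed.
HB.instance Definition _ := Measure_isSigmaFinite.Build _ _ _ L2 L2_sigma_finite.

(** Half-open intervals determine Lebesgue measure, and translation keeps their lengths. *)
Lemma leb1_shift (c : R) (A : set R) : measurable A ->
  mu ((fun x => x + c) @^-1` A) = mu A.
Proof.
move=> mA; apply/esym.
have mf : measurable_fun (setT : set TR) ((fun x => x + c) : TR -> TR).
  have : measurable_fun (setT : set R) (fun x : R => x + c) by exact: measurable_funD.
  by [].
pose f : {mfun TR >-> TR} := HB.pack ((fun x : R => x + c) : TR -> TR) (isMeasurableFun.Build _ _ _ _ _ mf).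
suff H X : ocitv X -> mu X = pushforward mu f X.
  exact: (@lebesgue_measure_unique R (measure_function_pushforward__canonical__measure_function_Measure mu mf) H A mA).
move=> [[a b] _ <-] /=; rewrite /pushforward /=.
have -> : (fun x => x + c) @^-1` `]a, b]%classic = `]a - c, b - c]%classic.
  by apply/seteqP; split => x /=; rewrite !in_itv /= ltrBlDr lerBrDr.
rewrite !lebesgue_measure_itv /= !lte_fin ltrD2r; case: ifP => // _.
by rewrite -!EFinB; congr EFin; ring.
Qed.

Definition mpres (f : R * R -> R * R) :=
  measurable_fun setT f /\ forall A, measurable A -> L2 (f @^-1` A) = L2 A.

Lemma mpres_comp f g : mpres f -> mpres g -> mpres (f \o g).
Proof.
move=> [mf ef] [mg eg]; split; first exact: measurableT_comp.
move=> A mA; rewrite comp_preimage eg ?ef //.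
by rewrite -[X in measurable X]setTI; exact: mf.
Qed.

(** The product measure integrates the lengths of vertical sections, and this shear only translates
    them. *)
Lemma mpres_shy (g : R -> R) : measurable_fun setT g ->
  mpres (fun z => (z.1, z.2 + g z.1)).
Proof.
move=> mg.
have mf : measurable_fun setT (fun z : R * R => (z.1, z.2 + g z.1)).
  apply: measurable_fun_pair => //; apply: measurable_funD => //.
  exact: measurableT_comp.
split=> // A mA; rewrite !L2E /Defs.leb2 /product_measure1; apply: eq_integral => x _ /=.
rewrite -[RHS](leb1_shift (g x)); last exact: measurable_xsection.
by congr (mu _); apply/seteqP; split => y /=; rewrite /xsection /= !inE.
Qed.

(** Tonelli for indicators: horizontal shears act on horizontal sections, while the product measure
    is defined through vertical ones. *)
Lemma leb2E2 (A : set (R * R)) : measurable A ->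
  L2 A = (\int[mu]_y mu (ysection A y))%E.
Proof.
move=> mA; rewrite L2E.
have /= := @indic_fubini_tonelli _ _ _ _ _ mu mu A mA.
have FE := @indic_fubini_tonelli_FE _ _ TR TR _ mu A mA.
have GE := @indic_fubini_tonelli_GE _ _ TR TR _ mu A mA.
pose I (F : TR -> \bar R) := (\int[mu]_x F x)%E.
by move=> H; exact: (etrans (etrans (congr1 I (esym FE)) H) (congr1 I GE)).
Qed.

Lemma mpres_shx (g : R -> R) : measurable_fun setT g ->
  mpres (fun z => (z.1 + g z.2, z.2)).
Proof.
move=> mg.
have mf : measurable_fun setT (fun z : R * R => (z.1 + g z.2, z.2)).
  apply: measurable_fun_pair => //; apply: measurable_funD => //.
  exact: measurableT_comp.
split=> // A mA; rewrite !leb2E2 //; last by rewrite -[X in measurable X]setTI; exact: mf.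
apply: eq_integral => y _ /=.
rewrite -[RHS](leb1_shift (g y)); last exact: measurable_ysection.
by congr (mu _); apply/seteqP; split => x /=; rewrite /ysection /= !inE.
Qed.

Lemma mpres_shift (c : R * R) : mpres (fun z => z + c).
Proof.
have := mpres_comp (mpres_shx (@measurable_cst _ _ _ _ setT c.1)) (mpres_shy (@measurable_cst _ _ _ _ setT c.2)).
by congr mpres; apply/funext => -[x y].
Qed.

Definition rot (a b : R) (z : R * R) : R * R := (a * z.1 - b * z.2, b * z.1 + a * z.2).

(** A rotation other than the half-turn is a product of three shears, with [t] minus the tangent of
    the half angle; the half-turn is the square of a quarter-turn. *)
Lemma mpres_rot a b : a ^+ 2 + b ^+ 2 = 1 -> mpres (rot a b).
Proof.
have H a' b' : a' ^+ 2 + b' ^+ 2 = 1 -> 1 + a' != 0 -> mpres (rot a' b').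
  move=> ab a0; pose t := - b' / (1 + a').
  have ml c : measurable_fun setT (fun x : R => c * x) by exact: measurable_funM.
  have := mpres_comp (mpres_shx (ml t)) (mpres_comp (mpres_shy (ml b')) (mpres_shx (ml t))).
  congr mpres; apply/funext => -[x y]; rewrite /rot /=.
  have tb : 1 + t * b' = a'.
    have b2 : b' ^+ 2 = (1 - a') * (1 + a') by rewrite -(addrK (a' ^+ 2) (b' ^+ 2)) [_ + a' ^+ 2]addrC ab; ring.
    have -> : t * b' = - (b' ^+ 2) / (1 + a') by rewrite /t; field.
    by rewrite b2; field.
  have ta : a' * t + t = - b' by rewrite /t; field.
  congr pair; last by rewrite -[in RHS]tb; ring.
  have -> : a' * x - b' * y = a' * x + (- b') * y by ring.
  by rewrite -ta -tb; ring.
move=> ab; have [a1|] := eqVneq (1 + a) 0; last exact: H.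
have -> : rot a b = rot 0 1 \o rot 0 1.
  have ea : a = -1 by lra.
  have b0 : b = 0 by apply/eqP; rewrite -sqrf_eq0; apply/eqP; rewrite ea in ab; lra.
  by apply/funext => -[x y]; rewrite /rot /= ea b0; congr pair; ring.
by apply: mpres_comp; apply: H; rewrite ?addr0 ?oner_neq0 //; ring.
Qed.

Lemma mpres_int f (A : set (R * R)) (h : R * R -> \bar R) : mpres f -> measurable A ->
  measurable_fun A h -> (forall x, A x -> 0 <= h x)%E ->
  (\int[L2]_(x in f @^-1` A) h (f x) = \int[L2]_(x in A) h x)%E.
Proof.
move=> [mf ef] mA mh h0; have h0' : {in A, forall y, (0 <= h y)%E}.
  by move=> x; rewrite inE; exact: h0.
have E := @ge0_integral_pushforward _ _ _ _ _ f mf L2 A h mA mh h0'.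
transitivity (\int[pushforward L2 f]_(y in A) h y)%E; first exact: (esym E).
apply: (@eq_measure_integral _ _ _ _ L2
  (measure_function_pushforward__canonical__measure_function_Measure L2 mf)).
by move=> B mB _; exact: ef.
Qed.

End Plane.

(** * Polar coordinates and Gaussian moments *)

Section Radial.
Variable R : realType.
Local Notation TR := (measurableTypeR R).
Local Notation mu := (@lebesgue_measure R).
Local Notation L2 := (@L2 R).

(** Substituting [r * sin t] turns the integrand into [2 * r ^+ 2 * cos t ^+ 2], with primitive
    [r ^+ 2 * (t + sin t * cos t)]. *)
Lemma int_half_disc (r : R) : 0 < r ->
  (\int[mu]_(x in `[(- r)%R, r]) (2 * Num.sqrt (r ^+ 2 - x ^+ 2))%:E = (pi * r ^+ 2)%:E)%E.
Proof.
move=> r0; pose F : R -> R := fun t => r * sin t.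
have dF (t : R) : is_derive t 1 F (r * cos t).
  by rewrite /F; apply: is_deriveZ.
have F'E : derive1 F = (fun t => r * cos t) by apply/funext => t; rewrite derive1E; exact: derive_val.
have Fb : F (pi / 2) = r by rewrite /F sin_pihalf mulr1.
have Fa : F (- (pi / 2)) = - r by rewrite /F sinN sin_pihalf mulrN1.
have cF : continuous F by move=> t; apply: differentiable_continuous; apply/derivable1_diffP.
have ccos : continuous (fun t : R => r * cos t).
  by move=> t; apply: cvgM; [exact: cvg_cst | exact: continuous_cos].
have cG : continuous (fun x : R => 2 * Num.sqrt (r ^+ 2 - x ^+ 2)).
  move=> x; apply: cvgM; first exact: cvg_cst.
  have c1 : {for x, continuous (fun x : R => r ^+ 2 - x ^+ 2)}.
    by apply: cvgB; [exact: cvg_cst | exact: exprn_continuous].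
  exact: (continuous_comp c1 (@sqrt_continuous R _)).
have p0 : (- (pi / 2) < pi / 2 :> R) by have := pi_gt0 R; lra.
rewrite -{1}Fa -Fb (@integration_by_substitution_increasing R F); last first.
- by apply: continuous_subspaceT; rewrite Fb; exact: cG.
- split; [by move=> x _ | |]; [apply: cvg_at_right_filter | apply: cvg_at_left_filter]; exact: cF.
- by rewrite F'E; apply/cvg_ex; exists (r * cos (pi / 2)); apply: cvg_at_left_filter; exact: ccos.
- by rewrite F'E; apply/cvg_ex; exists (r * cos (- (pi / 2))); apply: cvg_at_right_filter; exact: ccos.
- by rewrite F'E => x _; exact: ccos.
- by move=> x y xi yi xy; rewrite /F ltr_pM2l // ltr_sin.
- exact: ltW.
pose H : R -> R := fun t => r ^+ 2 * (t + sin t * cos t).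
have dH (t : R) : is_derive t 1 H (2 * r ^+ 2 * cos t ^+ 2).
  rewrite /H; apply: is_derive_eq; rewrite /GRing.scale /=.
  have := cos2Dsin2 t => e; transitivity (r ^+ 2 * (1 + cos t ^+ 2 - sin t ^+ 2)); first by ring.
  by rewrite (_ : 1 + _ - _ = 2 * cos t ^+ 2); [ring | lra].
transitivity (\int[mu]_(t in `[(- (pi / 2))%R, (pi / 2)%R]) (2 * r ^+ 2 * cos t ^+ 2)%:E)%E.
  apply: eq_integral => t; rewrite inE /= in_itv /= => tb; congr EFin.
  rewrite F'E Fb mulrfctE /= /F (_ : r ^+ 2 - _ = (r * cos t) ^+ 2); last first.
    rewrite !exprMn (_ : cos t ^+ 2 = 1 - sin t ^+ 2); first by ring.
    by rewrite -(cos2Dsin2 t) addrK.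
  rewrite sqrtr_sqr ger0_norm; first by ring.
  by apply: mulr_ge0; [exact: ltW | exact: cos_ge0_pihalf].
rewrite (@continuous_FTC2 R _ H) //.
- by rewrite -EFinB /H cosN cos_pihalf !mulr0 !addr0; congr EFin; rewrite Fb; field.
- apply: continuous_subspaceT => x; apply: cvgM; first exact: cvg_cst.
  by apply: cvgM; exact: continuous_cos.
- have cH : continuous H by move=> t; apply: differentiable_continuous; apply/derivable1_diffP.
  by split; [by move=> x _ | |]; [apply: cvg_at_right_filter | apply: cvg_at_left_filter]; exact: cH.
- by move=> t _; rewrite derive1E; exact: derive_val.
Qed.

Lemma measurable_sqmod : measurable_fun setT (@sqmod R).
Proof.
by apply: measurable_funD; apply: measurable_funX.
Qed.

Lemma measurable_disc (b : R) : measurable [set z : R * R | sqmod z <= b].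
Proof.
rewrite (_ : [set z | _] = setT `&` (@sqmod R) @^-1` `]-oo, b]%classic).
  exact: measurable_sqmod.
by apply/seteqP; split => z /=; rewrite in_itv /= ?andbT => // -[].
Qed.

Lemma L2_disc (b : R) : 0 <= b -> L2 [set z : R * R | sqmod z <= b] = (pi * b)%:E.
Proof.
move=> b0; rewrite L2E /Defs.leb2 /product_measure1.
pose s := Num.sqrt b; have s0 : 0 <= s by exact: sqrtr_ge0.
have sb : s ^+ 2 = b by exact: sqr_sqrtr.
have sec x : (mu \o xsection [set z : R * R | sqmod z <= b]) x =
    ((fun x => (2 * Num.sqrt (s ^+ 2 - x ^+ 2))%:E) \_ `[(- s)%R, s]%classic x)%E.
  rewrite /= patchE; case: ifPn.
    rewrite inE /= in_itv /= => /andP[x1 x2].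
    have q0 : 0 <= s ^+ 2 - x ^+ 2 by nra.
    pose q := Num.sqrt (s ^+ 2 - x ^+ 2).
    rewrite (_ : xsection _ _ = `[- q, q]%classic).
      rewrite lebesgue_measure_itv /= lte_fin; case: ltP => qq.
        by rewrite -EFinB; congr EFin; rewrite -/q; ring.
      by have := sqrtr_ge0 (s ^+ 2 - x ^+ 2); rewrite -/q => ?; congr EFin; lra.
    apply/seteqP; split => y; rewrite /xsection /= inE /= /sqmod /= in_itv /= -ler_norml.
      move=> h; rewrite -sqrtr_sqr; apply: ler_wsqrtr; lra.
    rewrite -sqrtr_sqr => h.
    by have := sqr_sqrtr q0; rewrite -/q => qe; rewrite -sb;
       move: h; rewrite /q ler_sqrt // => h; lra.
  rewrite notin_setE /= in_itv /= => /negP; rewrite -ler_norml -ltNge => xs.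
  rewrite (_ : xsection _ _ = set0) ?measure0 //.
  apply/seteqP; split => y //; rewrite /xsection /= inE /= /sqmod /= => h.
  have : s ^+ 2 < `|x| ^+ 2 by rewrite ltr_pXn2r // nnegrE.
  by rewrite real_normK ?num_real // sb; have := sqr_ge0 y; lra.
transitivity (\int[mu]_(x in `[(- s)%R, s]) (2 * Num.sqrt (s ^+ 2 - x ^+ 2))%:E)%E.
  by rewrite [RHS]integral_mkcond; apply: eq_integral => x _; exact: sec.
have [s_gt0|] := ltP 0 s; first by rewrite int_half_disc // sb.
move=> s_le0; have s00 : s = 0 by apply/eqP; rewrite eq_le s_le0.
by rewrite -sb s00 oppr0 set_itv1 integral_set1 expr0n /= mulr0.
Qed.

Lemma L2_radial_set (B : set R) : measurable B ->
  L2 ((@sqmod R) @^-1` B) = (pi%:E * mu (B `&` `[0%R, +oo[%classic))%E.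
Proof.
move=> mB.
have msq : measurable_fun (setT : set (R * R)) (@sqmod R : R * R -> TR) by exact: measurable_sqmod.
pose m1 := measure_function_pushforward__canonical__measure_function_Measure L2 msq.
have mneg : @measurable _ TR `]-oo, 0%R[%classic by exact: measurable_itv.
have pi0 : 0 <= (pi : R)^-1 by rewrite invr_ge0 pi_ge0.
(* The law of [sqmod] lives on the half-line only. Completing it by Lebesgue measure on the
   negatives gives a measure on the whole line, to which the uniqueness of Lebesgue measure
   applies. *)
pose nu := measure_add (mscale (NngNum pi0) m1) (mrestr mu mneg).
have piE : (pi^-1%:E * pi%:E = 1 :> \bar R)%E by rewrite -EFinM mulVf // gt_eqF ?pi_gt0.
have nuE A : nu A = (pi^-1%:E * L2 ((@sqmod R) @^-1` A) + mu (A `&` `]-oo, 0%R[%classic))%E.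
  by rewrite /nu measure_addE.
have HO X : ocitv X -> mu X = nu X.
  move=> /ocitvP[->|[[a b] /= ab ->]]; first by rewrite !measure0.
  rewrite nuE lebesgue_measure_itv /= lte_fin ab.
  have [b0|b0] := ltP b 0.
    rewrite (_ : _ @^-1` _ = set0) ?measure0 ?mule0 ?add0e.
      rewrite (_ : _ `&` _ = `]a, b]%classic) ?lebesgue_measure_itv /= ?lte_fin ?ab //.
      by apply/seteqP; split => x /=; rewrite !in_itv /= => H; [case: H|split => //; lra].
    apply/seteqP; split => z //=; rewrite in_itv /= => /andP[_ zb].
    by have := sqr_ge0 z.1; have := sqr_ge0 z.2; rewrite /sqmod in zb; lra.
  have [a0|a0] := leP 0 a.
    rewrite (_ : _ `&` _ = set0) ?measure0 ?adde0; last first.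
      by apply/seteqP; split => x //=; rewrite !in_itv /= => -[]; lra.
    rewrite (_ : _ @^-1` _ = [set z | sqmod z <= b] `\` [set z | sqmod z <= a]); last first.
      apply/seteqP; split => z /=; rewrite in_itv /=.
        by move=> /andP[za zb]; split => //; apply/negP; rewrite -ltNge.
      by move=> -[-> /negP]; rewrite -ltNge => ->.
    rewrite measureD; [|exact: measurable_disc..|].
      rewrite setIidr; last by move=> z /=; lra.
      transitivity (pi^-1%:E * (pi%:E * (b - a)%:E))%E.
        by rewrite muleA piE mul1e EFinB.
      have -> : (pi%:E * (b - a)%:E = (pi * b)%:E - (pi * a)%:E :> \bar R)%E.
        by rewrite -EFinB -EFinM; congr EFin; ring.
      by congr (_ * (_ - _))%E; apply: esym; exact: L2_disc.
    by apply: (le_lt_trans (y := (pi * b)%:E)); [rewrite -(L2_disc b0) | exact: ltry].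
  rewrite (_ : _ @^-1` _ = [set z | sqmod z <= b]); last first.
    apply/seteqP; split => z /=; rewrite in_itv /=; first by case/andP.
    move=> ->; rewrite andbT; apply: (lt_le_trans a0).
    by rewrite /sqmod addr_ge0 ?sqr_ge0.
  rewrite (_ : _ `&` _ = `]a, 0%R[%classic); last first.
    by apply/seteqP; split => x /=; rewrite !in_itv /= => H; [case: H; lra | split; lra].
  rewrite lebesgue_measure_itv /= lte_fin a0 L2_disc // EFinM muleA piE mul1e.
  by rewrite -!EFinB -EFinD; congr EFin; ring.
have := @lebesgue_measure_unique R nu HO (B `&` `[0%R, +oo[%classic).
move=> /(_ (measurableI _ _ mB (measurable_itv _))) H.
pose BD := B `&` `[0%R, +oo[%classic.
transitivity (pi%:E * (pi^-1%:E * L2 ((@sqmod R) @^-1` BD) + mu (BD `&` `]-oo, 0%R[%classic)))%E; last first.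
  by rewrite H; congr (_ * _)%E; exact: (esym (nuE _)).
rewrite /BD (_ : _ `&` _ `&` _ = set0) ?measure0 ?adde0; last first.
  by apply/seteqP; split => x //=; rewrite !in_itv /= => -[[]]; lra.
rewrite muleA muleC; rewrite [(pi%:E * _)%E]muleC piE mule1.
congr (Defs.leb2 _); apply/seteqP; split => z /=; last by case.
move=> Bz; split => //; rewrite in_itv /= andbT /sqmod; by rewrite addr_ge0 ?sqr_ge0.
Qed.

(** Polar coordinates in the squared modulus, where the density is the constant [pi]. *)
Lemma L2_radial (h : R -> \bar R) : measurable_fun setT h -> (forall s, 0 <= h s)%E ->
  (\int[L2]_z h (sqmod z) = pi%:E * \int[mu]_(s in `[0%R, +oo[) h s)%E.
Proof.
move=> mh h0.
have msq : measurable_fun (setT : set (R * R)) (@sqmod R : R * R -> TR) by exact: measurable_sqmod.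
pose D : set TR := `[0%R, +oo[%classic.
have mD : measurable D by exact: measurable_itv.
have mhD : measurable_fun (D : set TR) (h : TR -> \bar R).
  have : measurable_fun (D : set R) h by exact: measurable_funTS.
  by [].
have h0' : {in D, forall y, (0 <= h y)%E} by [].
have E := @ge0_integral_pushforward _ _ _ _ _ _ msq L2 D h mD mhD h0'.
transitivity (\int[pushforward L2 (@sqmod R : R * R -> TR)]_(y in D) h y)%E.
  rewrite E (_ : _ @^-1` _ = setT) //.
  by apply/seteqP; split => z //= _; rewrite /D /= in_itv /= andbT /sqmod addr_ge0 ?sqr_ge0.
have E2 := @ge0_integral_mscale _ TR R mu D mD (NngNum (pi_ge0 R)) h mhD (fun x _ => h0 x).
rewrite -E2; apply: (@eq_measure_integral _ _ _ _ _
  (measure_function_pushforward__canonical__measure_function_Measure L2 msq)).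
move=> A mA AD; rewrite /= /pushforward L2_radial_set // /mscale /=.
by congr (_ * mu _)%E; apply/seteqP; split => x /=; [case | move=> Ax; split => //; exact: AD].
Qed.

(** The primitive of [s ^+ k * expR (- (a * s))] produced by repeated integration by parts; for
    [0 < a] it is the one that vanishes at infinity. *)
Fixpoint gamma_prim (a : R) (k : nat) (s : R) : R :=
  match k with
  | 0 => - expR (- (a * s)) / a
  | k'.+1 => (k'.+1%:R * gamma_prim a k' s - s ^+ k'.+1 * expR (- (a * s))) / a
  end.

Lemma is_derive_gamma_prim (a : R) k (s : R) : 0 < a ->
  is_derive s 1 (gamma_prim a k) (s ^+ k * expR (- (a * s))).
Proof.
move=> a0; have an : a != 0 by exact: lt0r_neq0.
elim: k => [|k IH] /=.
  apply: is_derive_eq; rewrite /GRing.scale /= expr0 !mulr1 mul1r.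
  by field.
have dX : is_derive s 1 (fun t : R => t ^+ k.+1) (k.+1%:R * s ^+ k).
  by apply: DeriveDef; [exact: exprn_derivable | rewrite exp_derive /GRing.scale /= mulr1].
move: IH; move: (gamma_prim a k) => G IH.
apply: is_derive_eq; rewrite /GRing.scale /=.
by rewrite exprS; field.
Qed.

Lemma gamma_prim0 (a : R) k : 0 < a -> gamma_prim a k 0 = - (k`!%:R / a ^+ k.+1).
Proof.
move=> a0; have an : a != 0 by exact: lt0r_neq0.
elim: k => [|k IH] /=; first by rewrite mulr0 oppr0 expR0 fact0; field.
rewrite IH expr0n /= mul0r subr0 factS natrM [a ^+ k.+2]exprS; field.
by rewrite an expf_neq0.
Qed.

Lemma cvg_pow_expR (a : R) k : 0 < a -> (s ^+ k * expR (- (a * s))) @[s --> +oo%R] --> (0 : R).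
Proof.
move=> a0; have an : a != 0 by exact: lt0r_neq0.
(* The term of degree [k.+1] of the exponential series leaves a decay of [C / s]. *)
pose C : R := (k.+1)`!%:R / a ^+ k.+1.
have bd s : 0 < s -> 0 <= s ^+ k * expR (- (a * s)) <= C / s.
  move=> s0; apply/andP; split; first by rewrite mulr_ge0 ?exprn_ge0 ?expR_ge0 // ltW.
  have := @expR_ge1Dxn R (a * s) k (ltW (mulr_gt0 a0 s0)) => H.
  rewrite expRN ler_pdivrMr ?expR_gt0 // /C.
  have H2 : (a * s) ^+ k.+1 / (k.+1)`!%:R <= expR (a * s) by lra.
  have f0 : (0 : R) < (k.+1)`!%:R by rewrite ltr0n fact_gt0.
  have -> : s ^+ k = (k.+1)`!%:R / a ^+ k.+1 / s * ((a * s) ^+ k.+1 / (k.+1)`!%:R).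
    rewrite exprMn [s ^+ k.+1]exprS; field.
    by rewrite !lt0r_neq0 ?exprn_gt0.
  by rewrite ler_wpM2l // !divr_ge0 ?exprn_ge0 // ltW.
have g0 : (C / s) @[s --> +oo%R] --> (0 : R).
  rewrite -(mulr0 C); apply: cvgM; first exact: cvg_cst.
  by apply/gtr0_cvgV0; [exact: nbhs_pinfty_gt | exact: cvg_id].
apply: (@squeeze_cvgr _ _ _ _ (fun=> 0) (fun s => C / s)) => //; last exact: cvg_cst.
by near=> s; apply: bd; near: s; exact: nbhs_pinfty_gt.
Unshelve. all: by end_near. Qed.

Lemma cvg_gamma_prim (a : R) k : 0 < a -> gamma_prim a k s @[s --> +oo%R] --> (0 : R).
Proof.
move=> a0; elim: k => [|k IH] /=.
  have := @cvg_pow_expR a 0 a0 => H.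
  rewrite (_ : 0 = - 0 / a); last by rewrite oppr0 mul0r.
  apply: cvgM; last exact: cvg_cst.
  rewrite (_ : (fun s => _) = (fun s => - (s ^+ 0 * expR (- (a * s))))).
    exact: cvgN.
  by apply/funext => s; rewrite expr0 mul1r.
rewrite (_ : 0 = (k.+1%:R * 0 - 0) / a); last by rewrite mulr0 subr0 mul0r.
apply: cvgM; last exact: cvg_cst.
by apply: cvgB; [apply: cvgM; [exact: cvg_cst|exact: IH] | exact: cvg_pow_expR].
Qed.

Lemma integral_gamma (a : R) k : 0 < a ->
  (\int[mu]_(s in `[0%R, +oo[) (s ^+ k * expR (- (a * s)))%:E = (k`!%:R / a ^+ k.+1)%:E)%E.
Proof.
move=> a0; rewrite (@ge0_continuous_FTC2y R _ (gamma_prim a k) _ 0).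
- by rewrite gamma_prim0 // -EFinB sub0r opprK.
- by move=> x x0; rewrite mulr_ge0 ?exprn_ge0 ?expR_ge0.
- apply: continuous_subspaceT => x; apply: cvgM; first exact: exprn_continuous.
  have c1 : {for x, continuous (fun x : R => - (a * x))}.
    by apply: cvgN; apply: cvgM; [exact: cvg_cst | exact: cvg_id].
  exact: (continuous_comp c1 (@continuous_expR R _)).
- exact: cvg_gamma_prim.
- by move=> x _; have [] := @is_derive_gamma_prim a k x a0.
- apply: cvg_at_right_filter; apply: differentiable_continuous; apply/derivable1_diffP.
  by have [] := @is_derive_gamma_prim a k 0 a0.
- by move=> x _; rewrite derive1E; have [] := @is_derive_gamma_prim a k x a0.
Qed.

Lemma L2_gauss_moment (a : R) k : 0 < a ->
  (\int[L2]_z (sqmod z ^+ k * expR (- (a * sqmod z)))%:E = (pi * (k`!%:R / a ^+ k.+1))%:E)%E.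
Proof.
(* The absolute value makes [h] nonnegative on the whole line, as [L2_radial] asks. *)
move=> a0; pose h s : \bar R := (`|s| ^+ k * expR (- (a * s)))%:E.
have mh : measurable_fun setT h.
  apply/measurable_EFinP; apply: measurable_funM.
    by apply: measurable_funX; exact: normr_measurable.
  by apply: measurableT_comp => //; apply: measurableT_comp => //.
transitivity (\int[L2]_z h (sqmod z))%E.
  apply: eq_integral => z _; rewrite /h ger0_norm // /sqmod.
  by rewrite addr_ge0 ?sqr_ge0.
rewrite L2_radial //; last by move=> s; rewrite lee_fin mulr_ge0 ?expR_ge0 ?exprn_ge0.
rewrite EFinM -integral_gamma //; congr (_ * _)%E; apply: eq_integral => s.
by rewrite inE /= in_itv /= andbT => s0; rewrite /h ger0_norm.
Qed.

End Radial.

(** * Hermitian forms *)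

Section HermitianForms.
Variable C : numClosedFieldType.

Definition ctr m n (x : 'M[C]_(m, n)) : 'M[C]_(n, m) := (map_mx Num.conj x)^T.
Definition hf n (H : 'M[C]_n) (x : 'rV[C]_n) : C := (x *m H *m ctr x) 0 0.
Definition psd n (H : 'M[C]_n) := forall x, 0 <= hf H x.

Lemma ctrM m n p (A : 'M[C]_(m, n)) (B : 'M[C]_(n, p)) : ctr (A *m B) = ctr B *m ctr A.
Proof. by rewrite /ctr map_mxM trmx_mul. Qed.

Lemma det_ctr n (A : 'M[C]_n) : \det (ctr A) = (\det A)^*.
Proof. by rewrite /ctr det_tr det_map_mx. Qed.

Lemma hfE n (H : 'M[C]_n) x : hf H x = \sum_i \sum_j x 0 i * H i j * (x 0 j)^*.
Proof.
rewrite /hf mxE exchange_big /=; apply: eq_bigr => j _.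
by rewrite [in LHS]mxE mulr_suml; apply: eq_bigr => i _; rewrite /ctr !mxE.
Qed.

Lemma hf_mul n m (H : 'M[C]_n) (V : 'M[C]_(m, n)) x : hf (V *m H *m ctr V) x = hf H (x *m V).
Proof. by rewrite /hf ctrM !mulmxA. Qed.

Lemma hf_delta n (H : 'M[C]_n) i : hf H (delta_mx 0 i) = H i i.
Proof.
rewrite hfE (bigD1 i) //= (bigD1 i) //= !mxE !eqxx mul1r conjC1 mulr1.
rewrite big1 ?addr0; last by move=> j ji; rewrite !mxE eqxx (negPf ji) conjC0 mulr0.
rewrite big1 ?addr0 // => k ki; rewrite big1 // => j _.
by rewrite !mxE eqxx (negPf ki) !mul0r.
Qed.

Lemma hf_delta2 n (H : 'M[C]_n) (i j : 'I_n) t : i != j ->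
  hf H (t *: delta_mx 0 i + delta_mx 0 j) =
  `|t| ^+ 2 * H i i + t * H i j + t^* * H j i + H j j.
Proof.
move=> ij; set v := _ + _.
have ji : j != i by rewrite eq_sym.
have vi : v 0 i = t by rewrite !mxE !eqxx (negPf ij) mulr1 addr0.
have vj : v 0 j = 1 by rewrite !mxE !eqxx (negPf ji) mulr0 add0r.
have v0 k : k != i -> k != j -> v 0 k = 0.
  by move=> ki kj; rewrite !mxE eqxx (negPf ki) (negPf kj) mulr0 addr0.
have S (f : 'I_n -> C) : (forall k, k != i -> k != j -> f k = 0) -> \sum_k f k = f i + f j.
  move=> f0; rewrite (bigD1 i) //= (bigD1 j) //= big1 ?addr0 // => k /andP[ki kj].
  exact: f0.
rewrite hfE S; last first.
  by move=> k ki kj; apply: big1 => l _; rewrite v0 // !mul0r.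
rewrite !S; last first.
- by move=> k ki kj; rewrite (v0 k) // conjC0 mulr0.
- by move=> k ki kj; rewrite (v0 k) // conjC0 mulr0.
by rewrite vi vj conjC1 normCK; ring.
Qed.

Lemma psd_diag n (H : 'M[C]_n) i : psd H -> 0 <= H i i.
Proof. by move=> pH; rewrite -hf_delta; exact: pH. Qed.

(** Polarisation: a complex form with real values at [e_i + e_j] and at ['i e_i + e_j] has a real
    symmetric part and an imaginary antisymmetric part. *)
Lemma psd_herm n (H : 'M[C]_n) i j : psd H -> H j i = (H i j)^*.
Proof.
move=> pH; have [->|ij] := eqVneq i j.
  by apply/esym/CrealP; apply: ger0_real; exact: psd_diag.
have ri k : H k k \is Num.real by apply: ger0_real; exact: psd_diag.
have := ger0_real (pH (1 *: delta_mx 0 i + delta_mx 0 j)).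
rewrite hf_delta2 // normr1 conjC1 !expr1n !mul1r => h1.
have := ger0_real (pH ('i *: delta_mx 0 i + delta_mx 0 j)).
rewrite hf_delta2 // normCi conjCi expr1n !mul1r => h2.
have r1 : H i j + H j i \is Num.real.
  have -> : H i j + H j i = H i i + H i j + H j i + H j j - H i i - H j j by ring.
  by rewrite !rpredB.
have r2 : 'i * (H i j - H j i) \is Num.real.
  have -> : 'i * (H i j - H j i) = H i i + 'i * H i j + - 'i * H j i + H j j - H i i - H j j by ring.
  by rewrite !rpredB.
move/CrealP: r1; move/CrealP: r2; rewrite rmorphM rmorphB rmorphD /= conjCi => e2 e1.
have e3 : (H i j)^* - (H j i)^* = H j i - H i j.
  by apply: (mulfI (neq0Ci C)); rewrite -[LHS]opprK -mulNr e2; ring.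
have t2 : (2 : C) != 0 by rewrite pnatr_eq0.
apply: (mulfI t2); transitivity ((H i j)^* + (H j i)^* + ((H i j)^* - (H j i)^*)); last by ring.
by rewrite e1 e3; ring.
Qed.

Lemma psd_diag0 n (H : 'M[C]_n) i j : psd H -> H i i = 0 -> H i j = 0.
Proof.
move=> pH Hi; have [<-//|ij] := eqVneq i j.
have [//|h0] := eqVneq (H i j) 0.
(* With this [t] the two cross terms add up to [- (H j j + 1)], so the form would take the value
   [-1]. *)
pose t := - ((H i j)^* * (H j j + 1)) / (`|H i j| ^+ 2 * 2).
have := pH (t *: delta_mx 0 i + delta_mx 0 j); rewrite hf_delta2 // Hi mulr0 add0r.
have hj : (H j j)^* = H j j by apply/CrealP; apply: ger0_real; exact: psd_diag.
have n0 : `|H i j| ^+ 2 != 0 by rewrite expf_neq0 // normr_eq0.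
have tH : t * H i j = - (H j j + 1) / 2.
  rewrite /t; have -> : - ((H i j)^* * (H j j + 1)) / (`|H i j| ^+ 2 * 2) * H i j =
     - (H j j + 1) * (H i j * (H i j)^*) / (`|H i j| ^+ 2 * 2) by ring.
  by rewrite -normCK; field; rewrite normr_eq0.
have -> : t^* * H j i = (t * H i j)^* by rewrite (psd_herm i j pH) [RHS]rmorphM.
rewrite tH.
have -> : (- (H j j + 1) / 2)^* = - (H j j + 1) / 2.
  by rewrite rmorphM /= rmorphN /= rmorphD /= conjC1 hj fmorphV /= conjC_nat.
have -> : - (H j j + 1) / 2 + - (H j j + 1) / 2 + H j j = -1 by field.
by rewrite ler0N1.
Qed.

Definition schur p q (H : 'M[C]_(p + q)) : 'M[C]_q :=
  drsubmx H - dlsubmx H *m invmx (ulsubmx H) *m ursubmx H.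

Lemma det_schur p q (H : 'M[C]_(p + q)) : ulsubmx H \in unitmx ->
  \det H = \det (ulsubmx H) * \det (schur H).
Proof.
move=> uB; rewrite -{1}[H]submxK.
have -> : block_mx (ulsubmx H) (ursubmx H) (dlsubmx H) (drsubmx H) =
  block_mx 1%:M 0 (dlsubmx H *m invmx (ulsubmx H)) 1%:M *m
  block_mx (ulsubmx H) (ursubmx H) 0 (schur H).
  rewrite mulmx_block !mul1mx !mul0mx ?mulmx0 !addr0 mulmxKV //.
  by rewrite /schur addrCA subrr addr0.
by rewrite det_mulmx det_lblock det_ublock !det1 !mul1r.
Qed.

(** The first block is chosen to annihilate the first block of the product with [H]. The Schur
    complement is thus a restriction of the same form, and inherits every lower bound on it. *)
Lemma hf_schur p q (H : 'M[C]_(p + q)) y : ulsubmx H \in unitmx ->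
  hf (schur H) y = hf H (row_mx (- (y *m dlsubmx H *m invmx (ulsubmx H))) y).
Proof.
move=> uB; rewrite /hf; set u := - _.
have -> : row_mx u y *m H = row_mx 0 (y *m schur H).
  rewrite -{1}[H]submxK mul_row_block; congr row_mx.
    by rewrite /u mulNmx mulmxKV // addNr.
  by rewrite /u /schur mulmxBr mulNmx !mulmxA addrC.
by rewrite /ctr map_row_mx tr_row_mx mul_row_col mul0mx add0r.
Qed.

Lemma psd_schur p q (H : 'M[C]_(p + q)) : psd H -> ulsubmx H \in unitmx -> psd (schur H).
Proof. by move=> pH uB y; rewrite hf_schur. Qed.

Lemma psd_ul p q (H : 'M[C]_(p + q)) : psd H -> psd (ulsubmx H).
Proof.
move=> pH x; have := pH (row_mx x 0); rewrite /hf -{1}[H]submxK mul_row_block.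
by rewrite !mul0mx !addr0 /ctr map_row_mx tr_row_mx mul_row_col !map_mx0 trmx0 mulmx0 addr0.
Qed.

(** Quantitative positivity: with positive [d] it makes the pivots invertible, and it passes to
    corner blocks and to Schur complements. *)
Definition dom n (d : 'I_n -> C) (H : 'M[C]_n) :=
  forall x : 'rV[C]_n, \sum_i d i * `|x 0 i| ^+ 2 <= hf H x.

Lemma dom_schur p q d (H : 'M[C]_(p + q)) : (forall i, 0 <= d i) -> dom d H ->
  ulsubmx H \in unitmx -> dom (d \o @rshift p q) (schur H).
Proof.
move=> d0 dH uB y; rewrite hf_schur //; apply: le_trans (dH _).
rewrite big_split_ord /= -[X in X <= _]add0r lerD //.
  by apply: sumr_ge0 => i _; rewrite mulr_ge0 ?exprn_ge0.
by apply: ler_sum => i _; rewrite row_mxEr.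
Qed.

Lemma dom_ul p q d (H : 'M[C]_(p + q)) : dom d H -> dom (d \o @lshift p q) (ulsubmx H).
Proof.
move=> dH x; have := dH (row_mx x 0).
have -> : hf H (row_mx x 0) = hf (ulsubmx H) x.
  rewrite /hf -{1}[H]submxK mul_row_block.
  by rewrite !mul0mx !addr0 /ctr map_row_mx tr_row_mx mul_row_col !map_mx0 trmx0 mulmx0 addr0.
apply: le_trans; rewrite big_split_ord /= -[X in X <= _]addr0 lerD //.
  by apply: ler_sum => i _; rewrite row_mxEl.
by apply: sumr_ge0 => i _; rewrite row_mxEr mxE normr0 expr0n mulr0.
Qed.

Lemma ul11_unit n (H : 'M[C]_(1 + n)) : H 0 0 != 0 -> ulsubmx H \in unitmx.
Proof.
move=> h; rewrite unitmxE det_mx11 unitfE !mxE (_ : lshift n 0 = 0) //.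
exact/val_inj.
Qed.

Lemma det_ul11 n (H : 'M[C]_(1 + n)) : \det (ulsubmx H) = H 0 0.
Proof. by rewrite det_mx11 !mxE (_ : lshift n 0 = 0) //; exact/val_inj. Qed.

(** Induction on the size: the first pivot is at least [d 0], and the Schur complement still
    dominates the remaining entries of [d]. *)
Lemma dom_det n d (H : 'M[C]_n) : (forall i, 0 < d i) -> dom d H -> \prod_i d i <= \det H.
Proof.
elim: n d H => [|n IH] d H d0 dH; first by rewrite big_ord0 det_mx00.
have h0 : d 0 <= H 0 0.
  have := dH (delta_mx 0 0); rewrite hf_delta; apply: le_trans.
  rewrite (bigD1 0) //= mxE !eqxx normr1 expr1n mulr1 lerDl sumr_ge0 // => i _.
  by rewrite mulr_ge0 ?exprn_ge0 // ltW.
have H0 : H 0 0 != 0 by rewrite gt_eqF // (lt_le_trans (d0 0)).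
pose H' : 'M[C]_(1 + n) := H.
have uB : ulsubmx H' \in unitmx by exact: ul11_unit.
rewrite -[H]/H' (det_schur uB) det_ul11 big_ord_recl.
apply: ler_pM => //; [exact: ltW | by apply: prodr_ge0 => i _; exact: ltW |].
have := IH _ _ (fun i => d0 (rshift 1 i)) (dom_schur (p := 1) (q := n) (fun i => ltW (d0 i)) dH uB).
congr (_ <= _); apply: eq_bigr => i _; congr d; exact/val_inj.
Qed.

Lemma schur_diag_le n (H : 'M[C]_(1 + n)) i : psd H -> 0 < H 0 0 ->
  schur H i i <= H (rshift 1 i) (rshift 1 i).
Proof.
move=> pH h0; rewrite /schur !mxE big_ord1 !mxE big_ord1 !mxE.
rewrite (_ : lshift n 0 = 0); last exact/val_inj.
have -> : invmx (ulsubmx H) 0 0 = (H 0 0)^-1.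
  have uB : ulsubmx H \in unitmx by apply: ul11_unit; rewrite gt_eqF.
  apply: (mulfI (lt0r_neq0 h0)); rewrite divff ?gt_eqF //.
  have := congr1 (fun M : 'M[C]_1 => M 0 0) (mulmxV uB).
  by rewrite !mxE big_ord1 !mxE eqxx (_ : lshift n 0 = 0) //; exact/val_inj.
rewrite (psd_herm 0 (rshift 1 i) pH) lerBlDr lerDl mulrAC mulrC mulrA.
by rewrite -mulrA -normCKC mulr_ge0 ?exprn_ge0 // invr_ge0 ltW.
Qed.

(** Hadamard's inequality: passing to a Schur complement can only decrease the diagonal, and a
    vanishing pivot kills its whole row. *)
Lemma psd_det n (H : 'M[C]_n) : psd H -> 0 <= \det H <= \prod_i H i i.
Proof.
elim: n H => [|n IH] H pH; first by rewrite big_ord0 det_mx00 ler01 lexx.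
have h0 : 0 <= H 0 0 by exact: psd_diag.
have [H0|H0] := eqVneq (H 0 0) 0.
  rewrite (expand_det_row _ 0) big1; last by move=> j _; rewrite (psd_diag0 j pH H0) mul0r.
  by rewrite lexx; apply: prodr_ge0 => i _; exact: psd_diag.
pose H' : 'M[C]_(1 + n) := H.
have uB : ulsubmx H' \in unitmx by exact: ul11_unit.
have hp : 0 < H 0 0 by rewrite lt_def H0 h0.
rewrite -[H]/H' (det_schur uB) det_ul11 big_ord_recl.
have /andP[s0 s1] := IH _ (psd_schur (p := 1) (q := n) pH uB).
rewrite mulr_ge0 //= ler_wpM2l // (le_trans s1) //.
apply: ler_prod => i _; rewrite psd_diag /=; last exact: psd_schur.
have := @schur_diag_le n H' i pH hp; congr (_ <= H _ _); exact/val_inj.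
Qed.

Lemma unit_dom n d (H : 'M[C]_n) : (forall i, 0 < d i) -> dom d H -> H \in unitmx.
Proof.
move=> d0 dH; rewrite unitmxE unitfE gt_eqF //.
by apply: lt_le_trans (dom_det d0 dH); apply: prodr_gt0.
Qed.

Lemma dom_psd n d (H : 'M[C]_n) : (forall i, 0 < d i) -> dom d H -> psd H.
Proof.
move=> d0 dH x; apply: le_trans (dH x); apply: sumr_ge0 => i _.
by rewrite mulr_ge0 ?exprn_ge0 // ltW.
Qed.

(** The last [q] indices enter through the determinant of a Schur complement, which still dominates
    the tail of [d]. *)
Lemma det_tail p q d (H : 'M[C]_(p + q)) : (forall i, 0 < d i) -> dom d H ->
  \det (ulsubmx H) * \prod_i d (rshift p i) <= \det H.
Proof.
move=> d0 dH; have uB := unit_dom (fun i => d0 (lshift q i)) (dom_ul dH).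
rewrite (det_schur uB) ler_wpM2l //.
  by have /andP[] := psd_det (psd_ul (dom_psd d0 dH)).
exact: (dom_det (fun i => d0 (rshift p i)) (dom_schur (fun i => ltW (d0 i)) dH uB)).
Qed.

Lemma det_mono p q d (H : 'M[C]_(p + q)) : (forall i, 0 < d i) -> dom d H ->
  (forall i, H (rshift p i) (rshift p i) <= 1) ->
  \det H <= \det (ulsubmx H).
Proof.
move=> d0 dH Hd; have uB := unit_dom (fun i => d0 (lshift q i)) (dom_ul dH).
have pH := dom_psd d0 dH.
rewrite (det_schur uB) ler_piMr //.
  by have /andP[] := psd_det (psd_ul pH).
have pS := psd_schur pH uB.
have /andP[_ /le_trans] := psd_det pS; apply.
apply: prodr_ile1 => i _; rewrite psd_diag //=.
apply: le_trans (Hd i).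
rewrite /schur !mxE lerBlDr lerDl.
(* positivity of [c B^-1 c^*] since B^-1 is psd *)
set B := ulsubmx H; set c := row i (dlsubmx H).
suff -> : \sum_j (dlsubmx H *m invmx B) i j * ursubmx H j i = hf B (c *m invmx B) by exact: (psd_ul pH).
have <- : (dlsubmx H *m invmx B *m ursubmx H) i i = \sum_j (dlsubmx H *m invmx B) i j * ursubmx H j i by rewrite mxE.
  have -> : ursubmx H = ctr (dlsubmx H).
    by apply/matrixP => k l; rewrite !mxE (psd_herm _ _ pH).
  rewrite /hf mulmxKV // /ctr map_mxM trmx_mul.
  transitivity ((row i (dlsubmx H *m invmx B *m (map_mx Num.conj (dlsubmx H))^T)) 0 i); first by rewrite !mxE.
  have hB : ctr (invmx B) = invmx B.
    rewrite /ctr map_invmx trmx_inv; congr invmx.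
    by apply/matrixP => k l; rewrite !mxE /= (psd_herm (lshift q k) (lshift q l) pH) conjCK.
  rewrite -/(ctr (invmx B)) hB !row_mul -/c !mulmxA !mxE; apply: eq_bigr => k _.
  by rewrite !mxE.
Qed.

(** In the coordinates given by the sample values [x *m V], the form dominates [c] times the
    identity. *)
Lemma hf_sample n (H V : 'M[C]_n) (c : C) : 0 < c -> V \in unitmx ->
  (forall x : 'rV[C]_n, c * \sum_j `|(x *m V) 0 j| ^+ 2 <= hf H x) ->
  c ^+ n * `|\det V| ^+ 2 <= \det H.
Proof.
move=> c0 uV cH; pose W := invmx V.
have dW : dom (fun=> c) (W *m H *m ctr W).
  by move=> x; rewrite hf_mul -mulr_sumr; have := cH (x *m W); rewrite mulmxKV.
have := dom_det (fun=> c0) dW; rewrite prodr_const card_ord !det_mulmx det_ctr det_inv => h.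
have v0 : \det V != 0 by rewrite -unitfE -unitmxE.
have : (\det V)^-1 * \det H * ((\det V)^-1)^* = \det H / `|\det V| ^+ 2.
  by rewrite normCK fmorphV invfM; ring.
by move=> e; move: h; rewrite e ler_pdivlMr // exprn_gt0 // normr_gt0.
Qed.

(** Hadamard's inequality in the dual basis: the rows of [invmx V] are the Lagrange functions of the
    sample points. *)
Lemma det_sample_le n (H V : 'M[C]_n) : V \in unitmx -> psd H ->
  \det H <= `|\det V| ^+ 2 * \prod_j hf H (row j (invmx V)).
Proof.
move=> uV pH; pose W := invmx V.
have pW : psd (W *m H *m ctr W) by move=> x; rewrite hf_mul.
have /andP[_] := psd_det pW; rewrite !det_mulmx det_ctr det_inv => h.
have v0 : \det V != 0 by rewrite -unitfE -unitmxE.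
have e : (\det V)^-1 * \det H * ((\det V)^-1)^* = \det H / `|\det V| ^+ 2.
  by rewrite normCK fmorphV invfM; ring.
move: h; rewrite e ler_pdivrMr ?exprn_gt0 ?normr_gt0 // mulrC; congr (_ <= _ * _).
by apply: eq_bigr => j _; rewrite -hf_delta hf_mul rowE.
Qed.

End HermitianForms.

(** * Finite Ginibre ensembles *)

Section ComplexIntegral.
Variable R : realType.
Local Notation C := R[i].
Local Notation Re := (@complex.Re R).
Local Notation Im := (@complex.Im R).
Local Notation mu := (@lebesgue_measure R).
Local Notation L2 := (@L2 R).

(** Real-valued, so that integrals and inequalities of squared moduli stay in [R]. *)
Definition nsq (c : C) : R := Re c ^+ 2 + Im c ^+ 2.

Lemma nsq_ge0 c : 0 <= nsq c. Proof. by rewrite addr_ge0 ?sqr_ge0. Qed.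

Lemma nsqE (c : C) : (nsq c)%:C%C = `|c| ^+ 2.
Proof. by rewrite normc_def -rmorphXn sqr_sqrtr ?nsq_ge0. Qed.

Lemma nsqM a b : nsq (a * b) = nsq a * nsq b.
Proof. by case: a b => [a1 a2] [b1 b2]; rewrite /nsq /=; ring. Qed.

Lemma nsqX a n : nsq (a ^+ n) = nsq a ^+ n.
Proof.
elim: n => [|n IH]; first by rewrite !expr0 /nsq /= expr1n expr0n addr0.
by rewrite !exprS nsqM IH.
Qed.

Lemma nsq_real (r : R) : nsq r%:C%C = r ^+ 2.
Proof. by rewrite /nsq /= expr0n addr0. Qed.

Lemma nsq_cpx z : nsq (cpx z) = sqmod z :> R.
Proof. by []. Qed.

Lemma conjE (c : C) : c^* = Complex (Re c) (- Im c).
Proof. by case: c. Qed.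

Lemma nsq_conj c : nsq c^* = nsq c.
Proof. by rewrite conjE /nsq /= sqrrN. Qed.

Definition cmeas (F : R * R -> C) :=
  measurable_fun setT (Re \o F) /\ measurable_fun setT (Im \o F).

Lemma cmeas_cst c : cmeas (fun=> c). Proof. by split; exact: measurable_cst. Qed.

Lemma cmeas_cpx : cmeas (@cpx R).
Proof. by split; [exact: measurable_fst | exact: measurable_snd]. Qed.

Lemma cmeasM F G : cmeas F -> cmeas G -> cmeas (fun z => F z * G z).
Proof.
move=> [F1 F2] [G1 G2]; split.
  rewrite (_ : _ \o _ = (fun z => Re (F z) * Re (G z) - Im (F z) * Im (G z))).
    by apply: measurable_funB; apply: measurable_funM.
  by apply/funext => z /=; case: (F z) (G z) => [? ?] [].
rewrite (_ : _ \o _ = (fun z => Re (F z) * Im (G z) + Im (F z) * Re (G z))).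
  by apply: measurable_funD; apply: measurable_funM.
by apply/funext => z /=; case: (F z) (G z) => [? ?] [].
Qed.

Lemma cmeasD F G : cmeas F -> cmeas G -> cmeas (fun z => F z + G z).
Proof.
move=> [F1 F2] [G1 G2]; split.
  rewrite (_ : _ \o _ = (fun z => Re (F z) + Re (G z))); first exact: measurable_funD.
  by apply/funext => z /=; case: (F z) (G z) => [? ?] [].
rewrite (_ : _ \o _ = (fun z => Im (F z) + Im (G z))); first exact: measurable_funD.
by apply/funext => z /=; case: (F z) (G z) => [? ?] [].
Qed.

Lemma cmeasX F n : cmeas F -> cmeas (fun z => F z ^+ n).
Proof.
move=> mF; elim: n => [|n IH]; first exact: cmeas_cst.
by under eq_fun do rewrite exprS; exact: cmeasM.
Qed.

Lemma cmeas_conj F : cmeas F -> cmeas (fun z => (F z)^*).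
Proof.
move=> [F1 F2]; split.
  by rewrite (_ : _ \o _ = Re \o F) //; apply/funext => z /=; case: (F z).
rewrite (_ : _ \o _ = (fun z => - Im (F z))); first exact: measurableT_comp.
by apply/funext => z /=; case: (F z).
Qed.

Lemma cmeas_sum n (F : 'I_n -> R * R -> C) : (forall i, cmeas (F i)) ->
  cmeas (fun z => \sum_i F i z).
Proof.
elim: n F => [|n IH] F mF.
  by under eq_fun do rewrite big_ord0; exact: cmeas_cst.
under eq_fun do rewrite big_ord_recl.
by apply: cmeasD => //; apply: IH.
Qed.

Lemma cmeas_nsq F : cmeas F -> measurable_fun setT (nsq \o F).
Proof. by move=> [F1 F2]; apply: measurable_funD; apply: measurable_funX. Qed.

Lemma cmeas_real (f : R * R -> R) : measurable_fun setT f -> cmeas (fun z => (f z)%:C%C).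
Proof. by move=> mf; split => //; exact: measurable_cst. Qed.

Definition cint (A : set (R * R)) (F : R * R -> C) :=
  L2.-integrable A (EFin \o (Re \o F)) /\ L2.-integrable A (EFin \o (Im \o F)).

Definition Cint (A : set (R * R)) (F : R * R -> C) : C :=
  Complex (\int[L2]_(z in A) Re (F z)) (\int[L2]_(z in A) Im (F z)).

Lemma cintS A B F : measurable A -> measurable B -> A `<=` B -> cint B F -> cint A F.
Proof. by move=> mA mB AB [F1 F2]; split; [apply: integrableS F1 | apply: integrableS F2]. Qed.

Lemma cint_le A F (g : R * R -> R) : measurable A -> cmeas F -> L2.-integrable A (EFin \o g) ->
  (forall z, A z -> nsq (F z) <= g z ^+ 2) -> (forall z, A z -> 0 <= g z) -> cint A F.
Proof.
move=> mA [F1 F2] ig Fg g0.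
have B (x y g' : R) : x ^+ 2 + y ^+ 2 <= g' ^+ 2 -> 0 <= g' -> `|x| <= g'.
  move=> h g0'; rewrite -ler_sqr ?nnegrE // real_normK ?num_real //.
  by have := sqr_ge0 y; lra.
split; apply: (le_integrable _ _ _ ig) => //.
- by apply/measurable_EFinP; exact: measurable_funTS.
- move=> z Az /=; rewrite lee_fin [leRHS]ger0_norm ?g0 //.
  by apply: (B _ (Im (F z))) (g0 z Az); exact: Fg.
- by apply/measurable_EFinP; exact: measurable_funTS.
- move=> z Az /=; rewrite lee_fin [leRHS]ger0_norm ?g0 //.
  by apply: (B _ (Re (F z))) (g0 z Az); rewrite addrC; exact: Fg.
Qed.

Lemma cintD A F G : measurable A -> cint A F -> cint A G -> cint A (fun z => F z + G z).
Proof.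
move=> mA [F1 F2] [G1 G2]; split.
  apply: eq_integrable (integrableD mA F1 G1) => // z _ /=; by case: (F z) (G z) => [? ?] [].
apply: eq_integrable (integrableD mA F2 G2) => // z _ /=; by case: (F z) (G z) => [? ?] [].
Qed.

Lemma cintZ A F c : measurable A -> cint A F -> cint A (fun z => c * F z).
Proof.
move=> mA [F1 F2]; case: c => a b; split.
  apply: eq_integrable (integrableB mA (integrableZl mA a F1) (integrableZl mA b F2)) => // z _ /=.
  by case: (F z).
apply: eq_integrable (integrableD mA (integrableZl mA a F2) (integrableZl mA b F1)) => // z _ /=.
by case: (F z).
Qed.

Lemma CintD A F G : measurable A -> cint A F -> cint A G ->
  Cint A (fun z => F z + G z) = Cint A F + Cint A G.
Proof.
move=> mA [F1 F2] [G1 G2]; rewrite /Cint; apply/eqP; rewrite eq_complex /=; apply/andP; split; apply/eqP.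
  by rewrite -RintegralD //; apply: eq_Rintegral => z _; case: (F z) (G z) => [? ?] [].
by rewrite -RintegralD //; apply: eq_Rintegral => z _; case: (F z) (G z) => [? ?] [].
Qed.

Lemma CintZ A F c : measurable A -> cint A F -> Cint A (fun z => c * F z) = c * Cint A F.
Proof.
move=> mA [F1 F2]; case: c => a b; rewrite /Cint; apply/eqP; rewrite eq_complex /=; apply/andP; split; apply/eqP.
  rewrite -!RintegralZl // -(RintegralB mA (integrableZl mA a F1) (integrableZl mA b F2)).
  by apply: eq_Rintegral => z _ /=; case: (F z).
rewrite -!RintegralZl // -(RintegralD mA (integrableZl mA a F2) (integrableZl mA b F1)).
by apply: eq_Rintegral => z _ /=; case: (F z).
Qed.

Lemma cint_sum A n (F : 'I_n -> R * R -> C) : measurable A -> (forall i, cint A (F i)) ->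
  cint A (fun z => \sum_i F i z).
Proof.
move=> mA; elim: n F => [|n IH] F cF.
  under eq_fun do rewrite big_ord0.
  by split; exact: integrable0.
by under eq_fun do rewrite big_ord_recl; apply: cintD => //; apply: IH.
Qed.

Lemma Cint_sum A n (F : 'I_n -> R * R -> C) : measurable A -> (forall i, cint A (F i)) ->
  Cint A (fun z => \sum_i F i z) = \sum_i Cint A (F i).
Proof.
move=> mA; elim: n F => [|n IH] F cF.
  under eq_fun do rewrite big_ord0.
  by rewrite big_ord0 /Cint /= !Rintegral_cst // !mul0r.
under eq_fun do rewrite big_ord_recl.
by rewrite CintD // ?big_ord_recl ?IH //; apply: cint_sum.
Qed.

Lemma CintU A B F : measurable A -> measurable B -> [disjoint A & B]%classic -> cint (A `|` B) F ->
  Cint (A `|` B) F = Cint A F + Cint B F.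
Proof.
move=> mA mB AB [F1 F2]; rewrite /Cint; apply/eqP; rewrite eq_complex /=.
by rewrite -!Rintegral_setU //; exact/andP.
Qed.

Lemma Cint_real A (f : R * R -> R) : Cint A (fun z => (f z)%:C%C) = (\int[L2]_(z in A) f z)%:C%C.
Proof.
rewrite /Cint /=; congr Complex; rewrite Rintegral_mkcond /=.
by rewrite /Rintegral integral0_eq // => z _; rewrite patchE; case: ifP.
Qed.

Lemma mpres_Rint (f : R * R -> R * R) A (h : R * R -> R) : mpres f -> measurable A ->
  f @^-1` A = A -> L2.-integrable setT (EFin \o h) ->
  \int[L2]_(z in A) h (f z) = \int[L2]_(z in A) h z.
Proof.
move=> pf mA fA ih; rewrite /Rintegral; congr fine.
have mh : measurable_fun setT (EFin \o h) by case/integrableP: ih.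
rewrite [LHS]integralE [RHS]integralE.
congr (_ - _)%E.
  transitivity (\int[L2]_(z in f @^-1` A) ((EFin \o h)^\+ (f z)))%E; first by rewrite fA; apply: eq_integral => z _; rewrite -[RHS]/((_ \o f) z) -funepos_comp.
  apply: (mpres_int pf) => //.
  exact/measurable_funepos/measurable_funTS.
transitivity (\int[L2]_(z in f @^-1` A) ((EFin \o h)^\- (f z)))%E; first by rewrite fA; apply: eq_integral => z _; rewrite -[RHS]/((_ \o f) z) -funeneg_comp.
apply: (mpres_int pf) => //.
exact/measurable_funeneg/measurable_funTS.
Qed.

Lemma mpres_Cint (f : R * R -> R * R) A F : mpres f -> measurable A ->
  f @^-1` A = A -> cint setT F -> Cint A (fun z => F (f z)) = Cint A F.
Proof.
move=> pf mA fA [F1 F2]; rewrite /Cint; congr Complex.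
  exact: (mpres_Rint (h := Re \o F)).
exact: (mpres_Rint (h := Im \o F)).
Qed.

End ComplexIntegral.

(** * Gaussian monomials, their Gram matrices and gap determinants *)

Section GinibreBasis.
Variable R : realType.
Local Notation C := R[i].
Local Notation Re := (@complex.Re R).
Local Notation Im := (@complex.Im R).
Local Notation L2 := (@L2 R).
Local Notation "x %:CC" := (real_complex R x) (at level 1, format "x %:CC").

Lemma sqmod_ge0 (z : R * R) : 0 <= sqmod z.
Proof. by rewrite addr_ge0 ?sqr_ge0. Qed.

Definition phic (k : nat) (z : R * R) : R := expR (- (sqmod z / 2)) / Num.sqrt (pi * k`!%:R).
Definition phi (k : nat) (z : R * R) : C := cpx z ^+ k * (phic k z)%:CC.

Lemma pifact_gt0 k : 0 < pi * k`!%:R :> R.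
Proof. by rewrite mulr_gt0 ?pi_gt0 // ltr0n fact_gt0. Qed.

Lemma nsq_phi k z : nsq (phi k z) = sqmod z ^+ k * expR (- sqmod z) / (pi * k`!%:R).
Proof.
rewrite /phi nsqM nsqX nsq_real nsq_cpx /phic expr_div_n sqr_sqrtr ?ltW ?pifact_gt0 //.
by rewrite -expRM_natl mulrA; congr (_ * expR _ / _); field.
Qed.

Lemma measurable_gauss (c : R) : measurable_fun setT (fun z : R * R => expR (c * sqmod z)).
Proof.
by apply: measurableT_comp => //; apply: measurable_funM => //; exact: measurable_sqmod.
Qed.

Lemma cmeas_phi k : cmeas (phi k).
Proof.
apply: cmeasM; first by apply: cmeasX; exact: cmeas_cpx.
apply: cmeas_real; apply: measurable_funM => //.
by have := measurable_gauss (- 2^-1); congr measurable_fun; apply/funext => z; rewrite mulNr mulrC.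
Qed.

Lemma integrable_gauss_moment (a : R) k : 0 < a ->
  L2.-integrable setT (EFin \o (fun z => sqmod z ^+ k * expR (- (a * sqmod z)))).
Proof.
move=> a0; apply/integrableP; split.
  apply/measurable_EFinP; apply: measurable_funM.
    by apply: measurable_funX; exact: measurable_sqmod.
  by have := measurable_gauss (- a); congr measurable_fun; apply/funext => z; rewrite mulNr.
rewrite (eq_integral (fun z => (sqmod z ^+ k * expR (- (a * sqmod z)))%:E)).
  by rewrite L2_gauss_moment // ltry.
move=> z _ /=; rewrite ger0_norm // mulr_ge0 ?expR_ge0 ?exprn_ge0 ?sqmod_ge0 //.
Qed.

Lemma cint_phiphi j k A : measurable A -> cint A (fun z => phi j z * (phi k z)^*).
Proof.
move=> mA; apply: (@cintS _ _ setT) => //.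
have mM : cmeas (fun z => phi j z * (phi k z)^*).
  by apply: cmeasM; [|apply: cmeas_conj]; exact: cmeas_phi.
(* The square of the modulus is at most [x] times a squared Gaussian with [x = sqmod z ^+ (j + k)];
   since [x <= (1 + x) ^+ 2], this sum of two Gaussian moments dominates without any square root. *)
have iG : L2.-integrable setT (EFin \o (fun z => sqmod z ^+ 0 * expR (- (1 * sqmod z)) +
    sqmod z ^+ (j + k) * expR (- (1 * sqmod z)))).
  have := integrableD measurableT (@integrable_gauss_moment 1 0 ltr01) (@integrable_gauss_moment 1 (j + k) ltr01).
  by apply: eq_integrable.
apply: (cint_le _ mM iG) => // z _; last first.
  by rewrite addr_ge0 // mulr_ge0 ?expR_ge0 ?exprn_ge0 ?sqmod_ge0.
have s0 := sqmod_ge0 z.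
rewrite nsqM nsq_conj !nsq_phi !mul1r.
set s := sqmod z in s0 *; set e := expR _.
have -> : e + s ^+ (j + k) * e = (1 + s ^+ (j + k)) * e by ring.
have p1 i : (pi * i`!%:R)^-1 <= 1 :> R.
  rewrite invf_le1 ?pifact_gt0 //; have := pi_ge2 R => p2.
  have : 1 <= i`!%:R :> R by rewrite ler1n fact_gt0.
  by move=> f1; rewrite -[1]mulr1 ler_pM //; lra.
have e0 : 0 <= e by exact: expR_ge0.
have pw : 0 <= s ^+ (j + k) by exact: exprn_ge0.
apply: (@le_trans _ _ (s ^+ (j + k) * e ^+ 2)).
  have -> : s ^+ j * e / (pi * j`!%:R) * (s ^+ k * e / (pi * k`!%:R)) =
     (s ^+ (j + k) * e ^+ 2) * ((pi * j`!%:R)^-1 * (pi * k`!%:R)^-1) by rewrite exprD; ring.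
  by rewrite ler_piMr ?mulr_ge0 ?exprn_ge0 // mulr_ile1 // ?invr_ge0 ltW // ?pifact_gt0.
by rewrite [X in _ <= X]exprMn ler_wpM2r ?exprn_ge0 //; nra.
Qed.

Definition Hm (N : nat) (A : set (R * R)) : 'M[C]_N :=
  \matrix_(j, k) Cint A (fun z => phi j z * (phi k z)^*).

Definition psum (N : nat) (x : 'rV[C]_N) (z : R * R) : C := \sum_j x 0 j * phi j z.

Lemma cmeas_psum N (x : 'rV[C]_N) : cmeas (psum x).
Proof.
apply: cmeas_sum => i; apply: cmeasM; [exact: cmeas_cst | exact: cmeas_phi].
Qed.

Lemma psum_conj N (x : 'rV[C]_N) z : (nsq (psum x z))%:CC =
  \sum_j \sum_k (x 0 j * (x 0 k)^*) * (phi j z * (phi k z)^*).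
Proof.
rewrite nsqE normCK {1}/psum mulr_suml; apply: eq_bigr => j _.
rewrite /psum rmorph_sum mulr_sumr; apply: eq_bigr => k _.
by rewrite rmorphM /=; ring.
Qed.

Lemma cint_psum N (x : 'rV[C]_N) A : measurable A -> cint A (fun z => (nsq (psum x z))%:CC).
Proof.
move=> mA; under eq_fun do rewrite psum_conj.
apply: cint_sum => // j; apply: cint_sum => // k; apply: cintZ => //; exact: cint_phiphi.
Qed.

Lemma integrable_psum N (x : 'rV[C]_N) A : measurable A ->
  L2.-integrable A (EFin \o (fun z => nsq (psum x z))).
Proof. by move=> mA; have [] := cint_psum x mA. Qed.

Lemma hf_Hm N A (x : 'rV[C]_N) : measurable A ->
  hf (Hm N A) x = (\int[L2]_(z in A) nsq (psum x z))%:CC.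
Proof.
move=> mA; rewrite -Cint_real; under [in RHS]eq_fun do rewrite psum_conj.
have c2 j k : cint A (fun z => x 0 j * (x 0 k)^* * (phi j z * (phi k z)^*)).
  by apply: cintZ => //; exact: cint_phiphi.
rewrite Cint_sum //; last by move=> j; apply: cint_sum.
rewrite hfE; apply: eq_bigr => j _; rewrite Cint_sum //; apply: eq_bigr => k _.
by rewrite CintZ ?mxE; [ring | | exact: cint_phiphi].
Qed.

Lemma Hm_psd N A : measurable A -> psd (Hm N A).
Proof.
by move=> mA x; rewrite hf_Hm // lecR; apply: Rintegral_ge0 => z _; exact: nsq_ge0.
Qed.

(** Substitute for angular integration: averaging a function with its image under such a rotation
    kills the angular mode of order [n]. *)
Lemma exists_rotation (n : nat) : (0 < n)%N -> exists w : C, w ^+ n = -1 /\ nsq w = 1.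
Proof.
move=> n0; exists (n.-root (-1)); rewrite rootCK //; split=> //.
apply/eqP; rewrite -(@pexpr_eq1 _ _ n) ?nsq_ge0 // -nsqX rootCK //.
by rewrite /nsq /= oppr0 sqrrN expr1n expr0n addr0.
Qed.

Definition rotc (w : C) : R * R -> R * R := rot (Re w) (Im w).

Lemma cpx_rotc w z : cpx (rotc w z) = w * cpx z.
Proof. by case: w => a b; rewrite /rotc /rot /cpx /=; congr Complex; ring. Qed.

Lemma sqmod_rotc w z : nsq w = 1 -> sqmod (rotc w z) = sqmod z.
Proof. by move=> w1; rewrite -!nsq_cpx cpx_rotc nsqM w1 mul1r. Qed.

Lemma mpres_rotc w : nsq w = 1 -> mpres (rotc w).
Proof. by move=> w1; apply: mpres_rot. Qed.

Definition radial (A : set (R * R)) := forall w z, nsq w = 1 -> A (rotc w z) <-> A z.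

Lemma phi_rotc w k z : nsq w = 1 -> phi k (rotc w z) = w ^+ k * phi k z.
Proof.
by move=> w1; rewrite /phi cpx_rotc exprMn -mulrA /phic sqmod_rotc.
Qed.

(** Rotation invariance multiplies the integral by [w ^+ j * (w ^+ k)^*], which is [-1] when [w] to
    the power [|j - k|] is [-1]. *)
Lemma phi_orth j k A : measurable A -> radial A -> j != k ->
  Cint A (fun z => phi j z * (phi k z)^*) = 0.
Proof.
move=> mA rA jk.
have H (w : C) : nsq w = 1 -> Cint A (fun z => phi j z * (phi k z)^*) =
   w ^+ j * (w ^+ k)^* * Cint A (fun z => phi j z * (phi k z)^*).
  move=> w1; rewrite -CintZ //; last exact: cint_phiphi.
  rewrite -[LHS](@mpres_Cint _ (rotc w)) //; [|exact: mpres_rotc| |exact: cint_phiphi].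
    by congr Cint; apply/funext => z; rewrite !phi_rotc // rmorphM /=; ring.
  by apply/seteqP; split => z /=; rewrite rA.
have nw (w : C) : nsq w = 1 -> w * w^* = 1 by move=> w1; rewrite -normCK -nsqE w1.
have E (w : C) m n : nsq w = 1 -> w ^+ (m + n) = -1 * w ^+ n -> w ^+ (m + n) * (w ^+ n)^* = -1.
  move=> w1 ->; rewrite -mulrA nw ?mulr1 // nsqX w1 expr1n //.
have fin (X : C) : X = -1 * X -> X = 0.
  by rewrite mulN1r => /eqP; rewrite -addr_eq0 -mulr2n mulrn_eq0 /= => /eqP.
case: (ltngtP j k) jk => // jk _.
  have [w [wn w1]] := @exists_rotation (k - j) ltac:(by rewrite subn_gt0).
  apply: fin; rewrite {1}(H w w1); congr (_ * _).
  have : w ^+ ((k - j) + j) * (w ^+ j)^* = -1 by apply: E => //; rewrite exprD wn.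
  move/(congr1 Num.conj); rewrite subnK ?(ltnW jk) // rmorphM /= conjCK rmorphN /= conjC1 mulrC //.
have [w [wn w1]] := @exists_rotation (j - k) ltac:(by rewrite subn_gt0).
apply: fin; rewrite {1}(H w w1); congr (_ * _).
by rewrite -[j](@subnK k) ?(ltnW jk) //; apply: E => //; rewrite exprD wn.
Qed.

Lemma phi_diag k A : measurable A ->
  Cint A (fun z => phi k z * (phi k z)^*) = (\int[L2]_(z in A) nsq (phi k z))%:CC.
Proof. by move=> mA; rewrite -Cint_real; congr Cint; apply/funext => z; rewrite nsqE normCK. Qed.

Lemma integral_phi k : (\int[L2]_z (nsq (phi k z))%:E)%E = 1%E.
Proof.
transitivity (\int[L2]_z ((pi * k`!%:R)^-1%:E * (sqmod z ^+ k * expR (- (1 * sqmod z)))%:E))%E.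
  apply: eq_integral => z _; rewrite nsq_phi -EFinM; congr EFin; rewrite mul1r; ring.
rewrite ge0_integralZl //; last 3 first.
- by case/integrableP: (@integrable_gauss_moment 1 k ltr01).
- by move=> z _; rewrite lee_fin mulr_ge0 ?expR_ge0 ?exprn_ge0 ?sqmod_ge0.
- by rewrite lee_fin invr_ge0 ltW // pifact_gt0.
rewrite L2_gauss_moment // -EFinM expr1n divr1 mulVf //.
by rewrite gt_eqF // pifact_gt0.
Qed.

Lemma Hm_setT N : Hm N setT = 1%:M.
Proof.
apply/matrixP => j k; rewrite !mxE; case: eqVneq => [->|jk].
  by rewrite phi_diag // /Rintegral integral_phi.
by rewrite phi_orth.
Qed.

Lemma Hm_compl N A : measurable A -> Hm N A + Hm N (~` A) = 1%:M.
Proof.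
move=> mA; rewrite -Hm_setT; apply/matrixP => j k; rewrite !mxE -CintU.
- by rewrite setUv.
- by [].
- exact: measurableC.
- by apply/disj_setPS; rewrite setICr.
- by rewrite setUv; exact: cint_phiphi.
Qed.

Lemma measurable_ann (b : R) : measurable [set z : R * R | b <= sqmod z].
Proof.
rewrite (_ : [set z | _] = setT `&` (@sqmod R) @^-1` `[b, +oo[%classic).
  exact: measurable_sqmod.
by apply/seteqP; split => z /=; rewrite in_itv /= ?andbT // => -[].
Qed.

(** The Gram matrix of a radial set is diagonal. These are its entries for the exterior of a disk,
    and they bound from below the form on the complement of any subset of that disk. *)
Definition dk (b : R) (k : nat) : R := \int[L2]_(z in [set z | b <= sqmod z]) nsq (phi k z).

Lemma le_Hm N A B (x : 'rV[C]_N) : measurable A -> measurable B -> A `<=` B ->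
  hf (Hm N A) x <= hf (Hm N B) x.
Proof.
move=> mA mB AB; rewrite !hf_Hm // lecR /Rintegral fine_le //.
- exact: integrable_fin_num (integrable_psum x mA).
- exact: integrable_fin_num (integrable_psum x mB).
apply: ge0_subset_integral => //.
- by apply/measurable_EFinP; apply: measurable_funTS; apply: cmeas_nsq; exact: cmeas_psum.
- by move=> z _; rewrite lee_fin nsq_ge0.
Qed.

Lemma Hm_dom N A b : measurable A -> A `<=` [set z | sqmod z < b] ->
  dom (fun k : 'I_N => (dk b k)%:CC) (Hm N (~` A)).
Proof.
move=> mA Ab x; pose B := [set z : R * R | b <= sqmod z].
have mB : measurable B by exact: measurable_ann.
apply: (@le_trans _ _ (hf (Hm N B) x)); last first.
  apply: le_Hm => //; first exact: measurableC.
  by move=> z /= Bz Az; have := Ab z Az; rewrite /= ltNge Bz.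
rewrite hfE; apply: ler_sum => j _; rewrite (bigD1 j) //= big1 ?addr0; last first.
  move=> k kj; rewrite mxE phi_orth ?mulr0 ?mul0r // 1?eq_sym //.
  by move=> w z w1; rewrite /B /= sqmod_rotc.
by rewrite mxE phi_diag // normCK -/(dk b j) mulrAC mulrC.
Qed.

(** Chernoff's bound: the weight [expR (c * (b - sqmod z))] is at least 1 inside the disk, and with
    it the integral can be extended to the plane, where it is a Gamma integral. *)
Lemma dk_ge b c k : 0 < c -> 1 - expR (c * b) / (1 + c) ^+ k.+1 <= dk b k.
Proof.
move=> c0; pose B := [set z : R * R | b <= sqmod z].
have mB : measurable B by exact: measurable_ann.
have mBC : measurable (~` B) by exact: measurableC.
have iphi A : measurable A -> L2.-integrable A (EFin \o (fun z => nsq (phi k z))).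
  move=> mA; have := integrable_psum (delta_mx 0 ord_max : 'rV[C]_k.+1) mA.
  apply: eq_integrable => // z _ /=; congr (EFin (nsq _)).
  rewrite /psum (bigD1 ord_max) //= mxE !eqxx mul1r big1 ?addr0 // => i /negPf i0.
  by rewrite mxE eqxx i0 mul0r.
have e1 : dk b k = 1 - \int[L2]_(z in ~` B) nsq (phi k z).
  have : \int[L2]_(z in setT) nsq (phi k z) = 1 by rewrite /Rintegral integral_phi.
  rewrite -(setUv B) Rintegral_setU //; [by rewrite -/(dk b k) => <-; ring | | ].
    by rewrite setUv; exact: iphi.
  by apply/disj_setPS; rewrite setICr.
rewrite e1 lerD2l lerN2 -lee_fin.
have c1 : 0 < 1 + c by lra.
rewrite /Rintegral fineK; last exact: integrable_fin_num (iphi _ mBC).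
apply: (@le_trans _ _ (\int[L2]_z ((expR (c * b) / (pi * k`!%:R))%:E *
    (sqmod z ^+ k * expR (- ((1 + c) * sqmod z)))%:E))%E).
  apply: (@le_trans _ _ (\int[L2]_(z in ~` B) ((expR (c * b) / (pi * k`!%:R))%:E *
    (sqmod z ^+ k * expR (- ((1 + c) * sqmod z)))%:E))%E).
    apply: ge0_le_integral => //.
    - by move=> z _; rewrite lee_fin nsq_ge0.
    - by case/integrableP: (iphi _ mBC).
    - apply: measurable_funTS; apply: emeasurable_funM => //.
      by case/integrableP: (@integrable_gauss_moment (1 + c) k c1).
    move=> z /= /negP; rewrite -ltNge => zb; rewrite -EFinM lee_fin nsq_phi.
    have -> : expR (c * b) / (pi * k`!%:R) * (sqmod z ^+ k * expR (- ((1 + c) * sqmod z))) =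
      (sqmod z ^+ k / (pi * k`!%:R)) * (expR (c * b) * expR (- ((1 + c) * sqmod z))) by ring.
    have -> : sqmod z ^+ k * expR (- sqmod z) / (pi * k`!%:R) =
      (sqmod z ^+ k / (pi * k`!%:R)) * expR (- sqmod z) by ring.
    rewrite ler_wpM2l // ?divr_ge0 ?exprn_ge0 ?sqmod_ge0 ?(ltW (pifact_gt0 k)) //.
    by rewrite -expRD ler_expR; nra.
  apply: ge0_subset_integral => //.
    apply: emeasurable_funM => //.
    by case/integrableP: (@integrable_gauss_moment (1 + c) k c1).
  move=> z _; rewrite -EFinM lee_fin mulr_ge0 ?divr_ge0 ?expR_ge0 ?(ltW (pifact_gt0 k)) //.
  by rewrite mulr_ge0 ?expR_ge0 ?exprn_ge0 ?sqmod_ge0.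
rewrite ge0_integralZl //; last 3 first.
- by case/integrableP: (@integrable_gauss_moment (1 + c) k c1).
- by move=> z _; rewrite lee_fin mulr_ge0 ?expR_ge0 ?exprn_ge0 ?sqmod_ge0.
- by rewrite lee_fin divr_ge0 ?expR_ge0 ?(ltW (pifact_gt0 k)).
rewrite L2_gauss_moment // -EFinM lee_fin.
by rewrite [pi * (_ / _)]mulrA mulrA divfK // gt_eqF ?pifact_gt0.
Qed.

Lemma integrable_phi k A : measurable A -> L2.-integrable A (EFin \o (fun z => nsq (phi k z))).
Proof.
move=> mA; have := integrable_psum (delta_mx 0 ord_max : 'rV[C]_k.+1) mA.
apply: eq_integrable => // z _ /=; congr (EFin (nsq _)).
rewrite /psum (bigD1 ord_max) //= mxE !eqxx mul1r big1 ?addr0 // => i /negPf i0.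
by rewrite mxE eqxx i0 mul0r.
Qed.

Lemma L2_ring (b : R) : 0 <= b -> L2 [set z : R * R | b <= sqmod z <= b + 1] = pi%:E.
Proof.
move=> b0; rewrite (_ : [set z | _] = (@sqmod R) @^-1` `[b, b + 1]%classic); last first.
  by apply/seteqP; split => z /=; rewrite in_itv.
rewrite L2_radial_set //; rewrite (_ : _ `&` _ = `[b, b + 1]%classic); last first.
  by apply/seteqP; split => x /=; rewrite !in_itv /= ?andbT; [case | move=> /andP[bx ->]; rewrite bx (le_trans b0 bx)].
by rewrite lebesgue_measure_itv /= lte_fin ltrDl ltr01 -EFinB addrAC subrr add0r mule1.
Qed.

(** The ring [m <= sqmod z <= m + 1] with [m = max b 1] has area [pi], and there the density is at
    least [kp]. *)
Lemma dk_gt0 b k : 0 < dk b k.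
Proof.
pose m := Num.max b 1; have m1 : 1 <= m by rewrite /m le_max lexx orbT.
pose Rg := [set z : R * R | m <= sqmod z <= m + 1].
have mRg : measurable Rg.
  rewrite (_ : Rg = [set z | m <= sqmod z] `&` [set z | sqmod z <= m + 1]).
    by apply: measurableI; [exact: measurable_ann | exact: measurable_disc].
  by apply/seteqP; split => z /=; [move=> /andP[? ?] | move=> [? ?]; apply/andP].
pose kp : R := expR (- (m + 1)) / (pi * k`!%:R).
have kp0 : 0 < kp by rewrite divr_gt0 ?expR_gt0 ?pifact_gt0.
have mB := measurable_ann b.
suff : ((kp * pi)%:E <= \int[L2]_(z in [set z | (b <= sqmod z)%R]) (nsq (phi k z))%:E)%E.
  move=> h; have : 0 < kp * pi by rewrite mulr_gt0 ?pi_gt0.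
  move=> /lt_le_trans; apply; rewrite -lee_fin /dk /Rintegral fineK //.
  exact: integrable_fin_num (integrable_phi k mB).
apply: (@le_trans _ _ (\int[L2]_(z in Rg) (nsq (phi k z))%:E)%E); last first.
  apply: ge0_subset_integral => //.
  - by case/integrableP: (integrable_phi k mB).
  - by move=> z _; rewrite lee_fin nsq_ge0.
  - by move=> z /= /andP[+ _]; apply: le_trans; rewrite /m le_max lexx.
apply: (@le_trans _ _ (\int[L2]_(z in Rg) (cst kp%:E z))%E).
  have LR : L2 Rg = pi%:E by apply: L2_ring; rewrite (le_trans _ m1).
  rewrite integral_cst // EFinM; apply: lee_pmul; rewrite ?lee_fin //.
  - exact: ltW.
  - exact: pi_ge0.
  - by rewrite -LR.
apply: ge0_le_integral => //.
- by move=> z _; rewrite lee_fin ltW.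
- by case/integrableP: (integrable_phi k mRg).
move=> z /= /andP[z1 z2]; rewrite lee_fin nsq_phi /kp ler_wpM2r ?invr_ge0 ?(ltW (pifact_gt0 k)) //.
rewrite -[leLHS]mul1r ler_pM ?expR_ge0 //; last by rewrite ler_expR lerN2.
by rewrite exprn_ege1 // (le_trans m1).
Qed.

Lemma dk_le1 b k : dk b k <= 1.
Proof.
have mB := measurable_ann b.
rewrite -lee_fin /dk /Rintegral fineK; last exact: integrable_fin_num (integrable_phi k mB).
rewrite -(integral_phi k); apply: ge0_subset_integral => //.
- by case/integrableP: (integrable_phi k measurableT).
- by move=> z _; rewrite lee_fin nsq_ge0.
Qed.

Lemma Hm_diag_le1 N A j : measurable A -> Hm N A j j <= 1.
Proof.
move=> mA; rewrite -hf_delta; apply: (@le_trans _ _ (hf (Hm N setT) (delta_mx 0 j))).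
  exact: le_Hm.
by rewrite hf_delta Hm_setT mxE eqxx.
Qed.

(* [gapdet N A = det (I - M_N(A))], the gap probability of the N-point Ginibre ensemble. *)
Definition gapdet (N : nat) (A : set (R * R)) : R := Re (\det (Hm N (~` A))).

Lemma ge0_Re (c : C) : 0 <= c -> c = (Re c)%:CC.
Proof. by case: c => a b; rewrite lecE /= => /andP[/eqP -> _]. Qed.

Lemma gapdetE N A : measurable A -> \det (Hm N (~` A)) = (gapdet N A)%:CC.
Proof.
move=> mA; apply: ge0_Re; have /psd_det/andP[] // : psd (Hm N (~` A)).
exact/Hm_psd/measurableC.
Qed.

Lemma gapdet_ge0 N A : measurable A -> 0 <= gapdet N A.
Proof.
move=> mA; rewrite -lecR -gapdetE //.
by have /psd_det/andP[] // : psd (Hm N (~` A)); exact/Hm_psd/measurableC.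
Qed.

Lemma ul_Hm n m A : @ulsubmx C n m n m (Hm (n + m) A) = Hm n A.
Proof. by apply/matrixP => j k; rewrite !mxE. Qed.

(** The extra basis functions contribute the determinant of a Schur complement with diagonal at most
    1. With [gapdet_tail] this controls the limit in the number of functions from both sides. *)
Lemma gapdet_mono n m A b : measurable A -> A `<=` [set z | sqmod z < b] ->
  gapdet (n + m) A <= gapdet n A.
Proof.
move=> mA Ab; rewrite -lecR -!gapdetE // -[X in _ <= \det X](ul_Hm n m).
apply: (det_mono (d := fun k : 'I_(n + m) => (dk b k)%:CC)).
- by move=> i; rewrite ltcR dk_gt0.
- exact: Hm_dom.
- by move=> i; apply: Hm_diag_le1; exact: measurableC.
Qed.

Lemma gapdet_tail n m A b : measurable A -> A `<=` [set z | sqmod z < b] ->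
  gapdet n A * \prod_(i < m) dk b (n + i) <= gapdet (n + m) A.
Proof.
move=> mA Ab; rewrite -lecR rmorphM rmorph_prod /= -!gapdetE // -[X in \det X * _ <= _](ul_Hm n m).
apply: (det_tail (d := fun k : 'I_(n + m) => (dk b k)%:CC)).
- by move=> i; rewrite ltcR dk_gt0.
- exact: Hm_dom.
Qed.

Lemma gapdet_set0 n : gapdet n set0 = 1.
Proof. by rewrite /gapdet setC0 Hm_setT det1. Qed.

Definition Vm (n : nat) (y : 'I_n -> R * R) : 'M[C]_n := \matrix_(k, j) phi k (y j).

Definition vdm2 (n : nat) (y : 'I_n -> R * R) : R :=
  \prod_(i < n) \prod_(j < n | (i < j)%N) sqmod (y j - y i).

Definition Zn (n : nat) : R := \prod_(k < n) (pi * k`!%:R).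

Lemma Zn_gt0 n : 0 < Zn n. Proof. by apply: prodr_gt0 => k _; exact: pifact_gt0. Qed.

Lemma mul_Vm n (y : 'I_n -> R * R) (x : 'rV[C]_n) j : (x *m Vm y) 0 j = psum x (y j).
Proof. by rewrite mxE; apply: eq_bigr => k _; rewrite mxE. Qed.

Lemma nsq_prod (I : finType) (P : pred I) (F : I -> C) :
  nsq (\prod_(i | P i) F i) = \prod_(i | P i) nsq (F i).
Proof. have n1 : nsq (1 : C) = 1 by rewrite /nsq /= expr1n expr0n addr0.
apply: (big_rec2 (fun a b => nsq a = b)) => // i a b _ <-; exact: nsqM. Qed.

Lemma cpxB (z w : R * R) : cpx (z - w) = cpx z - cpx w.
Proof. by []. Qed.

(** Extracting the norming constants from the rows and the Gaussian factors from the columns leaves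
    a Vandermonde matrix. *)
Lemma nsq_det_Vm n (y : 'I_n -> R * R) :
  nsq (\det (Vm y)) = vdm2 y * expR (- \sum_j sqmod (y j)) / Zn n.
Proof.
pose r : 'rV[C]_n := \row_k (Num.sqrt (pi * k`!%:R))^-1%:CC.
pose e : 'rV[C]_n := \row_j (expR (- (sqmod (y j) / 2)))%:CC.
have -> : Vm y = diag_mx r *m Vandermonde n (\row_j cpx (y j)) *m diag_mx e.
  apply/matrixP => k j; rewrite mul_mx_diag mxE mul_diag_mx !mxE /phi /phic.
  by rewrite rmorphM /=; ring.
rewrite !det_mulmx !det_diag det_Vandermonde !nsqM !nsq_prod.
have -> : \prod_i nsq (r 0 i) = (Zn n)^-1.
  rewrite /Zn -prodfV; apply: eq_bigr => k _.
  by rewrite mxE nsq_real exprVn sqr_sqrtr // ltW // pifact_gt0.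
have -> : \prod_i nsq (e 0 i) = expR (- \sum_j sqmod (y j)).
  rewrite -sumrN expR_sum; apply: eq_bigr => j _; rewrite mxE nsq_real -expRM_natl.
  by congr expR; field.
rewrite mulrC [(Zn n)^-1 * _]mulrC mulrA; congr (_ / _); rewrite mulrC; congr (_ * _).
apply: eq_bigr => i _; rewrite nsq_prod; apply: eq_bigr => j _.
by rewrite !mxE -cpxB nsq_cpx.
Qed.

End GinibreBasis.

(** * Void probabilities of the infinite ensemble *)

Section DetExpansion.
Variable F : fieldType.

(** The matrix determinant lemma, from two triangular factorisations of one block matrix. *)
Lemma det_addmul n p (A : 'M[F]_n) (c : 'M[F]_(n, p)) (v : 'M[F]_(p, n)) : A \in unitmx ->
  \det (A + c *m v) = \det A * \det (1%:M + v *m invmx A *m c).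
Proof.
move=> uA.
have E1 : block_mx 1%:M (- v) c A = block_mx 1%:M 0 c 1%:M *m block_mx 1%:M (- v) 0 (A + c *m v).
  rewrite mulmx_block !mul1mx !mulmx1 !mul0mx ?mulmx0 !addr0 mulmxN.
  by rewrite addrCA addNr addr0.
have E2 : block_mx 1%:M (- v) c A =
    block_mx (1%:M + v *m invmx A *m c) (- (v *m invmx A)) 0 1%:M *m block_mx 1%:M 0 c A.
  rewrite mulmx_block !mul1mx !mulmx1 !mul0mx ?mulmx0 !add0r mulNmx addrK mulNmx.
  by rewrite -mulmxA mulVmx // mulmx1.
have := congr1 (fun M => \det M) E1; rewrite {1}E2 !det_mulmx !det_ublock !det_lblock !det1.
by rewrite !mulr1 !mul1r => <-; rewrite mulrC.
Qed.

Lemma det_sylvester n p (c : 'M[F]_(n, p)) (v : 'M[F]_(p, n)) :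
  \det (1%:M + c *m v) = \det (1%:M + v *m c).
Proof. by rewrite det_addmul ?unitmx1 // det1 mul1r invmx1 mulmx1. Qed.

(** Its determinant is the principal minor of [M] on [S], written without leaving size [N]. *)
Definition colsel N (M : 'M[F]_N) (S : {set 'I_N}) : 'M[F]_N :=
  \matrix_(i, j) if j \in S then M i j else (i == j)%:R.

(** Multilinearity in the columns: each column comes from [M] or from the identity. *)
Lemma det_1add N (M : 'M[F]_N) : \det (1%:M + M) = \sum_(S : {set 'I_N}) \det (colsel M S).
Proof.
under [RHS]eq_bigr do rewrite -det_tr.
rewrite -det_tr /determinant [RHS]exchange_big /=; apply: eq_bigr => s _.
rewrite (eq_bigr (fun i => M (s i) i + (s i == i)%:R)); last first.
  by move=> i _; rewrite !mxE addrC.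
rewrite bigA_distr mulr_sumr; apply: eq_bigr => S _; congr (_ * _).
by apply: eq_bigr => i _; rewrite !mxE.
Qed.

Definition tupsel k N (M : 'M[F]_N) (s : {ffun 'I_k -> 'I_N}) : 'M[F]_k :=
  \matrix_(i, j) M (s i) (s j).

Lemma det_tupsel_ninj k N (M : 'M[F]_N) (s : {ffun 'I_k -> 'I_N}) :
  ~~ injectiveb s -> \det (tupsel M s) = 0.
Proof.
move=> /injectivePn[i [j ij sij]]; apply: (determinant_alternate ij) => l.
by rewrite !mxE sij.
Qed.

(** With [E] the 0-1 matrix of [s], the minor is [1%:M] plus a product through size [N]; Sylvester's
    identity moves the determinant from size [k] to size [N]. *)
Lemma det_tupsel k N (M : 'M[F]_N) (s : {ffun 'I_k -> 'I_N}) : injectiveb s ->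
  \det (tupsel M s) = \det (colsel M (s @: [set: 'I_k]%SET)).
Proof.
move=> /injectiveP si.
pose E : 'M[F]_(k, N) := \matrix_(i, j) (s i == j)%:R.
have EM p (X : 'M[F]_(N, p)) i j : (E *m X) i j = X (s i) j.
  rewrite mxE (bigD1 (s i)) //= !mxE eqxx mul1r big1 ?addr0 // => l /negPf ls.
  by rewrite !mxE eq_sym ls mul0r.
have ME p (X : 'M[F]_(p, N)) i j : (X *m E^T) i j = X i (s j).
  rewrite mxE (bigD1 (s j)) //= !mxE eqxx mulr1 big1 ?addr0 // => l /negPf ls.
  by rewrite !mxE eq_sym ls mulr0.
have -> : tupsel M s = 1%:M + E *m ((M - 1%:M) *m E^T).
  apply/matrixP => i j; rewrite [RHS]mxE EM ME !mxE.
  by rewrite (inj_eq si) addrC subrK.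
rewrite det_sylvester; congr determinant; apply/matrixP => i j.
rewrite -mulmxA [LHS]mxE [X in _ + X]mxE !mxE.
have [/imsetP[l _ ->]|jS] := boolP (j \in s @: [set: 'I_k]%SET).
  rewrite (bigD1 (s l)) //= [X in _ * X + _]mxE (bigD1 l) //= !mxE eqxx mulr1.
  rewrite big1 ?addr0 ?mulr1; last first.
    by move=> l' /negPf l'l; rewrite !mxE (inj_eq si) l'l mulr0.
  rewrite [X in _ + (_ + X)]big1 ?addr0; first by rewrite addrCA subrr addr0.
  move=> x xs; rewrite [X in _ * X]mxE big1 ?mulr0 // => l' _; rewrite !mxE.
  have [/eqP e1|] := boolP (s l' == x); last by rewrite mul0r.
  have [/eqP e2|] := boolP (s l' == s l); last by rewrite mulr0.
  by move: xs; rewrite -e1 e2 eqxx.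
rewrite big1 ?addr0 // => x _; rewrite [X in _ * X]mxE big1 ?mulr0 // => l _; rewrite !mxE.
have [/eqP e|] := boolP (s l == j); last by rewrite mulr0.
by case/negP: jS; apply/imsetP; exists l.
Qed.

Lemma sum_det_tupsel k N (M : 'M[F]_N) :
  \sum_(s : {ffun 'I_k -> 'I_N}) \det (tupsel M s) =
  k`!%:R * \sum_(S : {set 'I_N} | #|S| == k) \det (colsel M S).
Proof.
rewrite (bigID (fun s : {ffun 'I_k -> 'I_N} => injectiveb s)) /= [X in _ + X]big1 ?addr0; last first.
  by move=> s; exact: det_tupsel_ninj.
rewrite (partition_big (fun s : {ffun 'I_k -> 'I_N} => s @: [set: 'I_k]%SET) (fun S => #|S| == k)) /=; last first.
  by move=> s /injectiveP si; rewrite card_imset // cardsT card_ord.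
rewrite mulr_sumr; apply: eq_bigr => S /eqP Sk.
rewrite (eq_bigr (fun=> \det (colsel M S))); last first.
  by move=> s /andP[si /eqP <-]; exact: det_tupsel.
rewrite big_const -[X in iter X]/(#|_|).
have -> : #|[pred s : {ffun 'I_k -> 'I_N} | injectiveb s && (s @: [set: 'I_k]%SET == S)]| = k`!.
  rewrite -ffactnn -[X in X ^_ _]Sk -[X in _ ^_ X](card_ord k) -card_inj_ffuns_on.
  apply: eq_card => s; rewrite !inE andbC; apply/andP/andP.
    move=> [/eqP sS si]; split=> //; apply/ffun_onP => i; rewrite -sS; exact: imset_f.
  move=> [/ffun_onP sS si]; split=> //; rewrite eqEcard; apply/andP; split.
    by apply/fintype.subsetP => x /imsetP[i _ ->]; exact: sS.
  by move/injectiveP: (si) => si'; rewrite card_imset // cardsT card_ord Sk.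
by rewrite iter_addr_0 mulr_natl.
Qed.

End DetExpansion.

(** Finite Fredholm expansion. It sums over tuples instead of subsets, to match correlation
    functions integrated over products; a [k]-subset is the image of [k]! injective tuples, and the
    other tuples have determinant 0. *)
Lemma det_1sub (F : numFieldType) N (M : 'M[F]_N) :
  \det (1%:M - M) =
  \sum_(k < N.+1) (-1) ^+ k / k`!%:R * \sum_(s : {ffun 'I_k -> 'I_N}) \det (tupsel M s).
Proof.
rewrite det_1add (partition_big (fun S : {set 'I_N} => inord #|S| : 'I_N.+1) predT) //=.
apply: eq_bigr => k _; rewrite sum_det_tupsel mulrA divfK ?pnatr_eq0 ?gtn_eqF ?fact_gt0 //.
have cS (S : {set 'I_N}) : (#|S| < N.+1)%N by rewrite ltnS -[X in (_ <= X)%N](card_ord N) max_card.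
rewrite (eq_bigl (fun S : {set 'I_N} => #|S| == k)); last first.
  by move=> S; rewrite -val_eqE /= inordK.
rewrite mulr_sumr; apply: eq_bigr => S /eqP Sk.
pose d : 'rV[F]_N := \row_j (if j \in S then -1 else 1).
have -> : colsel (- M) S = colsel M S *m diag_mx d.
  apply/matrixP => i j; rewrite mul_mx_diag !mxE; case: ifP => _; by rewrite ?mulrN1 ?mulr1.
rewrite det_mulmx det_diag mulrC; congr (_ * _).
rewrite (bigID (mem S)) /= [X in _ * X]big1 ?mulr1; last by move=> j /negPf jS; rewrite mxE jS.
rewrite (eq_bigr (fun=> -1)); last by move=> j jS; rewrite mxE jS.
by rewrite prodr_const Sk.
Qed.

(** * Counting injective choices *)

Section Combinatorics.

(** When every [x i] is 0 or 1, both sides count the injections into the support of [x]. *)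
Lemma sum_inj_ffun01 (T : finType) k (x : T -> nat) : (forall i, x i <= 1)%N ->
  (\sum_(f : {ffun 'I_k -> T} | injectiveb f) \prod_i x (f i) = (\sum_i x i) ^_ k)%N.
Proof.
move=> x1; pose S := [set i | x i == 1%N]%SET.
have xS i : x i = (i \in S) :> nat.
  by rewrite finset.in_set; have := x1 i; case: (x i) => [|[]].
have -> : (\sum_i x i = #|S|)%N.
  by rewrite -sum1_card [RHS]big_mkcond /=; apply: eq_bigr => i _; rewrite xS; case: (i \in S).
rewrite -[X in _ = (_ ^_ X)%N](card_ord k) -card_inj_ffuns_on -sum1_card [RHS]big_mkcond [LHS]big_mkcond /=.
apply: eq_bigr => f _; rewrite !inE.
case: (injectiveb f); rewrite ?andbF //= andbT.
have [/forallP fS|] := boolP [forall i, f i \in S].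
  by apply: big1 => i _; rewrite xS fS.
by rewrite negb_forall => /existsP[i iS]; rewrite (bigD1 i) //= xS (negPf iS) mul0n.
Qed.

(* Union bound over the pairs of equal indices. *)
Lemma sum_ninj_ffun_le (R : numFieldType) (T : finType) k (a : T -> R) (del : R) : 0 <= del ->
  (forall i, 0 <= a i <= del) ->
  \sum_(f : {ffun 'I_k -> T} | ~~ injectiveb f) \prod_i a (f i) <=
  (k ^ 2)%:R * (del * (\sum_i a i) ^+ k.-1).
Proof.
move=> del0 ab; have a0 i : 0 <= a i by case/andP: (ab i).
have p0 (f : {ffun 'I_k -> T}) : 0 <= \prod_i a (f i) by apply: prodr_ge0.
set A := \sum_i a i; have A0 : 0 <= A by apply: sumr_ge0.
pose w (i j : 'I_k) := \sum_(f : {ffun 'I_k -> T} | (i != j) && (f i == f j)) \prod_l a (f l).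
have wb i j : w i j <= del * A ^+ k.-1.
  rewrite /w; have [->|ij] := eqVneq i j.
    rewrite big_pred0; last by move=> f; rewrite eqxx.
    by rewrite mulr_ge0 ?exprn_ge0.
  have ji : j != i by rewrite eq_sym.
  (* The factor at [i] and [j] is concentrated at [c], so the sum restricted to [f i = f j] becomes
     a sum over the common value [c] of a full product. *)
  pose G c (l : 'I_k) := fun x : T =>
    if (l == i) || (l == j) then (if x == c then a x else 0) else a x.
  have -> : \sum_(f : {ffun 'I_k -> T} | true && (f i == f j)) \prod_l a (f l) =
     \sum_c \prod_l \sum_x G c l x.
    under [RHS]eq_bigr do rewrite bigA_distr_bigA.
    rewrite exchange_big /= [LHS]big_mkcond /=; apply: eq_bigr => f _.
    rewrite (bigD1 (f i)) //= [X in _ = _ + X]big1 ?addr0; last first.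
      by move=> c /negPf cf; rewrite (bigD1 i) //= /G eqxx /= eq_sym cf mul0r.
    case: ifPn => [/eqP fij|fij].
      by apply: eq_bigr => l _; rewrite /G; case: ifPn => // /orP[/eqP ->|/eqP ->]; rewrite -?fij eqxx.
    by rewrite [RHS](bigD1 j) //= /G eqxx orbT eq_sym (negPf fij) mul0r.
  pose P := \prod_(l : 'I_k | (l != i) && (l != j)) A.
  have AP : A ^+ k.-1 = A * P.
    have <- : \prod_(l : 'I_k | l != i) A = A ^+ k.-1 by rewrite prodr_const cardC1 card_ord.
    by rewrite (bigD1 j).
  have Gc c : \prod_l \sum_x G c l x = a c * (a c * P).
    have Gs l : (l == i) || (l == j) -> \sum_x G c l x = a c.
      by move=> lij; rewrite /G lij -big_mkcond /= big_pred1_eq.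
    rewrite (bigD1 i) //= Gs ?eqxx // (bigD1 j) //= Gs ?eqxx ?orbT //; congr (_ * (_ * _)).
    by apply: eq_bigr => l /andP[/negPf li /negPf lj]; rewrite /G li lj.
  have P0 : 0 <= P by apply: prodr_ge0.
  rewrite AP mulrCA /A mulr_suml; apply: ler_sum => c _; rewrite Gc.
  by rewrite ler_wpM2l // ler_wpM2r //; case/andP: (ab c).
apply: (@le_trans _ _ (\sum_i \sum_j w i j)).
  have -> : \sum_i \sum_j w i j = \sum_(f : {ffun 'I_k -> T}) \sum_i \sum_j
      (if (i != j) && (f i == f j) then \prod_l a (f l) else 0).
    rewrite [RHS]exchange_big; apply: eq_bigr => i _; rewrite [RHS]exchange_big.
    by apply: eq_bigr => j _; exact: big_mkcond.
  rewrite [leLHS]big_mkcond /=; apply: ler_sum => f _; case: ifPn => [|_]; last first.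
    by apply: sumr_ge0 => i _; apply: sumr_ge0 => j _; case: ifP.
  move=> /injectivePn[i [j ij fij]]; rewrite [leRHS](bigD1 i) //= [X in _ <= X + _](bigD1 j) //= ij fij eqxx /=.
  rewrite -addrA lerDl addr_ge0 //; first by apply: sumr_ge0 => l _; case: ifP.
  by apply: sumr_ge0 => l _; apply: sumr_ge0 => m _; case: ifP.
apply: (@le_trans _ _ (\sum_(i < k) \sum_(j < k) del * A ^+ k.-1)).
  by apply: ler_sum => i _; apply: ler_sum => j _.
by rewrite !sumr_const !card_ord -mulrnA mulr_natl -mulnn.
Qed.

(** Pascal's rule makes the sum telescope; this is the exact error of truncated
    inclusion-exclusion. *)
Lemma alt_sum_bin (R : comNzRingType) n L : (0 < n)%N ->
  \sum_(k < L.+1) (-1) ^+ k * 'C(n, k)%:R = (-1) ^+ L * 'C(n.-1, L)%:R :> R.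
Proof.
case: n => // n _; elim: L => [|L IH]; first by rewrite big_ord1 !bin0.
rewrite big_ord_recr /= IH binS natrD exprS; ring.
Qed.

End Combinatorics.

(** * Finite-rank kernels and their convergence to the Ginibre kernel *)

Section Kernel.
Variable R : realType.
Local Notation C := R[i].
Local Notation Re := (@complex.Re R).
Local Notation Im := (@complex.Im R).
Local Notation "x %:CC" := (real_complex R x) (at level 1, format "x %:CC").

Definition cabs (c : C) : R := Num.sqrt (nsq c).

Lemma cabsE (c : C) : (cabs c)%:CC = `|c|. Proof. by rewrite normc_def. Qed.

Lemma cabs_ge0 c : 0 <= cabs c. Proof. exact: sqrtr_ge0. Qed.

Lemma cabsM a b : cabs (a * b) = cabs a * cabs b.
Proof. by rewrite /cabs nsqM sqrtrM ?nsq_ge0. Qed.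

Lemma cabsX a n : cabs (a ^+ n) = cabs a ^+ n.
Proof.
elim: n => [|n IH]; last by rewrite !exprS cabsM IH.
by rewrite !expr0 /cabs /nsq /= expr1n expr0n addr0 sqrtr1.
Qed.

Lemma cabsD a b : cabs (a + b) <= cabs a + cabs b.
Proof. by rewrite -lecR rmorphD /= !cabsE ler_normD. Qed.

Lemma cabs_sum (I : Type) (r : seq I) (P : pred I) (F : I -> C) :
  cabs (\sum_(i <- r | P i) F i) <= \sum_(i <- r | P i) cabs (F i).
Proof.
rewrite -lecR rmorph_sum /= cabsE; under [leRHS]eq_bigr do rewrite cabsE.
exact: ler_norm_sum.
Qed.

Lemma cabs_prod (I : finType) (P : pred I) (F : I -> C) :
  cabs (\prod_(i | P i) F i) = \prod_(i | P i) cabs (F i).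
Proof.
apply: (big_rec2 (fun a b => cabs a = b)) => [|i a b _ <-]; last exact: cabsM.
by rewrite /cabs /nsq /= expr1n expr0n addr0 sqrtr1.
Qed.

Lemma cabsN a : cabs (- a) = cabs a.
Proof. by rewrite /cabs /nsq; case: a => a b /=; rewrite !sqrrN. Qed.

Lemma cabs_real (r : R) : 0 <= r -> cabs r%:CC = r.
Proof. by move=> r0; rewrite /cabs nsq_real sqrtr_sqr ger0_norm. Qed.

Lemma cabs_conj a : cabs a^* = cabs a.
Proof. by rewrite /cabs nsq_conj. Qed.

Lemma Re_le_cabs a : `|Re a| <= cabs a.
Proof.
rewrite -sqrtr_sqr /cabs ler_sqrt ?nsq_ge0 //; rewrite /nsq lerDl; exact: sqr_ge0.
Qed.

Lemma cabs_le_ReIm a : cabs a <= `|Re a| + `|Im a|.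
Proof.
rewrite -(ler_sqr (cabs_ge0 a)) ?nnegrE ?addr_ge0 // sqr_sqrtr ?nsq_ge0 // /nsq.
by rewrite sqrrD !real_normK ?num_real // lerD2r lerDl mulrn_wge0 // mulr_ge0.
Qed.

Definition esum_ (N : nat) (u : C) : C := \sum_(k < N) u ^+ k / k`!%:R.
Definition rsum (N : nat) (x : R) : R := \sum_(k < N) x ^+ k / k`!%:R.
Definition rtail (N : nat) (x : R) : R := expR x - rsum N x.

Lemma rsum_series (x : R) : rsum ^~ x = series (exp_coeff x).
Proof. by apply/funext => N; rewrite /rsum seriesEord. Qed.

Lemma cvg_rsum (x : R) : rsum N x @[N --> \oo] --> expR x.
Proof. by rewrite rsum_series; exact: is_cvg_series_exp_coeff. Qed.

Lemma cvg_rtail (x : R) : rtail N x @[N --> \oo] --> (0 : R).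
Proof. rewrite -(subrr (expR x)); apply: cvgB; [exact: cvg_cst | exact: cvg_rsum]. Qed.

Lemma rsumD (N M : nat) x : rsum (N + M) x = rsum N x + \sum_(k < M) x ^+ (N + k) / (N + k)`!%:R.
Proof. by rewrite /rsum big_split_ord. Qed.

Lemma rsum_le_rtail N M x : 0 <= x -> rsum (N + M) x - rsum N x <= rtail N x.
Proof.
move=> x0; rewrite /rtail lerD2r.
have : nondecreasing_seq (rsum ^~ x).
  apply/nondecreasing_seqP => n; rewrite /rsum big_ord_recr /= lerDl.
  by rewrite divr_ge0 ?exprn_ge0.
move=> /nondecreasing_cvgn_le; move=> /(_ (cvgP _ (@cvg_rsum x)) (N + M)%N).
by rewrite (cvg_lim _ (@cvg_rsum x)).
Qed.

Lemma rtail_ge0 N x : 0 <= x -> 0 <= rtail N x.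
Proof. by move=> x0; have := @rsum_le_rtail N 0 x x0; rewrite addn0 subrr. Qed.

Lemma rtail_mono N x y : 0 <= x <= y -> rtail N x <= rtail N y.
Proof.
move=> /andP[x0 xy].
have cv z : (rsum (N + M) z - rsum N z) @[M --> \oo] --> rtail N z.
  apply: cvgB; last exact: cvg_cst.
  rewrite (_ : (fun M => rsum (N + M) z) = (fun M => rsum (M + N) z)).
    by have := @cvg_rsum z; rewrite -(cvg_shiftn N).
  by apply/funext => M; rewrite addnC.
apply: (ler_cvg_to (cv x) (cv y)); apply: nearW => M.
rewrite !rsumD ![rsum N _ + _]addrC !addrK; apply: ler_sum => k _.
by rewrite ler_wpM2r ?invr_ge0 // lerXn2r // nnegrE // (le_trans x0).
Qed.

Definition cexp (u : C) : C := Complex (expR (Re u) * cos (Im u)) (expR (Re u) * sin (Im u)).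

Lemma esum_real N (a : R) : esum_ N a%:CC = (rsum N a)%:CC.
Proof.
rewrite /esum_ /rsum rmorph_sum; apply: eq_bigr => k _ /=.
by rewrite rmorphM /= rmorphXn /= fmorphV /= rmorph_nat.
Qed.

Lemma esum_im N (b : R) : esum_ N (Complex 0 b) =
  Complex (\sum_(k < N) cos_coeff b k) (\sum_(k < N) sin_coeff b k).
Proof.
rewrite /esum_.
elim: N => [|N IH]; first by rewrite !big_ord0.
rewrite !big_ord_recr /= IH.
have -> : Complex 0 b ^+ N / N`!%:R =
   Complex (cos_coeff b N) (sin_coeff b N) :> C; last by [].
have e1 : Complex 0 b ^+ N = Complex ((~~ odd N)%:R * (-1) ^+ N./2 * b ^+ N) ((odd N)%:R * (-1) ^+ N.-1./2 * b ^+ N) :> C.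
  elim: (N) => [|n ih]; first by rewrite !expr0 /= !mul0r !mulr1.
  rewrite exprS ih /=; apply/eqP; rewrite eq_complex /= !mul0r !add0r; apply/andP; split; apply/eqP.
    rewrite negbK; case: n {ih} => [|n] /=; first by rewrite !mul0r mulr0 oppr0.
    by rewrite [(-1) ^+ _.+1]exprS [b ^+ n.+2]exprS; ring.
  by rewrite !exprS; ring.
rewrite e1 /cos_coeff /sin_coeff /=.
have -> : (N`!%:R : C)^-1 = ((N`!%:R : R)^-1)%:CC by rewrite fmorphV /= rmorph_nat.
by apply/eqP; rewrite eq_complex /= !mulr0 subr0 add0r !eqxx.
Qed.

Lemma exp_sumD (K : numFieldType) (a b : K) N :
  \sum_(0 <= n < N) (a + b) ^+ n / n`!%:R =
  \sum_(0 <= i < N) (\sum_(0 <= j < N - i) a ^+ j / j`!%:R) * (b ^+ i / i`!%:R).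
Proof.
have trm n : (a + b) ^+ n / n`!%:R =
   \sum_(0 <= i < n.+1) (a ^+ (n - i) / (n - i)`!%:R) * (b ^+ i / i`!%:R).
  rewrite exprDn mulr_suml big_mkord; apply: eq_bigr => i _.
  have ilen : (i <= n)%N by rewrite -ltnS.
  have f0 m : m`!%:R != 0 :> K by rewrite pnatr_eq0 gtn_eqF ?fact_gt0.
  have c0 : 'C(n, i)%:R != 0 :> K by rewrite pnatr_eq0 gtn_eqF ?bin_gt0.
  rewrite -mulr_natr -(bin_fact ilen) !natrM; field.
  by rewrite !f0 c0.
elim: N => [|N IH]; first by rewrite !big_geq.
rewrite big_nat_recr //= IH trm [RHS]big_nat_recr //= subSnn big_nat1 expr0 fact0 divr1 mul1r.
rewrite [X in _ + X]big_nat_recr //= subnn expr0 fact0 divr1 mul1r addrA; congr (_ + _).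
rewrite -big_split /=; apply: eq_big_nat => i /andP[_ iN].
by rewrite (subSn (ltnW iN)) [X in _ = X * _]big_nat_recr //= mulrDl.
Qed.

(** The truncated exponential fails to be multiplicative by a polynomial in [a] and [b] with
    nonnegative coefficients, so a complex defect is bounded by the one at the moduli. *)
Lemma exp_sum_defect (K : numFieldType) (a b : K) N :
  (\sum_(0 <= j < N) a ^+ j / j`!%:R) * (\sum_(0 <= i < N) b ^+ i / i`!%:R) -
  \sum_(0 <= n < N) (a + b) ^+ n / n`!%:R =
  \sum_(0 <= i < N) (\sum_(N - i <= j < N) a ^+ j / j`!%:R) * (b ^+ i / i`!%:R).
Proof.
rewrite exp_sumD mulr_sumr -sumrB; apply: eq_bigr => i _; rewrite -mulrBl; congr (_ * _).
by rewrite (@big_cat_nat _ _ _ (N - i) 0 N) //= ?leq_subr // addrAC subrr add0r.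
Qed.

Lemma cabs_nat n : cabs (n%:R : C) = n%:R.
Proof. by rewrite -(rmorph_nat (real_complex R)) cabs_real. Qed.

Lemma cabsV a : cabs a^-1 = (cabs a)^-1.
Proof. by apply: complexI; rewrite fmorphV /= !cabsE normfV. Qed.

Lemma cabs_term (u : C) k : cabs (u ^+ k / k`!%:R) = cabs u ^+ k / k`!%:R.
Proof. by rewrite cabsM cabsX cabsV cabs_nat. Qed.

Lemma rsum_le_exp N x : 0 <= x -> rsum N x <= expR x.
Proof. by move=> x0; rewrite -subr_ge0; exact: rtail_ge0. Qed.

Lemma rsum_ge0 N x : 0 <= x -> 0 <= rsum N x.
Proof. by move=> x0; apply: sumr_ge0 => i _; rewrite divr_ge0 ?exprn_ge0. Qed.

Lemma esum_mul N (u v : C) :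
  cabs (esum_ N u * esum_ N v - esum_ N (u + v)) <= rtail N (cabs u + cabs v).
Proof.
rewrite /esum_ -!(big_mkord xpredT (fun k => _ ^+ k / k`!%:R)) exp_sum_defect.
apply: le_trans (cabs_sum _ _ _) _.
apply: (@le_trans _ _ (\sum_(0 <= i < N) (\sum_(N - i <= j < N) cabs u ^+ j / j`!%:R) * (cabs v ^+ i / i`!%:R))).
  apply: ler_sum => i _; rewrite cabsM cabs_term ler_wpM2r ?divr_ge0 ?exprn_ge0 ?cabs_ge0 //.
  by apply: le_trans (cabs_sum _ _ _) _; apply: ler_sum => j _; rewrite cabs_term.
rewrite -exp_sum_defect !big_mkord -!/(rsum _ _) /rtail expRD lerD2r.
by rewrite ler_pM ?rsum_ge0 ?rsum_le_exp ?cabs_ge0.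
Qed.

Lemma cvg_le_dist (u : nat -> R) l (B : R) (N : nat) : u n @[n --> \oo] --> l ->
  (forall n, `|u (N + n)%N - u N| <= B) -> `|l - u N| <= B.
Proof.
move=> ul uB.
have c : `|u (n + N)%N - u N| @[n --> \oo] --> `|l - u N|.
  by apply: cvg_norm; apply: cvgB; [by have := ul; rewrite -(cvg_shiftn N) | exact: cvg_cst].
rewrite -(cvg_lim _ c) //; apply: limr_le; first by apply: cvgP c.
by apply: nearW => n; rewrite addnC.
Qed.

Lemma coeff_series_dist (cf : nat -> R) (b l : R) N :
  series cf n @[n --> \oo] --> l -> (forall k, `|cf k| <= `|b| ^+ k / k`!%:R) ->
  `|l - \sum_(k < N) cf k| <= rtail N `|b|.
Proof.
move=> cl cb; have e n : series cf n = \sum_(k < n) cf k by rewrite seriesEord.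
rewrite -e; apply: (cvg_le_dist cl) => n; rewrite !e big_split_ord /= addrAC subrr add0r.
apply: le_trans (ler_norm_sum _ _ _) _.
apply: le_trans (@rsum_le_rtail N n `|b| (normr_ge0 _)).
by rewrite rsumD addrAC subrr add0r; apply: ler_sum => k _.
Qed.

Lemma esum_cexp N (u : C) (B : R) : `|Re u| <= B -> `|Im u| <= B ->
  cabs (cexp u - esum_ N u) <= rtail N (B + B) + 3 * expR B * rtail N B.
Proof.
move=> aB bB; set a := Re u in aB *; set b := Im u in bB *.
have B0 : 0 <= B by exact: le_trans aB.
have uE : u = a%:CC + Complex 0 b by rewrite /a /b; case: (u) => ? ?; apply/eqP; rewrite eq_complex /= addr0 add0r !eqxx.
have cu : cexp u = (expR a)%:CC * Complex (cos b) (sin b).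
  by rewrite /cexp -/a -/b; apply/eqP; rewrite eq_complex /= !mul0r subr0 addr0 !eqxx.
set E1 := esum_ N a%:CC; set E2 := esum_ N (Complex 0 b).
(* The three errors are the multiplicative defect, the real exponential series and the cosine and
   sine series. *)
have -> : cexp u - esum_ N u = (E1 * E2 - esum_ N u) + (((expR a)%:CC - E1) * Complex (cos b) (sin b) + E1 * (Complex (cos b) (sin b) - E2)).
  by rewrite cu; ring.
have ca : cabs a%:CC = `|a| by rewrite /cabs nsq_real sqrtr_sqr.
have cb : cabs (Complex 0 b) = `|b| by rewrite /cabs /nsq /= expr0n add0r sqrtr_sqr.
have tB (x : R) : `|x| <= B -> rtail N `|x| <= rtail N B by move=> h; apply: rtail_mono; rewrite normr_ge0.
apply: le_trans (cabsD _ _) _; apply: lerD.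
  rewrite {1}uE; apply: le_trans (esum_mul _ _ _) _; rewrite ca cb.
  by apply: rtail_mono; rewrite addr_ge0 //= lerD.
apply: le_trans (cabsD _ _) _.
have -> : 3 * expR B * rtail N B = expR B * rtail N B + expR B * (2 * rtail N B) by ring.
have e1 : 1 <= expR B by apply: le_trans (expR_ge1Dx B); rewrite lerDl.
have t0 : 0 <= rtail N B by exact: rtail_ge0.
have dE : `|expR a - rsum N a| <= rtail N B.
  apply: le_trans (tB _ aB); apply: (@coeff_series_dist (exp_coeff a)).
    by have := @cvg_rsum a; rewrite rsum_series.
  by move=> k; rewrite /exp_coeff /= normrM normfV normrX [`|k`!%:R|]ger0_norm.
have dc : `|cos b - \sum_(k < N) cos_coeff b k| <= rtail N B.
  apply: le_trans (tB _ bB); apply: (@coeff_series_dist (cos_coeff b)).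
    have -> : cos b = lim (series (cos_coeff b) @ \oo) by rewrite unlock.
    exact: is_cvg_series_cos_coeff.
  move=> k; rewrite /cos_coeff /= !normrM normfV normrX [`|k`!%:R|]ger0_norm // ler_wpM2r ?invr_ge0 //.
  rewrite normrX normrN1 expr1n mulr1 ler_piMl ?exprn_ge0 //; by case: (odd k); rewrite /= ?normr0 ?normr1.
have ds : `|sin b - \sum_(k < N) sin_coeff b k| <= rtail N B.
  apply: le_trans (tB _ bB); apply: (@coeff_series_dist (sin_coeff b)).
    have -> : sin b = lim (series (sin_coeff b) @ \oo) by rewrite unlock.
    exact: is_cvg_series_sin_coeff.
  move=> k; rewrite /sin_coeff /= !normrM normfV normrX [`|k`!%:R|]ger0_norm // ler_wpM2r ?invr_ge0 //.
  rewrite normrX normrN1 expr1n mulr1 ler_piMl ?exprn_ge0 //; by case: (odd k); rewrite /= ?normr0 ?normr1.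
apply: lerD; rewrite cabsM.
  have -> : cabs (Complex (cos b) (sin b)) = 1.
    by rewrite /cabs /nsq /= cos2Dsin2 sqrtr1.
  rewrite mulr1 /E1 esum_real -rmorphB /= /cabs nsq_real sqrtr_sqr.
  by apply: le_trans dE _; rewrite ler_peMl.
apply: ler_pM; rewrite ?cabs_ge0 //.
  rewrite /E1 esum_real /cabs nsq_real sqrtr_sqr.
  apply: (@le_trans _ _ (rsum N B)); last exact: rsum_le_exp.
  apply: le_trans (ler_norm_sum _ _ _) _; apply: ler_sum => k _.
  by rewrite normrM normfV normrX [`|k`!%:R|]ger0_norm // ler_wpM2r ?invr_ge0 // lerXn2r ?nnegrE.
apply: le_trans (cabs_le_ReIm _) _; rewrite /E2 esum_im /= mulr_natl mulr2n; exact: lerD.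
Qed.

Definition Kn (N : nat) (z w : R * R) : C := \sum_(s < N) phi s z * (phi s w)^*.

Lemma KnE N z w : Kn N z w =
  (pi^-1 * expR (- (sqmod z / 2)) * expR (- (sqmod w / 2)))%:CC * esum_ N (cpx z * (cpx w)^*).
Proof.
rewrite /Kn /esum_ mulr_sumr; apply: eq_bigr => s _; rewrite /phi /phic.
have k0 : (0 : R) < s`!%:R by rewrite ltr0n fact_gt0.
have -> : (s`!%:R : C)^-1 = ((s`!%:R : R)^-1)%:CC by rewrite fmorphV /= rmorph_nat.
rewrite exprMn -rmorphXn /= [(cpx w ^+ s * _)^*]rmorphM /=.
have -> (x : R) : (x%:CC)^* = x%:CC by rewrite conjE /= oppr0.
set ez := expR _; set ew := expR _; set q := Num.sqrt _.
have -> : cpx z ^+ s * (ez / q)%:CC * ((cpx w ^+ s)^* * (ew / q)%:CC) =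
  (ez / q * (ew / q))%:CC * (cpx z ^+ s * (cpx w ^+ s)^*) by rewrite [in RHS]rmorphM /=; ring.
have -> : (pi^-1 * ez * ew)%:CC * (cpx z ^+ s * (cpx w ^+ s)^* * (s`!%:R^-1)%:CC) =
  (pi^-1 * ez * ew / s`!%:R)%:CC * (cpx z ^+ s * (cpx w ^+ s)^*) by rewrite [in RHS]rmorphM /=; ring.
congr (_%:CC * _).
have -> : ez / q * (ew / q) = ez * ew / q ^+ 2.
  by field; rewrite sqrtr_eq0 -ltNge pifact_gt0.
rewrite sqr_sqrtr ?ltW ?pifact_gt0 // invfM !mulrA; congr (_ / _).
by rewrite mulrC mulrA.
Qed.

Lemma ginibreKE z w : ginibreK z w =
  (pi^-1 * expR (- (sqmod z / 2)) * expR (- (sqmod w / 2)))%:CC * cexp (cpx z * (cpx w)^*) :> C.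
Proof.
rewrite /ginibreK; have -> : cpx z * conjc (cpx w) = cpx z * (cpx w)^* :> C by [].
set u := cpx z * _.
rewrite /cexp; move: (complex.Re u) (complex.Im u) => a b.
rewrite !expRD; apply/eqP; rewrite eq_complex /= !mul0r !subr0 !addr0.
by apply/andP; split; apply/eqP; ring.
Qed.

Lemma Kn_ginibre N z w B : sqmod z <= B -> sqmod w <= B ->
  cabs (ginibreK z w - Kn N z w) <= rtail N (B + B) + 3 * expR B * rtail N B.
Proof.
move=> zB wB; have B0 : 0 <= B by apply: le_trans zB; exact: sqmod_ge0.
rewrite ginibreKE KnE -mulrBr cabsM cabs_real; last first.
  by rewrite !mulr_ge0 ?expR_ge0 // invr_ge0 pi_ge0.
have p1 : pi^-1 <= 1 :> R by rewrite invf_le1 ?pi_gt0 //; have := pi_ge2 R; lra.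
have e1 (v : R * R) : expR (- (sqmod v / 2)) <= 1.
  by rewrite -expR0 ler_expR oppr_le0 divr_ge0 // sqmod_ge0.
have uB : cabs (cpx z * (cpx w)^*) <= B.
  rewrite cabsM cabs_conj /cabs !nsq_cpx -sqrtrM ?sqmod_ge0 //.
  rewrite -[leRHS]ger0_norm // -sqrtr_sqr ler_wsqrtr // expr2.
  by rewrite ler_pM ?sqmod_ge0.
have rB : `|Re (cpx z * (cpx w)^*)| <= B by exact: le_trans (Re_le_cabs _) uB.
have iB : `|Im (cpx z * (cpx w)^*)| <= B.
  apply: le_trans uB; rewrite -sqrtr_sqr /cabs ler_wsqrtr // /nsq lerDr; exact: sqr_ge0.
apply: le_trans (esum_cexp N rB iB); rewrite ler_piMl ?cabs_ge0 //.
apply: mulr_ile1; rewrite ?mulr_ge0 ?expR_ge0 ?invr_ge0 ?pi_ge0 //.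
by apply: mulr_ile1; rewrite ?expR_ge0 ?invr_ge0 ?pi_ge0.
Qed.

Lemma Kn_cvg B e : 0 < e -> exists N0, forall N, (N0 <= N)%N -> forall z w : R * R,
  sqmod z <= B -> sqmod w <= B -> cabs (ginibreK z w - Kn N z w) <= e.
Proof.
move=> e0.
have c : (rtail N (B + B) + 3 * expR B * rtail N B) @[N --> \oo] --> (0 + 3 * expR B * 0 : R).
  by apply: cvgD; [exact: cvg_rtail | apply: cvgM; [exact: cvg_cst | exact: cvg_rtail]].
have /cvgrPdist_le/(_ _ e0)[N0 _ N0P] := c.
exists N0 => N N0N z w zB wB; apply: le_trans (Kn_ginibre N zB wB) _.
have := N0P N N0N; rewrite mulr0 addr0 sub0r normrN; apply: le_trans; exact: ler_norm.
Qed.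

Lemma Kn_psd N n (x : 'I_n -> R * R) : psd (\matrix_(i, j) Kn N (x i) (x j)).
Proof.
move=> y; pose V : 'M[C]_(n, N) := \matrix_(i, s) phi s (x i).
have -> : \matrix_(i, j) Kn N (x i) (x j) = V *m 1%:M *m ctr V.
  by apply/matrixP => i j; rewrite mulmx1 !mxE; apply: eq_bigr => s _; rewrite !mxE.
rewrite hf_mul /hf mulmx1 mxE; apply: sumr_ge0 => s _.
by rewrite [ctr _ _ _]mxE [map_mx _ _ _ _]mxE -normCK exprn_ge0.
Qed.

Definition Kdet N n (x : 'I_n -> R * R) : R := Re (\det (\matrix_(i < n, j < n) Kn N (x i) (x j))).

Lemma KdetE N n (x : 'I_n -> R * R) : (Kdet N x)%:CC = \det (\matrix_(i < n, j < n) Kn N (x i) (x j)).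
Proof. by rewrite /Kdet -ge0_Re //; have /andP[] := psd_det (@Kn_psd N n x). Qed.

Lemma Kdet_ge0 N n (x : 'I_n -> R * R) : 0 <= Kdet N x.
Proof. by rewrite -lecR KdetE; have /andP[] := psd_det (@Kn_psd N n x). Qed.

Lemma Kn_diag_le N z : Kn N z z <= (pi^-1)%:CC.
Proof.
rewrite KnE -normCK -nsqE nsq_cpx esum_real -rmorphM /= lecR.
have -> : pi^-1 * expR (- (sqmod z / 2)) * expR (- (sqmod z / 2)) = pi^-1 * expR (- sqmod z) :> R.
  by rewrite -mulrA -expRD; congr (_ * expR _); field.
rewrite -mulrA ler_piMr ?invr_ge0 ?pi_ge0 // expRN mulrC ler_pdivrMr ?expR_gt0 // mul1r.
by rewrite rsum_le_exp // sqmod_ge0.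
Qed.

Lemma Kdet_le N n (x : 'I_n -> R * R) : Kdet N x <= pi^-1 ^+ n.
Proof.
rewrite -lecR KdetE; have /andP[_ /le_trans] := psd_det (@Kn_psd N n x); apply.
rewrite rmorphXn /= -[X in _ ^+ X]card_ord -prodr_const.
apply: ler_prod => i _; rewrite mxE Kn_diag_le andbT.
have := psd_diag i (@Kn_psd N n x); by rewrite mxE.
Qed.

(** One more basis function adds a rank one positive matrix. If [A] is invertible, the determinant
    is multiplied by 1 plus a value of the form; otherwise it was 0. *)
Lemma Kdet_monoS N n (x : 'I_n -> R * R) : Kdet N x <= Kdet N.+1 x.
Proof.
rewrite -lecR !KdetE; set A := \matrix_(i, j) Kn N _ _.
pose v : 'rV[C]_n := \row_j (phi N (x j))^*.
have -> : \matrix_(i, j) Kn N.+1 (x i) (x j) = A + ctr v *m v.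
  apply/matrixP => i j; rewrite !mxE big_ord1 !mxE conjCK /Kn big_ord_recr /=; congr (_ + _).
have pA : psd A by exact: Kn_psd.
have [A0|A0] := eqVneq (\det A) 0.
  rewrite A0; have /psd_det/andP[] // : psd (A + ctr v *m v).
  move=> y; rewrite /hf mulmxDr mulmxDl mxE addr_ge0 //; first exact: pA.
  have -> : y *m (ctr v *m v) *m ctr y = (y *m ctr v) *m ctr (y *m ctr v).
    rewrite ctrM; have -> : ctr (ctr v) = v by apply/matrixP => i j; rewrite !mxE conjCK.
    by rewrite !mulmxA.
  by rewrite mxE big_ord1 [ctr _ _ _]mxE [map_mx _ _ _ _]mxE -normCK exprn_ge0.
have uA : A \in unitmx by rewrite unitmxE unitfE.
rewrite det_addmul // ler_peMr //; first by have /andP[] := psd_det pA.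
rewrite det_mx11 mxE [1%:M 0 0]mxE eqxx lerDl.
have hA : ctr (invmx A) = invmx A.
  rewrite /ctr map_invmx trmx_inv; congr invmx.
  by apply/matrixP => k l; rewrite [LHS]mxE [LHS]mxE /= (psd_herm k l pA) conjCK.
have -> : (v *m invmx A *m ctr v) 0 0 = hf A (v *m invmx A).
  have e1 : v *m invmx A *m A = v by rewrite mulmxKV.
  have e2 : ctr (v *m invmx A) = invmx A *m ctr v by rewrite ctrM hA.
  by rewrite /hf e1 e2 mulmxA.
exact: pA.
Qed.

Lemma Kdet_mono N N' n (x : 'I_n -> R * R) : (N <= N')%N -> Kdet N x <= Kdet N' x.
Proof.
move=> /subnK <-; elim: (N' - N)%N => [|m IH] //.
by rewrite addSn; apply: le_trans IH (Kdet_monoS _ _).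
Qed.

Lemma det_close n (B e : R) : 0 < e -> exists2 d : R, 0 < d & forall M M' : 'M[C]_n,
  (forall i j, cabs (M i j) <= B) -> (forall i j, cabs (M i j - M' i j) <= d) ->
  cabs (\det M - \det M') <= e.
Proof.
move=> e0.
(* each permutation term is a product of entries, handled one factor at a time *)
have H (k : nat) (eps : R) : 0 < eps -> exists2 d : R, 0 < d & forall a b : 'I_k -> C,
    (forall i, cabs (a i) <= B) -> (forall i, cabs (a i - b i) <= d) ->
    cabs (\prod_i a i - \prod_i b i) <= eps.
  elim: k eps => [|k IH] eps eps0.
    exists 1 => // a b _ _; rewrite !big_ord0 subrr /cabs /nsq /= expr0n addr0 sqrtr0; exact: ltW.
  pose B' := Num.max B 1; have B1 : 1 <= B' by rewrite /B' le_max lexx orbT.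
  have BB : B <= B' by rewrite /B' le_max lexx.
  have C0 : 0 < B' ^+ k + 1 by rewrite ltr_wpDl // exprn_ge0 // (le_trans ler01).
  pose e1 := Num.min (eps / (2 * (B' + 1))) 1.
  have e10 : 0 < e1 by rewrite /e1 lt_min ltr01 andbT divr_gt0 // mulr_gt0 //; lra.
  have [d d0 dP] := IH e1 e10.
  pose d1 := Num.min (Num.min d 1) (eps / (2 * (B' ^+ k + 1))).
  exists d1 => [|a b aB ab]; first by rewrite /d1 !lt_min d0 ltr01 /= divr_gt0 // mulr_gt0.
  have d1d : d1 <= d by rewrite /d1 !ge_min lexx.
  have d1e : d1 <= eps / (2 * (B' ^+ k + 1)) by rewrite /d1 ge_min lexx orbT.
  have d11 : d1 <= 1 by rewrite /d1 !ge_min lexx orbT.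
  rewrite !big_ord_recl; set pa := \prod_(i < k) _; set pb := \prod_(i < k) _.
  have pab : cabs (pa - pb) <= e1 by apply: dP => i //; exact: le_trans (ab _) d1d.
  have paB : cabs pa <= B' ^+ k.
    rewrite /pa cabs_prod -[X in _ ^+ X]card_ord -prodr_const; apply: ler_prod => i _.
    by rewrite cabs_ge0 (le_trans (aB _)).
  have -> : a ord0 * pa - b ord0 * pb = (a ord0 - b ord0) * pa + b ord0 * (pa - pb) by ring.
  apply: le_trans (cabsD _ _) _; rewrite !cabsM.
  have bB : cabs (b ord0) <= B' + 1.
    have -> : b ord0 = a ord0 + - (a ord0 - b ord0) by ring.
    apply: le_trans (cabsD _ _) _; rewrite cabsN lerD // ?(le_trans (aB _)) ?(le_trans (ab _)) //.
  rewrite [leRHS](splitr eps); apply: lerD.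
    apply: (@le_trans _ _ (d1 * (B' ^+ k + 1))).
      by apply: ler_pM; rewrite ?cabs_ge0 // (le_trans paB) // lerDl.
    apply: (@le_trans _ _ (eps / (2 * (B' ^+ k + 1)) * (B' ^+ k + 1))).
      by rewrite ler_wpM2r // ltW.
    by rewrite le_eqVlt; apply/orP; left; apply/eqP; field; rewrite gt_eqF.
  apply: (@le_trans _ _ ((B' + 1) * (eps / (2 * (B' + 1))))).
    apply: ler_pM; rewrite ?cabs_ge0 // (le_trans pab) // /e1 ge_min lexx //.
  by rewrite le_eqVlt; apply/orP; left; apply/eqP; field; rewrite gt_eqF //; lra.
pose c : R := #|{: 'S_n}|%:R.
have c0 : 0 < c by rewrite ltr0n; apply/card_gt0P; exists (1%g : 'S_n).
have [d d0 dP] := H n (e / c) (divr_gt0 e0 c0).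
exists d => // M M' MB MM.
rewrite /determinant -sumrB; apply: le_trans (cabs_sum _ _ _) _.
apply: (@le_trans _ _ (\sum_(s : 'S_n) e / c)).
  apply: ler_sum => s _; rewrite -mulrBr cabsM.
  have -> : cabs ((-1) ^+ s) = 1.
    by rewrite cabsX cabsN; have := cabs_nat 1; rewrite mulr1n => ->; rewrite expr1n.
  by rewrite mul1r; apply: dP => i.
by rewrite sumr_const -[e / c *+ _]mulr_natr -[X in _ * X]/c divfK // gt_eqF.
Qed.

Lemma corr_close n B e : 0 < e -> exists N0, forall N, (N0 <= N)%N -> forall x : 'I_n -> R * R,
  (forall i, sqmod (x i) <= B) -> Kdet N x <= ginibre_corr x <= Kdet N x + e.
Proof.
move=> e0.
have close e' : 0 < e' -> exists N0, forall N, (N0 <= N)%N -> forall x : 'I_n -> R * R,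
    (forall i, sqmod (x i) <= B) -> `|ginibre_corr x - Kdet N x| <= e'.
  move=> e'0.
  have gB z w : sqmod z <= B -> sqmod w <= B -> cabs (ginibreK z w : C) <= expR B.
    move=> zB wB; rewrite ginibreKE cabsM cabs_real ?mulr_ge0 ?expR_ge0 ?invr_ge0 ?pi_ge0 //.
    have -> : cabs (cexp (cpx z * (cpx w)^*)) = expR (Re (cpx z * (cpx w)^*)).
      rewrite /cexp /cabs /nsq /= !exprMn -mulrDr cos2Dsin2 mulr1 sqrtr_sqr ger0_norm // expR_ge0.
    have p1 : pi^-1 <= 1 :> R by rewrite invf_le1 ?pi_gt0 //; have := pi_ge2 R; lra.
    rewrite -!mulrA -!expRD; apply: (@le_trans _ _ (1 * expR B)); last by rewrite mul1r.
    apply: ler_pM; rewrite ?expR_ge0 ?invr_ge0 ?pi_ge0 // ler_expR conjE /= /sqmod in zB wB *.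
    have h1 := sqr_ge0 (z.1 - w.1); have h2 := sqr_ge0 (z.2 - w.2); rewrite !sqrrB in h1 h2.
    have h3 := sqr_ge0 z.1; have h4 := sqr_ge0 z.2; lra.
  have [d d0 dP] := @det_close n (expR B) e' e'0.
  have [N0 N0P] := @Kn_cvg B d d0.
  exists N0 => N N0N x xB; rewrite /ginibre_corr /Kdet.
  rewrite -[X in `|X|]/(_ + _) -raddfB; apply: le_trans (Re_le_cabs _) _.
  by apply: dP => i j; rewrite !mxE ?gB // N0P.
have [N0 N0P] := close e e0.
exists N0 => N N0N x xB; apply/andP; split.
  (* The lower bound carries no error because [Kdet] increases in [N] towards the correlation
     function. *)
  apply/ler_addgt0Pr => e1 e10; have [N1 N1P] := close e1 e10.
  have := N1P _ (leq_maxr N N1) x xB; rewrite ler_distl => /andP[+ _].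
  have := Kdet_mono x (leq_maxl N N1); lra.
have := N0P N N0N x xB; rewrite ler_distl => /andP[]; lra.
Qed.

End Kernel.

(** * Iterated integrals of the correlation functions *)

Section IteratedIntegral.
Variable R : realType.
Local Notation C := R[i].
Local Notation Re := (@complex.Re R).
Local Notation Im := (@complex.Im R).
Local Notation "x %:CC" := (real_complex R x) (at level 1, format "x %:CC").
Local Notation L2 := (@L2 R).

Lemma L2_int_gen (A : set (R * R)) (f : R * R -> \bar R) : measurable A ->
  measurable_fun A f -> (\int[@leb2 R]_(x in A) f x = \int[L2]_(x in A) f x)%E.
Proof.
move=> mA mf; rewrite [LHS]integralE [RHS]integralE; congr (_ - _)%E.
  by apply: L2_int => //; exact: measurable_funepos.
by apply: L2_int => //; exact: measurable_funeneg.
Qed.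

(** Integrals of nonnegative functions are suprema over simple functions below them, so monotonicity
    holds for arbitrary functions. This spares measurability proofs for the inner integrals of
    [iint]. *)
Lemma le_integral_nomeas d (T : measurableType d) (mu : {measure set T -> \bar R}) (D : set T)
  (f g : T -> \bar R) : (forall x, D x -> (0 <= f x <= g x)%E) ->
  (\int[mu]_(x in D) f x <= \int[mu]_(x in D) g x)%E.
Proof.
move=> fg; rewrite [leLHS]integral_mkcond [leRHS]integral_mkcond.
have f0 x : (0 <= (f \_ D) x)%E.
  by apply: erestrict_ge0 => y /fg /andP[].
have g0 x : (0 <= (g \_ D) x)%E.
  by apply: erestrict_ge0 => y /fg /andP[]; exact: le_trans.
rewrite !ge0_integralTE //; apply: ub_ereal_sup => _ [h hf <-]; apply: ereal_sup_ubound; exists h => // x.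
by apply: le_trans (hf x) _; apply: lee_restrict => y /fg /andP[].
Qed.

Lemma tcons0 k (x : R * R) (y : 'I_k -> R * R) : tcons x y ord0 = x.
Proof. by rewrite /tcons unlift_none. Qed.

Lemma tconsS k (x : R * R) (y : 'I_k -> R * R) j : tcons x y (lift ord0 j) = y j.
Proof. by rewrite /tcons liftK. Qed.

Lemma eq_iint k (F G : ('I_k -> R * R) -> \bar R) A : (forall y, F y = G y) -> iint F A = iint G A.
Proof. by move=> FG; have -> : F = G by exact/funext. Qed.

Lemma iint_le k (F G : ('I_k -> R * R) -> \bar R) (A : 'I_k -> set (R * R)) :
  (forall y, (forall i, A i (y i)) -> (0 <= F y <= G y)%E) -> (0 <= iint F A <= iint G A)%E.
Proof.
elim: k F G A => [|k IH] F G A FG /=; first by apply: FG => -[].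
have H x : A ord0 x -> (0 <= iint (fun y => F (tcons x y)) (fun i => A (lift ord0 i))
   <= iint (fun y => G (tcons x y)) (fun i => A (lift ord0 i)))%E.
  move=> Ax; apply: IH => y Ay; apply: FG => i.
  by case: (unliftP ord0 i) => [j|] ->; rewrite ?tconsS ?tcons0.
apply/andP; split; last exact: (@le_integral_nomeas _ _ (@leb2 R)).
by apply: integral_ge0 => x /H /andP[].
Qed.

Lemma cint_bigsum A (I : Type) (s : seq I) (F : I -> R * R -> C) : measurable A -> (forall i, cint A (F i)) ->
  cint A (fun z => \sum_(i <- s) F i z).
Proof.
move=> mA cF; elim: s => [|i s IH].
  under eq_fun do rewrite big_nil.
  by split; exact: integrable0.
by under eq_fun do rewrite big_cons; apply: cintD.
Qed.

Lemma Cint_bigsum A (I : Type) (s : seq I) (F : I -> R * R -> C) : measurable A -> (forall i, cint A (F i)) ->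
  Cint A (fun z => \sum_(i <- s) F i z) = \sum_(i <- s) Cint A (F i).
Proof.
move=> mA cF; elim: s => [|i s IH].
  under eq_fun do rewrite big_nil.
  by rewrite big_nil /Cint /= !Rintegral_cst // !mul0r.
under eq_fun do rewrite big_cons.
by rewrite CintD // ?big_cons ?IH //; apply: cint_bigsum.
Qed.

(** Every summand separates the variables, so integrating them one at a time only uses linearity. *)
Lemma iint_prod k (D : finType) (c : D -> C) (g : D -> 'I_k -> R * R -> C) (A : 'I_k -> set (R * R)) :
  (forall i, measurable (A i)) -> (forall t i, cint (A i) (g t i)) ->
  iint (fun y => (Re (\sum_t c t * \prod_i g t i (y i)))%:E) A =
  (Re (\sum_t c t * \prod_i Cint (A i) (g t i)))%:E.
Proof.
elim: k c g A => [|k IH] c g A mA cg.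
  by rewrite /=; congr (Re _)%:E; apply: eq_bigr => t _; rewrite !big_ord0.
have E x : iint (fun y : 'I_k -> R * R => (Re (\sum_t c t * \prod_i g t i (tcons x y i)))%:E)
    (fun i => A (lift ord0 i)) =
   (Re (\sum_t (c t * \prod_(i < k) Cint (A (lift ord0 i)) (g t (lift ord0 i))) * g t ord0 x))%:E.
  under eq_iint => y.
    under eq_bigr => t _.
      rewrite big_ord_recl tcons0 mulrA.
      under eq_bigr do rewrite tconsS.
      over.
    over.
  rewrite (IH (fun t => c t * g t ord0 x) (fun t i => g t (lift ord0 i))) //.
  by congr (Re _)%:E; apply: eq_bigr => t _; rewrite mulrAC.
rewrite /=; under eq_integral do rewrite E.
pose G t x := (c t * \prod_(i < k) Cint (A (lift ord0 i)) (g t (lift ord0 i))) * g t ord0 x.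
have cG t : cint (A ord0) (G t) by apply: cintZ.
have [i1 _] := cint_bigsum (index_enum D) (mA ord0) cG.
rewrite L2_int_gen //; last by case/integrableP: i1.
transitivity (Re (Cint (A ord0) (fun z => \sum_t G t z)%R))%:E.
  by rewrite /Cint /= /Rintegral fineK // integrable_fin_num.
rewrite Cint_bigsum //; congr (Re _)%:E; apply: eq_bigr => t _.
by rewrite CintZ // big_ord_recl -mulrA [X in _ * X]mulrC.
Qed.

Definition phiphi (j k : nat) (z : R * R) : C := phi j z * (phi k z)^*.

(** Reindexing the conjugated factors by the permutation gathers everything that depends on [x i]
    into one factor, the form that [iint_prod] accepts. *)
Lemma Kdet_expand N k (x : 'I_k -> R * R) : \det (\matrix_(i < k, j < k) Kn N (x i) (x j)) =
  \sum_(t : 'S_k * {ffun 'I_k -> 'I_N}) (-1) ^+ t.1 *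
     \prod_i phiphi (t.2 i) (t.2 (t.1^-1 i)%g) (x i).
Proof.
rewrite -(pair_bigA _ (fun (u : 'S_k) (s : {ffun 'I_k -> 'I_N}) =>
   (-1) ^+ u * \prod_i phiphi (s i) (s (u^-1 i)%g) (x i))) /=; apply: eq_bigr => u _.
rewrite -mulr_sumr; congr (_ * _).
under eq_bigr => i _ do rewrite mxE /Kn.
rewrite bigA_distr_bigA; apply: eq_bigr => s _; rewrite !big_split /=; congr (_ * _).
rewrite [RHS](reindex_inj (@perm_inj _ u)) /=.
by apply: eq_bigr => i _; rewrite permK.
Qed.

Definition ikdet N k (A : 'I_k -> set (R * R)) : R :=
  Re (\sum_(t : 'S_k * {ffun 'I_k -> 'I_N}) (-1) ^+ t.1 *
     \prod_i Cint (A i) (phiphi (t.2 i) (t.2 (t.1^-1 i)%g))).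

Lemma iint_Kdet N k (A : 'I_k -> set (R * R)) : (forall i, measurable (A i)) ->
  iint (fun y => (Kdet N y)%:E) A = (ikdet N A)%:E.
Proof.
move=> mA; under eq_iint do rewrite /Kdet Kdet_expand.
rewrite (@iint_prod k _ (fun t : 'S_k * {ffun 'I_k -> 'I_N} => (-1) ^+ t.1)
  (fun t i => phiphi (t.2 i) (t.2 (t.1^-1 i)%g)) _ mA) // => t i; exact: cint_phiphi.
Qed.

Lemma sum_tupselE N k (M : 'M[C]_N) :
  \sum_(t : 'S_k * {ffun 'I_k -> 'I_N}) (-1) ^+ t.1 * \prod_i M (t.2 i) (t.2 (t.1^-1 i)%g) =
  \sum_(s : {ffun 'I_k -> 'I_N}) \det (tupsel M s).
Proof.
rewrite -(pair_bigA _ (fun (u : 'S_k) (s : {ffun 'I_k -> 'I_N}) =>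
   (-1) ^+ u * \prod_i M (s i) (s (u^-1 i)%g))) /= exchange_big; apply: eq_bigr => s _.
rewrite (reindex_inj invg_inj) /=; apply: eq_bigr => u _; rewrite odd_permV invgK; congr (_ * _).
by apply: eq_bigr => i _; rewrite mxE.
Qed.

(** The factorial moment of order [k] of the number of points in [A], for the ensemble of [N]
    points. *)
Definition Tk N k (A : set (R * R)) : R := Re (\sum_(s : {ffun 'I_k -> 'I_N}) \det (tupsel (Hm N A) s)).

Lemma Cint_bigcup (T : finType) (c : T -> set (R * R)) F : (forall t, measurable (c t)) ->
  (forall t u, t != u -> c t `&` c u = set0) -> (forall A, measurable A -> cint A F) ->
  Cint (\big[setU/set0]_t c t) F = \sum_t Cint (c t) F.
Proof.
move=> mc dc cF.
have := index_enum_uniq T; elim: (index_enum T) => [|t s IH] /=.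
  by rewrite !big_nil /Cint !Rintegral_set0.
move=> /andP[ts us]; rewrite !big_cons CintU ?IH //.
- exact: bigsetU_measurable.
- apply/disj_setPS => x [ctx]; elim: s ts {IH us} => [|u s IH]; first by rewrite big_nil.
  rewrite inE negb_or big_cons => /andP[tu ts] [cux|]; last exact: IH.
  by have : (c t `&` c u) x by []; rewrite dc.
- by apply: cF; apply: measurableU => //; exact: bigsetU_measurable.
Qed.

(** All choices of cells are summed, repeated ones included: integrals over products of cells then
    add up to the integral over the product of the union. *)
Lemma sum_ikdet N k (T : finType) (c : T -> set (R * R)) : (forall t, measurable (c t)) ->
  (forall t u, t != u -> c t `&` c u = set0) ->
  \sum_(f : {ffun 'I_k -> T}) ikdet N (fun i => c (f i)) = Tk N k (\big[setU/set0]_t c t).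
Proof.
move=> mc dc; rewrite /Tk -sum_tupselE /ikdet -raddf_sum; congr Re.
rewrite exchange_big /=; apply: eq_bigr => -[u s] _ /=; rewrite -mulr_sumr; congr (_ * _).
rewrite -(bigA_distr_bigA (fun i t => Cint (c t) (phiphi (s i) (s (u^-1 i)%g)))).
apply: eq_bigr => i _; rewrite mxE Cint_bigcup // => A mA; exact: cint_phiphi.
Qed.

Lemma bounded2_L2 (A : set (R * R)) : measurable A -> bounded2 A -> (L2 A < +oo)%E.
Proof.
move=> mA [M AM]; apply: (@le_lt_trans _ _ (L2 [set z | (sqmod z <= Num.max M 0)%R])).
  apply: le_measure => //; last by move=> z /AM h; rewrite /= le_max h.
  - by apply/mem_set.
  - by apply/mem_set; exact: measurable_disc.
by rewrite L2_disc ?ltry // le_max lexx orbT.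
Qed.

Definition area (A : set (R * R)) : R := fine (L2 A).

Lemma area_ge0 A : 0 <= area A. Proof. exact: fine_ge0. Qed.

Lemma areaE A : measurable A -> bounded2 A -> L2 A = (area A)%:E.
Proof. by move=> mA bA; rewrite fineK // ge0_fin_numE // bounded2_L2. Qed.

Lemma iint_cst k (c : R) (A : 'I_k -> set (R * R)) : (forall i, measurable (A i)) ->
  (forall i, bounded2 (A i)) -> iint (fun=> c%:E) A = (c * \prod_i area (A i))%:E.
Proof.
elim: k A => [|k IH] A mA bA /=; first by rewrite big_ord0 mulr1.
under eq_integral do rewrite IH //.
rewrite L2_int_gen //.
have -> := integral_cst L2 (mA ord0) (c * \prod_(i < k) area (A (lift ord0 i)))%:E.
rewrite -[X in (_ * X)%E]/(L2 (A ord0)) areaE // -EFinM; congr EFin.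
by rewrite big_ord_recl; ring.
Qed.

Lemma ikdet_bound N k (A : 'I_k -> set (R * R)) : (forall i, measurable (A i)) ->
  (forall i, bounded2 (A i)) -> 0 <= ikdet N A <= \prod_i (area (A i) / pi).
Proof.
move=> mA bA; rewrite -!lee_fin -iint_Kdet //.
have -> : \prod_i (area (A i) / pi) = pi^-1 ^+ k * \prod_i area (A i).
  by rewrite mulrC big_split /= prodr_const card_ord.
rewrite -iint_cst //; apply: iint_le => y _.
by rewrite !lee_fin Kdet_ge0 Kdet_le.
Qed.

Lemma iint_KdetD N k (e : R) (A : 'I_k -> set (R * R)) : (forall i, measurable (A i)) ->
  (forall i, bounded2 (A i)) ->
  iint (fun y => (Kdet N y + e)%:E) A = (ikdet N A + e * \prod_i area (A i))%:E.
Proof.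
move=> mA bA.
(* The added constant is one more product term, indexed by [unit]. *)
pose c (t : 'S_k * {ffun 'I_k -> 'I_N} + unit) : C := if t is inl t' then (-1) ^+ t'.1 else e%:CC.
pose g (t : 'S_k * {ffun 'I_k -> 'I_N} + unit) (i : 'I_k) : R * R -> C :=
  if t is inl t' then phiphi (t'.2 i) (t'.2 (t'.1^-1 i)%g) else fun=> (1 : R)%:CC.
have E y : Kdet N y + e = Re (\sum_t c t * \prod_i g t i (y i)).
  rewrite big_sumType /= big_const card_unit /= addr0 big1_eq mulr1 raddfD /=.
  by rewrite /Kdet Kdet_expand.
under eq_iint do rewrite E.
rewrite iint_prod //; last first.
  move=> [t|t] i; first exact: cint_phiphi.
  split; rewrite /g /= /comp /=; last exact: integrable0.
  apply/integrableP; split; first exact: measurable_cst.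
  by under eq_integral do rewrite abse1; rewrite integral_cst // mul1e bounded2_L2.
congr EFin; rewrite big_sumType /= big_const card_unit /= addr0 raddfD /=; congr (_ + _).
under eq_bigr do rewrite (Cint_real _ (fun=> 1)) Rintegral_cst // mul1r.
by rewrite -(rmorph_prod (real_complex R)) -rmorphM.
Qed.

Lemma iint_corr k B e : 0 < e -> exists N0, forall N, (N0 <= N)%N -> forall A : 'I_k -> set (R * R),
  (forall i, measurable (A i)) -> (forall i x, A i x -> sqmod x <= B) ->
  ((ikdet N A)%:E <= iint (fun x => (ginibre_corr x)%:E) A <=
   (ikdet N A + e * \prod_i area (A i))%:E)%E.
Proof.
move=> e0; have [N0 N0P] := @corr_close R k B e e0.
exists N0 => N N0N A mA AB.
have bA i : bounded2 (A i) by exists B; exact: AB.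
rewrite -iint_Kdet // -iint_KdetD //.
have H y : (forall i, A i (y i)) -> Kdet N y <= ginibre_corr y <= Kdet N y + e.
  by move=> Ay; apply: N0P => // i; exact/AB/Ay.
apply/andP; split.
  have /andP[] // : (0 <= iint (fun y => (Kdet N y)%:E) A <= iint (fun x => (ginibre_corr x)%:E) A)%E.
  by apply: iint_le => y /H /andP[h _]; rewrite !lee_fin Kdet_ge0.
have /andP[] // : (0 <= iint (fun y => (ginibre_corr y)%:E) A <= iint (fun x => (Kdet N x + e)%:E) A)%E.
by apply: iint_le => y /H /andP[h1 h2]; rewrite !lee_fin h2 andbT (le_trans _ h1) // Kdet_ge0.
Qed.

End IteratedIntegral.

(** * A grid of small half-open squares *)

Section Grid.
Variable R : realType.
Local Notation L2 := (@L2 R).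

Definition gint (n B i : nat) : set R := `[i%:R / n%:R - B%:R, i.+1%:R / n%:R - B%:R[%classic.
(** One interval more than [2 * B * n], so that the right end [B] is covered as well. *)
Definition gsize (n B : nat) := (2 * B * n).+1.
Definition gcell (n B : nat) (ij : 'I_(gsize n B) * 'I_(gsize n B)) : set (R * R) :=
  gint n B ij.1 `*` gint n B ij.2.

Lemma gintP n B i (x : R) : (0 < n)%N -> gint n B i x <-> i%:R <= (x + B%:R) * n%:R < i.+1%:R.
Proof.
move=> n0; rewrite /gint /= in_itv /=.
by rewrite lerBlDr ltrBrDr ler_pdivrMr ?ltr0n // ltr_pdivlMr ?ltr0n.
Qed.

Lemma gint_inj n B i j (x : R) : (0 < n)%N -> gint n B i x -> gint n B j x -> i = j.
Proof.
move=> n0 /(gintP _ _ _ n0) /andP[i1 i2] /(gintP _ _ _ n0) /andP[j1 j2].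
have := le_lt_trans i1 j2; have := le_lt_trans j1 i2; rewrite !ltr_nat !ltnS => ji ij.
by apply/eqP; rewrite eqn_leq ij.
Qed.

Lemma gint_cover n B (x : R) : (0 < n)%N -> `|x| <= B%:R -> exists i : 'I_(gsize n B), gint n B i x.
Proof.
move=> n0; rewrite ler_norml => /andP[x1 x2].
have x0 : 0 <= (x + B%:R) * n%:R by rewrite mulr_ge0 // -lerBlDr sub0r.
have /andP[t1 t2] := truncn_itv x0.
have tB : (Num.truncn ((x + B%:R) * n%:R)%R < gsize n B)%N.
  rewrite ltnS -(@ler_nat R); apply: le_trans t1 _; rewrite natrM ler_wpM2r //.
  by rewrite natrM mulr_natl mulr2n lerD2r.
by exists (Ordinal tB); apply/gintP => //=; rewrite t1.
Qed.

Lemma gint_close n B i (x y : R) : (0 < n)%N -> gint n B i x -> gint n B i y -> `|x - y| < n%:R^-1.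
Proof.
move=> n0; rewrite /gint /= !in_itv /= => /andP[x1 x2] /andP[y1 y2].
have -> : n%:R^-1 = i.+1%:R / n%:R - i%:R / n%:R :> R by rewrite -mulrBl -natr1 addrC addKr mul1r.
by rewrite ltr_norml; apply/andP; split; lra.
Qed.

Lemma measurable_gcell n B ij : measurable (@gcell n B ij).
Proof. by apply: measurableX; exact: measurable_itv. Qed.

Lemma gcell_disj n B ij kl : (0 < n)%N -> ij != kl -> @gcell n B ij `&` @gcell n B kl = set0.
Proof.
move=> n0; apply: contra_neqP => /eqP/set0P[z [[z1 z2] [z3 z4]]].
case: ij kl z1 z2 z3 z4 => i j [k l] /= z1 z2 z3 z4.
by congr pair; apply: val_inj; [exact: gint_inj z1 z3|exact: gint_inj z2 z4].
Qed.

Lemma gcell_area n B ij : (0 < n)%N -> L2 (@gcell n B ij) = ((n%:R ^- 2)%:E).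
Proof.
move=> n0; rewrite L2E /Defs.leb2 /gcell product_measure1E; try exact: measurable_itv.
have E i : lebesgue_measure (gint n B i) = (n%:R^-1)%:E :> \bar R.
  rewrite /gint lebesgue_measure_itv /= lte_fin ltrD2r ltr_pM2r ?invr_gt0 ?ltr0n // ltr_nat ltnSn.
  by rewrite -EFinB; congr EFin; rewrite -natr1 mulrDl; ring.
by rewrite -exprVn expr2 EFinM; congr (_ * _)%E; exact: E.
Qed.

Lemma norm_le_sqmod (z : R * R) B : sqmod z <= B ^+ 2 -> 0 <= B -> `|z.1| <= B /\ `|z.2| <= B.
Proof.
rewrite /sqmod => zB B0; rewrite -!(ler_sqr (normr_ge0 _)) ?nnegrE // !real_normK ?num_real //.
by have := sqr_ge0 z.1; have := sqr_ge0 z.2; split; lra.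
Qed.

Lemma gcell_cover n B (z : R * R) : (0 < n)%N -> sqmod z <= B%:R ^+ 2 -> exists ij, @gcell n B ij z.
Proof.
move=> n0 /norm_le_sqmod [] // z1 z2.
have [i iP] := gint_cover n0 z1; have [j jP] := gint_cover n0 z2.
by exists (i, j).
Qed.

End Grid.

Lemma near_inv_lt (R : realType) (e : R) : 0 < e -> \forall n \near \oo, n%:R^-1 < e.
Proof.
move=> e0; exists (Num.truncn e^-1).+1 => // n /= ne.
have ne' : e^-1 < n%:R :> R by rewrite (lt_le_trans (truncnS_gt _)) ?ler_nat.
by rewrite invf_plt ?posrE // (lt_trans _ ne') // invr_gt0.
Qed.

Section FallingFactorialBound.

Lemma sum_inj_ffun_le (T : finType) k (x : T -> nat) :
  (\sum_(f : {ffun 'I_k -> T} | injectiveb f) \prod_i x (f i) <= (\sum_i x i) ^_ k)%N.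
Proof.
(* Send an injective choice of cells with a point in each to the injective choice of points. *)
pose P := {c : T & 'I_(x c)}.
have -> : (\sum_i x i = #|{: P}|)%N.
  by rewrite card_tagged sumnE big_map enumT; apply: eq_bigr => c _; rewrite card_ord.
rewrite -[X in _ ^_ X](card_ord k) -card_inj_ffuns -sum1_card.
rewrite (partition_big (fun g : {ffun 'I_k -> P} => [ffun i => tag (g i)]) predT) //=.
rewrite big_mkcond /=; apply: leq_sum => f _; case: ifP => // /injectiveP fi.
have -> : (\prod_i x (f i) = #|[pred h : {dffun forall i : 'I_k, 'I_(x (f i))} | true]|)%N.
  by rewrite cardT -cardE card_dep_ffun foldrE big_map enumT; apply: eq_bigr => i _; rewrite card_ord.
pose G (h : {dffun forall i : 'I_k, 'I_(x (f i))}) : {ffun 'I_k -> P} :=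
  [ffun i => Tagged (fun c => 'I_(x c)) (h i)].
have Gi : injective G.
  move=> h1 h2 e; apply/ffunP => i; have := congr1 (fun g : {ffun 'I_k -> P} => g i) e.
  by rewrite !ffunE => /eqP; rewrite -tag_eqE /tag_eq eqxx /= tagged_asE => /eqP.
rewrite sum1_card -(card_imset _ Gi); apply: subset_leq_card; apply/fintype.subsetP => g /imsetP[h _ ->].
rewrite unfold_in; apply/andP; split.
  by rewrite inE; apply/injectiveP => i j; rewrite !ffunE => /(congr1 tag) /= /fi.
by apply/eqP/ffunP => i; rewrite !ffunE.
Qed.

End FallingFactorialBound.

Lemma near_all_seq (T : eqType) (s : seq T) (Q : T -> nat -> Prop) :
  (forall x, x \in s -> \forall n \near \oo, Q x n) -> \forall n \near \oo, forall x, x \in s -> Q x n.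
Proof.
elim: s => [|a s IH] H; first by apply: nearW => n x.
have H1 : \forall n \near \oo, Q a n by apply: H; rewrite mem_head.
have H2 : \forall n \near \oo, forall x, x \in s -> Q x n.
  by apply: IH => x xs; apply: H; rewrite inE xs orbT.
near=> n => x; rewrite inE => /orP[/eqP ->|xs]; first by near: n.
by move: x xs; near: n.
Unshelve. all: end_near. Qed.

Lemma expR1_le4 (R : realType) : expR 1 <= 4 :> R.
Proof.
have h := expR_ge1Dx (- (2^-1) : R); have h0 := expR_gt0 (2^-1 : R).
have h1 : expR (2^-1) * expR (- 2^-1) = 1 :> R by rewrite -expRD subrr expR0.
have -> : expR 1 = expR (2^-1) * expR 2^-1 :> R by rewrite -expRD; congr expR; field.
have h2 : expR 2^-1 <= 2 :> R by nra.
nra.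
Qed.

(** Weierstrass' product inequality. *)
Lemma prod_1B_ge (R : realType) m (x : nat -> R) : (forall i, 0 <= x i <= 1) ->
  1 - \sum_(i < m) x i <= \prod_(i < m) (1 - x i).
Proof.
move=> x01; elim: m => [|m IH]; first by rewrite !big_ord0 subr0.
rewrite !big_ord_recr /=; have /andP[x0 x1] := x01 m.
have s0 : 0 <= \sum_(i < m) x i by apply: sumr_ge0 => i _; case/andP: (x01 i).
apply: (@le_trans _ _ ((1 - \sum_(i < m) x i) * (1 - x m))); first nra.
by rewrite ler_wpM2r // subr_ge0.
Qed.

(** [dk_ge] with [c = del] bounds [1 - dk b (n + i)] by [rho ^+ n / (1 + del) ^+ i.+1], where
    [rho < 1] because [del / (1 + del) < ln (1 + del)]. The series in [i] sums to at most [1 / del],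
    so [rho ^+ n < del / 2] leaves a product of at least one half, whatever its length. *)
Lemma dk_prod_ge (R : realType) (del : R) : 0 < del -> exists b0 : R, forall b, b0 <= b ->
  forall n : nat, (1 + del) * b <= n%:R -> forall m, 2^-1 <= \prod_(i < m) dk b (n + i).
Proof.
move=> d0; have d1 : 0 < 1 + del by lra.
pose q := expR (del / (1 + del)).
have q1 : q < 1 + del.
  have : 1 + - (del / (1 + del)) < expR (- (del / (1 + del))).
    by rewrite expR_gt1Dx // oppr_eq0 mulf_neq0 ?invr_eq0 ?gt_eqF.
  have -> : 1 + - (del / (1 + del)) = (1 + del)^-1 by field; rewrite gt_eqF.
  by rewrite expRN ltf_pV2 ?posrE ?expR_gt0.
pose rho := q / (1 + del).
have r0 : 0 <= rho by rewrite divr_ge0 ?expR_ge0 // ltW.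
have r1 : rho < 1 by rewrite ltr_pdivrMr // mul1r.
have [n0 _ n0P] : \forall n \near \oo, rho ^+ n < del / 2.
  have : `|rho| < 1 by rewrite ger0_norm.
  move=> /cvg_expr /(@cvgr0Pnorm_lt _ _ _ _ _ _) /(_ (del / 2)).
  rewrite divr_gt0 // => /(_ isT); apply: filterS => L; exact: (le_lt_trans (ler_norm _)).
exists n0%:R => b b0 n nb m.
have bn : b <= n%:R by apply: le_trans nb; rewrite ler_peMl ?(le_trans _ b0) // lerDl ltW.
have /n0P nn : (n0 <= n)%N by rewrite -(ler_nat R) (le_trans b0).
have H i : 1 - dk b (n + i) <= rho ^+ n / (1 + del) ^+ i.+1.
  have h := dk_ge b (n + i) d0.
  rewrite lerBlDr -lerBlDl; apply: le_trans h; rewrite lerD2l lerN2.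
  have e0 k : 0 <= (1 + del) ^- k by rewrite invr_ge0 exprn_ge0 // ltW.
  rewrite /rho expr_div_n -addnS exprD invfM mulrA ler_wpM2r // ler_wpM2r // /q -expRM_natl ler_expR.
  rewrite mulrCA ler_wpM2l //; first exact: ltW.
  by rewrite ler_pdivlMr // mulrC.
have x01 i : 0 <= 1 - dk b (n + i) <= 1 by rewrite subr_ge0 dk_le1 gerBl ltW ?dk_gt0.
have -> : \prod_(i < m) dk b (n + i) = \prod_(i < m) (1 - (1 - dk b (n + i))).
  by apply: eq_bigr => i _; rewrite subKr.
apply: le_trans (prod_1B_ge m x01).
have S : \sum_(i < m) (1 + del) ^- i.+1 = (1 - (1 + del) ^- m) / del.
  elim: (m) => [|k IH]; first by rewrite big_ord0 expr0 invr1 subrr mul0r.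
  rewrite big_ord_recr /= IH exprS invfM; field.
  by rewrite expf_neq0 ?gt_eqF.
have : \sum_(i < m) (1 - dk b (n + i)) <= 2^-1; last lra.
apply: (@le_trans _ _ (rho ^+ n * \sum_(i < m) (1 + del) ^- i.+1)).
  by rewrite mulr_sumr; apply: ler_sum => i _.
apply: (@le_trans _ _ (del / 2 * (del^-1))).
  have s0 : 0 <= \sum_(i < m) (1 + del) ^- i.+1.
    by apply: sumr_ge0 => i _; rewrite invr_ge0 exprn_ge0 // ltW.
  apply: (ler_pM _ s0 (ltW nn)); first by rewrite exprn_ge0.
  rewrite S ler_piMl // ?invr_ge0; first exact: ltW.
  by rewrite gerBl invr_ge0 exprn_ge0 // ltW.
by rewrite mulrAC divff ?gt_eqF // mul1r.
Qed.

(** * Factorial moments and void probabilities of the process *)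

Section Process.
Variable R : realType.
Local Notation C := R[i].
Local Notation Re := (@complex.Re R).
Local Notation Im := (@complex.Im R).
Local Notation "x %:CC" := (real_complex R x) (at level 1, format "x %:CC").
Local Notation L2 := (@L2 R).
Variables (d : measure_display) (Omega : measurableType d) (P : probability Omega R)
  (S : Omega -> set (R * R)).
Hypothesis gin : is_infinite_ginibre P S.
Variables (A : set (R * R)) (B : nat).
Hypothesis mA : measurable A.
Hypothesis AB : forall z, A z -> sqmod z <= B%:R ^+ 2.

Let bA : bounded2 A. Proof. by exists (B%:R ^+ 2). Qed.

Definition pts (w : Omega) : seq (R * R) := finmap.enum_fset (fset_set (S w `&` A)).
Definition cnt (w : Omega) (c : set (R * R)) : nat := count (fun x => `[< c x >]) (pts w).

Lemma ptsP w x : x \in pts w <-> (S w `&` A) x.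
Proof.
have [fS _ _] := gin; have h : (x \in pts w) = (x \in S w `&` A) := in_fset_set (fS w A bA) x.
by rewrite h; split; [exact: set_mem|exact: mem_set].
Qed.

Lemma nptsE w c : c `<=` A -> npts (S w) c = ((cnt w c)%:R)%:E.
Proof.
move=> cA; have [fS _ _] := gin.
have fc : finite_set (S w `&` c) by apply: sub_finite_set (fS w A bA) => x [Sx /cA].
rewrite /npts esum_fset ?fsbig_finite //= sumEFin; congr EFin.
rewrite big_const_seq count_predT iter_addr_0; congr (_%:R).
rewrite /cnt -size_filter; apply: perm_size; apply: uniq_perm.
- exact: finmap.fset_uniq.
- by rewrite filter_uniq //; exact: finmap.fset_uniq.
- move=> x; rewrite mem_filter in_fset_set //; apply/idP/idP.
    move=> /set_mem [Sx cx]; apply/andP; split; first exact/asboolP.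
    by apply/ptsP; split => //; exact: cA.
  by move=> /andP[/asboolP cx /ptsP[Sx _]]; apply: mem_set.
Qed.

Lemma measurable_cnt c : measurable c -> c `<=` A -> measurable_fun setT (fun w => (cnt w c)%:R : R).
Proof.
move=> mc cA; have [_ mS _] := gin; apply/measurable_EFinP.
by apply: eq_measurable_fun (mS c mc) => w _; rewrite nptsE.
Qed.

Local Notation num w := (size (pts w)).

Lemma cnt_num w : cnt w A = num w.
Proof. by apply/eqP; rewrite -all_count; apply/allP => x /ptsP[_ /asboolP]. Qed.

Lemma measurable_num : measurable_fun setT (fun w => (num w)%:R : R).
Proof. by under eq_fun do rewrite -cnt_num; exact: measurable_cnt. Qed.

Definition cell n (ij : 'I_(gsize n B) * 'I_(gsize n B)) := @gcell R n B ij `&` A.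

Lemma measurable_cell n ij : measurable (@cell n ij).
Proof. by apply: measurableI => //; exact: measurable_gcell. Qed.

Lemma cellA n ij : @cell n ij `<=` A. Proof. by move=> z []. Qed.

Lemma cell_disj n ij kl : (0 < n)%N -> ij != kl -> @cell n ij `&` @cell n kl = set0.
Proof.
by move=> n0 /(@gcell_disj R _ B _ _ n0) e; rewrite /cell setIACA e set0I.
Qed.

Lemma cell_cover n : (0 < n)%N -> \big[setU/set0]_ij (@cell n ij) = A.
Proof.
move=> n0; apply/seteqP; split => z.
  elim: (index_enum _) => [|ij s IH]; rewrite ?big_nil // big_cons => -[[]//|]; exact: IH.
move=> Az; have [ij ijz] := gcell_cover n0 (AB Az).
by rewrite (bigD1 ij) //=; left.
Qed.

Lemma sum_cnt n w : (0 < n)%N -> (\sum_ij cnt w (@cell n ij) = num w)%N.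
Proof.
move=> n0; under eq_bigr do rewrite /cnt -sum1_count big_mkcond.
rewrite exchange_big /= -sum1_size; apply: eq_big_seq => x /ptsP[_ Ax].
have [ij ijx] := gcell_cover n0 (AB Ax).
rewrite (bigD1 ij) //= big1 => [|kl klij]; first by rewrite asboolT.
rewrite asboolF // => -[klx _]; have := @gcell_disj R _ B _ _ n0 klij; rewrite -subset0 => /(_ x); exact.
Qed.

(** Only finitely many points lie in [A]; a mesh below their smallest separation puts them in
    different cells. The threshold depends on [w]. *)
Lemma near_cnt_le1 w : \forall n \near \oo, forall ij, (cnt w (@cell n ij) <= 1)%N.
Proof.
have H : \forall n \near \oo, forall x, x \in pts w -> forall y, y \in pts w ->
    x != y -> ~ exists ij, @cell n ij x /\ @cell n ij y.
  apply: near_all_seq => x xs; apply: near_all_seq => y ys.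
  have [->|xy] := eqVneq x y; first exact: nearW.
  have e0 : 0 < Num.max `|x.1 - y.1| `|x.2 - y.2|.
    rewrite lt_max !normr_gt0 !subr_eq0 -negb_and; apply: contra xy => /andP[/eqP e1 /eqP e2].
    by apply/eqP; case: x y {xs ys} e1 e2 => ? ? [? ?] /= -> ->.
  near=> n => _ [ij [[[x1 x2] _] [[y1 y2] _]]].
  have n0 : (0 < n)%N by near: n; exact: nbhs_infty_gt.
  have c1 := gint_close n0 x1 y1; have c2 := gint_close n0 x2 y2.
  have : n%:R^-1 < Num.max `|x.1 - y.1| `|x.2 - y.2| by near: n; exact: near_inv_lt.
  by rewrite lt_max => /orP[]; lra.
near=> n => ij; rewrite leqNgt; apply/negP; rewrite /cnt -size_filter.
have us : uniq [seq x <- pts w | `[< cell ij x >]] by rewrite filter_uniq //; exact: finmap.fset_uniq.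
case E : [seq x <- pts w | `[< cell ij x >]] us => [|x [|y s]] //= /andP[xy _] _.
have : x \in [seq x <- pts w | `[< cell ij x >]] by rewrite E mem_head.
have : y \in [seq x <- pts w | `[< cell ij x >]] by rewrite E !inE eqxx orbT.
rewrite !mem_filter => /andP[/asboolP cy yw] /andP[/asboolP cx xw].
have Hn : forall x, x \in pts w -> forall y, y \in pts w ->
    x != y -> ~ exists ij, @cell n ij x /\ @cell n ij y by near: n.
apply: (Hn x xw y yw); last by exists ij.
by apply: contra xy => /eqP ->; rewrite mem_head.
Unshelve. all: end_near. Qed.

(** Counts [k]-tuples of points lying in [k] distinct cells. Its expectation involves only disjoint
    sets, where the defining property of the process applies, and on a fine grid it equals the
    falling factorial of the number of points. *)
Definition Yk n k w : nat :=
  (\sum_(f : {ffun 'I_k -> 'I_(gsize n B) * 'I_(gsize n B)} | injectiveb f) \prod_i cnt w (cell (f i)))%N.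

Lemma Yk_le n k w : (0 < n)%N -> (Yk n k w <= num w ^_ k)%N.
Proof. by move=> n0; rewrite -(sum_cnt w n0); exact: sum_inj_ffun_le. Qed.

Lemma Yk_near k w : \forall n \near \oo, Yk n k w = (num w ^_ k)%N.
Proof.
near=> n; rewrite -(@sum_cnt n w); last by near: n; exact: nbhs_infty_gt.
apply: sum_inj_ffun01; near: n; exact: near_cnt_le1.
Unshelve. all: end_near. Qed.

Lemma Yk_R n k w : (Yk n k w)%:R =
 \sum_(f : {ffun 'I_k -> 'I_(gsize n B) * 'I_(gsize n B)} | injectiveb f) \prod_i (cnt w (cell (f i)))%:R :> R.
Proof. by rewrite natr_sum; apply: eq_bigr => f _; rewrite natr_prod. Qed.

Lemma measurable_prodcnt n k (f : {ffun 'I_k -> 'I_(gsize n B) * 'I_(gsize n B)}) :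
  measurable_fun setT (fun w => \prod_i (cnt w (cell (f i)))%:R : R).
Proof.
apply: measurable_prod => i _; apply: measurable_cnt; [exact: measurable_cell|exact: cellA].
Qed.

Lemma measurable_Yk n k : measurable_fun setT (fun w => (Yk n k w)%:R : R).
Proof.
under eq_fun do rewrite Yk_R -big_filter.
by apply: measurable_sum => f; exact: measurable_prodcnt.
Qed.

Lemma int_Yk n k : (0 < n)%N -> (\int[P]_w ((Yk n k w)%:R : R)%:E =
  \sum_(f : {ffun 'I_k -> 'I_(gsize n B) * 'I_(gsize n B)} | injectiveb f)
     iint (fun x => (ginibre_corr x)%:E) (fun i => cell (f i)))%E.
Proof.
move=> n0; under eq_integral do rewrite Yk_R -big_filter -sumEFin.
rewrite ge0_integral_sum //; last 2 first.
- by move=> f; apply/measurable_EFinP; exact: measurable_prodcnt.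
- by move=> f w _; rewrite lee_fin prodr_ge0.
rewrite big_filter; apply: eq_bigr => f /injectiveP fi.
have [_ _ <-] := gin.
- apply: eq_integral => w _; rewrite -prodEFin; apply: eq_bigr => i _; rewrite nptsE //; exact: cellA.
- by move=> i; exact: measurable_cell.
- by move=> i; exists (B%:R ^+ 2) => x [_ /AB].
- by move=> i j ij; rewrite cell_disj // (inj_eq fi).
Qed.

Let a : R := area A / pi.
Let a0 : 0 <= a. Proof. by rewrite divr_ge0 ?area_ge0 // pi_ge0. Qed.

Lemma Tk_bound N k : 0 <= Tk N k A <= a ^+ k.
Proof.
(* [sum_ikdet] for the trivial partition of [A] into one cell. *)
have d1 (t u : unit) : t != u -> (fun=> A) t `&` (fun=> A) u = set0 by case: t u => -[].
have := @sum_ikdet R N k unit (fun=> A) (fun=> mA) d1.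
rewrite [X in Tk N k X]big_const card_unit /= setU0 => <-.
rewrite big_const card_ffun card_unit exp1n /= addr0.
have := @ikdet_bound R N k (fun=> A) (fun=> mA) (fun=> bA).
by rewrite prodr_const card_ord.
Qed.

(** The grid has side at most [2 * B + 1] for every mesh, so [W] bounds the total area of the
    cells. *)
Let W : R := (2 * B%:R + 1) ^+ 2.
Let W1 : 1 <= W. Proof. by rewrite exprn_ege1 // lerDr mulr_ge0. Qed.

Lemma area_cell n (ij : 'I_(gsize n B) * 'I_(gsize n B)) : (0 < n)%N -> 0 <= area (cell ij) <= n%:R ^- 2.
Proof.
move=> n0; rewrite area_ge0 /= -lee_fin -areaE; last 2 first.
- exact: measurable_cell.
- by exists (B%:R ^+ 2) => x [_ /AB].
rewrite -(@gcell_area R n B ij n0); apply: le_measure.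
- by apply/mem_set; exact: measurable_cell.
- by apply/mem_set; exact: measurable_gcell.
- by move=> z [].
Qed.

Lemma sum_area n : (0 < n)%N -> \sum_(ij : 'I_(gsize n B) * 'I_(gsize n B)) area (cell ij) <= W.
Proof.
move=> n0; apply: (@le_trans _ _ (\sum_(ij : 'I_(gsize n B) * 'I_(gsize n B)) n%:R ^- 2)).
  by apply: ler_sum => ij _; case/andP: (area_cell ij n0).
rewrite sumr_const card_prod !card_ord -[_ *+ (_ * _)]mulr_natl natrM -expr2 -exprVn -exprMn ler_sqr ?nnegrE ?addr_ge0 ?mulr_ge0 //.
have -> : (gsize n B)%:R = 2 * B%:R * n%:R + 1 :> R by rewrite /gsize -natr1 !natrM.
by rewrite ler_pdivrMr ?ltr0n // [leRHS]mulrDl mul1r lerD2l ler1n.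
Qed.

Definition Ek k : \bar R := (\int[P]_w ((num w ^_ k)%:R : R)%:E)%E.

Lemma sum_ikdet_cell N k n : (0 < n)%N ->
  \sum_(f : {ffun 'I_k -> 'I_(gsize n B) * 'I_(gsize n B)}) ikdet N (fun i => cell (f i)) = Tk N k A.
Proof.
move=> n0; rewrite sum_ikdet; first by rewrite cell_cover.
  exact: measurable_cell.
by move=> t u; exact: cell_disj.
Qed.

Lemma ikdet_cell N k n (f : {ffun 'I_k -> 'I_(gsize n B) * 'I_(gsize n B)}) :
  0 <= ikdet N (fun i => cell (f i)) <= \prod_i (area (cell (f i)) / pi).
Proof.
apply: ikdet_bound => i; first exact: measurable_cell.
by exists (B%:R ^+ 2) => x [_ /AB].
Qed.

Lemma int_Yk_bounds k (e : R) : 0 < e -> exists N0, forall N, (N0 <= N)%N -> forall n, (0 < n)%N ->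
  ((Tk N k A - (k ^ 2)%:R * (n%:R ^- 2 * W ^+ k.-1))%:E <= \int[P]_w ((Yk n k w)%:R : R)%:E <= (Tk N k A + e)%:E)%E.
Proof.
move=> e0; have e'0 : 0 < e / W ^+ k by rewrite divr_gt0 // exprn_gt0 // (lt_le_trans ltr01).
have W0 : 0 <= W by apply: le_trans W1.
have [N0 N0P] := @iint_corr R k (B%:R ^+ 2) _ e'0.
exists N0 => N N0N n n0; rewrite int_Yk //.
have cellB f (i : 'I_k) x : cell (n := n) (f i) x -> sqmod x <= B%:R ^+ 2 by case=> _ /AB.
have H (f : {ffun 'I_k -> 'I_(gsize n B) * 'I_(gsize n B)}) :=
  N0P N N0N (fun i => cell (f i)) (fun i => measurable_cell (f i)) (@cellB f).
have i0 (f : {ffun 'I_k -> 'I_(gsize n B) * 'I_(gsize n B)}) : 0 <= ikdet N (fun i => cell (f i)).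
  by case/andP: (ikdet_cell N f).
apply/andP; split.
  apply: (@le_trans _ _ (\sum_(f : {ffun 'I_k -> 'I_(gsize n B) * 'I_(gsize n B)} | injectiveb f)
     (ikdet N (fun i => cell (f i)))%:E)%E); last first.
    by apply: lee_sum => f _; case/andP: (H f).
  rewrite sumEFin lee_fin -(sum_ikdet_cell N k n0).
  rewrite (bigID (fun f : {ffun 'I_k -> 'I_(gsize n B) * 'I_(gsize n B)} => injectiveb f)) /=.
  rewrite -addrA gerDl subr_le0.
  (* Choices repeating a cell have a total weight of the order of one cell area, [n%:R ^- 2]. *)
  apply: (@le_trans _ _ (\sum_(f : {ffun 'I_k -> 'I_(gsize n B) * 'I_(gsize n B)} | ~~ injectiveb f)
     \prod_i area (cell (f i)))).
    apply: ler_sum => f _; have /andP[_ /le_trans] := ikdet_cell N f; apply.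
    apply: ler_prod => i _; rewrite divr_ge0 ?area_ge0 ?pi_ge0 //=.
    rewrite ler_pdivrMr ?pi_gt0 // ler_peMr ?area_ge0 //; have := pi_ge2 R; lra.
  have d0 : 0 <= n%:R ^- 2 :> R by rewrite invr_ge0 exprn_ge0.
  apply: le_trans (@sum_ninj_ffun_le R _ k (fun ij => area (cell ij)) _ d0 (fun ij => area_cell ij n0)) _.
  rewrite ler_wpM2l // ler_wpM2l ?invr_ge0 ?exprn_ge0 // lerXn2r ?nnegrE //.
    by apply: sumr_ge0 => ij _; exact: area_ge0.
  exact: sum_area.
apply: (@le_trans _ _ (\sum_(f : {ffun 'I_k -> 'I_(gsize n B) * 'I_(gsize n B)} | injectiveb f)
   (ikdet N (fun i => cell (f i)) + e / W ^+ k * \prod_i area (cell (f i)))%:E)%E).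
  by apply: lee_sum => f _; case/andP: (H f).
rewrite sumEFin lee_fin.
apply: (@le_trans _ _ (\sum_(f : {ffun 'I_k -> 'I_(gsize n B) * 'I_(gsize n B)})
   (ikdet N (fun i => cell (f i)) + e / W ^+ k * \prod_i area (cell (f i))))).
  rewrite [leRHS](bigID (fun f : {ffun 'I_k -> 'I_(gsize n B) * 'I_(gsize n B)} => injectiveb f)) /= lerDl; apply: sumr_ge0 => f _.
  rewrite addr_ge0 // mulr_ge0 //; first exact: ltW.
  by apply: prodr_ge0 => i _; exact: area_ge0.
rewrite big_split /= sum_ikdet_cell // lerD2l -mulr_sumr.
rewrite -(bigA_distr_bigA (fun (i : 'I_k) ij => area (cell ij))) prodr_const card_ord.
have Wk : 0 < W ^+ k by rewrite exprn_gt0 // (lt_le_trans ltr01).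
apply: (@le_trans _ _ (e / W ^+ k * W ^+ k)); last by rewrite divfK // gt_eqF.
apply: ler_wpM2l; first exact: ltW.
apply: lerXn2r; rewrite ?nnegrE //.
  by apply: sumr_ge0 => ij _; exact: area_ge0.
exact: sum_area.
Qed.

(** From below, [Yk] never exceeds the falling factorial. From above, Fatou's lemma along finer
    grids, where [Yk] is eventually equal to it at each [w]. *)
Lemma Ek_bounds k (e : R) : 0 < e -> exists N0, forall N, (N0 <= N)%N ->
  ((Tk N k A)%:E <= Ek k <= (Tk N k A + e)%:E)%E.
Proof.
move=> e0; have [N0 N0P] := int_Yk_bounds k e0; exists N0 => N N0N; apply/andP; split.
  apply/lee_addgt0Pr => t t0.
  pose D := (k ^ 2)%:R * W ^+ k.-1.
  have D0 : 0 <= D by rewrite mulr_ge0 // exprn_ge0 // (le_trans _ W1).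
  near \oo => n.
  have n0 : (0 < n)%N by near: n; exact: nbhs_infty_gt.
  have /andP[h _] := N0P N N0N n n0.
  have h2 : (\int[P]_w ((Yk n k w)%:R : R)%:E <= Ek k)%E.
    apply: le_integral_nomeas => w _; rewrite !lee_fin ler0n ler_nat; exact: Yk_le.
  rewrite -leeBlDr //; apply: le_trans (le_trans h h2).
  rewrite -EFinB lee_fin lerD2l lerN2 mulrCA -/D.
  have n1 : n%:R^-1 < t / (D + 1) by near: n; apply: near_inv_lt; rewrite divr_gt0 // ltr_wpDl.
  have n2 : n%:R ^- 2 <= n%:R^-1 :> R.
    by rewrite -exprVn expr2 ler_piMl ?invr_ge0 // invf_le1 ?ltr0n // ler1n.
  rewrite -/D; apply: (@le_trans _ _ (t / (D + 1) * (D + 1))); last by rewrite divfK // gt_eqF // ltr_wpDl.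
  apply: ler_pM; rewrite ?lerDl ?invr_ge0 ?exprn_ge0 //.
  by rewrite (le_trans n2) // ltW.
pose f n w : \bar R := ((Yk n.+1 k w)%:R : R)%:E.
have mf n : measurable_fun setT (f n) by apply/measurable_EFinP; exact: measurable_Yk.
have f0 n w : setT w -> (0 <= f n w)%E by rewrite lee_fin.
have -> : Ek k = (\int[P]_w limn_einf (f ^~ w))%E.
  apply: eq_integral => w _.
  have c : f n w @[n --> \oo] --> (((num w ^_ k)%:R : R)%:E : \bar R).
    apply: cvg_near_cst; have [m _ mP] := Yk_near k w.
    by exists m => // n /= mn; rewrite /f mP //= ltnW.
  by rewrite is_cvg_limn_einfE; [rewrite (cvg_lim _ c)|apply/cvg_ex; eexists; exact: c].
apply: le_trans (fatou P measurableT mf f0) _.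
rewrite limn_einf_lim; apply: lime_le; first exact: is_cvg_einfs.
near=> n; apply: ereal_inf_le; exists (\int[P]_w f n w)%E; first by exists n => //=.
by have /andP[] := N0P N N0N n.+1 isT.
Unshelve. all: end_near. Qed.

Lemma Ek_fin k : exists2 e, Ek k = e%:E & 0 <= e <= a ^+ k.
Proof.
have H t : 0 < t -> (0 <= Ek k <= (a ^+ k + t)%:E)%E.
  move=> t0; have [N0 /(_ _ (leqnn _)) /andP[h1 h2]] := Ek_bounds k t0.
  have /andP[T0 T1] := Tk_bound N0 k.
  by rewrite (le_trans _ h1) ?lee_fin // (le_trans h2) // lee_fin lerD2r.
have /andP[E0 _] := H 1 ltr01.
have Ea : (Ek k <= (a ^+ k)%:E)%E.
  by apply/lee_addgt0Pr => t t0; rewrite -EFinD; case/andP: (H t t0).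
exists (fine (Ek k)); first by rewrite fineK // ge0_fin_numE // (le_lt_trans Ea) ?ltry.
by rewrite fine_ge0 //= -lee_fin fineK // ge0_fin_numE // (le_lt_trans Ea) ?ltry.
Qed.

Definition void : R := fine (P [set w | npts (S w) A = 0%E]).

Lemma voidE : [set w | npts (S w) A = 0%E] = [set w | num w = 0%N].
Proof.
apply/seteqP; split=> w /=; rewrite nptsE // cnt_num; last by move=> ->.
by move=> /eqP; rewrite eqe pnatr_eq0 => /eqP.
Qed.

Lemma measurable_void : measurable [set w | num w = 0%N].
Proof.
rewrite (_ : [set w | _] = setT `&` (fun w => (num w)%:R : R) @^-1` [set 0]).
  exact: measurable_num.
apply/seteqP; split=> w /=; first by move=> ->.
by move=> [_ /eqP]; rewrite pnatr_eq0 => /eqP.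
Qed.

Lemma bonferroni n L : `|(n == 0%N)%:R - \sum_(k < L.+1) (-1) ^+ k * 'C(n, k)%:R| <= 'C(n, L)%:R :> R.
Proof.
case: n => [|n].
  rewrite big_ord_recl bin0 expr0 mulr1 big1 ?addr0 ?subrr ?normr0 ?ler0n // => i _.
  by rewrite bin0n mulr0.
rewrite alt_sum_bin // sub0r normrN normrM normrX normrN1 expr1n mul1r ger0_norm // ler_nat.
by rewrite leq_bin2l.
Qed.

Lemma integrable_Ek k : P.-integrable setT (fun w => ((num w ^_ k)%:R : R)%:E).
Proof.
apply/integrableP; split; last first.
  under eq_integral do rewrite gee0_abs ?lee_fin //.
  by have [e Ee _] := Ek_fin k; rewrite -/(Ek k) Ee ltry.
apply/measurable_EFinP; elim: k => [|k IH].
  by under eq_fun do rewrite ffactn0; exact: measurable_cst.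
have E w : ((num w ^_ k.+1)%:R : R) = (num w ^_ k)%:R * ((num w)%:R - k%:R).
  rewrite ffactnSr natrM; have [kn|nk] := leqP k (num w); first by rewrite natrB.
  by rewrite ffact_small ?mul0r.
under eq_fun do rewrite E.
by apply: measurable_funM => //; apply: measurable_funB => //; exact: measurable_num.
Qed.

Lemma Rint_bin k : P.-integrable setT (fun w => ('C(num w, k)%:R : R)%:E) /\
  \int[P]_w ('C(num w, k)%:R : R) = fine (Ek k) / k`!%:R.
Proof.
have E w : ('C(num w, k)%:R : R) = k`!%:R^-1 * (num w ^_ k)%:R.
  by rewrite -bin_ffact natrM mulrCA mulVf ?mulr1 // pnatr_eq0 gtn_eqF // fact_gt0.
have i1 := integrable_Ek k; split.
  by apply: eq_integrable (integrableZl measurableT (k`!%:R^-1) i1) => // w _; rewrite E EFinM.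
under eq_Rintegral do rewrite E.
by rewrite RintegralZl // mulrC.
Qed.

Lemma Rint_altbin n :
  P.-integrable setT (fun w => (\sum_(k < n) (-1) ^+ k * 'C(num w, k)%:R : R)%:E) /\
  \int[P]_w (\sum_(k < n) (-1) ^+ k * 'C(num w, k)%:R : R) = \sum_(k < n) (-1) ^+ k / k`!%:R * fine (Ek k).
Proof.
elim: n => [|n [IH1 IH2]].
  under eq_fun do rewrite big_ord0.
  under eq_Rintegral do rewrite big_ord0.
  by rewrite big_ord0 Rintegral_cst // mul0r; split; first exact: integrable0.
have [i1 e1] := Rint_bin n; have i2 := integrableZl measurableT ((-1) ^+ n) i1.
have i3 := integrableD measurableT IH1 i2.
split; first by apply: eq_integrable i3 => // w _; rewrite big_ord_recr EFinD EFinM.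
under eq_Rintegral do rewrite big_ord_recr /=.
have i2' : P.-integrable setT (EFin \o (fun w => (-1) ^+ n * 'C(num w, n)%:R : R)).
  by apply: eq_integrable i2 => // w _; rewrite /= EFinM.
by rewrite (RintegralD measurableT IH1 i2') IH2 RintegralZl // e1 big_ord_recr /= mulrA mulrAC.
Qed.

(** The pointwise Bonferroni inequality is integrated; its error is the factorial moment of order
    [L] divided by [L]!. *)
Lemma void_bonferroni L :
  `|void - \sum_(k < L.+1) (-1) ^+ k / k`!%:R * fine (Ek k)| <= a ^+ L / L`!%:R.
Proof.
pose g w : R := (num w == 0%N)%:R - \sum_(k < L.+1) (-1) ^+ k * 'C(num w, k)%:R.
have mV := measurable_void.
have vE w : (w \in [set w | num w = 0%N]) = (num w == 0%N).
  by apply/idP/eqP => [/set_mem|h]; last exact: mem_set.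
have i0 : P.-integrable setT (fun w => ((num w == 0%N)%:R : R)%:E).
  apply: eq_integrable (integrable_indic P mV) => // w _.
  by rewrite indicE vE.
have [i1 e1] := Rint_altbin L.+1; have [i2 e2] := Rint_bin L.
have ig : P.-integrable setT (EFin \o g).
  by apply: eq_integrable (integrableB measurableT i0 i1) => // w _; rewrite -EFinB.
have -> : void - \sum_(k < L.+1) (-1) ^+ k / k`!%:R * fine (Ek k) = \int[P]_w g w.
  rewrite /g RintegralB // e1; congr (_ - _).
  rewrite /void voidE -[X in P X]setIT -integral_indic // /Rintegral; congr fine.
  by apply: eq_integral => w _; rewrite indicE vE.
apply: le_trans (le_normr_Rintegral measurableT ig) _.
apply: (@le_trans _ _ (\int[P]_w ('C(num w, L)%:R : R))).
  apply: le_Rintegral => //; first exact: integrable_norm.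
  by move=> w _; exact: bonferroni.
by rewrite e2; have [e -> /andP[_ ea]] := Ek_fin L; rewrite /= ler_wpM2r // invr_ge0.
Qed.

Lemma gapdet_Tk N : gapdet N A = \sum_(k < N.+1) (-1) ^+ k / k`!%:R * Tk N k A.
Proof.
rewrite /gapdet; have -> : Hm N (~` A) = 1%:M - Hm N A by rewrite -(Hm_compl N mA) addrAC subrr add0r.
rewrite det_1sub raddf_sum; apply: eq_bigr => k _; rewrite /Tk.
have -> : (-1) ^+ k / k`!%:R = ((-1) ^+ k / k`!%:R : R)%:CC.
  by rewrite rmorphM rmorphXn /= rmorphN1 fmorphV rmorph_nat.
by case: (\sum_s _) => x y /=; rewrite mul0r subr0.
Qed.

(** The terms beyond [L] are dominated by the exponential series at [a], uniformly in [N]; this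
    allows [N] to grow at fixed [L]. *)
Lemma gapdet_truncated N L : (L <= N)%N ->
  `|gapdet N A - \sum_(k < L.+1) (-1) ^+ k / k`!%:R * Tk N k A| <= rtail L a.
Proof.
move=> LN; rewrite gapdet_Tk -(subnKC LN) -addSn big_split_ord /= addrAC subrr add0r.
apply: le_trans (ler_norm_sum _ _ _) _.
apply: le_trans (rsum_le_rtail L (N - L).+1 a0).
rewrite rsumD addrAC subrr add0r big_ord_recl addn0 ler_wpDl //.
  by rewrite divr_ge0 ?exprn_ge0.
apply: ler_sum => i _; have /andP[t0 t1] := Tk_bound (L + (N - L)) (L.+1 + i).
rewrite normrM normrM normrX normrN1 expr1n mul1r ger0_norm ?invr_ge0 // ger0_norm //.
  rewrite mulrC (_ : (L + lift ord0 i = L.+1 + i)%N); first by rewrite ler_wpM2r // invr_ge0.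
  by rewrite /= /bump add1n addnS addSn.
Qed.

Lemma gapdet_cvg (e : R) : 0 < e -> exists N0, forall N, (N0 <= N)%N -> `|void - gapdet N A| <= e.
Proof.
move=> e0.
(* First [L] is fixed by the exponential tail, then [N] is taken so large that the moments of order
   at most [L] agree. *)
have [L _ LP] : \forall L \near \oo, rtail L a < e / 4.
  have := @cvg_rtail R a => /(@cvgr0Pnorm_lt _ _ _ _ _ _) /(_ (e / 4)).
  rewrite divr_gt0 // => /(_ isT); apply: filterS => L; exact: (le_lt_trans (ler_norm _)).
have rL := LP L (leqnn L).
have H : exists N0, forall N, (N0 <= N)%N -> forall k, (k <= L)%N ->
    `|fine (Ek k) - Tk N k A| <= e / 8.
  elim: (L) => [|l [N0 IH]].
    have [N0 N0P] := @Ek_bounds 0%N (e / 8) ltac:(lra); exists N0 => N /N0P + k.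
    rewrite leqn0 => + /eqP ->; have [x -> _] := Ek_fin 0.
    by rewrite !lee_fin /= ler_distl => /andP[? ?]; apply/andP; split; lra.
  have [N1 N1P] := @Ek_bounds l.+1 (e / 8) ltac:(lra); exists (maxn N0 N1) => N.
  rewrite geq_max => /andP[h0 h1] k; rewrite leq_eqVlt => /orP[/eqP ->|kl]; last exact: IH.
  have := N1P N h1; have [x -> _] := Ek_fin l.+1.
  by rewrite !lee_fin /= ler_distl => /andP[? ?]; apply/andP; split; lra.
have [N0 N0P] := H; exists (maxn N0 L) => N; rewrite geq_max => /andP[h0 LN].
have b1 := void_bonferroni L; have b2 := gapdet_truncated LN.
have b3 : a ^+ L / L`!%:R <= rtail L a.
  by have := rsum_le_rtail L 1 a0; rewrite rsumD addrAC subrr add0r big_ord1 addn0.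
have b4 : `|\sum_(k < L.+1) (-1) ^+ k / k`!%:R * fine (Ek k) -
           \sum_(k < L.+1) (-1) ^+ k / k`!%:R * Tk N k A| <= e / 2.
  rewrite -sumrB; apply: le_trans (ler_norm_sum _ _ _) _.
  apply: (@le_trans _ _ (e / 8 * rsum L.+1 1)).
    rewrite /rsum mulr_sumr; apply: ler_sum => k _; rewrite -mulrBr.
    rewrite normrM normrM normrX normrN1 !expr1n [`|_^-1|]ger0_norm ?invr_ge0 // mulrC.
    by rewrite ler_wpM2r ?divr_ge0 // N0P // -ltnS.
  (* The weights [1 / k!] sum to at most [expR 1 <= 4]. *)
  apply: (@le_trans _ _ (e / 8 * 4)); last lra.
  apply: ler_wpM2l; first lra.
  apply: le_trans (rsum_le_exp _ ler01) _.
  exact: expR1_le4.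
move: b1 b2 b4; rewrite !ler_distl => /andP[? ?] /andP[? ?] /andP[? ?]; apply/andP; split; lra.
Qed.

(** The gap determinants decrease in the number of basis functions, and the void probability is
    their limit. *)
Lemma void_le n (b : R) : A `<=` [set z | sqmod z < b] -> void <= gapdet n A.
Proof.
move=> Ab; apply/ler_addgt0Pr => e e0; have [N0 N0P] := gapdet_cvg e0.
have := N0P (n + N0)%N (leq_addl _ _); rewrite ler_distl => /andP[_].
have := gapdet_mono n N0 mA Ab; lra.
Qed.

Lemma void_ge n (b : R) : A `<=` [set z | sqmod z < b] ->
  (forall m, 2^-1 <= \prod_(i < m) dk b (n + i)) -> gapdet n A / 2 <= void.
Proof.
move=> Ab H; apply/ler_addgt0Pr => e e0; have [N0 N0P] := gapdet_cvg e0.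
have := N0P (n + N0)%N (leq_addl _ _); rewrite ler_distl => /andP[+ _].
have := gapdet_tail n N0 mA Ab; have := H N0; have := gapdet_ge0 n mA.
move: (gapdet n A) (\prod_(i < N0) _) => x y x0 y2 xy; nra.
Qed.

End Process.

(** * Sampling bounds for the gap determinants *)

Section RotationAverage.
Variable R : realType.
Local Notation C := R[i].
Local Notation Re := (@complex.Re R).
Local Notation Im := (@complex.Im R).
Local Notation "x %:CC" := (real_complex R x) (at level 1, format "x %:CC").
Local Notation L2 := (@L2 R).

Definition dil (w : C) (p : {poly C}) : {poly C} := \poly_(i < size p) (p`_i * w ^+ i).
Definition avg (p : {poly C}) (w c : C) : {poly C} := 2^-1 *: (p + c *: dil w p).

Lemma coef_avg p w c i : (avg p w c)`_i = p`_i * (1 + c * w ^+ i) / 2.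
Proof.
rewrite coefZ coefD coefZ coef_poly; case: ltnP => h; first by field.
by rewrite (nth_default 0 h) mulr0 !mul0r addr0 mulr0.
Qed.

Lemma horner_avg p w c z : (avg p w c).[z] = 2^-1 * (p.[z] + c * p.[w * z]).
Proof.
rewrite hornerZ hornerD hornerZ horner_poly (horner_coef p (w * z)).
by congr (_ * (_ + _ * _)); apply: eq_bigr => i _; rewrite exprMn mulrA.
Qed.

(* Averaging p(z) and c p(wz) with c w^j = 1 and c w^k = -1 keeps the coefficient of degree j
   and removes the one of degree k. *)
Lemma coef_of_avg (Q : {poly C} -> Prop) :
  (forall p w c, nsq w = 1 -> nsq c = 1 -> Q p -> Q (avg p w c)) ->
  forall p j, Q p -> Q (p`_j *: 'X^j).
Proof.
move=> Qavg p j Qp.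
have H m : exists p', [/\ Q p', p'`_j = p`_j, (forall k, (k < m)%N -> k != j -> p'`_k = 0) &
    (forall k, p`_k = 0 -> p'`_k = 0)].
  elim: m => [|m [p1 [Q1 e1 z1 k1]]]; first by exists p.
  have [mj|mj] := eqVneq m j.
    exists p1; split=> // k; rewrite ltnS leq_eqVlt => /orP[/eqP ->|km]; last exact: z1.
    by rewrite mj eqxx.
  have [w [c [w1 c1 wj wm]]] : exists w c : C, [/\ nsq w = 1, nsq c = 1, c * w ^+ j = 1 & c * w ^+ m = -1].
    have mj0 : (0 < (m - j) + (j - m))%N by move/eqP: mj; lia.
    have [w [wn w1]] := @exists_rotation R _ mj0.
    have w0 : w != 0.
      by apply/eqP => w00; move: w1; rewrite w00 /nsq /= expr0n addr0 => /eqP; rewrite eq_sym oner_eq0.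
    exists w, (w ^- j); split=> //; last 2 first.
    - by rewrite mulVf // expf_neq0.
    - case: (ltngtP m j) mj wn => // h _.
        rewrite (eqP (ltnW h)) add0n => wn.
        have -> : w ^+ j = - w ^+ m by rewrite -[in LHS](subnK (ltnW h)) exprD wn mulN1r.
        by rewrite invrN mulNr mulVf // expf_neq0.
      rewrite (eqP (ltnW h)) addn0 => wn; rewrite -[in X in _ * X](subnK (ltnW h)) exprD mulrCA mulVf ?expf_neq0 //.
      by rewrite wn mulr1.
    have := nsqM (w ^- j) (w ^+ j); rewrite mulVf ?expf_neq0 // nsqX w1 expr1n mulr1.
    by move=> <-; rewrite /nsq /= expr1n expr0n addr0.
  exists (avg p1 w c); split.
  - exact: Qavg.
  - by rewrite coef_avg wj e1; field.
  - move=> k; rewrite ltnS leq_eqVlt coef_avg => /orP[/eqP -> _|km kj]; first by rewrite wm subrr mulr0 mul0r.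
    by rewrite z1 // !mul0r.
  - by move=> k /k1 h; rewrite coef_avg h !mul0r.
have [p' [Qp' e z k0]] := H (size p).
suff -> : p`_j *: 'X^j = p' by [].
apply/polyP => k; rewrite coefZ coefXn; have [->|kj] := eqVneq k j; first by rewrite mulr1 e.
rewrite mulr0; have [ks|ks] := ltnP k (size p); first by rewrite z.
by rewrite k0 // nth_default.
Qed.

Lemma nsq_avg (a b c : C) : nsq c = 1 -> nsq (2^-1 * (a + c * b)) <= (nsq a + nsq b) / 2.
Proof.
move=> c1; have -> : nsq b = nsq (c * b) by rewrite nsqM c1 mul1r.
move: (c * b) => d; rewrite nsqM.
have -> : nsq (2^-1 : C) = 4^-1.
  by rewrite (_ : 2^-1 = (2^-1 : R)%:CC) ?nsq_real; [field|rewrite fmorphV rmorph_nat].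
rewrite /nsq !raddfD /=; have := sqr_ge0 (Re a - Re d); have := sqr_ge0 (Im a - Im d).
rewrite !sqrrB !sqrrD; lra.
Qed.

(** A bound on a circle survives the averaging of [coef_of_avg], which leaves a single monomial. *)
Lemma cauchy_coef (p : {poly C}) (s M : R) j : 0 <= s ->
  (forall z : R * R, sqmod z = s -> nsq p.[cpx z] <= M) -> nsq p`_j * s ^+ j <= M.
Proof.
move=> s0 pM; pose Q (p : {poly C}) := forall z : R * R, sqmod z = s -> nsq p.[cpx z] <= M.
have : Q (p`_j *: 'X^j).
  apply: coef_of_avg pM => {}p w c w1 c1 Qp z zs; rewrite horner_avg; apply: le_trans (nsq_avg _ _ c1) _.
  by have := Qp z zs; have := Qp (rotc w z); rewrite sqmod_rotc // cpx_rotc => /(_ zs); lra.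
move=> /(_ (Num.sqrt s, 0)); rewrite /sqmod /= sqr_sqrtr // expr0n addr0 => /(_ erefl).
by rewrite hornerZ hornerXn nsqM nsqX nsq_cpx /sqmod /= sqr_sqrtr // expr0n addr0.
Qed.

Lemma cmeas_horner (p : {poly C}) : cmeas (fun z => p.[cpx z]).
Proof.
under eq_fun do rewrite horner_coef.
by apply: cmeas_sum => i; apply: cmeasM; [exact: cmeas_cst|apply: cmeasX; exact: cmeas_cpx].
Qed.

(** The same averaging never increases the integral over a centred disk, and it ends with the
    constant term alone. *)
Lemma mean_value0 (p : {poly C}) (b : R) : 0 <= b ->
  ((nsq p.[0] * (pi * b))%:E <= \int[L2]_(z in [set z | (sqmod z <= b)%R]) (nsq p.[cpx z])%:E)%E.
Proof.
move=> b0; pose D := [set z : R * R | (sqmod z <= b)%R].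
have mD : measurable D by exact: measurable_disc.
pose Q (q : {poly C}) : Prop :=
  (\int[L2]_(z in D) (nsq q.[cpx z])%:E <= \int[L2]_(z in D) (nsq p.[cpx z])%:E)%E.
have mh (q : {poly C}) : measurable_fun setT (fun z => (nsq q.[cpx z])%:E).
  by apply/measurable_EFinP; apply: (cmeas_nsq (cmeas_horner q)).
have : Q (p`_0 *: 'X^0).
  apply: (@coef_of_avg Q); last exact: lexx.
  move=> q w c w1 c1 Qq; apply: le_trans Qq.
  pose h z : \bar R := (2^-1%:E * ((nsq q.[cpx z])%:E + (nsq q.[cpx (rotc w z)])%:E))%E.
  have mr : measurable_fun setT (fun z => (nsq q.[cpx (rotc w z)])%:E).
    have [mf _] := mpres_rotc w1.
    by have := measurableT_comp (mh q) mf.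
  apply: (@le_trans _ _ (\int[L2]_(z in D) h z)%E).
    apply: ge0_le_integral => //.
    - by move=> z _; rewrite lee_fin nsq_ge0.
    - exact: measurable_funTS.
    - apply: emeasurable_funM => //; apply: emeasurable_funD; exact: measurable_funTS.
    - move=> z _; rewrite /h -EFinD -EFinM lee_fin horner_avg cpx_rotc [leRHS]mulrC; exact: nsq_avg.
  rewrite ge0_integralZl //; last 2 first.
  - by apply: emeasurable_funD; exact: measurable_funTS.
  - by move=> z _; rewrite -EFinD lee_fin addr_ge0 ?nsq_ge0.
  rewrite ge0_integralD //; try (by move=> z _; rewrite lee_fin nsq_ge0); try exact: measurable_funTS.
  have -> : (\int[L2]_(z in D) (nsq q.[cpx (rotc w z)])%:E = \int[L2]_(z in D) (nsq q.[cpx z])%:E)%E.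
    have {1}-> : D = rotc w @^-1` D by apply/seteqP; split=> z; rewrite /D /= sqmod_rotc.
    apply: (mpres_int (mpres_rotc w1) mD (h := fun z => (nsq q.[cpx z])%:E)).
      exact: measurable_funTS.
    by move=> z _; rewrite lee_fin nsq_ge0.
  have := @integral_ge0 _ _ _ L2 D (fun z => (nsq q.[cpx z])%:E) (fun z _ => nsq_ge0 _ : (0 <= (nsq q.[cpx z])%:E)%E).
  case: (\int[L2]_(z in D) _)%E => [x| |] //= x0.
    by rewrite -EFinD -EFinM lee_fin; lra.
  by rewrite addye // mulry gtr0_sg ?mul1e // invr_gt0.
rewrite /Q; under eq_integral do rewrite expr0 alg_polyC hornerC.
rewrite integral_cst // -[X in (_ * X)%E]/(L2 D) L2_disc // -EFinM.
by rewrite horner_coef0.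
Qed.

Lemma mean_value (p : {poly C}) (b : R) (w : R * R) : 0 <= b ->
  ((nsq p.[cpx w] * (pi * b))%:E <=
    \int[L2]_(z in [set z | (sqmod (z - w) <= b)%R]) (nsq p.[cpx z])%:E)%E.
Proof.
move=> b0; have := mean_value0 (p \Po ('X + (cpx w)%:P)) b0.
rewrite horner_comp hornerD hornerX hornerC add0r => h; apply: le_trans h _.
have := @mpres_int R (fun z => z - w) [set z | (sqmod z <= b)%R]
  (fun z => (nsq p.[cpx (z + w)])%:E) (mpres_shift (- w)) (measurable_disc b).
have -> : (fun z => z - w) @^-1` [set z | sqmod z <= b] = [set z | (sqmod (z - w) <= b)%R] by [].
under eq_integral do rewrite subrK.
move=> ->; last 2 first.
- apply/measurable_EFinP; apply: measurable_funTS.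
  have := measurableT_comp (cmeas_nsq (cmeas_horner p)) (mpres_shift w).1.
  by [].
- by move=> z _; rewrite lee_fin nsq_ge0.
rewrite le_eqVlt; apply/orP; left; apply/eqP; apply: eq_integral => z _.
by rewrite horner_comp hornerD hornerX hornerC; congr ((nsq p.[_])%:E).
Qed.

Definition fpoly n (x : 'rV[C]_n) : {poly C} :=
  \poly_(k < n) (if insub k is Some i then x 0 i * (Num.sqrt (pi * k`!%:R))^-1%:CC else 0).

Lemma psumE n (x : 'rV[C]_n) z : psum x z = (fpoly x).[cpx z] * (expR (- (sqmod z / 2)))%:CC.
Proof.
rewrite /psum /fpoly horner_poly mulr_suml; apply: eq_bigr => i _.
rewrite valK /phi /phic rmorphM /= fmorphV /=; ring.
Qed.

Lemma nsq_psum n (x : 'rV[C]_n) z : nsq (psum x z) = nsq (fpoly x).[cpx z] * expR (- sqmod z).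
Proof.
by rewrite psumE nsqM nsq_real expr2 -expRD; congr (_ * expR _); field.
Qed.

Lemma sqmod_near (y z : R * R) (M t : R) : 0 <= M -> 0 <= t -> sqmod y <= M ^+ 2 ->
  sqmod (z - y) <= t ^+ 2 -> sqmod z <= sqmod y + (2 * M * t + t ^+ 2).
Proof.
move=> M0 t0; case: y z => a b [c d]; rewrite /sqmod /= => yM zt.
pose u := c - a; pose v := d - b.
have cs : (a * u + b * v) ^+ 2 <= (M * t) ^+ 2.
  rewrite exprMn; apply: (@le_trans _ _ ((a ^+ 2 + b ^+ 2) * (u ^+ 2 + v ^+ 2))).
    have := sqr_ge0 (a * v - b * u); rewrite !expr2; lra.
  by apply: ler_pM; rewrite ?addr_ge0 ?sqr_ge0.
have : a * u + b * v <= M * t.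
  by apply: le_trans (ler_norm _) _; rewrite -ler_sqr ?nnegrE ?mulr_ge0 // real_normK ?num_real.
rewrite /u /v in cs *; move: zt; rewrite /u /v; rewrite !expr2; lra.
Qed.

(** The mean value property on the disk around [y j] bounds each sample value by the full quadratic
    form; summing the [n] of them costs the factor [1 / n]. The exponential accounts for the
    variation of the Gaussian weight over the disk. *)
Lemma gapdet_lower n (A : set (R * R)) (y : 'I_n -> R * R) (M t : R) : measurable A -> (0 < n)%N ->
  0 <= M -> 0 < t -> (forall i z, sqmod (z - y i) <= t ^+ 2 -> ~ A z) -> (forall i, sqmod (y i) <= M ^+ 2) ->
  (pi * t ^+ 2 * expR (- (2 * M * t + t ^+ 2)) / n%:R) ^+ n * nsq (\det (Vm y)) <= gapdet n A.
Proof.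
move=> mA n0 M0 t0 yA yM; set c := _ / n%:R.
have c0 : 0 < c by rewrite /c !(divr_gt0, mulr_gt0) ?ltr0n ?expR_gt0 ?pi_gt0.
have [uV|] := boolP (Vm y \in unitmx); last first.
  rewrite unitmxE unitfE negbK => /eqP ->; rewrite /nsq /= expr0n addr0 mulr0; exact: gapdet_ge0.
rewrite -lecR -gapdetE // rmorphM rmorphXn /= nsqE; apply: hf_sample => //; first by rewrite ltcR.
move=> x; rewrite hf_Hm; last exact: measurableC.
set I := \int[L2]_(z in ~` A) _.
have ii : L2.-integrable (~` A) (EFin \o (fun z => nsq (psum x z))).
  by apply: integrable_psum; exact: measurableC.
have H j : nsq (psum x (y j)) * (pi * t ^+ 2 * expR (- (2 * M * t + t ^+ 2))) <= I.
  rewrite -lee_fin /I /Rintegral fineK ?integrable_fin_num //; last exact: measurableC.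
  pose D := [set z | (sqmod (z - y j) <= t ^+ 2)%R].
  have mD : measurable D.
    have -> : D = setT `&` (fun z => z - y j) @^-1` [set z | (sqmod z <= t ^+ 2)%R] by rewrite setTI.
    by apply: (mpres_shift (- y j)).1 => //; exact: measurable_disc.
  have mp : measurable_fun setT (fun z => (nsq (psum x z))%:E).
    by apply/measurable_EFinP; exact: (cmeas_nsq (cmeas_psum x)).
  have mh : measurable_fun setT (fun z => (nsq (fpoly x).[cpx z])%:E).
    by apply/measurable_EFinP; exact: (cmeas_nsq (cmeas_horner _)).
  apply: (@le_trans _ _ (\int[L2]_(z in D) (nsq (psum x z))%:E)%E); last first.
    apply: ge0_subset_integral => //; first exact: measurableC.
    - exact: measurable_funTS.
    - by move=> z _; rewrite lee_fin nsq_ge0.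
    - by move=> z /yA.
  pose e := expR (- (sqmod (y j) + (2 * M * t + t ^+ 2))).
  apply: (@le_trans _ _ (\int[L2]_(z in D) (e%:E * (nsq (fpoly x).[cpx z])%:E))%E); last first.
    apply: ge0_le_integral => //.
    - by move=> z _; rewrite mule_ge0 ?lee_fin ?nsq_ge0 // expR_ge0.
    - by apply: emeasurable_funM => //; exact: measurable_funTS.
    - exact: measurable_funTS.
    - move=> z Dz; rewrite -EFinM lee_fin nsq_psum mulrC ler_wpM2l ?nsq_ge0 // /e ler_expR lerN2.
      exact: sqmod_near (ltW t0) _ Dz.
  rewrite ge0_integralZl //; last 3 first.
  - exact: measurable_funTS.
  - by move=> z _; rewrite lee_fin nsq_ge0.
  - by rewrite lee_fin expR_ge0.
  have := @mean_value (fpoly x) (t ^+ 2) (y j) (sqr_ge0 t) => h.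
  apply: (@le_trans _ _ (e%:E * (nsq (fpoly x).[cpx (y j)] * (pi * t ^+ 2))%:E)%E).
    have -> : e = expR (- sqmod (y j)) * expR (- (2 * M * t + t ^+ 2)) by rewrite -expRD -opprD.
    by rewrite -EFinM lee_fin nsq_psum le_eqVlt; apply/orP; left; apply/eqP; ring.
  by apply: lee_wpmul2l => //; rewrite lee_fin expR_ge0.
have -> : \sum_j `|(x *m Vm y) 0 j| ^+ 2 = (\sum_j nsq (psum x (y j)))%:CC.
  by rewrite rmorph_sum; apply: eq_bigr => j _; rewrite mul_Vm /= nsqE.
rewrite -rmorphM lecR /c mulrAC ler_pdivrMr ?ltr0n // mulr_sumr.
apply: (@le_trans _ _ (\sum_(j < n) I)); last by rewrite sumr_const card_ord mulr_natr.
by apply: ler_sum => j _; rewrite mulrC.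
Qed.

(** Source of the constant 9: three times the radius is far enough for the Gaussian to beat
    polynomial growth. *)
Lemma le_expR_half (u : R) : 9 <= u -> u <= expR (u / 2 - 1).
Proof.
move=> u9.
have h1 := expR_ge1Dx (u / 3 - 1); have h2 := expR_ge1Dx (2^-1 : R).
have e0 := expR_gt0 (u / 3 - 1).
have h3 : 3 <= expR (u / 6).
  apply: (@le_trans _ _ (expR (3%:R * 2^-1))); last by rewrite ler_expR; lra.
  rewrite expRM_natl; apply: (@le_trans _ _ ((3 / 2) ^+ 3)); first by rewrite !exprS expr0; lra.
  by apply: lerXn2r; rewrite ?nnegrE ?expR_ge0 //; lra.
have -> : u / 2 - 1 = u / 6 + (u / 3 - 1) by field.
by rewrite expRD; nra.
Qed.

(** Cramer's rule: a Lagrange function is the ratio of the determinants after and before replacing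
    one sample point. *)
Lemma psum_lagrange n (z : 'I_n -> R * R) (j : 'I_n) (w : R * R) : Vm z \in unitmx ->
  nsq (psum (row j (invmx (Vm z))) w) * nsq (\det (Vm z)) =
  nsq (\det (Vm (fun i => if i == j then w else z i))).
Proof.
move=> uV; rewrite -nsqM; congr nsq.
rewrite [RHS](expand_det_col _ j) /psum mulr_suml; apply: eq_bigr => i _.
rewrite !mxE eqxx mulrAC mulrC; congr (_ * _).
rewrite /invmx uV mxE mulrAC mulVf ?mul1r; last by rewrite -unitfE -unitmxE.
rewrite mxE /cofactor; congr (_ * \det _).
by apply/matrixP => k l; rewrite !mxE eq_sym (negPf (neq_lift j l)).
Qed.

Lemma nsq_sum_le n (F : 'I_n -> C) : nsq (\sum_i F i) <= n%:R * \sum_i nsq (F i).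
Proof.
elim: n F => [|n IH] F; first by rewrite !big_ord0 mulr0 /nsq /= expr0n addr0.
rewrite !big_ord_recl; set a := F ord0; set b := \sum_(i < n) _; set s := \sum_(i < n) nsq _.
have hb : nsq b <= n%:R * s by exact: IH.
have cs m : (0 < m)%N -> nsq b <= m%:R * s -> nsq (a + b) <= m.+1%:R * (nsq a + s).
  move=> m0 h; have m1 : 1 <= m%:R :> R by rewrite ler1n.
  have key : m%:R * nsq (a + b) <= m%:R * m.+1%:R * nsq a + m.+1%:R * nsq b.
    rewrite -natr1 /nsq !raddfD /=.
    have := sqr_ge0 (m%:R * Re a - Re b); have := sqr_ge0 (m%:R * Im a - Im b).
    by rewrite !expr2; lra.
  rewrite -(ler_pM2l (lt_le_trans ltr01 m1)); apply: le_trans key _.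
  have := ler_wpM2l (ler0n R m.+1) h; lra.
case: n {IH} F @a @b @s hb cs => [|n] F a b s hb cs; last exact: cs.
by rewrite /b /s !big_ord0 !addr0 mul1r.
Qed.

(** Cauchy's estimate on the circle of radius [r] controls each coefficient; far outside, half of
    the Gaussian exponent absorbs the powers of degree below [n <= r ^+ 2], and the other half
    remains for integrability. *)
Lemma growth_bound n (x : 'rV[C]_n) (r M : R) (z : R * R) : 0 < r -> n%:R <= r ^+ 2 -> 0 <= M ->
  (forall w, sqmod w = r ^+ 2 -> nsq (psum x w) <= M) -> 9 * r ^+ 2 <= sqmod z ->
  nsq (psum x z) <= n%:R ^+ 2 * M * expR (- (sqmod z / 2)).
Proof.
move=> r0 nr M0 xM z9; have r20 : 0 < r ^+ 2 by rewrite exprn_gt0.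
pose u := sqmod z / r ^+ 2.
have u9 : 9 <= u by rewrite ler_pdivlMr.
have fM w : sqmod w = r ^+ 2 -> nsq (fpoly x).[cpx w] <= M * expR (r ^+ 2).
  move=> wr; have := xM w wr; rewrite nsq_psum wr expRN => h.
  by rewrite -ler_pdivrMr ?expR_gt0.
have coefB (k : nat) : (k < n)%N -> nsq (fpoly x)`_k * sqmod z ^+ k <= M * expR (r ^+ 2 * (u / 2)).
  move=> kn; have := cauchy_coef k (ltW r20) fM => h.
  have -> : sqmod z = r ^+ 2 * u by rewrite /u mulrC divfK // gt_eqF.
  rewrite exprMn [leLHS]mulrA; apply: (@le_trans _ _ (M * expR (r ^+ 2) * u ^+ k)).
    by rewrite ler_wpM2r // exprn_ge0 // (le_trans _ u9).
  rewrite -mulrA ler_wpM2l //.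
  have uk : u ^+ k <= expR (r ^+ 2 * (u / 2 - 1)).
    apply: (@le_trans _ _ (expR (u / 2 - 1) ^+ k)).
      by apply: lerXn2r; rewrite ?nnegrE ?expR_ge0 ?(le_trans _ u9) // le_expR_half.
    rewrite -expRM_natl ler_expR ler_wpM2r //; first lra.
    by apply: le_trans nr; rewrite ler_nat ltnW.
  apply: (@le_trans _ _ (expR (r ^+ 2) * expR (r ^+ 2 * (u / 2 - 1)))).
    by rewrite ler_wpM2l // expR_ge0.
  by rewrite -expRD ler_expR mulrBr mulr1 addrC subrK.
rewrite nsq_psum.
have szf : (size (fpoly x) <= n)%N by exact: size_poly.
rewrite (horner_coef_wide _ szf).
apply: (@le_trans _ _ (n%:R * (\sum_(k < n) M * expR (r ^+ 2 * (u / 2))) * expR (- sqmod z))).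
  rewrite ler_wpM2r ?expR_ge0 //; apply: le_trans (nsq_sum_le _) _; rewrite ler_wpM2l //.
  by apply: ler_sum => k _; rewrite nsqM nsqX nsq_cpx coefB.
rewrite sumr_const card_ord.
set e1 := expR (r ^+ 2 * _); set e2 := expR (- _).
have -> : n%:R * (M * e1 *+ n) * e2 = n%:R ^+ 2 * (M * (e1 * e2)) by rewrite -mulr_natl; ring.
rewrite /e1 /e2 -expRD -mulrA.
have -> : r ^+ 2 * (u / 2) = sqmod z / 2 by rewrite /u mulrA mulrCA divff ?gt_eqF // mulr1.
rewrite ler_wpM2l ?exprn_ge0 // ler_wpM2l // ler_expR; lra.
Qed.

(** [A] is merely measurable, so a maximising configuration may fail to exist; one reaching half of
    the supremum already gives Lagrange functions with squared modulus at most 2. *)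
Lemma gapdet_upper n (A : set (R * R)) (r : R) : measurable A -> A `<=` [set z | sqmod z < r ^+ 2] ->
  0 < r -> n%:R <= r ^+ 2 -> exists z : 'I_n -> R * R, [/\ (forall i, ~ A (z i)),
    (forall i, sqmod (z i) <= 9 * r ^+ 2) &
    gapdet n A <= nsq (\det (Vm z)) * (2 * (9 * pi * r ^+ 2 + 2 * pi * n%:R ^+ 2)) ^+ n].
Proof.
move=> mA Ar r0 nr.
pose K := [set z : R * R | ~ A z /\ sqmod z <= 9 * r ^+ 2].
pose E := [set nsq (\det (Vm z)) | z in [set z : 'I_n -> R * R | forall i, K (z i)]].
have r20 : 0 < r ^+ 2 by rewrite exprn_gt0.
have circK w : sqmod w = r ^+ 2 -> K w.
  move=> wr; split; first by move/Ar; rewrite /= wr ltxx.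
  by rewrite wr; lra.
(* Distinct points on a segment between the circles of radius [r] and [2 * r], which show that the
   supremum is positive. *)
pose p (i : 'I_n) : R * R := (r + r * (i%:R / n%:R), 0).
have pK i : K (p i).
  have n0 : (0 < n)%N by case: n i {nr E p} => // -[].
  have t0 : 0 <= i%:R / n%:R :> R by rewrite divr_ge0.
  have t1 : i%:R / n%:R <= 1 :> R by rewrite ler_pdivrMr ?ltr0n // mul1r ler_nat ltnW.
  have e : sqmod (p i) = r ^+ 2 * (1 + i%:R / n%:R) ^+ 2.
    by rewrite /sqmod /p /= expr0n addr0 -exprMn mulrDr mulr1.
  split; last by rewrite e mulrC ler_wpM2r ?(ltW r20) //; nra.
  move/Ar; rewrite /= e ltNge => /negP; apply; rewrite ler_peMr ?(ltW r20) //; nra.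
have sep : vdm2 p > 0.
  apply: prodr_gt0 => i _; apply: prodr_gt0 => j ij.
  rewrite /sqmod /= subrr expr0n addr0 lt_neqAle sqr_ge0 andbT eq_sym sqrf_eq0 subr_eq0.
  have n0 : n%:R != 0 :> R by rewrite pnatr_eq0; case: n i j {nr E p pK ij} => // -[].
  rewrite (inj_eq (addrI _)) (inj_eq (mulfI (lt0r_neq0 r0))) (inj_eq (mulIf _)) ?invr_eq0 //.
  by rewrite eqr_nat gtn_eqF.
have Ep : E (nsq (\det (Vm p))) by exists p.
have supE : has_sup E.
  split; first by exists (nsq (\det (Vm p))).
  exists (\prod_(i < n) \prod_(j < n | (i < j)%N) (36 * r ^+ 2) / Zn R n) => _ [z zK <-].
  rewrite nsq_det_Vm ler_wpM2r ?invr_ge0 ?(ltW (Zn_gt0 R n)) //.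
  apply: (@le_trans _ _ (vdm2 z * 1)).
    apply: ler_wpM2l; last by rewrite expR_le1 oppr_le0 sumr_ge0 // => i _; exact: sqmod_ge0.
    by apply: prodr_ge0 => i _; apply: prodr_ge0 => j _; exact: sqmod_ge0.
  rewrite mulr1; apply: ler_prod => i _; apply/andP; split.
    by apply: prodr_ge0 => j _; exact: sqmod_ge0.
  apply: ler_prod => j _; rewrite sqmod_ge0 /=.
  have [_ z1] := zK i; have [_ z2] := zK j; move: z1 z2; case: (z i) (z j) => a b [c d]; rewrite /sqmod /=.
  have := sqr_ge0 (a + c); have := sqr_ge0 (b + d); rewrite !sqrrB !sqrrD; lra.
have s0 : 0 < sup E.
  apply: (@lt_le_trans _ _ (nsq (\det (Vm p)))); last by apply: (ub_le_sup supE.2).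
  by rewrite nsq_det_Vm divr_gt0 ?Zn_gt0 // mulr_gt0 // expR_gt0.
have [_ [z zK <-] zs] : exists2 e, E e & sup E / 2 < e.
  have [e Ee he] := sup_adherent (divr_gt0 s0 (ltr0n R 2)) supE; exists e => //.
  by apply: le_lt_trans he; lra.
have dz : 0 < nsq (\det (Vm z)) by apply: lt_trans zs; rewrite divr_gt0.
have uV : Vm z \in unitmx.
  by rewrite unitmxE unitfE; apply/eqP => h; move: dz; rewrite h /nsq /= expr0n addr0 ltxx.
exists z; split; [by move=> i; case: (zK i)|by move=> i; case: (zK i)|].
have lK j w : K w -> nsq (psum (row j (invmx (Vm z))) w) <= 2.
  move=> Kw; rewrite -(ler_pM2r dz) psum_lagrange //.
  apply: (@le_trans _ _ (sup E)); last by rewrite -ler_pdivrMl // mulrC ltW.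
  apply: (ub_le_sup supE.2); exists (fun i => if i == j then w else z i) => // i.
  by case: ifP.
have mAC : measurable (~` A) by exact: measurableC.
pose D := [set z : R * R | (sqmod z <= 9 * r ^+ 2)%R].
have mD : measurable D by exact: measurable_disc.
have hfB j : \int[L2]_(w in ~` A) nsq (psum (row j (invmx (Vm z))) w) <=
    2 * (9 * pi * r ^+ 2 + 2 * pi * n%:R ^+ 2).
  set x := row j _.
  rewrite -lee_fin /Rintegral fineK ?integrable_fin_num //; last exact: integrable_psum.
  have mp : measurable_fun setT (fun z => (nsq (psum x z))%:E).
    by apply/measurable_EFinP; exact: (cmeas_nsq (cmeas_psum x)).
  (* The near-maximality bound inside the disk of radius [3 * r], and [growth_bound] outside; the
     latter applies because the circle of radius [r] lies in [K]. *)
  pose g w : \bar R := ((\1_D w * 2 : R) + n%:R ^+ 2 * 2 * expR (- (sqmod w / 2)))%:E.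
  have mg2 : measurable_fun setT (fun w : R * R => (expR (- (sqmod w / 2)))%:E : \bar R).
    apply/measurable_EFinP; apply: eq_measurable_fun (measurable_gauss (- 2^-1)) => w _.
    by congr expR; rewrite mulNr mulrC.
  apply: (@le_trans _ _ (\int[L2]_(w in ~` A) g w)%E).
    apply: le_integral_nomeas => w Aw; rewrite !lee_fin nsq_ge0 /=.
    have [Dw|Dw] := leP (sqmod w) (9 * r ^+ 2).
      rewrite indicE mem_set // mul1r; apply: le_trans (lK j w _) _; first by split.
      by rewrite lerDl !mulr_ge0 // expR_ge0.
    rewrite indicE memNset ?mul0r ?add0r; last by rewrite /D /= => h; move: (le_lt_trans h Dw); rewrite ltxx.
    have h2 : 0 <= 2 :> R by [].
    apply: (growth_bound r0 nr h2) => [v vr|]; last exact: ltW.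
    by apply: lK; exact: circK.
  apply: (@le_trans _ _ (\int[L2]_w g w)%E).
    apply: ge0_subset_integral => //.
    - apply/measurable_EFinP; apply: measurable_funD; apply: measurable_funM => //.
      by apply/measurable_EFinP.
    - by move=> w _; rewrite lee_fin addr_ge0 ?mulr_ge0 // expR_ge0.
  rewrite /g; under eq_integral do rewrite EFinD EFinM (EFinM (n%:R ^+ 2 * 2)) muleC.
  have mi : measurable_fun setT (fun w => (\1_D w)%:E : \bar R) by apply/measurable_EFinP.
  rewrite (@ge0_integralD _ _ _ L2 setT measurableT (fun w => 2%:E * (\1_D w)%:E)%E
    (fun w => (n%:R ^+ 2 * 2)%:E * (expR (- (sqmod w / 2)))%:E)%E); last 4 first.
  - by move=> w _; rewrite -EFinM lee_fin mulr_ge0.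
  - by apply: emeasurable_funM.
  - by move=> w _; rewrite -EFinM lee_fin !mulr_ge0 // expR_ge0.
  - by apply: emeasurable_funM.
  have i0 w : setT w -> (0 <= (\1_D w)%:E :> \bar R)%E by rewrite lee_fin.
  have g20 w : setT w -> (0 <= (expR (- (sqmod w / 2)))%:E :> \bar R)%E by rewrite lee_fin expR_ge0.
  have c20 : (0 <= 2%:E :> \bar R)%E by rewrite lee_fin.
  have cn0 : (0 <= (n%:R ^+ 2 * 2)%:E :> \bar R)%E by rewrite lee_fin mulr_ge0.
  rewrite (ge0_integralZl L2 measurableT mi i0 c20) (ge0_integralZl L2 measurableT mg2 g20 cn0).
  rewrite integral_indic // setIT -[X in (_ * X + _)%E]/(L2 D) L2_disc; last by rewrite mulr_ge0 // ltW.
  have h : (0 : R) < 2^-1 by rewrite invr_gt0.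
  have := L2_gauss_moment 0 h.
  have -> : (\int[L2]_z0 (sqmod z0 ^+ 0 * expR (- (2^-1 * sqmod z0)))%:E =
     \int[L2]_w (expR (- (sqmod w / 2)))%:E)%E.
    by apply: eq_integral => w _; rewrite expr0 mul1r mulrC.
  move=> ->; rewrite -!EFinM -EFinD lee_fin fact0 expr1 invrK mul1r le_eqVlt; apply/orP; left; apply/eqP.
  ring.
rewrite -lecR -gapdetE // rmorphM /= rmorphXn /= nsqE.
have pH : psd (Hm n (~` A)) by exact: Hm_psd.
apply: (le_trans (det_sample_le uV pH)).
rewrite ler_wpM2l ?exprn_ge0 // -[X in _ <= _ ^+ X]card_ord -prodr_const; apply: ler_prod => j _.
by rewrite hf_Hm // !lecR hfB andbT; apply: Rintegral_ge0 => w _; exact: nsq_ge0.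
Qed.

End RotationAverage.

(** * Discrete and continuous logarithmic energies *)

Section Energy.
Variable R : realType.
Local Notation L2 := (@L2 R).
Local Notation prob := (probability (R * R)%type R).

Lemma ln_le_sub1 (x : R) : 0 < x -> ln x <= x - 1.
Proof.
move=> x0; have h := @le_ln1Dx R (x - 1).
by rewrite (_ : 1 + (x - 1) = x) in h; [apply: h; lra|ring].
Qed.

Lemma sqmodB_ge0 (z w : R * R) : 0 <= sqmod (z - w). Proof. exact: sqmod_ge0. Qed.

Lemma sqmodB_eq0 (z w : R * R) : (sqmod (z - w) == 0) = (z == w).
Proof.
rewrite /sqmod paddr_eq0 ?sqr_ge0 // !sqrf_eq0 /= !subr_eq0.
by case: z w => ? ? [? ?] /=; rewrite xpair_eqE.
Qed.

Lemma sqmodB_gt0 (z w : R * R) : z != w -> 0 < sqmod (z - w).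
Proof. by move=> zw; rewrite lt_neqAle sqmodB_ge0 andbT eq_sym sqmodB_eq0. Qed.

Lemma sqmodBC (z w : R * R) : sqmod (z - w) = sqmod (w - z).
Proof. by rewrite /sqmod /=; ring. Qed.

Lemma sqmodB_le (z w : R * R) : sqmod (z - w) <= 2 * (sqmod z + sqmod w).
Proof.
rewrite /sqmod /=; have := sqr_ge0 (z.1 + w.1); have := sqr_ge0 (z.2 + w.2).
by rewrite !sqrrB !sqrrD; lra.
Qed.

Lemma loginvE (z w : R * R) : z != w -> loginv z w = (- (ln (sqmod (z - w)) / 2))%:E.
Proof.
move=> zw; rewrite /loginv (negPf zw); congr EFin; congr (- _).
have s0 := sqmodB_gt0 zw; have -> : cdist z w = Num.sqrt (sqmod (z - w)) by [].
have e : ln (sqmod (z - w)) = ln (Num.sqrt (sqmod (z - w))) *+ 2.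
  by rewrite -lnXn ?sqrtr_gt0 // sqr_sqrtr // ltW.
by rewrite [in RHS]e mulr2n; lra.
Qed.

(* Adding [pot] makes the logarithmic kernel nonnegative and absorbs the external field:
   [J mu mu] is [Rmu mu + 1]. *)
Definition pot (z w : R * R) : R := (sqmod z + sqmod w) / 2 + 1.
Definition kk (z w : R * R) : \bar R := (loginv z w + (pot z w)%:E)%E.
(** Truncation of [kk] at squared distance [del]: finite on the diagonal, uniformly continuous on
    bounded sets, and increasing to [kk] as [del] decreases to 0. *)
Definition kt (del : R) (z w : R * R) : R := - (ln (Num.max (sqmod (z - w)) del) / 2) + pot z w.

Lemma kt_ge0 (del : R) z w : 0 < del <= 1 -> 0 <= kt del z w.
Proof.
move=> /andP[d0 d1]; rewrite /kt /pot.
have m0 : 0 < Num.max (sqmod (z - w)) del by rewrite lt_max d0 orbT.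
have h : ln (Num.max (sqmod (z - w)) del) <= sqmod (z - w) / 4 + 2.
  have [sd|sd] := leP (sqmod (z - w)) del.
    by have := ln_le0 d1; have := sqmodB_ge0 z w; lra.
  have -> : sqmod (z - w) = sqmod (z - w) / 4 * 4 by field.
  rewrite lnM ?posrE ?divr_gt0 // ?(lt_trans d0) //; have h4 := @ln_le_sub1 4 ltac:(by []).
  have := @ln_le_sub1 (sqmod (z - w) / 4) ltac:(by rewrite divr_gt0 // (lt_trans d0)); lra.
have := sqmodB_le z w; have := sqmodB_ge0 z w; lra.
Qed.

Lemma kk_neq z w : z != w -> kk z w = (- (ln (sqmod (z - w)) / 2) + pot z w)%:E.
Proof. by move=> zw; rewrite /kk loginvE // EFinD. Qed.

Lemma kk_diag z : kk z z = +oo%E.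
Proof. by rewrite /kk /loginv eqxx. Qed.

Lemma kt_le_kk (del : R) z w : 0 < del -> ((kt del z w)%:E <= kk z w)%E.
Proof.
move=> d0; have [->|zw] := eqVneq z w; first by rewrite kk_diag leey.
rewrite kk_neq // lee_fin /kt lerD2r lerN2 ler_pM2r ?invr_gt0 // ler_ln ?posrE ?sqmodB_gt0 //.
  by rewrite le_max lexx.
by rewrite lt_max d0 orbT.
Qed.

Lemma kt_mono (d1 d2 : R) z w : 0 < d1 -> d1 <= d2 -> kt d2 z w <= kt d1 z w.
Proof.
move=> d0 d12; rewrite /kt lerD2r lerN2 ler_pM2r ?invr_gt0 // ler_ln ?posrE ?lt_max ?d0 ?orbT //.
  by rewrite ge_max !le_max lexx /= d12 orbT.
by rewrite (lt_le_trans d0 d12) orbT.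
Qed.

Definition ktn (m : nat) := kt m.+1%:R^-1.

Lemma invn_bd m : 0 < (m.+1%:R^-1 : R) <= 1.
Proof. by rewrite invr_gt0 ltr0n /= invf_le1 ?ler1n ?ltr0n. Qed.

Lemma ktn_cvg z w : (ktn m z w)%:E @[m --> \oo] --> kk z w.
Proof.
have [->|zw] := eqVneq z w.
  rewrite kk_diag; apply/cvgeyPge => A.
  near=> m; rewrite lee_fin /ktn /kt /sqmod /= !subrr expr0n addr0 max_r ?invr_ge0 //.
  have s0 := sqmod_ge0 w.
  have : 2 * A <= ln (m.+1%:R).
    have e : expR (2 * A) <= m.+1%:R.
      near: m; exists (Num.truncn (expR (2 * A))) => // k /= hk.
      by rewrite (le_trans (ltW (truncnS_gt _))) // ler_nat ltnS.
    by rewrite -[leLHS]expRK ler_ln ?posrE ?expR_gt0 ?ltr0n.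
  by rewrite lnV ?posrE ?ltr0n // /pot; lra.
rewrite kk_neq //; apply: cvg_near_cst; near=> m; congr EFin; rewrite /ktn /kt max_l //.
have : m.+1%:R^-1 < sqmod (z - w).
  by near: m; apply: (near_infty_natSinv_lt (PosNum (sqmodB_gt0 zw))).
exact: ltW.
Unshelve. all: end_near. Qed.

Lemma kk_ge0 z w : (0 <= kk z w)%E.
Proof.
apply: le_trans (kt_le_kk z w (del := 1) ltr01); rewrite lee_fin; apply: kt_ge0.
by rewrite ltr01 lexx.
Qed.

Lemma ktC d z w : kt d z w = kt d w z. Proof. by rewrite /kt sqmodBC /pot [sqmod z + _]addrC. Qed.

Lemma measurable_kt del : measurable_fun setT (fun p : (R * R) * (R * R) => kt del p.1 p.2).
Proof.
have ms (f : (R * R) * (R * R) -> R * R) : measurable_fun setT f ->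
    measurable_fun setT (fun p => sqmod (f p)).
  by move=> mf; have := measurableT_comp (@measurable_sqmod R) mf.
have m1 : measurable_fun setT (fun p : (R * R) * (R * R) => sqmod (p.1 - p.2)).
  apply: measurable_funD; apply: measurable_funX; apply: measurable_funB.
  - exact: (measurableT_comp measurable_fst measurable_fst).
  - exact: (measurableT_comp measurable_fst measurable_snd).
  - exact: (measurableT_comp measurable_snd measurable_fst).
  - exact: (measurableT_comp measurable_snd measurable_snd).
apply: measurable_funD.
  apply: measurable_funN; apply: measurable_funM => //.
  apply: measurableT_comp; first exact: measurable_ln.
  by apply: measurable_maxr.
apply: measurable_funD => //; apply: measurable_funM => //.
by apply: measurable_funD; apply: ms; [exact: measurable_fst|exact: measurable_snd].
Qed.

Lemma measurable_kk : measurable_fun setT (fun p : (R * R) * (R * R) => kk p.1 p.2).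
Proof.
apply: (@emeasurable_fun_cvg _ _ _ _ (fun m p => (ktn m p.1 p.2)%:E)).
  by move=> m; apply/measurable_EFinP; exact: measurable_kt.
by move=> p _; exact: ktn_cvg.
Qed.

Lemma measurable_kk1 z : measurable_fun setT (kk z).
Proof.
have mf : measurable_fun setT (fun w : R * R => (z, w)) by exact: measurable_fun_pair.
by have := measurableT_comp measurable_kk mf.
Qed.

Definition kpot (mu : {measure set (R * R) -> \bar R}) z : \bar R := (\int[mu]_w kk z w)%E.
Definition J (mu nu : {measure set (R * R) -> \bar R}) : \bar R := (\int[mu]_z kpot nu z)%E.

Lemma kpot_ge0 mu z : (0 <= kpot mu z)%E. Proof. by apply: integral_ge0 => w _; exact: kk_ge0. Qed.
Lemma J_ge0 mu nu : (0 <= J mu nu)%E. Proof. by apply: integral_ge0 => w _; exact: kpot_ge0. Qed.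

Lemma measurable_kpot (mu : prob) : measurable_fun setT (kpot mu).
Proof.
by apply: (@measurable_fun_fubini_tonelli_F _ _ _ _ _ mu (fun p => kk p.1 p.2)) => [|p];
  [exact: measurable_kk|exact: kk_ge0].
Qed.

(** Covers an infinite integral of [f], as for measures of infinite energy: the positive part of the
    sum then has infinite integral and the negative part a finite one. *)
Lemma integral_add_integrable d (T : measurableType d) (mu : {measure set T -> \bar R})
  (f : T -> \bar R) (g : T -> R) : measurable_fun setT f -> (forall x, (0 <= f x)%E) ->
  mu.-integrable setT (EFin \o g) -> (\int[mu]_x (f x + (g x)%:E) = \int[mu]_x f x + \int[mu]_x (g x)%:E)%E.
Proof.
move=> mf f0 ig; have mg : measurable_fun setT (EFin \o g) by case/integrableP: ig.
have [fi|] := boolP (\int[mu]_x f x < +oo)%E.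
  rewrite (integralD measurableT _ ig) //; apply/integrableP; split => //.
  by under eq_integral do rewrite gee0_abs //.
rewrite -leNgt leye_eq => /eqP foo; rewrite foo.
have gfin : (\int[mu]_x (g x)%:E)%E \is a fin_num by apply: integrable_fin_num.
rewrite addye; last by move: gfin; rewrite fin_numE => /andP[].
have ia : mu.-integrable setT (EFin \o (fun x => `|g x|)) by exact: (integrable_norm ig).
have mh : measurable_fun setT (fun x => (f x + (g x)%:E)%E) by exact: emeasurable_funD.
have neg : (\int[mu]_x (fun x => f x + (g x)%:E)%E^\- x < +oo)%E.
  have /integrableP[_ /(le_lt_trans _)] := ia; apply.
  apply: ge0_le_integral => //.
  - exact: measurable_funeneg.
  - by apply: measurableT_comp => //; case/integrableP: ia.
  - move=> x _; rewrite /= funenegE ge_max lee_fin normr_id normr_ge0 andbT leeNl.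
    rewrite -[leLHS]add0e; apply: leeD; first exact: f0.
    by rewrite -EFinN lee_fin lerNl; have := ler_norm (- g x); rewrite normrN.
have pos : (\int[mu]_x (fun x => f x + (g x)%:E)%E^\+ x = +oo)%E.
  apply/eqP; rewrite -leye_eq leNgt; apply/negP => pfin.
  have /integrableP[_ ai] := ia.
  have : (\int[mu]_x f x < +oo)%E; last by rewrite foo ltxx.
  apply: (@le_lt_trans _ _ (\int[mu]_x ((fun x => f x + (g x)%:E)%E^\+ x + (`|g x|)%:E))%E).
    apply: ge0_le_integral => //.
    - apply: emeasurable_funD; first exact: measurable_funepos.
      by case/integrableP: ia.
    - move=> x _; rewrite funeposE.
      apply: (@le_trans _ _ (f x + (g x)%:E + (`|g x|)%:E)%E).
        by rewrite -addeA -EFinD leeDl // lee_fin; have := ler_norm (- g x); rewrite normrN; lra.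
      by rewrite leeD2r // le_max lexx.
  rewrite ge0_integralD //; last 2 first.
  - exact: measurable_funepos.
  - by case/integrableP: ia.
  rewrite lte_add_pinfty //; move: ai; by under eq_integral do rewrite /= normr_id.
have nfin : (\int[mu]_x (fun x => f x + (g x)%:E)%E^\- x)%E \is a fin_num.
  by rewrite ge0_fin_numE // integral_ge0.
by rewrite integralE pos -(fineK nfin).
Qed.

Lemma continuous_sqmod : continuous (@sqmod R).
Proof.
move=> z; apply: cvgD; rewrite /= expr2.
  by under eq_fun do rewrite expr2; apply: cvgM; exact: cvg_fst.
by under eq_fun do rewrite expr2; apply: cvgM; exact: cvg_snd.
Qed.

Lemma compact_sqmod (K : set (R * R)) : compact K -> exists2 M, 0 <= M & forall z, K z -> sqmod z <= M.
Proof.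
move=> cK; have cS : compact (@sqmod R @` K).
  by apply: continuous_compact => //; apply: continuous_subspaceT; exact: continuous_sqmod.
have [M [Mr HM]] := compact_bounded cS.
exists (Num.max (M + 1) 0); first by rewrite le_max lexx orbT.
move=> z Kz; rewrite le_max; apply/orP; left.
apply: le_trans (ler_norm _) _; apply: (HM (M + 1)); first by rewrite ltrDl.
by exists z.
Qed.

(** The sigma-algebra on the plane is the product one; an open set is the countable union of the
    grid boxes that it contains. *)
Lemma open_R2_measurable (V : set (R * R)) : open V -> measurable V.
Proof.
move=> oV; pose G (q : nat * nat * nat * nat) : set (R * R) :=
  gint q.1.1.1.+1 q.1.1.2 q.1.2 `*` gint q.1.1.1.+1 q.1.1.2 q.2.
pose D := [set q | G q `<=` V].
have -> : V = \bigcup_(q in D) G q.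
  apply/seteqP; split=> [z Vz|z [q Dq /Dq]] //.
  have [e /= e0 eV] : nbhs_ball z V by rewrite nbhs_ballE; exact: open_nbhs_nbhs.
  have [n nP] : exists n : nat, n.+1%:R^-1 < e.
    have [N _ NP] := near_infty_natSinv_lt (PosNum e0); exists N; exact: (NP N (leqnn N)).
  pose B := (Num.truncn (Num.max `|z.1| `|z.2|)).+1.
  have := ltW (truncnS_gt (Num.max `|z.1| `|z.2|)); rewrite ge_max => /andP[B1 B2].
  have [i iP] := @gint_cover R n.+1 B z.1 isT B1.
  have [j jP] := @gint_cover R n.+1 B z.2 isT B2.
  exists (n, B, i : nat, j : nat) => // w [/= wi wj]; apply: eV; split => /=.
    exact: (lt_trans (gint_close _ iP wi)).
  exact: (lt_trans (gint_close _ jP wj)).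
pose H n : set (R * R) := if unpickle n is Some q then (if `[< D q >] then G q else set0) else set0.
have -> : \bigcup_(q in D) G q = \bigcup_n H n.
  apply/seteqP; split=> z [].
    by move=> q Dq Gz; exists (pickle q) => //; rewrite /H pickleK asboolT.
  by move=> n _; rewrite /H; case: unpickle => // q; case: asboolP => // Dq Gz; exists q.
apply: bigcupT_measurable => n; rewrite /H; case: unpickle => [q|]; last exact: measurable0.
case: asboolP => _; last exact: measurable0.
by apply: measurableX; exact: measurable_itv.
Qed.

Lemma closed_R2_measurable (V : set (R * R)) : closed V -> measurable V.
Proof.
by move=> cV; rewrite -(setCK V); apply: measurableC; apply: open_R2_measurable; rewrite openC.
Qed.

Lemma hausdorff_R2 : hausdorff_space (R * R)%type.
Proof. exact: norm_hausdorff. Qed.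

Lemma prob_setC0 (mu : prob) (A : set (R * R)) : measurable A -> mu (~` A) = 0%E -> mu A = 1%E.
Proof.
by move=> mA A0; rewrite -(setCK A) probability_setC ?A0 ?sube0 //; exact: measurableC.
Qed.

Lemma int_cst_prob (mu : prob) (c : \bar R) : (\int[mu]_x c)%E = c.
Proof. by rewrite integral_cst //= probability_setT mule1. Qed.

Lemma cpt_suppP (mu : prob) E : cpt_supported_in mu E -> exists (K : set (R * R)) (M : R),
  [/\ compact K, measurable K, K `<=` E, mu (~` K) = 0%E & 0 <= M /\ forall z, K z -> sqmod z <= M].
Proof.
move=> [K [cK KE K0]]; have [M M0 KM] := compact_sqmod cK; exists K, M; split=> //.
by apply: closed_R2_measurable; apply: compact_closed cK; exact: hausdorff_R2.
Qed.

Lemma integrable_sqmod (mu : prob) E : cpt_supported_in mu E -> mu.-integrable setT (EFin \o @sqmod R).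
Proof.
move=> /cpt_suppP [K [M [cK mK KE K0 [M0 KM]]]].
apply/integrableP; split; first by apply/measurable_EFinP; exact: measurable_sqmod.
apply: (@le_lt_trans _ _ (\int[mu]_x M%:E)%E); last first.
  by rewrite int_cst_prob ltry.
apply: ae_ge0_le_integral => //.
- by apply: measurableT_comp => //; apply/measurable_EFinP; exact: measurable_sqmod.
- exists (~` K); split => //; first exact: measurableC.
  move=> z /= h; apply: contra_not h => Kz _.
  by rewrite lee_fin ger0_norm ?sqmod_ge0 // KM.
Qed.

Lemma Rmu_J (mu : prob) E : cpt_supported_in mu E -> J mu mu = (Rmu mu + 1)%E.
Proof.
move=> sE; have iS := integrable_sqmod sE.
pose S := fine (\int[mu]_z (sqmod z)%:E)%E.
have SE : (\int[mu]_z (sqmod z)%:E)%E = S%:E by rewrite fineK // integrable_fin_num.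
have icst (c : R) : mu.-integrable setT (EFin \o (fun _ : R * R => c)).
  apply/integrableP; split; first exact: measurable_cst.
  by rewrite int_cst_prob ltry.
have ipot z : mu.-integrable setT (EFin \o (fun w => - pot z w)).
  have i1 := integrableD measurableT (integrableZl measurableT (- 2^-1) iS) (icst (- (sqmod z / 2 + 1))).
  by apply: eq_integrable i1 => // w _; rewrite /= /pot -EFinD; congr EFin; ring.
have ipotE z : (\int[mu]_w (- pot z w)%:E)%E = (- (sqmod z / 2) - (S / 2 + 1))%:E.
  have i1 := integrableZl measurableT (- 2^-1) iS.
  transitivity (\int[mu]_w ((- 2^-1)%:E * (sqmod w)%:E + (- (sqmod z / 2 + 1))%:E))%E.
    by apply: eq_integral => w _; rewrite /pot -EFinM -EFinD; congr EFin; ring.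
  rewrite (integralD measurableT i1 (icst _)) (integralZl measurableT iS) SE int_cst_prob.
  by rewrite -EFinM -EFinD; congr EFin; ring.
have loginvk z w : loginv z w = (kk z w + (- pot z w)%:E)%E.
  by rewrite /kk EFinN -addeA subee // adde0.
have inner z : (\int[mu]_w loginv z w = kpot mu z + (- (sqmod z / 2) - (S / 2 + 1))%:E)%E.
  under eq_integral do rewrite loginvk.
  by rewrite integral_add_integrable ?ipotE //; [exact: measurable_kk1|move=> w; exact: kk_ge0].
have i2 : mu.-integrable setT (EFin \o (fun z : R * R => - (sqmod z / 2) - (S / 2 + 1))).
  have i1 := integrableD measurableT (integrableZl measurableT (- 2^-1) iS) (icst (- (S / 2 + 1))).
  by apply: eq_integrable i1 => // w _; rewrite /= -EFinD; congr EFin; ring.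
have -> : Rmu mu = (J mu mu + (- (S + 1))%:E + S%:E)%E.
  rewrite /Rmu SE; congr (_ + _)%E; rewrite /log_energy; under eq_integral do rewrite inner.
  rewrite (integral_add_integrable (measurable_kpot mu) (kpot_ge0 mu) i2); congr (_ + _)%E.
  transitivity (\int[mu]_z ((- 2^-1)%:E * (sqmod z)%:E + (- (S / 2 + 1))%:E))%E.
    by apply: eq_integral => z _; rewrite -EFinM -EFinD; congr EFin; ring.
  rewrite (integralD measurableT (integrableZl measurableT _ iS) (icst _)) (integralZl measurableT iS) SE.
  by rewrite int_cst_prob -EFinM -EFinD; congr EFin; field.
rewrite -!addeA -!EFinD (_ : - (S + 1) + (S + 1) = 0) ?adde0 //; ring.
Qed.

(** Otherwise [f] would exceed its own mean by 1 on a set of full measure. A slack of 1 per point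
    only adds [n] to an energy of order [n ^+ 2]. *)
Lemma exists_le_int (mu : prob) (A : set (R * R)) (f : R * R -> \bar R) : measurable A -> mu (~` A) = 0%E ->
  measurable_fun setT f -> (forall z, (0 <= f z)%E) -> exists2 z, A z & (f z <= \int[mu]_x f x + 1)%E.
Proof.
move=> mA A0 mf f0; have A1 := prob_setC0 mA A0; apply: contrapT => H.
have fA z : A z -> (\int[mu]_x f x + 1 < f z)%E.
  by move=> Az; rewrite ltNge; apply/negP => h; apply: H; exists z.
have I0 : (0 <= \int[mu]_x f x)%E by apply: integral_ge0.
have [z Az] : A !=set0.
  by apply/set0P; apply/eqP => A00; move: A1; rewrite A00 measure0 => /esym/eqP; rewrite onee_eq0.
have Ifin : (\int[mu]_x f x)%E \is a fin_num.
  rewrite ge0_fin_numE // ltey; apply/eqP => Ioo; have := fA z Az; rewrite Ioo addye //.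
  by rewrite ltNge leey.
have : (\int[mu]_x f x + 1 <= \int[mu]_x f x)%E; last first.
  by rewrite -(fineK Ifin) -EFinD lee_fin gerDl ler10.
apply: (@le_trans _ _ (\int[mu]_(x in A) (\int[mu]_x f x + 1))%E).
  by rewrite integral_cst //= A1 mule1.
apply: (@le_trans _ _ (\int[mu]_(x in A) f x)%E).
  apply: ge0_le_integral => //.
  - by move=> w _; rewrite adde_ge0.
  - exact: measurable_funTS.
  - by move=> w /fA /ltW.
by apply: ge0_subset_integral.
Qed.

Lemma greedy (mu : prob) (A : set (R * R)) (Jr : R) n : measurable A -> mu (~` A) = 0%E ->
  J mu mu = Jr%:E -> exists2 z : nat -> R * R, (forall i, (i < n)%N -> A (z i)) &
  (\sum_(i < n) \sum_(j < i) kk (z j) (z i) <= (n%:R ^+ 2 / 2 * Jr + n%:R)%:E)%E.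
Proof.
move=> mA A0 JE; have Jr0 : 0 <= Jr by rewrite -lee_fin -JE J_ge0.
(* Method of conditional expectations. If the remaining points were drawn independently from [mu],
   their mutual energy would be ['C(n - m, 2) * Jr]; the coefficient of [Jr] is
   ['C(n, 2) - 'C(n - m, 2)], and the last term is the slack spent so far. *)
pose c (m : nat) : R := (m%:R * n%:R - m%:R * (m%:R + 1) / 2) * Jr + m%:R.
suff H m : (m <= n)%N -> exists2 z : nat -> R * R, (forall i, (i < m)%N -> A (z i)) &
    (\sum_(i < m) \sum_(j < i) kk (z j) (z i) + (n - m)%:R%:E * \sum_(i < m) kpot mu (z i) <= (c m)%:E)%E.
  have [z zA zE] := H n (leqnn n); exists z => //.
  rewrite subnn mul0e adde0 in zE; apply: le_trans zE _; rewrite lee_fin /c lerD2r ler_wpM2r //.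
  have : 0 <= n%:R :> R by []. lra.
elim: m => [_|m IH mn].
  exists (fun=> (0, 0)) => //; rewrite !big_ord0 mule0 adde0 lee_fin /c !mul0r subr0 mul0r addr0 //.
have [z zA zE] := IH (ltnW mn).
pose k := (n - m.+1)%N.
have nmk : (n - m)%N = k.+1 by rewrite /k subnSK.
(* The cost of choosing [w]: its energy with the earlier points plus the mean energy with the [k]
   later ones. *)
pose g w : \bar R := (\sum_(j < m) kk (z j) w + k%:R%:E * kpot mu w)%E.
have mkp := measurable_kpot mu.
have mg : measurable_fun setT g.
  apply: emeasurable_funD; last by apply: emeasurable_funM.
  by apply: emeasurable_sum => j; exact: measurable_kk1.
have s0 w : (0 <= \sum_(j < m) kk (z j) w)%E by apply: sume_ge0 => j _; exact: kk_ge0.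
have kp0 w : (0 <= k%:R%:E * kpot mu w)%E by rewrite mule_ge0 ?lee_fin ?kpot_ge0.
have g0 w : (0 <= g w)%E by rewrite adde_ge0.
have [w Aw gw] := exists_le_int mA A0 mg g0.
have gI : (\int[mu]_x g x = \sum_(j < m) kpot mu (z j) + (k%:R * Jr)%:E)%E.
  rewrite /g ge0_integralD //; last 2 first.
  - by apply: emeasurable_sum => j; exact: measurable_kk1.
  - by apply: emeasurable_funM.
  rewrite ge0_integralZl ?lee_fin //; last by move=> x _; exact: kpot_ge0.
  rewrite ge0_integral_sum //.
  - by rewrite -/(J mu mu) JE -EFinM.
  - by move=> j; exact: measurable_kk1.
  - by move=> j x _; exact: kk_ge0.
pose z' i := if i == m then w else z i.
have z'z i : (i < m)%N -> z' i = z i by move=> im; rewrite /z' ltn_eqF.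
have z'm : z' m = w by rewrite /z' eqxx.
exists z'.
  by move=> i; rewrite ltnS leq_eqVlt => /orP[/eqP ->|im]; rewrite ?z'm // z'z //; exact: zA.
rewrite !big_ord_recr /= z'm.
rewrite (eq_bigr (fun i : 'I_m => \sum_(j < i) kk (z j) (z i))%E); last first.
  by move=> i _; apply: eq_bigr => j _; rewrite !z'z // (ltn_trans (ltn_ord j)).
rewrite (eq_bigr (fun j : 'I_m => kk (z j) w)); last by move=> j _; rewrite z'z.
rewrite (eq_bigr (fun j : 'I_m => kpot mu (z j)) (F1 := fun j : 'I_m => kpot mu (z' j))); last by move=> j _; rewrite z'z.
rewrite nmk in zE; rewrite -/k.
set E := (\sum_(i < m) \sum_(j < i) _)%E in zE *; set V := (\sum_(i < m) kpot mu _)%E in zE gI *.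
have V0 : (0 <= V)%E by apply: sume_ge0 => j _; exact: kpot_ge0.
have -> : (E + \sum_(j < m) kk (z j) w + k%:R%:E * (V + kpot mu w) = E + k%:R%:E * V + g w)%E.
  by rewrite /g ge0_muleDr ?kpot_ge0 // -!addeA; congr (_ + _)%E; rewrite addeCA.
apply: (@le_trans _ _ (E + k%:R%:E * V + (V + (k%:R * Jr)%:E + 1))%E).
  by rewrite leeD2l // -gI.
have -> : (E + k%:R%:E * V + (V + (k%:R * Jr)%:E + 1) = (E + k.+1%:R%:E * V) + (k%:R * Jr + 1)%:E)%E.
  rewrite -natr1 EFinD ge0_muleDl ?lee_fin // mul1e EFinD.
  by rewrite !addeA.
apply: le_trans (leeD2r _ zE) _; rewrite -EFinD lee_fin /c.
have -> : k%:R = n%:R - m%:R - 1 :> R.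
  rewrite /k natrB // -natr1; ring.
by rewrite -[m.+1%:R]natr1 le_eqVlt; apply/orP; left; apply/eqP; field.
Qed.

End Energy.

(** * From measures to configurations with room around the points *)

Section Discretization.
Variable R : realType.
Local Notation C := R[i].
Local Notation prob := (probability (R * R)%type R).

(* Cauchy's estimate for a monic polynomial: its maximum on a circle of radius rho is at least
   rho to the degree. *)
Lemma circle_point (c : R * R) (rho2 : R) (s : seq (R * R)) : 0 < rho2 -> exists y : R * R,
  sqmod (y - c) = rho2 /\ 2^-1 * \prod_(w <- s) rho2 <= \prod_(w <- s) sqmod (y - w).
Proof.
move=> r0; apply: contrapT => H.
pose p : {poly C} := \prod_(w <- s) ('X - (cpx (w - c))%:P).
have pE u : nsq p.[cpx u] = \prod_(w <- s) sqmod (u + c - w).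
  rewrite /p horner_prod; elim: s {H p} => [|w s IH]; first by rewrite !big_nil /nsq /= expr1n expr0n addr0.
  rewrite !big_cons nsqM IH; congr (_ * _).
  by rewrite hornerXsubC -cpxB nsq_cpx; congr sqmod; rewrite opprB addrA addrAC.
have rE : \prod_(w <- s) rho2 = rho2 ^+ size s by rewrite big_const_seq count_predT iter_mulr_1.
have : nsq p`_(size s) * rho2 ^+ size s <= 2^-1 * rho2 ^+ size s.
  apply: cauchy_coef; first exact: ltW.
  move=> u ur; rewrite leNgt; apply/negP => h; apply: H; exists (u + c); split; first by rewrite addrK.
  by rewrite rE -pE ltW.
have mp : p \is monic by exact: monic_prod_XsubC.
have -> : p`_(size s) = 1.
  by move/monicP: mp; rewrite /lead_coef /p size_prod_XsubC.
have -> : nsq (1 : C) = 1 by rewrite /nsq /= expr1n expr0n addr0.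
rewrite ler_pM2r ?exprn_gt0 //; lra.
Qed.

(** Each new point is placed on its circle by [circle_point], applied to the earlier points declared
    close to it. Only the product of the distances is controlled, which is what the Vandermonde
    determinant contains. *)
Lemma circle_points (c : nat -> R * R) (rho2 : R) (close : nat -> nat -> bool) m : 0 < rho2 ->
  exists y : nat -> R * R, forall i, (i < m)%N -> sqmod (y i - c i) = rho2 /\
    2^-1 * \prod_(j < i | close j i) rho2 <= \prod_(j < i | close j i) sqmod (y i - y j).
Proof.
move=> r0; elim: m => [|m [y yP]]; first by exists (fun=> (0, 0)).
pose s := [seq y (nat_of_ord j) | j <- [seq j : 'I_m <- index_enum 'I_m | close j m]].
have [w [w1 w2]] := circle_point (c m) s r0.
pose y' i := if i == m then w else y i.
have y'y i : (i < m)%N -> y' i = y i by move=> im; rewrite /y' ltn_eqF.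
have y'm : y' m = w by rewrite /y' eqxx.
exists y' => i; rewrite ltnS leq_eqVlt => /orP[/eqP ->|im]; last first.
  have [h1 h2] := yP i im; rewrite y'y //; split=> //; apply: le_trans h2 _.
  by rewrite le_eqVlt; apply/orP; left; apply/eqP; apply: eq_bigr => j _; rewrite y'y // (ltn_trans _ im).
rewrite y'm; split=> //; move: w2; rewrite !big_map !big_filter => /le_trans; apply.
by rewrite le_eqVlt; apply/orP; left; apply/eqP; apply: eq_bigr => j _; rewrite y'y.
Qed.

Lemma sqrt_sqmod_triangle (u v : R * R) : Num.sqrt (sqmod (u + v)) <= Num.sqrt (sqmod u) + Num.sqrt (sqmod v).
Proof.
set a := Num.sqrt (sqmod u); set b := Num.sqrt (sqmod v).
have a0 : 0 <= a by exact: sqrtr_ge0.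
have b0 : 0 <= b by exact: sqrtr_ge0.
rewrite -ler_sqr ?nnegrE ?addr_ge0 ?sqrtr_ge0 // sqr_sqrtr ?sqmod_ge0 //.
have := @sqmod_near R u (u + v) a b a0 b0.
rewrite addrAC subrr add0r /a /b !sqr_sqrtr ?sqmod_ge0 // => /(_ (lexx _) (lexx _)).
by rewrite sqrrD !sqr_sqrtr ?sqmod_ge0 // mulr2n; lra.
Qed.

Lemma sqmodN (u : R * R) : sqmod (- u) = sqmod u. Proof. by rewrite /sqmod /=; ring. Qed.

Lemma sqrt_sqmodB_triangle (u v w : R * R) :
  Num.sqrt (sqmod (u - w)) <= Num.sqrt (sqmod (u - v)) + Num.sqrt (sqmod (v - w)).
Proof. by rewrite -[u - w](subrKA v); exact: sqrt_sqmod_triangle. Qed.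

(** The joint density of the points up to normalisation, at the scale where they fill the unit disk;
    [- ln Wn] is the discrete energy, of order [n ^+ 2]. *)
Definition Wn n (y : 'I_n -> R * R) : R := vdm2 y * expR (- (n%:R * \sum_i sqmod (y i))).

Lemma vdm2E n (y : nat -> R * R) : vdm2 (fun i : 'I_n => y i) = \prod_(i < n) \prod_(j < i) sqmod (y i - y j).
Proof.
rewrite /vdm2 (exchange_big_dep predT) //=; apply: eq_bigr => i _.
by rewrite -(big_ord_widen n (fun j => sqmod (y i - y j)) (ltnW (ltn_ord i))).
Qed.

Lemma sum_pairs (s : nat -> R) n : \sum_(i < n) \sum_(j < i) (s j + s i) = (n%:R - 1) * \sum_(i < n) s i.
Proof.
elim: n => [|n IH]; first by rewrite !big_ord0 mulr0.
by rewrite !big_ord_recr /= IH big_split /= sumr_const card_ord -mulr_natr -natr1; ring.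
Qed.

Lemma sum_pot (z : nat -> R * R) n :
  2 * \sum_(i < n) \sum_(j < i) pot (z j) (z i) = (n%:R - 1) * (\sum_(i < n) sqmod (z i) + n%:R).
Proof.
have := sum_pairs (fun i => sqmod (z i) + 1) n.
rewrite [in RHS]big_split /= sumr_const card_ord => <-; rewrite mulr_sumr; apply: eq_bigr => i _.
by rewrite mulr_sumr; apply: eq_bigr => j _; rewrite /pot; field.
Qed.

Lemma fine_kk_sum (z : nat -> R * R) n (B : R) : (\sum_(i < n) \sum_(j < i) kk (z j) (z i) <= B%:E)%E ->
  (forall i j, (i < n)%N -> (j < i)%N -> z j != z i) /\
  \sum_(i < n) \sum_(j < i) fine (kk (z j) (z i)) <= B.
Proof.
move=> H.
have k0 (i : 'I_n) : (0 <= \sum_(j < i) kk (z j) (z i))%E by apply: sume_ge0 => j _; exact: kk_ge0.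
have kB i j : (i < n)%N -> (j < i)%N -> (kk (z j) (z i) <= B%:E)%E.
  move=> im ji; apply: le_trans H.
  rewrite (bigD1 (Ordinal im)) //= (bigD1 (Ordinal ji)) //=.
  rewrite -addeA leeDl // adde_ge0 //; apply: sume_ge0 => l _; rewrite ?k0 //; exact: kk_ge0.
have zne i j : (i < n)%N -> (j < i)%N -> z j != z i.
  by move=> im ji; apply/eqP => e; have := kB i j im ji; rewrite e kk_diag leye_eq.
split=> //; rewrite -lee_fin; apply: le_trans H; rewrite -sumEFin; apply: lee_sum => i _.
by rewrite -sumEFin; apply: lee_sum => j _; rewrite kk_neq ?zne.
Qed.

(** The greedy points [z i] move by at most [5 * t / 2] to points [y i] on circles inside free
    balls. Pairs at distance above [D * t] lose a factor close to 1. Close pairs may lose a constant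
    factor, but their energy is large, and a small fraction [lam] of it pays for the loss. *)
Lemma low_energy (mu : prob) (A V : set (R * R)) (Jr M t0 : R) : measurable A -> mu (~` A) = 0%E ->
  0 <= M -> (forall z, A z -> sqmod z <= M ^+ 2) -> J mu mu = Jr%:E -> 0 < t0 ->
  (forall t, 0 < t < t0 -> forall z, A z -> exists c, sqmod (c - z) <= (2 * t) ^+ 2 /\
     forall u, sqmod (u - c) < t ^+ 2 -> ~ V u) ->
  forall eps, 0 < eps -> exists t M' n0, [/\ 0 < t, 0 <= M' & forall n, (n0 <= n)%N ->
    exists y : 'I_n -> R * R, [/\ (forall i u, sqmod (u - y i) <= t ^+ 2 -> ~ V u),
      (forall i, sqmod (y i) <= M' ^+ 2) & expR (- (n%:R ^+ 2 * (Jr - 1 + eps))) <= Wn y]].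
Proof.
move=> mA A0 M0 AM JE t00 H eps e0.
have Jr0 : 0 <= Jr by rewrite -lee_fin -JE J_ge0.
pose eta := eps / 8; have eta0 : 0 < eta by rewrite divr_gt0.
have ee1 : expR (- eta) < 1 by rewrite expR_lt1 oppr_lt0.
(* Two moves of [5 * t / 2] shorten a distance above [D * t] by a proportion of at most [5 / D]. *)
have [D D0 D5] : exists2 D, 0 < D & 1 - 5 / D = expR (- eta).
  exists (5 / (1 - expR (- eta))); first by rewrite divr_gt0 // subr_gt0.
  by rewrite invfM invrK mulrA divff ?mul1r ?subKr // gt_eqF.
have [lam lam0 lamJ] : exists2 lam, 0 < lam & lam * Jr <= eps / 8.
  have J1 : 0 < Jr + 1 by rewrite ltr_wpDl.
  exists (eps / 8 / (Jr + 1)); first by rewrite !divr_gt0.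
  by rewrite mulrAC ler_pdivrMr // ler_pM2l ?divr_gt0 // lerDl.
have M7 : 0 < 5 * M + 7 by lra.
(* The fourth condition yields [lnDt], which lets the energy of a close pair pay [ln (2 * D)]; the
   fifth, with [t <= 1], keeps the growth [theta] of the squared moduli below [eps / 8]. *)
have [t [t_gt0 tt0 tl1 tt1 tt2]] : exists t, [/\ 0 < t, t <= t0 / 2, t <= 1,
    t <= expR (- (ln (2 * D) / lam)) / D & t <= eps / 8 / (5 * M + 7)].
  exists (Num.min (Num.min (t0 / 2) 1) (Num.min (expR (- (ln (2 * D) / lam)) / D) (eps / 8 / (5 * M + 7)))).
  split; last by rewrite !ge_min lexx !orbT.
  - by rewrite !lt_min ltr01 !divr_gt0 ?expR_gt0.
  - by rewrite !ge_min lexx.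
  - by rewrite !ge_min lexx orbT.
  - by rewrite !ge_min lexx !orbT.
have lnDt : ln (2 * D) <= lam * (- ln (D * t)).
  have Dt0 : 0 < D * t by rewrite mulr_gt0.
  have : ln (D * t) <= - (ln (2 * D) / lam).
    by rewrite -[leRHS]expRK ler_ln ?posrE ?expR_gt0 // mulrC -ler_pdivlMr.
  by rewrite lerNr ler_pdivrMr // => h; rewrite [leRHS]mulrC.
(* On a circle of half the radius of the free ball, a disk of radius [t / 4] around each point stays
   inside the ball. *)
have [rho rho0 rhoE] : exists2 rho, 0 < rho & t = 2 * rho by exists (t / 2); [rewrite divr_gt0|field].
pose rho2 := rho ^+ 2; have rho20 : 0 < rho2 by rewrite exprn_gt0.
pose theta := 2 * M * (5 * t / 2) + (5 * t / 2) ^+ 2.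
have thetaE : theta <= eps / 8.
  have : (5 * M + 7) * t <= eps / 8 by rewrite mulrC -ler_pdivlMr.
  by rewrite /theta; nra.
(* Collects the terms of order [n]; from [n0] on they are at most [n ^+ 2 * (eps / 2)]. *)
pose lin := ln 2 + 2 * (1 + lam) + 2 + M ^+ 2.
pose n0 := (Num.truncn (lin / (eps / 2))).+1.
exists (t / 4), (M + 5 * t / 2), n0; split=> [||n n0n]; first by rewrite divr_gt0.
  by rewrite addr_ge0 // divr_ge0 // mulr_ge0 // ltW.
have [z zA zE] := greedy n mA A0 JE.
have [zne zS] := fine_kk_sum zE.
have tt : 0 < t < t0 by rewrite t_gt0 (le_lt_trans tt0) // ltr_pdivrMr // ltr_pMr // ltr1n.
have [c cP] : exists c : nat -> R * R, forall i, (i < n)%N -> sqmod (c i - z i) <= (2 * t) ^+ 2 /\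
    forall u, sqmod (u - c i) < t ^+ 2 -> ~ V u.
  have : forall i, exists c, (i < n)%N -> sqmod (c - z i) <= (2 * t) ^+ 2 /\
    forall u, sqmod (u - c) < t ^+ 2 -> ~ V u.
    move=> i; have [im|im] := ltnP i n; last by exists (0, 0).
    by have [c cP] := H t tt (z i) (zA i im); exists c.
  by move=> /choice[c cP]; exists c.
pose close j i := sqmod (z j - z i) <= (D * t) ^+ 2.
have [y yP] := circle_points c close n rho20.
have dist_y i : (i < n)%N -> Num.sqrt (sqmod (y i - z i)) <= 5 * t / 2.
  move=> im; have [y1 _] := yP i im; have [c1 _] := cP i im.
  apply: le_trans (sqrt_sqmodB_triangle _ (c i) _) _; rewrite y1 sqrtr_sqr ger0_norm ?(ltW rho0) //.
  have : Num.sqrt (sqmod (c i - z i)) <= 2 * t.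
    by rewrite -(ger0_norm (ltW (mulr_gt0 (ltr0n R 2) t_gt0))) -sqrtr_sqr ler_wsqrtr.
  rewrite rhoE; lra.
have dist_y2 i : (i < n)%N -> sqmod (y i - z i) <= (5 * t / 2) ^+ 2.
  move=> im; rewrite -(sqr_sqrtr (sqmod_ge0 _)) lerXn2r ?nnegrE ?sqrtr_ge0 ?dist_y //.
  by rewrite divr_ge0 // mulr_ge0 // ltW.
pose kap j i := fine (kk (z j) (z i)).
have kapE j i : (i < n)%N -> (j < i)%N -> kap j i = - (ln (sqmod (z j - z i)) / 2) + pot (z j) (z i).
  by move=> im ji; rewrite /kap kk_neq ?zne.
have kap0 j i : 0 <= kap j i by apply: fine_ge0; exact: kk_ge0.
(* Without [lam] and [eta] this is minus the logarithm of the distance of [z j] and [z i]; [lam] is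
   the reserve for close pairs and [eta] the one for far pairs. *)
pose f j i := (1 + lam) * kap j i - pot (z j) (z i) + eta.
(* A close pair has [kap >= - ln (D * t)], so [lam * kap >= ln (2 * D)], the logarithm of
   [D * t / rho]. *)
have closeP j i : (i < n)%N -> (j < i)%N -> close j i -> expR (- (2 * f j i)) <= rho2.
  move=> im ji cji; have s0 := sqmodB_gt0 (zne i j im ji).
  have -> : rho2 = expR (2 * ln rho) by rewrite mulrC -[2]/(2%:R) expRM_natr lnK.
  rewrite ler_expR.
  have Dt0 : 0 < D * t by rewrite mulr_gt0.
  have l1 : ln (sqmod (z j - z i)) <= 2 * ln (D * t).
    have -> : 2 * ln (D * t) = ln ((D * t) ^+ 2) by rewrite lnXn // mulr2n; ring.
    by rewrite ler_ln ?posrE ?exprn_gt0.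
  have l2 : ln (D * t) = ln (2 * D) + ln rho.
    by rewrite -lnM ?posrE ?mulr_gt0 //; congr ln; rewrite rhoE; ring.
  have k1 : - ln (D * t) <= kap j i.
    rewrite kapE //; have := sqmod_ge0 (z j); have := sqmod_ge0 (z i); rewrite /pot; lra.
  have k2 : lam * (- ln (D * t)) <= lam * kap j i by rewrite ler_wpM2l // ltW.
  have := kapE j i im ji; rewrite /f; lra.
have farP j i : (i < n)%N -> (j < i)%N -> ~~ close j i -> expR (- (2 * f j i)) <= sqmod (y i - y j).
  move=> im ji; rewrite /close -ltNge => cji; have s0 := sqmodB_gt0 (zne i j im ji).
  apply: (@le_trans _ _ (expR (ln (sqmod (z j - z i)) - 2 * eta))).
    rewrite ler_expR /f; have := kapE j i im ji; have := mulr_ge0 (ltW lam0) (kap0 j i); lra.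
  rewrite expRD lnK //; set sz := Num.sqrt (sqmod (z j - z i)).
  have szE : sqmod (z j - z i) = sz ^+ 2 by rewrite sqr_sqrtr // ltW.
  have sz0 : 0 <= sz by exact: sqrtr_ge0.
  have Dsz : D * t <= sz.
    rewrite -ler_sqr ?nnegrE ?mulr_ge0 ?(ltW D0) ?(ltW t_gt0) // -szE; exact: ltW.
  have -> : expR (- (2 * eta)) = expR (- eta) ^+ 2 by rewrite -expRM_natl mulrN.
  rewrite szE -exprMn -(sqr_sqrtr (sqmod_ge0 (y i - y j))) lerXn2r ?nnegrE ?mulr_ge0 ?expR_ge0 ?sqrtr_ge0 //.
  have tri : sz <= 5 * t + Num.sqrt (sqmod (y i - y j)).
    have jm := ltn_trans ji im.
    have h1 := sqrt_sqmodB_triangle (z j) (y j) (z i); have h2 := sqrt_sqmodB_triangle (y j) (y i) (z i).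
    have h3 := dist_y i im; have h4 := dist_y j jm.
    rewrite sqmodBC in h4; rewrite [sqmod (y j - y i)]sqmodBC in h2; rewrite /sz; lra.
  rewrite -D5 mulrBr mulr1; have : 5 * t <= sz * (5 / D); last lra.
  by rewrite mulrCA ler_wpM2l // ler_pdivlMr // mulrC.
exists (fun i : 'I_n => y i); split.
- move=> i u ui; have [y1 _] := yP i (ltn_ord i); have [_ c1] := cP i (ltn_ord i); apply: c1.
  rewrite -[X in X < _](sqr_sqrtr (sqmod_ge0 _)) ltr_sqr ?nnegrE ?sqrtr_ge0 ?(ltW t_gt0) //.
  apply: le_lt_trans (sqrt_sqmodB_triangle _ (y i) _) _; rewrite y1 sqrtr_sqr ger0_norm ?(ltW rho0) //.
  have : Num.sqrt (sqmod (u - y i)) <= t / 4.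
    have t4 : 0 <= t / 4 by rewrite divr_ge0 // ltW.
    by rewrite -(ger0_norm t4) -sqrtr_sqr ler_wsqrtr.
  rewrite rhoE; lra.
- move=> i; have h := sqrt_sqmodB_triangle (y i) (z i) 0; rewrite !subr0 in h.
  rewrite -(sqr_sqrtr (sqmod_ge0 (y i))) lerXn2r ?nnegrE ?sqrtr_ge0 ?addr_ge0 //.
    by rewrite divr_ge0 // mulr_ge0 // ltW.
  have := dist_y i (ltn_ord i).
  have : Num.sqrt (sqmod (z i)) <= M by rewrite -(ger0_norm M0) -sqrtr_sqr ler_wsqrtr //; apply: AM; exact: zA.
  lra.
have prodP i : (i < n)%N -> 2^-1 * \prod_(j < i) expR (- (2 * f j i)) <= \prod_(j < i) sqmod (y i - y j).
  move=> im; have [_ y2] := yP i im.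
  rewrite (bigID (fun j : 'I_i => close j i)) /= [leRHS](bigID (fun j : 'I_i => close j i)) /= mulrA.
  have e_ge0 (j : 'I_i) : 0 <= expR (- (2 * f j i)) by exact: expR_ge0.
  apply: ler_pM.
  - by rewrite mulr_ge0 ?invr_ge0 // prodr_ge0.
  - by rewrite prodr_ge0.
  - apply: le_trans y2; rewrite ler_wpM2l ?invr_ge0 //; apply: ler_prod => j cj.
    by rewrite e_ge0 closeP.
  - by apply: ler_prod => j cj; rewrite e_ge0 farP.
rewrite /Wn vdm2E.
apply: (@le_trans _ _ (\prod_(i < n) (2^-1 * \prod_(j < i) expR (- (2 * f j i))) *
    expR (- (n%:R * \sum_(i < n) sqmod (y i))))); last first.
  rewrite ler_wpM2r ?expR_ge0 //; apply: ler_prod => i _; rewrite prodP // andbT.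
  by rewrite mulr_ge0 ?invr_ge0 // prodr_ge0 // => j _; exact: expR_ge0.
have h2 : 2^-1 = expR (- ln 2) :> R by rewrite expRN lnK // posrE.
have -> : \prod_(i < n) (2^-1 * \prod_(j < i) expR (- (2 * f j i))) =
    expR (\sum_(i < n) (- ln 2 + \sum_(j < i) (- (2 * f j i)))).
  by rewrite expR_sum; apply: eq_bigr => i _; rewrite expRD -h2 expR_sum.
rewrite -expRD ler_expR big_split /= sumr_const card_ord.
have ysum : \sum_(i < n) sqmod (y i) <= \sum_(i < n) sqmod (z i) + n%:R * theta.
  have -> : n%:R * theta = \sum_(i < n) theta by rewrite sumr_const card_ord mulr_natl.
  rewrite -big_split /=; apply: ler_sum => i _; rewrite /theta.
  have t52 : 0 <= 5 * t / 2 by rewrite divr_ge0 // mulr_ge0 // ltW.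
  exact: (sqmod_near M0 t52 (AM _ (zA i (ltn_ord i))) (dist_y2 i (ltn_ord i))).
have zsum : \sum_(i < n) sqmod (z i) <= n%:R * M ^+ 2.
  have -> : n%:R * M ^+ 2 = \sum_(i < n) M ^+ 2 by rewrite sumr_const card_ord mulr_natl.
  by apply: ler_sum => i _; apply: AM; exact: zA.
have fsum : \sum_(i < n) \sum_(j < i) (- (2 * f j i)) =
   - (2 * (1 + lam) * \sum_(i < n) \sum_(j < i) kap j i) + 2 * \sum_(i < n) \sum_(j < i) pot (z j) (z i)
   - eta * (n%:R * (n%:R - 1)).
  have -> : eta * (n%:R * (n%:R - 1)) = \sum_(i < n) \sum_(j < i) 2 * eta.
    have := sum_pairs (fun=> 1) n; rewrite sumr_const card_ord => e.
    transitivity (eta * \sum_(i < n) \sum_(j < i) (1 + 1 : R)); first by rewrite e; ring.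
    by rewrite mulr_sumr; apply: eq_bigr => i _; rewrite mulr_sumr; apply: eq_bigr => j _; ring.
  rewrite !mulr_sumr -sumrN -!big_split -sumrN -big_split /=; apply: eq_bigr => i _.
  rewrite !mulr_sumr -sumrN -!big_split -sumrN -big_split /=; apply: eq_bigr => j _; rewrite /f; ring.
rewrite fsum sum_pot.
have l20 : 0 <= n%:R :> R by [].
have nlin : lin * n%:R <= n%:R ^+ 2 * (eps / 2).
  rewrite expr2 -mulrA [leLHS]mulrC ler_wpM2l //.
  rewrite -ler_pdivrMr ?divr_gt0 //; apply: (le_trans (ltW (truncnS_gt _))).
  by rewrite ler_nat.
have ksum : 2 * (1 + lam) * \sum_(i < n) \sum_(j < i) kap j i <= (1 + lam) * (n%:R ^+ 2 * Jr + 2 * n%:R).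
  have l1 : 0 <= 1 + lam by rewrite addr_ge0 // ltW.
  have := ler_wpM2l l1 zS; lra.
have nys : n%:R * \sum_(i < n) sqmod (y i) <= n%:R * (\sum_(i < n) sqmod (z i) + n%:R * theta).
  by rewrite ler_wpM2l.
have n2 : n%:R ^+ 2 * (lam * Jr) <= n%:R ^+ 2 * (eps / 8) by rewrite ler_wpM2l // exprn_ge0.
have n3 : n%:R ^+ 2 * theta <= n%:R ^+ 2 * (eps / 8) by rewrite ler_wpM2l // exprn_ge0.
have n4 : eta * (n%:R * (n%:R - 1)) <= n%:R ^+ 2 * (eps / 8).
  have : 0 <= eps / 8 * n%:R by rewrite mulr_ge0 // divr_ge0 // ltW.
  rewrite /eta; lra.
move: nlin; rewrite /lin => nlin; rewrite -[- ln 2 *+ n]mulr_natr.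
move: ksum nys n2 n3 n4 nlin zsum.
move: (\sum_(i < n) \sum_(j < i) kap j i) (\sum_(i < n) sqmod (y i)) (\sum_(i < n) sqmod (z i)) => KS YS ZS.
move: n%:R l20 => N N0 ksum nys n2 n3 n4 nlin zsum.
have Ne : 0 <= N ^+ 2 * eps by rewrite mulr_ge0 ?sqr_ge0 // ltW.
lra.
Qed.

End Discretization.

(** * Binary codes of points of a square *)

Section Codes.
Variable R : realType.

Definition bit (u : R) (k : nat) : bool := odd (Num.truncn (2 ^+ k.+1 * u)).

Lemma truncn_half (x : R) : 0 <= x -> ((Num.truncn (2 * x))./2 = Num.truncn x)%N.
Proof.
move=> x0; have x20 : 0 <= 2 * x by rewrite mulr_ge0.
have /andP[h1 h2] := truncn_itv x20; apply/esym/truncn_def.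
set n := Num.truncn (2 * x) in h1 h2 *; have e := odd_double_half n.
have o1 : (odd n <= 1)%N by case: (odd n).
move: h1 h2; rewrite -{1 2}e -addSn !natrD -!muln2 !natrM => h1 h2.
have o1R : (odd n)%:R <= 1 :> R by rewrite -[1]/(1%:R) ler_nat.
have o0R : 0 <= (odd n)%:R :> R by [].
apply/andP; split; first lra.
rewrite -natr1; move: h2; rewrite -natr1; lra.
Qed.

Lemma bits_trunc (u v : R) l : 0 <= u < 1 -> 0 <= v < 1 -> (forall k, (k < l)%N -> bit u k = bit v k) ->
  Num.truncn (2 ^+ l * u) = Num.truncn (2 ^+ l * v).
Proof.
move=> /andP[u0 u1] /andP[v0 v1]; elim: l => [|l IH] H.
  have tu : Num.truncn u = 0%N by apply: truncn_def; rewrite u0 u1.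
  have tv : Num.truncn v = 0%N by apply: truncn_def; rewrite v0 v1.
  by rewrite expr0 !mul1r tu tv.
have p0 (x : R) : 0 <= x -> 0 <= 2 ^+ l * x by move=> x0; rewrite mulr_ge0 // exprn_ge0.
have := IH (fun k kl => H k (ltnW kl)); rewrite -(truncn_half (p0 u u0)) -(truncn_half (p0 v v0)) !mulrA -exprS => e.
by have := H l (ltnSn l); rewrite /bit => b; rewrite -(odd_double_half (Num.truncn (2 ^+ l.+1 * u))) b e odd_double_half.
Qed.

Lemma bits_close (u v : R) l : 0 <= u < 1 -> 0 <= v < 1 -> (forall k, (k < l)%N -> bit u k = bit v k) ->
  `|u - v| <= 2 ^- l.
Proof.
move=> u01 v01 /(bits_trunc u01 v01) e; case/andP: u01 v01 => u0 _ /andP[v0 _].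
have l0 : 0 < 2 ^+ l :> R by rewrite exprn_gt0.
have /andP[u1 u2] := truncn_itv (mulr_ge0 (ltW l0) u0).
have /andP[v1 v2] := truncn_itv (mulr_ge0 (ltW l0) v0).
rewrite e in u1 u2; rewrite -natr1 in u2 v2.
rewrite -(ler_pM2l l0) mulfV ?gt_eqF // -{1}(ger0_norm (ltW l0)) -normrM mulrBr.
by rewrite ler_norml; apply/andP; split; lra.
Qed.

Variable B : R.
Hypothesis B0 : 0 < B.

(** The binary digits of the two normalised coordinates are interleaved, so that a code of even
    length has the same precision in both. *)
Definition code (z : R * R) (k : nat) : bool :=
  if odd k then bit ((z.2 + B) / (2 * B)) k./2 else bit ((z.1 + B) / (2 * B)) k./2.
(** The newest digit comes first: refining a cell is then a [cons]. *)
Fixpoint pre (l : nat) (z : R * R) : seq bool := if l is l'.+1 then code z l' :: pre l' z else [::].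

Lemma size_pre l z : size (pre l z) = l. Proof. by elim: l => //= l ->. Qed.

Lemma pre_code l z w : pre l z = pre l w -> forall k, (k < l)%N -> code z k = code w k.
Proof.
elim: l => // l IH /= [e1 e2] k; rewrite ltnS leq_eqVlt => /orP[/eqP ->|kl] //; exact: IH.
Qed.

Lemma pre_close l z w : `|z.1| < B -> `|z.2| < B -> `|w.1| < B -> `|w.2| < B ->
  pre l.*2 z = pre l.*2 w -> `|z.1 - w.1| <= 2 * B / 2 ^+ l /\ `|z.2 - w.2| <= 2 * B / 2 ^+ l.
Proof.
move=> z1 z2 w1 w2 /pre_code H; have B20 : 0 < 2 * B by rewrite mulr_gt0.
have nrm (x : R) : `|x| < B -> 0 <= (x + B) / (2 * B) < 1.
  rewrite ltr_norml => /andP[x1 x2]; rewrite divr_ge0 ?(ltW B20) //=; last lra.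
  by rewrite ltr_pdivrMr // mul1r; lra.
have cl (x y : R) : `|x| < B -> `|y| < B -> `|(x + B) / (2 * B) - (y + B) / (2 * B)| <= 2 ^- l ->
    `|x - y| <= 2 * B / 2 ^+ l.
  move=> _ _; rewrite -mulrBl (_ : x + B - (y + B) = x - y); last ring.
  by rewrite normrM [`|(_)^-1|]ger0_norm ?invr_ge0 ?(ltW B20) // ler_pdivrMr // mulrC.
split; apply: cl => //; apply: bits_close; rewrite ?nrm // => k kl.
  by have := H k.*2; rewrite /code odd_double doubleK ltn_double => /(_ kl).
by have := H k.*2.+1; rewrite /code /= odd_double /= uphalf_double; apply; rewrite ltn_Sdouble.
Qed.

End Codes.

(** * Limit masses of dyadic cells *)

Section Words.
Variable R : realType.

Lemma filter_all_seq (X : Type) (T : eqType) (F : set_system X) {FF : Filter F} (S : seq T)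
  (Q : T -> X -> Prop) : (forall w, w \in S -> F (Q w)) -> F [set g | forall w, w \in S -> Q w g].
Proof.
elim: S => [|a S IH] H; first by apply: filterS filterT => g _ w; rewrite in_nil.
have h1 : F (Q a) by apply: H; rewrite mem_head.
have h2 : F [set g | forall w, w \in S -> Q w g] by apply: IH => w wS; apply: H; rewrite inE wS orbT.
apply: filterS (filterI h1 h2) => g [g1 g2] w; rewrite inE => /orP[/eqP ->|wS] //; exact: g2.
Qed.

(** Tychonoff's theorem on a product of unit intervals stands in for weak compactness. A cluster
    point suffices, because only finitely many words are compared at a time. *)
Lemma cluster_masses (f : nat -> seq bool -> R) : (forall k w, 0 <= f k w <= 1) ->
  exists m : seq bool -> R, forall (S : seq (seq bool)) (e : R) k0, 0 < e ->
    exists2 k, (k0 <= k)%N & forall w, w \in S -> `|f k w - m w| < e.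
Proof.
move=> f01.
have c01 (w : seq bool) : compact (`[0, 1]%classic : set R) by exact: segment_compact.
have cA := tychonoff c01.
pose F := [set A : set (forall w : seq bool, R) | \forall k \near \oo, A (f k)].
have PF : ProperFilter F by apply: fmap_proper_filter.
have FA : F [set g : forall w : seq bool, R | forall w, (`[0, 1]%classic : set R) (g w)].
  by apply: nearW => k w; rewrite /= in_itv /=.
have [m [_ cm]] := cA F PF FA.
exists m => S e k0 e0.
pose N := [set g : forall w : seq bool, R | forall w, w \in S -> `|g w - m w| < e].
pose m' : prod_topology (fun _ : seq bool => R) := m.
have nN : nbhs m' N.
  apply: (@filter_all_seq _ _ (nbhs m') (nbhs_filter m') S (fun w g => `|g w - m w| < e)) => w _.
  have h := @proj_continuous (seq bool) (fun=> R) w m'.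
  by apply: (h [set x | `|x - m w| < e]); apply/nbhs_ballP; exists e => //= x; rewrite /ball /= distrC.
have FB : F [set f k | k in [set k | (k0 <= k)%N]].
  by exists k0 => // k /= kk; exists k.
have [g [[k kk <-] Ng]] := cm _ _ FB nN.
by exists k.
Qed.

Variable m : seq bool -> R.
Hypothesis m0 : forall w, 0 <= m w.
Hypothesis mnil : m [::] = 1.
Hypothesis madd : forall w, m w = m (false :: w) + m (true :: w).

(* Words are read from the deepest letter to the root; the intervals [wa w, wa w + m w)
   of the words of a given length partition [0, 1) in lexicographic order. *)
Fixpoint wa (w : seq bool) : R := if w is b :: v then wa v + (if b then m (false :: v) else 0) else 0.
Definition wint (w : seq bool) : set R := `[wa w, wa w + m w[%classic.
(** The default 0 keeps every real number inside the unit interval, so each one has a path of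
    words. *)
Definition clip (s : R) : R := if 0 <= s < 1 then s else 0.
Fixpoint wpath (l : nat) (s : R) : seq bool :=
  if l is l'.+1 then let w := wpath l' s in (wa w + m (false :: w) <= clip s) :: w else [::].

Lemma clip01 s : 0 <= clip s < 1.
Proof. by rewrite /clip; case: ifP => // _; rewrite lexx ltr01. Qed.

Lemma size_wpath l s : size (wpath l s) = l. Proof. by elim: l => //= l ->. Qed.

Lemma wint_path l s : wint (wpath l s) (clip s).
Proof.
elim: l => [|l IH]; first by rewrite /wint /= in_itv /= mnil add0r clip01.
move: IH; rewrite /wint /= !in_itv /= => /andP[h1 h2].
case: (leP (wa (wpath l s) + m (false :: wpath l s)) (clip s)) => h; rewrite ?addr0.
  by rewrite h /= -addrA -madd.
by rewrite h1.
Qed.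

Lemma path_wint w s : wint w (clip s) -> wpath (size w) s = w.
Proof.
elim: w => // b w IH; rewrite /wint /= in_itv /= => /andP[h1 h2].
have mt := m0 (true :: w); have mf := m0 (false :: w); have ma := madd w.
have hw : wint w (clip s).
  by rewrite /wint /= in_itv /=; case: b h1 h2 => h1 h2; apply/andP; split; lra.
rewrite (IH hw); congr (_ :: _); case: b h1 h2 => h1 h2; first by apply/idP; lra.
by apply/negbTE; rewrite -ltNge; lra.
Qed.

(** The half-open interval of the word contains a point; this keeps paths away from empty cells. *)
Lemma mpath_gt0 l s : 0 < m (wpath l s).
Proof. by have := wint_path l s; rewrite /wint /= in_itv /= => /andP[h1 h2]; lra. Qed.

Lemma wint01 w : wint w `<=` `[0, 1[%classic.
Proof.
elim: w => [|b w IH]; first by rewrite /wint /= mnil add0r.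
apply: subset_trans IH => s; have mt := m0 (true :: w); have mf := m0 (false :: w); have ma := madd w.
by rewrite /wint /= !in_itv /=; case: b => /andP[h1 h2]; apply/andP; split; lra.
Qed.

Fixpoint words (l : nat) : seq (seq bool) :=
  if l is l'.+1 then map (cons false) (words l') ++ map (cons true) (words l') else [:: [::]].

Lemma mem_words l w : (w \in words l) = (size w == l).
Proof.
elim: l w => [|l IH] [|b w] //=; first by rewrite mem_cat; apply/negbTE; rewrite negb_or; apply/andP; split; apply/mapP => -[].
rewrite mem_cat eqSS -IH; apply/orP/idP => [[/mapP[v vl [_ ->]]|/mapP[v vl [_ ->]]]|wl] //.
by case: b; [right|left]; apply/mapP; exists w.
Qed.

Lemma words_uniq l : uniq (words l).
Proof.
elim: l => //= l IH; rewrite cat_uniq !map_inj_uniq ?IH /=; try by move=> ? ? [].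
by rewrite andbT; apply/hasPn => _ /mapP[v vl ->]; apply/mapP => -[].
Qed.

Lemma wpath_words l s : wpath l s \in words l. Proof. by rewrite mem_words size_wpath. Qed.

Let mD : measurable (`[0 : R, 1[%classic : set (measurableTypeR R)). Proof. exact: measurable_itv. Qed.

Definition unif01 (A : set R) : \bar R := @lebesgue_measure R (A `&` `[0, 1[%classic).
Let unif010 : unif01 set0 = 0%E. Proof. by rewrite /unif01 set0I measure0. Qed.
Let unif01_ge0 A : (0 <= unif01 A)%E. Proof. exact: (measure_ge0 (@lebesgue_measure R)). Qed.
Let unif01_sadd : semi_sigma_additive unif01.
Proof.
by move=> F mF tF mU; exact: (@measure_semi_sigma_additive _ _ _ (mrestr (@lebesgue_measure R) mD) F mF tF mU).
Qed.
HB.instance Definition _ := isMeasure.Build _ _ _ unif01 unif010 unif01_ge0 unif01_sadd.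
Let unif01_setT : unif01 setT = 1%E.
Proof. by rewrite /unif01 setTI lebesgue_measure_itv /= lte_fin ltr01 sube0. Qed.
HB.instance Definition _ := Measure_isProbability.Build _ _ R unif01 unif01_setT.

Lemma unif01_wint w : unif01 (wint w) = (m w)%:E.
Proof.
rewrite /unif01 setIidl; last exact: wint01.
rewrite /wint lebesgue_measure_itv /= lte_fin ltrDl; case: ltP => h.
  by rewrite -EFinB addrAC subrr add0r.
by congr EFin; apply: le_anti; rewrite m0 h.
Qed.

Lemma measurable_wint w : measurable (wint w). Proof. exact: measurable_itv. Qed.

Lemma measurable_wint1 w : measurable_fun setT (fun s => (\1_(wint w) s)%:E : \bar R).
Proof. by apply/measurable_EFinP; apply: measurable_indic; exact: measurable_wint. Qed.

Lemma measurable_clip : measurable_fun setT clip.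
Proof.
apply: measurable_fun_ifT => //.
by apply: measurable_and; [exact: measurable_fun_ler|exact: measurable_fun_ltr].
Qed.

Lemma measurable_wpath (g : seq bool -> R) l :
  measurable_fun setT (fun s => g (wpath l s)).
Proof.
elim: l g => [|l IH] g; first by rewrite /=; exact: measurable_cst.
have E s : g (wpath l.+1 s) = if wa (wpath l s) + m (false :: wpath l s) <= clip s
    then g (true :: wpath l s) else g (false :: wpath l s) by rewrite /=; case: ifP.
under eq_fun do rewrite E.
apply: measurable_fun_ifT; [|exact: (IH (fun w => g (true :: w)))|exact: (IH (fun w => g (false :: w)))].
apply: measurable_fun_ler; last exact: measurable_clip.
by apply: measurable_funD; [exact: IH|exact: (IH (fun w => m (false :: w)))].
Qed.

Lemma clip_id s : `[0, 1[%classic s -> clip s = s.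
Proof. by rewrite /clip /= in_itv /= => ->. Qed.

Lemma int_wpath (g : seq bool -> R) l : (forall w, 0 <= g w) ->
  (\int[unif01]_s (g (wpath l s))%:E = (\sum_(w <- words l) m w * g w)%:E)%E.
Proof.
move=> g0.
transitivity (\int[unif01]_s (\sum_(w <- words l) (g w)%:E * (\1_(wint w) s)%:E))%E.
  have u1 : unif01 (`[0, 1[%classic) = 1%E.
    by rewrite /unif01 setIid lebesgue_measure_itv /= lte_fin ltr01 sube0.
  apply: ae_eq_integral => //.
  - by apply/measurable_EFinP; exact: measurable_wpath.
  - apply: emeasurable_sum => w; apply: emeasurable_funM => //.
    exact: measurable_wint1.
  - exists (~` `[0, 1[%classic); split; first exact: measurableC.
      by rewrite -[LHS]/(unif01 _) /unif01 setICl measure0.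
    move=> s /= h; apply: contra_not h => s01 _.
    rewrite (bigD1_seq (wpath l s)) ?wpath_words ?words_uniq //= big1_seq ?adde0.
      by rewrite indicE mem_set ?mule1 // -{2}(clip_id s01); exact: wint_path.
    move=> w /andP[wp wl]; rewrite indicE memNset ?mule0 // => ws.
    have := @path_wint w s; rewrite (clip_id s01) => /(_ ws) e; move: wl; rewrite mem_words => /eqP sw.
    by move: wp; rewrite -e sw eqxx.
rewrite ge0_integral_sum //; last 2 first.
- by move=> w; apply: emeasurable_funM => //; exact: measurable_wint1.
- by move=> w s _; rewrite mule_ge0 ?lee_fin.
rewrite -sumEFin; apply: eq_bigr => w _.
rewrite ge0_integralZl //; last 2 first.
- exact: measurable_wint1.
- by rewrite lee_fin.
rewrite integral_indic //; last exact: measurable_wint.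
by rewrite setIT -[X in (_ * X)%E]/(unif01 _) unif01_wint -EFinM mulrC.
Qed.

End Words.

(** * A limit of empirical measures *)

Section LimitMeasure.
Variable R : realType.
Local Notation prob := (probability (R * R)%type R).

Lemma seq_close_cvg (u : nat -> R) (b : nat -> R) : b n @[n --> \oo] --> (0 : R) ->
  (forall n k, (n <= k)%N -> `|u k - u n| <= b n) -> cvgn u.
Proof.
move=> b0 ub; apply: cauchy_cvg; apply: cauchy_exP => e e0.
have /cvgr0Pnorm_lt /(_ e e0) [N _ NP] := b0.
exists (u N); exists N => // k /= Nk; rewrite /ball /= distrC.
by apply: le_lt_trans (ub _ _ Nk) _; apply: le_lt_trans (ler_norm _) _; exact: NP (leqnn N).
Qed.

Definition dist1 (z w : R * R) (b : R) := `|z.1 - w.1| <= b /\ `|z.2 - w.2| <= b.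

(** The measure is realised as the law of a map [T] of a uniform variable: a real follows a path of
    cells with the limit masses, and representatives of these cells converge. The conclusion is
    tailored to truncated energies: bounds on discrete double sums pass to the limit. *)
Lemma limit_measure (K : set (R * R)) (n : nat -> nat) (y : forall k, 'I_(n k) -> R * R) :
  compact K -> (forall k, (0 < n k)%N) -> (forall k i, K (y k i)) ->
  exists mu : prob, mu (~` K) = 0%E /\
    forall (phi : R * R -> R * R -> R) (b : R), (forall z w, 0 <= phi z w) ->
    measurable_fun setT (fun p : (R * R) * (R * R) => phi p.1 p.2) ->
    (exists M, forall z w, K z -> K w -> phi z w <= M) ->
    (forall e, 0 < e -> exists2 eta, 0 < eta & forall z w z' w', K z -> K w -> K z' -> K w' ->
       dist1 z z' eta -> dist1 w w' eta -> phi z w <= phi z' w' + e) ->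
    (exists k0, forall k, (k0 <= k)%N -> \sum_i \sum_j phi (y k i) (y k j) <= b * (n k)%:R ^+ 2) ->
    (\int[mu]_z \int[mu]_w (phi z w)%:E <= b%:E)%E.
Proof.
move=> cK n0 yK.
have [M M0 KM] := compact_sqmod cK.
pose B := M + 2; have B0 : 0 < B by rewrite /B; lra.
have KB z : K z -> `|z.1| < B /\ `|z.2| < B.
  move=> Kz; have M1 : 0 <= M + 1 by lra.
  have [] := @norm_le_sqmod R z (M + 1) _ M1; first by have := KM z Kz; nra.
  by move=> *; rewrite /B; split; lra.
pose P l z := pre B l z.
pose eta l : R := 2 * B / 2 ^+ l.
have Pclose l z w : K z -> K w -> P l.*2 z = P l.*2 w -> dist1 z w (eta l).
  by move=> /KB[? ?] /KB[? ?] h; exact: pre_close.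
pose f k w : R := (\sum_(i < n k | P (size w) (y k i) == w) 1) / (n k)%:R.
have nk0 k : 0 < (n k)%:R :> R by rewrite ltr0n.
have f0 k w : 0 <= f k w by rewrite divr_ge0 // sumr_ge0.
have f01 k w : 0 <= f k w <= 1.
  rewrite f0 ler_pdivrMr // mul1r sumr_const -[leRHS]/((n k)%:R) ler_nat.
  by rewrite -[X in (_ <= X)%N]card_ord max_card.
have fnil k : f k [::] = 1.
  by rewrite /f /= (eq_bigl predT) // sumr_const card_ord divff // gt_eqF.
have fadd k w : f k w = f k (false :: w) + f k (true :: w).
  rewrite /f -mulrDl; congr (_ / _); rewrite (bigID (fun i => code B (y k i) (size w))) /= addrC.
  by congr (_ + _); apply: eq_bigl => i; rewrite eqseq_cons andbC; case: code.
have [m mP] := cluster_masses f01.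
have mge0 w : 0 <= m w.
  rewrite leNgt; apply/negP => mw; have [k _ /(_ w (mem_head _ _))] := mP [:: w] (- m w) 0%N ltac:(lra).
  by rewrite ltr_norml => /andP[_]; have := f0 k w; lra.
have mnil : m [::] = 1.
  apply/eqP; rewrite -subr_eq0 -normr_le0; apply/ler_addgt0Pr => e e0; rewrite add0r.
  have [k _ /(_ _ (mem_head _ _))] := mP [:: [::]] e 0%N e0; rewrite fnil distrC => /ltW //.
have madd w : m w = m (false :: w) + m (true :: w).
  apply/eqP; rewrite -subr_eq0 -normr_le0; apply/ler_addgt0Pr => e e0; rewrite add0r.
  have [k _ H] := mP [:: w; false :: w; true :: w] (e / 3) 0%N ltac:(by rewrite divr_gt0).
  have := H w; have := H (false :: w); have := H (true :: w); rewrite !inE !eqxx !orbT.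
  move=> /(_ isT) h1 /(_ isT) h2 /(_ isT) h3; have := fadd k w.
  move: h1 h2 h3; rewrite !ltr_norml ler_norml => /andP[? ?] /andP[? ?] /andP[? ?] ?.
  by apply/andP; split; lra.
have mK w : 0 < m w -> exists2 z, K z & P (size w) z = w.
  move=> mw; have [k _ /(_ w (mem_head _ _))] := mP [:: w] (m w) 0%N mw => h.
  have : f k w != 0 by apply/eqP => fk; move: h; rewrite fk sub0r normrN ger0_norm ?ltxx.
  have [/existsP[i /eqP ik] _|] := boolP [exists i, P (size w) (y k i) == w].
    by exists (y k i).
  by rewrite negb_exists => /forallP H; rewrite /f big_pred0 ?mul0r ?eqxx // => i; apply/negbTE; exact: H.
(* A representative in [K] for every cell that meets [K]; by [mK] these include all cells of
   positive mass, hence all cells on the paths. *)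
have [p pP] : exists p : seq bool -> R * R, forall w, (exists2 z, K z & P (size w) z = w) ->
    K (p w) /\ P (size w) (p w) = w.
  have : forall w, exists q, (exists2 z, K z & P (size w) z = w) -> K q /\ P (size w) q = w.
    move=> w; have [[z Kz zw]|H] := pselect (exists2 z, K z & P (size w) z = w); first by exists z.
    by exists (0, 0).
  by move=> /choice[q qP]; exists q.
pose path := wpath m; pose Tl l (s : R) := p (path l s).
have TlP l s : K (Tl l s) /\ P l (Tl l s) = path l s.
  have := pP _ (mK _ (mpath_gt0 mnil madd l s)); rewrite size_wpath //.
have Tlpre l k s : (l <= k)%N -> P l (Tl k s) = path l s.
  move=> /subnK <-; elim: (k - l)%N => [|j IH]; first by have [] := TlP l s.
  have H i z s' : P i.+1 z = path i.+1 s' -> P i z = path i s' by rewrite /= => -[].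
  have G j' : forall q, P (j' + l)%N q = path (j' + l)%N s -> P l q = path l s.
    by elim: j' => // j' IHj q; rewrite addSn => /H; exact: IHj.
  by apply: (G j.+1); have [] := TlP (j.+1 + l)%N s.
have eta0 : eta l @[l --> \oo] --> (0 : R).
  have h : `|2^-1 : R| < 1 by rewrite ger0_norm // invf_lt1 // ltr1n.
  have h2 : (2 * B) * 2^-1 ^+ l @[l --> \oo] --> (2 * B) * (0 : R).
    by apply: cvgM; [exact: cvg_cst|exact: cvg_expr].
  by rewrite mulr0 in h2; move: h2; under eq_fun do rewrite exprVn.
have Tlclose l k s : (l.*2 <= k)%N -> dist1 (Tl k s) (Tl l.*2 s) (eta l).
  move=> lk; apply: Pclose; try by case: (TlP k s).
    by case: (TlP l.*2 s).
  by rewrite (Tlpre _ _ _ lk) Tlpre.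
have c1 s : cvgn (fun l => (Tl l.*2 s).1).
  by apply: (seq_close_cvg eta0) => l k lk; have [] := @Tlclose l k.*2 s; rewrite // leq_double.
have c2 s : cvgn (fun l => (Tl l.*2 s).2).
  by apply: (seq_close_cvg eta0) => l k lk; have [] := @Tlclose l k.*2 s; rewrite // leq_double.
pose T (s : R) : R * R := (limn (fun l => (Tl l.*2 s).1), limn (fun l => (Tl l.*2 s).2)).
have Tcvg s : Tl l.*2 s @[l --> \oo] --> T s.
  have h := cvg_pair (c1 s) (c2 s).
  have {}h : ((Tl l.*2 s).1, (Tl l.*2 s).2) @[l --> \oo] --> T s by exact: h.
  by apply: cvg_trans h; apply: near_eq_cvg; apply: nearW => l /=; rewrite -surjective_pairing.
have TK s : K (T s).
  have clK : closed K by apply: compact_closed cK; exact: hausdorff_R2.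
  apply: (@closed_cvg nat _ _ _ (fun l => Tl l.*2 s) (fun z => K z) clK _ _ (Tcvg s)).
  by apply: nearW => l; case: (TlP l.*2 s).
have Tclose l s : dist1 (T s) (Tl l.*2 s) (eta l).
  split.
    by apply: (@cvg_le_dist R (fun l => (Tl l.*2 s).1) _ (eta l) l (c1 s)) => j; have [] := @Tlclose l (l + j).*2 s; rewrite // leq_double leq_addr.
  by apply: (@cvg_le_dist R (fun l => (Tl l.*2 s).2) _ (eta l) l (c2 s)) => j; have [] := @Tlclose l (l + j).*2 s; rewrite // leq_double leq_addr.
have mT : measurable_fun setT T.
  apply: measurable_fun_pair.
    apply: (@measurable_fun_cvg _ _ R setT (fun l s => (Tl l.*2 s).1)) => [l|s _]; last exact: c1.
    exact: (measurable_wpath m (fun w => (p w).1)).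
  apply: (@measurable_fun_cvg _ _ R setT (fun l s => (Tl l.*2 s).2)) => [l|s _]; last exact: c2.
  exact: (measurable_wpath m (fun w => (p w).2)).
pose U : probability R R := @unif01 R.
pose Tm : {mfun R >-> (R * R)%type} := HB.pack T (isMeasurableFun.Build _ _ _ _ T mT).
pose mu : prob := distribution U Tm.
have intmu (F : R * R -> \bar R) : measurable_fun setT F -> (forall z, (0 <= F z)%E) ->
    (\int[mu]_z F z = \int[U]_s F (T s))%E.
  move=> mF F0; rewrite -[LHS]/(\int[pushforward U T]_(z in setT) F z)%E.
  by rewrite (ge0_integral_pushforward mT) //= => z _; exact: F0.
exists mu; split.
  have -> : mu (~` K) = U (T @^-1` (~` K)) by [].
  have -> : T @^-1` (~` K) = set0 by rewrite -subset0 => s /=; apply; exact: TK.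
  by rewrite measure0.
move=> phi b phi0 mphi [M1 phiM] phic [k0 phib].
have mphi2 z : measurable_fun setT (fun w => (phi z w)%:E).
  by apply/measurable_EFinP; exact: (measurableT_comp mphi (pair1_measurable z)).
have mI : measurable_fun setT (fun z => \int[mu]_w (phi z w)%:E)%E.
  apply: (@measurable_fun_fubini_tonelli_F _ _ _ _ _ mu (fun q : (R * R) * (R * R) => (phi q.1 q.2)%:E)).
    by apply/measurable_EFinP.
  by move=> q; rewrite lee_fin.
rewrite intmu //; last by move=> z; apply: integral_ge0 => w _; rewrite lee_fin.
have intmu2 s : (\int[mu]_w (phi (T s) w)%:E = \int[U]_t (phi (T s) (T t))%:E)%E.
  by apply: intmu => // z; rewrite lee_fin.
under eq_integral => s _ do rewrite intmu2.
apply/lee_addgt0Pr => e e0.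
have e40 : 0 < e / 4 by rewrite divr_gt0.
have [et et0 phie] := phic _ e40.
have [l etl] : exists l, eta l <= et.
  have /cvgr0Pnorm_lt /(_ et et0) [N _ NP] := eta0.
  by exists N; apply: le_trans (ler_norm _) (ltW _); exact: NP (leqnn N).
have d1W z w : dist1 z w (eta l) -> dist1 z w et by case=> h1 h2; split; exact: le_trans etl.
pose L := l.*2.
(* The kernel frozen at representatives of depth [L]; uniform continuity puts it above [phi], at the
   price of [e / 4]. *)
pose Ph v w := phi (p v) (p w) + e / 4.
have Ph0 v w : 0 <= Ph v w by rewrite addr_ge0 // ltW.
apply: (@le_trans _ _ (\int[U]_s \int[U]_t (Ph (path L s) (path L t))%:E)%E).
  apply: le_integral_nomeas => s _; rewrite integral_ge0 /=; last by move=> t _; rewrite lee_fin.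
  apply: le_integral_nomeas => t _; rewrite lee_fin phi0 /= lee_fin.
  by apply: phie; [exact: TK|exact: TK|by case: (TlP L s)|by case: (TlP L t)|exact/d1W/Tclose|exact/d1W/Tclose].
have iP v : (\int[U]_t (Ph v (path L t))%:E = (\sum_(w <- words L) m w * Ph v w)%:E)%E.
  exact: int_wpath.
under eq_integral => s _ do rewrite iP.
rewrite (int_wpath mge0 mnil madd (g := fun v => \sum_(w <- words L) m w * Ph v w)); last first.
  by move=> v; apply: sumr_ge0 => w _; rewrite mulr_ge0.
rewrite -EFinD lee_fin.
pose M' := `|M1| + e / 4; have M'0 : 0 < M' by rewrite /M' ltr_wpDl.
pose W := (size (words L))%:R : R.
have W0 : 0 <= W by rewrite ler0n.
(* There are [W * W] pairs of words, and each product of masses is off by at most [3 * e'], against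
   a kernel of size at most [M']. *)
have [e' e'0 [e'1 e'e]] : exists2 e', 0 < e' & e' <= 1 /\ W * (W * (3 * e' * M')) <= e / 2.
  have D0 : 0 < W * W * 3 * M' + 1 by apply: ltr_wpDl => //; apply: mulr_ge0; [apply: mulr_ge0; [exact: mulr_ge0|exact: ler0n]|exact: ltW].
  exists (Num.min 1 (e / 2 / (W * W * 3 * M' + 1))).
    by rewrite lt_min ltr01 !divr_gt0.
  split; first by rewrite ge_min lexx.
  set e1 := Num.min _ _.
  have h : e1 * (W * W * 3 * M' + 1) <= e / 2 by rewrite -ler_pdivlMr // ge_min lexx orbT.
  have h0 : 0 <= e1 by rewrite le_min ler01 !divr_ge0 // ltW.
  have -> : W * (W * (3 * e1 * M')) = e1 * (W * W * 3 * M') by ring.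
  by apply: le_trans h; rewrite ler_wpM2l // lerDl ler01.
have [k kk0 km] := mP (words L) e' k0 e'0.
have fsum (g : seq bool -> R) : \sum_(v <- words L) f k v * g v = (\sum_i g (P L (y k i))) / (n k)%:R.
  rewrite mulr_suml [RHS](eq_bigr (fun i => \sum_(v <- words L) (P L (y k i) == v)%:R * g v / (n k)%:R)); last first.
    move=> i _; rewrite (bigD1_seq (P L (y k i))) ?words_uniq ?mem_words ?size_pre //= eqxx mul1r.
    by rewrite big1_seq ?addr0 // => v /andP[vi _]; rewrite eq_sym (negbTE vi) !mul0r.
  rewrite exchange_big /= big_seq [RHS]big_seq; apply: eq_bigr => v; rewrite mem_words => /eqP sv.
  rewrite /f sv mulrAC mulr_suml mulr_suml big_mkcond; apply: eq_bigr => i _.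
  by case: eqP; rewrite ?mul0r.
have pW i : K (p (P L (y k i))) /\ P L (p (P L (y k i))) = P L (y k i).
  have [|h1 h2] := pP (P L (y k i)); first by exists (y k i); rewrite ?size_pre.
  by split=> //; rewrite -{2}h2 size_pre.
have main : \sum_(v <- words L) f k v * \sum_(w <- words L) f k w * Ph v w <= b + e / 2.
  rewrite fsum; under eq_bigr => i _ do rewrite fsum.
  rewrite -mulr_suml -mulrA -invfM -expr2 ler_pdivrMr ?exprn_gt0 //.
  apply: (@le_trans _ _ (\sum_i \sum_j (phi (y k i) (y k j) + e / 2))).
    apply: ler_sum => i _; apply: ler_sum => j _; rewrite /Ph.
    have [Ki Pi] := pW i; have [Kj Pj] := pW j.
    have := phie _ _ _ _ Ki Kj (yK k i) (yK k j) (d1W _ _ (Pclose l _ _ Ki (yK k i) Pi)) (d1W _ _ (Pclose l _ _ Kj (yK k j) Pj)).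
    lra.
  under eq_bigr => i _ do rewrite big_split /= sumr_const card_ord.
  rewrite big_split /= sumr_const card_ord mulrDl lerD //; first exact: phib.
  by rewrite -[_ *+ n k *+ n k]mulr_natr -[_ *+ n k]mulr_natr -mulrA -expr2.
apply: (@le_trans _ _ (\sum_(v <- words L) (f k v * \sum_(w <- words L) f k w * Ph v w + W * (3 * e' * M')))); last first.
  rewrite big_split /= big_const_seq count_predT iter_addr_0 -[_ *+ size _]mulr_natl -/W.
  by lra.
rewrite big_seq [leRHS]big_seq; apply: ler_sum => v vL.
rewrite !mulr_sumr.
have -> : W * (3 * e' * M') = \sum_(w <- words L) (3 * e' * M').
  by rewrite big_const_seq count_predT iter_addr_0 -[_ *+ size _]mulr_natl.
rewrite -big_split /= big_seq [leRHS]big_seq; apply: ler_sum => w wL.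
have := km v vL; have := km w wL; rewrite !ltr_norml => /andP[w1 w2] /andP[v1 v2].
have /andP[fv0 fv1] := f01 k v; have /andP[fw0 fw1] := f01 k w.
have em0 : 0 <= 3 * e' * M' by rewrite !mulr_ge0 // ltW.
have q0 : 0 <= f k v * (f k w * Ph v w) by exact: mulr_ge0 fv0 (mulr_ge0 fw0 (Ph0 v w)).
(* Words of mass 0 may lack a representative in [K], hence a bound on the kernel; their terms vanish
   anyway. *)
have := mge0 v; rewrite le_eqVlt => /orP[/eqP <-|mv0]; first by rewrite mul0r addr_ge0.
have := mge0 w; rewrite le_eqVlt => /orP[/eqP <-|mw0]; first by rewrite mul0r mulr0 addr_ge0.
have [Kv _] := pP v (mK v mv0); have [Kw _] := pP w (mK w mw0).
have PhM : Ph v w <= M'.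
  by rewrite /Ph /M' lerD2r; apply: le_trans (phiM _ _ Kv Kw) (ler_norm _).
have mm : m v * m w <= f k v * f k w + 3 * e'.
  apply: (@le_trans _ _ ((f k v + e') * (f k w + e'))); first by apply: ler_pM; rewrite ?ltW //; lra.
  by nra.
move: (f k v) (f k w) (Ph v w) (Ph0 v w) PhM mm => a c P0 P00 PhM mm.
rewrite !mulrA; apply: (@le_trans _ _ ((a * c + 3 * e') * P0)); first by rewrite ler_wpM2r.
by rewrite mulrDl lerD2l ler_wpM2l // mulr_ge0 // ltW.
Qed.

End LimitMeasure.

(** * Upper bound for the weights of configurations in a compact set *)

Section High.
Variable R : realType.
Local Notation prob := (probability (R * R)%type R).

Lemma mct d (T : measurableType d) (mu : {measure set T -> \bar R}) (g : (T -> \bar R)^nat) (F : T -> \bar R) :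
  (forall n, measurable_fun setT (g n)) -> (forall n x, (0 <= g n x)%E) ->
  (forall x, nondecreasing_seq (g^~ x)) -> (forall x, g n x @[n --> \oo] --> F x) ->
  (\int[mu]_x g n x)%E @[n --> \oo] --> (\int[mu]_x F x)%E.
Proof.
move=> mg g0 ndg gF.
have := @cvg_monotone_convergence _ _ R mu setT measurableT g mg (fun n x _ => g0 n x) (fun x _ => ndg x).
by under [X in _ --> X]eq_integral => x _ do rewrite (cvg_lim _ (gF x)) //.
Qed.

Lemma mct2 (mu nu : prob) (phi : nat -> R * R -> R * R -> R) (F : R * R -> R * R -> \bar R) :
  (forall n z w, 0 <= phi n z w) ->
  (forall n, measurable_fun setT (fun p : (R * R) * (R * R) => phi n p.1 p.2)) ->
  (forall z w, {homo (fun n => phi n z w) : m n / (m <= n)%N >-> m <= n}) ->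
  (forall z w, (phi n z w)%:E @[n --> \oo] --> F z w) ->
  (\int[mu]_z \int[nu]_w (phi m z w)%:E)%E @[m --> \oo] --> (\int[mu]_z \int[nu]_w F z w)%E.
Proof.
move=> phi0 mphi nd cv.
have mk m z : measurable_fun setT (fun w => (phi m z w)%:E).
  by apply/measurable_EFinP; exact: (measurableT_comp (mphi m) (pair1_measurable z)).
apply: mct.
- move=> m; apply: (@measurable_fun_fubini_tonelli_F _ _ _ _ _ nu (fun p => (phi m p.1 p.2)%:E)) => [|p].
    by apply/measurable_EFinP; exact: mphi.
  by rewrite lee_fin.
- by move=> m z; apply: integral_ge0 => w _; rewrite lee_fin.
- by move=> z m n mn; apply: le_integral_nomeas => w _; rewrite !lee_fin phi0 /=; exact: nd.
- move=> z; apply: mct => [m|m w|w m n mn|w]; [exact: mk|by rewrite lee_fin| |exact: cv].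
  by rewrite lee_fin; exact: nd.
Qed.

Lemma iint_ktn_cvg (mu : prob) :
  (\int[mu]_z \int[mu]_w (ktn m z w)%:E)%E @[m --> \oo] --> J mu mu.
Proof.
apply: mct2 => [m z w|m|z w m n mn|z w]; [|exact: measurable_kt| |exact: ktn_cvg].
  by apply: kt_ge0; exact: invn_bd.
by apply: kt_mono; [rewrite invr_gt0|rewrite lef_pV2 ?posrE ?ltr0n // ler_nat].
Qed.

Lemma ln_lip (a b del : R) : 0 < del -> del <= a -> del <= b -> ln a - ln b <= `|a - b| / del.
Proof.
move=> d0 da db; have b0 := lt_le_trans d0 db; have a0 := lt_le_trans d0 da.
rewrite -ln_div ?posrE //; apply: le_trans (ln_le_sub1 _) _; first by rewrite divr_gt0.
have -> : a / b - 1 = (a - b) / b by rewrite mulrBl divff // gt_eqF.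
apply: (@le_trans _ _ (`|a - b| / b)).
  by rewrite ler_wpM2r ?invr_ge0 ?(ltW b0) // ler_norm.
by rewrite ler_wpM2l // lef_pV2 ?posrE.
Qed.

Lemma max_lip (s s' c del : R) : `|s - s'| <= c -> `|Num.max s del - Num.max s' del| <= c.
Proof.
rewrite !ler_norml => /andP[s1 s2].
by case: (leP s del) => h1; case: (leP s' del) => h2; apply/andP; split; lra.
Qed.

Lemma ln_prod_seq (I : Type) (r : seq I) (F : I -> R) : (forall i, 0 < F i) ->
  ln (\prod_(i <- r) F i) = \sum_(i <- r) ln (F i).
Proof.
move=> F0; elim: r => [|i r IH]; first by rewrite !big_nil ln1.
have p0 : 0 < \prod_(i <- r) F i by elim/big_rec: _ => // j x _ x0; rewrite mulr_gt0.
by rewrite !big_cons lnM ?IH // posrE.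
Qed.

Lemma kt_unif (del M e : R) : 0 < del -> 0 <= M -> 0 < e -> exists2 eta, 0 < eta &
  forall z w z' w', sqmod z <= M ^+ 2 -> sqmod w <= M ^+ 2 -> sqmod z' <= M ^+ 2 -> sqmod w' <= M ^+ 2 ->
    dist1 z z' eta -> dist1 w w' eta -> kt del z w <= kt del z' w' + e.
Proof.
move=> d0 M0 e0; pose D := M * (8 / del + 4) + 1.
have D0 : 0 < D by rewrite ltr_wpDl // mulr_ge0 // addr_ge0 // divr_ge0 // ltW.
have [eta eta0 etaD] : exists2 eta, 0 < eta & eta * D = e.
  by exists (e / D); [rewrite divr_gt0|rewrite divfK // gt_eqF].
exists eta => // z w z' w' /norm_le_sqmod /(_ M0) [z1 z2] /norm_le_sqmod /(_ M0) [w1 w2].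
move=> /norm_le_sqmod /(_ M0) [z1' z2'] /norm_le_sqmod /(_ M0) [w1' w2'] [a1 a2] [b1 b2].
have sq (a b c d : R) : `|a| <= d -> `|b| <= d -> `|a - b| <= c -> `|a ^+ 2 - b ^+ 2| <= c * (2 * d).
  move=> ha hb hc; rewrite subr_sqr normrM; apply: ler_pM => //.
  by apply: le_trans (ler_normD _ _) _; lra.
have sub (a b c d : R) : `|a| <= M -> `|b| <= M -> `|c| <= M -> `|d| <= M -> `|a - c| <= eta -> `|b - d| <= eta ->
    `|(a - b) ^+ 2 - (c - d) ^+ 2| <= 8 * eta * M.
  move=> ha hb hc hd h1 h2; have -> : 8 * eta * M = (2 * eta) * (2 * (2 * M)) by ring.
  apply: sq; [by apply: le_trans (ler_normB _ _) _; lra|by apply: le_trans (ler_normB _ _) _; lra|].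
  rewrite (_ : a - b - (c - d) = (a - c) - (b - d)); last ring.
  by apply: le_trans (ler_normB _ _) _; lra.
have := sub _ _ _ _ z1 w1 z1' w1' a1 b1; have := sub _ _ _ _ z2 w2 z2' w2' a2 b2.
have := sq _ _ _ _ z1 z1' a1; have := sq _ _ _ _ z2 z2' a2; have := sq _ _ _ _ w1 w1' b1; have := sq _ _ _ _ w2 w2' b2.
rewrite !ler_norml => /andP[c1 c2] /andP[c3 c4] /andP[c5 c6] /andP[c7 c8] /andP[e1 e2] /andP[e3 e4].
rewrite /kt /pot; set m1 := Num.max _ _; set m2 := Num.max _ _.
have dm1 : del <= m1 by rewrite le_max lexx orbT.
have dm2 : del <= m2 by rewrite le_max lexx orbT.
have := ln_lip d0 dm2 dm1.
have sl : `|sqmod (z' - w') - sqmod (z - w)| <= 16 * eta * M.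
  by rewrite /sqmod /= ler_norml; apply/andP; split; lra.
have : `|m2 - m1| <= 16 * eta * M by exact: max_lip.
move=> h1 h2; have h3 : `|m2 - m1| / del <= 16 * eta * M / del by rewrite ler_wpM2r // invr_ge0 ltW.
have : eta * D = 16 * eta * M / del / 2 + 4 * (M * eta) + eta by rewrite /D; field; rewrite gt_eqF.
rewrite etaD => ->.
have : sqmod z - sqmod z' <= 4 * (M * eta) by rewrite /sqmod; lra.
have : sqmod w - sqmod w' <= 4 * (M * eta) by rewrite /sqmod; lra.
lra.
Qed.

Lemma double_sum_split n (F : nat -> nat -> R) : (forall i j, F i j = F j i) ->
  \sum_(i < n) \sum_(j < n) F i j = \sum_(i < n) F i i + 2 * \sum_(i < n) \sum_(j < i) F j i.
Proof.
move=> Fs; elim: n => [|n IH]; first by rewrite !big_ord0 mulr0 addr0.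
rewrite big_ord_recr /= (eq_bigr (fun i : 'I_n => \sum_(j < n) F i j + F i n)); last by move=> i _; rewrite big_ord_recr.
rewrite big_split /= IH !big_ord_recr /= mulrDr (eq_bigr (fun i : 'I_n => F i n) (fun i _ => Fs n i)); ring.
Qed.

(** Off the diagonal truncation only decreases the kernel, and the pair sum of [pot] reproduces the
    external field of [Wn]. The [n] diagonal terms give [- n * ln del / 2], of lower order at fixed
    [del]. *)
Lemma kt_sum (del : R) n (y : 'I_n -> R * R) : 0 < del <= 1 -> 0 < vdm2 y ->
  \sum_i \sum_j kt del (y i) (y j) <= - ln (Wn y) + n%:R ^+ 2 - n%:R * (ln del / 2).
Proof.
move=> /andP[d0 d1].
pose Y (i : nat) : R * R := if insub i is Some o then y o else 0.
have -> : y = (fun i : 'I_n => Y i) by apply/funext => i; rewrite /Y valK.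
move: Y => {}y v0.
rewrite (double_sum_split n (F := fun i j => kt del (y i) (y j))); last by move=> i j; exact: ktC.
rewrite /Wn lnM ?posrE ?expR_gt0 // expRK.
have d (i : nat) : kt del (y i) (y i) = - (ln del / 2) + sqmod (y i) + 1.
  rewrite /kt subrr max_r ?/pot; first by field.
  by rewrite /sqmod /= expr0n addr0 ltW.
rewrite (eq_bigr (fun i : 'I_n => - (ln del / 2) + (sqmod (y i) + 1))); last by move=> i _; rewrite d -addrA.
have nz : forall i j, (i < n)%N -> (j < i)%N -> 0 < sqmod (y i - y j).
  move=> i j ni ji; rewrite lt_neqAle sqmodB_ge0 andbT eq_sym; apply/eqP => e.
  move: v0; rewrite vdm2E (bigD1 (Ordinal ni)) //= (bigD1 (Ordinal ji)) //= e !mul0r.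
  by rewrite ltxx.
have lnv : ln (vdm2 (fun i : 'I_n => y i)) = \sum_(i < n) \sum_(j < i) ln (sqmod (y i - y j)).
  rewrite vdm2E ln_prod_seq; last by move=> i; apply: prodr_gt0 => j _; exact: nz.
  by apply: eq_bigr => i _; rewrite ln_prod_seq // => j; exact: nz.
have h : 2 * \sum_(i < n) \sum_(j < i) kt del (y j) (y i) <=
    - \sum_(i < n) \sum_(j < i) ln (sqmod (y i - y j)) + 2 * \sum_(i < n) \sum_(j < i) pot (y j) (y i).
  rewrite -sumrN !mulr_sumr -big_split /=; apply: ler_sum => i _.
  rewrite -sumrN !mulr_sumr -big_split /=; apply: ler_sum => j _.
  rewrite /kt sqmodBC; have : ln (sqmod (y i - y j)) <= ln (Num.max (sqmod (y i - y j)) del).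
    by rewrite ler_ln ?posrE ?le_max ?lexx ?lt_max ?nz.
  lra.
rewrite sum_pot in h; rewrite lnv big_split /= sumr_const card_ord big_split /= sumr_const card_ord.
rewrite -[_ *+ n]mulr_natl; move: h; set s1 := \sum_(i < n) _; set s2 := \sum_(i < n) _; set s3 := \sum_(i < n) _.
move=> h; rewrite [1 *+ n]/(n%:R).
have -> : - (s2 - n%:R * s3) + n%:R ^+ 2 - n%:R * (ln del / 2) =
    n%:R * - (ln del / 2) + (s3 + n%:R) + (- s2 + (n%:R - 1) * (s3 + n%:R)) by ring.
by rewrite lerD2l.
Qed.

(** Violating configurations for unboundedly many [n] would have a limit measure on [K] whose
    truncated energies, hence its energy, are at most [Jl - eps / 2]. *)
Lemma high_energy (K : set (R * R)) (Jl : R) : compact K ->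
  (forall mu : prob, mu (~` K) = 0%E -> (Jl%:E <= J mu mu)%E) ->
  forall eps, 0 < eps -> exists n0, forall n, (n0 <= n)%N -> forall y : 'I_n -> R * R, (forall i, K (y i)) ->
    Wn y <= expR (- (n%:R ^+ 2 * (Jl - 1 - eps))).
Proof.
move=> cK HJ eps e0; apply: contrapT => H.
have {}H n0 : exists ny : {n & 'I_n -> R * R}, [/\ (n0 <= projT1 ny)%N, (forall i, K (projT2 ny i)) &
    expR (- ((projT1 ny)%:R ^+ 2 * (Jl - 1 - eps))) < Wn (projT2 ny)].
  apply: contrapT => H1; apply: H; exists n0 => n nn y Ky; rewrite leNgt; apply/negP => Wy.
  by apply: H1; exists (existT _ n y).
have [ny nyP] := choice (fun k => H k.+1).
pose n k := projT1 (ny k); pose y k : 'I_(n k) -> R * R := projT2 (ny k).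
have nk k : (k < n k)%N by have [] := nyP k.
have yK k i : K (y k i) by have [_ + _] := nyP k; apply.
have yW k : expR (- ((n k)%:R ^+ 2 * (Jl - 1 - eps))) < Wn (y k) by have [] := nyP k.
have [mu [muK muP]] := limit_measure (n := n) (y := y) cK (fun k => leq_ltn_trans (leq0n k) (nk k)) yK.
have [M2 M20 KM2] := compact_sqmod cK.
have M10 : 0 <= M2 + 1 by lra.
have KM z : K z -> sqmod z <= (M2 + 1) ^+ 2 by move=> /KM2; nra.
suff : (J mu mu <= (Jl - eps / 2)%:E)%E.
  by move=> /(le_trans (HJ mu muK)); rewrite lee_fin; lra.
have ic := @iint_ktn_cvg mu.
rewrite -(cvg_lim _ ic) //; apply: lime_le; first by apply/cvg_ex; exists (J mu mu).
apply: nearW => m; have /andP[d0 d1] := invn_bd R m; apply: muP.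
- by move=> z w; apply: kt_ge0; exact: invn_bd.
- exact: measurable_kt.
- exists (- (ln m.+1%:R^-1 / 2) + (M2 + 1)).
  move=> z w Kz Kw; rewrite /ktn /kt /pot; apply: lerD; last by have := KM2 z Kz; have := KM2 w Kw; lra.
  rewrite lerN2 ler_pM2r ?invr_gt0 // ler_ln ?posrE ?lt_max ?d0 ?orbT //.
  by rewrite le_max lexx orbT.
- move=> e e00; have [eta eta0 etaP] := kt_unif d0 M10 e00; exists eta => // z w z' w' Kz Kw Kz' Kw'.
  by apply: etaP; exact: KM.
(* For [k] large the diagonal terms [n * c] use up half of the margin [eps]. *)
- pose c := - (ln (m.+1%:R^-1 : R) / 2).
  exists (Num.truncn (2 * `|c| / eps)).+1 => k kk.
  have nkR : 2 * `|c| / eps <= (n k)%:R.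
    apply: le_trans (ltW (truncnS_gt _)) _; rewrite ler_nat; apply: leq_trans kk (ltnW (nk k)).
  have v0 : 0 < vdm2 (y k).
    have := lt_trans (expR_gt0 _) (yW k); rewrite /Wn => h.
    by move: h; rewrite pmulr_lgt0 // expR_gt0.
  apply: le_trans (kt_sum (invn_bd R m) v0) _; rewrite -[n k in X in _ - X * _]/(n k).
  have W0 : 0 < Wn (y k) by exact: lt_trans (expR_gt0 _) (yW k).
  have := yW k; rewrite -ltr_ln ?posrE ?expR_gt0 // expRK => lW.
  have : (n k)%:R * c <= (n k)%:R * ((n k)%:R * (eps / 2)).
    rewrite ler_wpM2l //; apply: le_trans (ler_norm c) _.
    by move: nkR; rewrite ler_pdivrMr //; lra.
  rewrite /c => h; nra.
Qed.

End High.

(** * Asymptotics of the void probabilities *)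

Section Asymptotics.
Variable R : realType.

(** The bound 9 on the squared moduli is the radius [3 * r] of [gapdet_upper] after scaling. *)
Definition upper_energy (V : set (R * R)) (rho : R) := forall e : R, 0 < e -> exists n0, forall n, (n0 <= n)%N ->
  forall y : 'I_n -> R * R, (forall i, ~ V (y i)) -> (forall i, sqmod (y i) <= 9) ->
    Wn y <= expR (- (n%:R ^+ 2 * (rho - e))).

Definition lower_energy (V : set (R * R)) (rho : R) := forall e : R, 0 < e -> exists t M n0, [/\ 0 < t, 0 <= M &
  forall n, (n0 <= n)%N -> exists y : 'I_n -> R * R,
    [/\ (forall i u, sqmod (u - y i) <= t ^+ 2 -> ~ V u), (forall i, sqmod (y i) <= M ^+ 2) &
    expR (- (n%:R ^+ 2 * (rho + e))) <= Wn y]].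

Lemma poly_le_exp (c e : R) k : 0 < e -> exists n0, forall n, (n0 <= n)%N -> c * n%:R ^+ k <= expR (e * n%:R).
Proof.
move=> e0; pose q := e / k.+1%:R; have q0 : 0 < q by rewrite divr_gt0.
have qk0 : 0 < q ^+ k.+1 by rewrite exprn_gt0.
exists (Num.truncn (`|c| / q ^+ k.+1)).+1 => n nn.
have nR : `|c| / q ^+ k.+1 <= n%:R by apply: le_trans (ltW (truncnS_gt _)) _; rewrite ler_nat.
have -> : e * n%:R = k.+1%:R * (q * n%:R) by rewrite /q mulrA [_ * (e / _)]mulrC divfK ?pnatr_eq0.
rewrite expRM_natl; apply: (@le_trans _ _ ((q * n%:R) ^+ k.+1)).
  rewrite exprMn [n%:R ^+ k.+1]exprS mulrA ler_wpM2r ?exprn_ge0 //.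
  by apply: le_trans (ler_norm c) _; rewrite mulrC -ler_pdivrMr.
have qn0 : 0 <= q * n%:R by rewrite mulr_ge0 // ltW.
apply: lerXn2r; rewrite ?nnegrE ?expR_ge0 //.
by apply: le_trans (expR_ge1Dx _); rewrite lerDr.
Qed.

Lemma poly_pow_le (c e : R) k : 0 <= c -> 0 < e ->
  exists n0, forall n, (n0 <= n)%N -> (c * n%:R ^+ k) ^+ n <= expR (n%:R ^+ 2 * e).
Proof.
move=> c0 e0; have [n0 n0P] := poly_le_exp c k e0; exists n0 => n /n0P h.
have -> : n%:R ^+ 2 * e = n%:R * (e * n%:R) by ring.
by rewrite expRM_natl; apply: lerXn2r; rewrite ?nnegrE ?expR_ge0 ?mulr_ge0 ?exprn_ge0.
Qed.

Lemma poly_pow_ge (c e : R) k : 0 < c -> 0 < e ->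
  exists n0, forall n, (n0 <= n)%N -> (0 < n)%N -> expR (- (n%:R ^+ 2 * e)) <= (c / n%:R ^+ k) ^+ n.
Proof.
move=> c0 e0; have ci : 0 <= c^-1 by rewrite invr_ge0 ltW.
have [n0 n0P] := poly_pow_le k ci e0; exists n0 => n /n0P h nn.
have nk0 : 0 < n%:R ^+ k :> R by rewrite exprn_gt0 ?ltr0n.
rewrite expRN -[c / _]invrK invf_div exprVn lef_pV2 ?posrE ?exprn_gt0 ?expR_gt0 ?invr_gt0 ?divr_gt0 //.
by rewrite mulrC.
Qed.

Definition sc (r : R) (z : R * R) : R * R := (r * z.1, r * z.2).

Lemma sqmod_sc r z : sqmod (sc r z) = r ^+ 2 * sqmod z.
Proof. by rewrite /sqmod /sc /=; ring. Qed.

Lemma vdm2_sc r n (y : 'I_n -> R * R) : vdm2 (fun i => sc r (y i)) = r ^+ (n * n.-1) * vdm2 y.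
Proof.
pose Y (i : nat) : R * R := if insub i is Some o then y o else 0.
have -> : y = (fun i : 'I_n => Y i) by apply/funext => i; rewrite /Y valK.
rewrite (vdm2E n (fun i => sc r (Y i))) vdm2E.
have E (i : nat) : \prod_(j < i) sqmod (sc r (Y i) - sc r (Y j)) = r ^+ (2 * i) * \prod_(j < i) sqmod (Y i - Y j).
  rewrite exprM -[X in _ = _ ^+ X * _]card_ord -prodr_const -big_split /=; apply: eq_bigr => j _.
  by rewrite -sqmod_sc; congr sqmod; rewrite /sc; apply/pair_equal_spec; split; rewrite /= mulrBr.
under eq_bigr do rewrite E.
rewrite big_split /=; congr (_ * _); elim: n {y Y E} => [|n IH]; first by rewrite big_ord0.
rewrite big_ord_recr /= IH -exprD; congr (_ ^+ _); case: n {IH} => //= n; lia.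
Qed.

Lemma nsq_det_sc r n (y : 'I_n -> R * R) :
  nsq (\det (Vm (fun i => sc r (y i)))) = r ^+ (n * n.-1) / Zn R n * (vdm2 y * expR (- (r ^+ 2 * \sum_i sqmod (y i)))).
Proof.
rewrite nsq_det_Vm vdm2_sc mulr_sumr; under eq_bigr do rewrite sqmod_sc.
by rewrite mulrAC -!mulrA; congr (_ * _); rewrite mulrCA.
Qed.

Lemma scale_setE r (V : set (R * R)) : 0 < r -> scale_set r V = sc r^-1 @^-1` V.
Proof.
move=> r0; apply/seteqP; split=> [z [w Vw <-]|[a b] Vz].
  by rewrite /= /sc /= !mulrA mulVf ?gt_eqF // !mul1r -surjective_pairing.
by exists (sc r^-1 (a, b)); rewrite // /sc /= !mulrA divff ?gt_eqF // !mul1r.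
Qed.

Lemma sc_scK r z : r != 0 -> sc r^-1 (sc r z) = z.
Proof. by move=> r0; rewrite /sc /= !mulrA mulVf // !mul1r -surjective_pairing. Qed.

Lemma sc_scVK r z : r != 0 -> sc r (sc r^-1 z) = z.
Proof. by move=> r0; rewrite /sc /= !mulrA divff // !mul1r -surjective_pairing. Qed.

Lemma scB r z w : sc r (z - w) = sc r z - sc r w.
Proof. by rewrite /sc; apply/pair_equal_spec; split; rewrite /= mulrBr. Qed.

Lemma measurable_scale_set r (V : set (R * R)) : 0 < r -> measurable V -> measurable (scale_set r V).
Proof.
move=> r0 mV; rewrite scale_setE // -[_ @^-1` _]setTI.
have : measurable_fun setT (sc r^-1) by apply: measurable_fun_pair; exact: measurable_funM.
exact.
Qed.

Lemma vdm2_ge0 n (y : 'I_n -> R * R) : 0 <= vdm2 y.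
Proof. by apply: prodr_ge0 => i _; apply: prodr_ge0 => j _; exact: sqmod_ge0. Qed.

Lemma sum_sqmod_ge0 n (y : 'I_n -> R * R) : 0 <= \sum_i sqmod (y i).
Proof. by apply: sumr_ge0 => i _; exact: sqmod_ge0. Qed.

Lemma gapdet_scale_le (V : set (R * R)) (rho e : R) : measurable V -> V `<=` [set z | sqmod z < 1] ->
  upper_energy V rho -> 0 < e -> exists n0, forall n, (n0 <= n)%N -> (0 < n)%N -> forall r, 0 < r ->
    n%:R <= r ^+ 2 -> r ^+ 2 <= n%:R + 1 ->
    gapdet n (scale_set r V) <= r ^+ (n * n.-1) / Zn R n * expR (- (n%:R ^+ 2 * (rho - e))).
Proof.
move=> mV V1 UV e0; have e20 : 0 < e / 2 by rewrite divr_gt0.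
have [n1 n1P] := UV _ e20.
(* The base in [gapdet_upper] is at most [40 * pi * n ^+ 2], since [r ^+ 2 <= 2 * n ^+ 2]. *)
have c0 : 0 <= 40 * pi :> R by rewrite mulr_ge0 // pi_ge0.
have [n2 n2P] := poly_pow_le 2 c0 e20.
exists (n1 + n2)%N => n nn n0 r r0 nr rn.
have rV : scale_set r V `<=` [set z | sqmod z < r ^+ 2].
  move=> _ [z Vz <-] /=; have := V1 z Vz; rewrite -[X in X < _ -> _]/(sqmod z) -/(sc r z) sqmod_sc /= => z1.
  by rewrite gtr_pMr // exprn_gt0.
have [z [zV zr]] := gapdet_upper (measurable_scale_set r0 mV) rV r0 nr.
have [y yE] : exists y, z = fun i : 'I_n => sc r (y i).
  by exists (fun i => sc r^-1 (z i)); apply/funext => i; rewrite sc_scVK // gt_eqF.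
move: zV zr; rewrite {z}yE => zV zr.
have yV i : ~ V (y i) by move=> Vy; apply: (zV i); exists (y i).
have y9 i : sqmod (y i) <= 9.
  by have := zr i; rewrite sqmod_sc [leRHS]mulrC ler_pM2l // exprn_gt0.
move=> h; apply: le_trans h _; rewrite nsq_det_sc.
have q0 : 0 <= r ^+ (n * n.-1) / Zn R n by rewrite divr_ge0 ?(ltW (Zn_gt0 R n)) // exprn_ge0 // ltW.
rewrite -mulrA ler_wpM2l //.
have -> : - (n%:R ^+ 2 * (rho - e)) = - (n%:R ^+ 2 * (rho - e / 2)) + n%:R ^+ 2 * (e / 2) by field.
rewrite expRD; apply: ler_pM.
- by rewrite mulr_ge0 ?vdm2_ge0 ?expR_ge0.
- by rewrite exprn_ge0 // mulr_ge0 // addr_ge0 // !mulr_ge0 ?exprn_ge0 ?pi_ge0 // ltW.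
- apply: le_trans (n1P n (leq_trans (leq_addr _ _) nn) y yV y9).
  by rewrite /Wn ler_wpM2l ?vdm2_ge0 // ler_expR lerN2 ler_wpM2r ?sum_sqmod_ge0.
- apply: le_trans (n2P n (leq_trans (leq_addl _ _) nn)).
  have n1R : 1 <= n%:R :> R by rewrite ler1n.
  have p0 := pi_gt0 R; apply: lerXn2r.
  + by rewrite nnegrE mulr_ge0 // addr_ge0 // !mulr_ge0 ?exprn_ge0 ?pi_ge0 // ltW.
  + by rewrite nnegrE mulr_ge0 ?exprn_ge0.
  + have : r ^+ 2 <= 2 * n%:R ^+ 2 by nra.
    move: (r ^+ 2) (n%:R ^+ 2) => a b ab; nra.
Qed.

Lemma gapdet_scale_ge (V : set (R * R)) (rho e : R) : measurable V -> lower_energy V rho -> 0 < e ->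
  exists n0, forall n, (n0 <= n)%N -> (0 < n)%N -> forall r, 1 <= r -> r ^+ 2 <= n%:R + 1 ->
    r ^+ (n * n.-1) / Zn R n * expR (- (n%:R ^+ 2 * (rho + e))) <= gapdet n (scale_set r V).
Proof.
move=> mV LV e0; have e30 : 0 < e / 3 by rewrite divr_gt0.
have [t [M [n1 [t0 M0 n1P]]]] := LV _ e30.
(* The final [/ 2] compensates [r ^+ 2 <= n + 1 <= 2 * n]. *)
pose c := pi * t ^+ 2 * expR (- (2 * M * t + t ^+ 2)) / 2.
have c0 : 0 < c by rewrite divr_gt0 // !mulr_gt0 ?pi_gt0 ?exprn_gt0 ?expR_gt0.
have [n2 n2P] := poly_pow_ge 2 c0 e30.
have cM : 0 < expR (- M ^+ 2) by exact: expR_gt0.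
have [n3 n3P] := poly_pow_ge 0 cM e30.
exists (n1 + n2 + n3)%N => n nn n0 r r1 rn; have r0 : 0 < r by exact: lt_le_trans r1.
have nn1 : (n1 <= n)%N by lia.
have nn2 : (n2 <= n)%N by lia.
have nn3 : (n3 <= n)%N by lia.
have [y [yV yM yW]] := n1P n nn1.
have q0 : 0 <= r ^+ (n * n.-1) / Zn R n by rewrite divr_ge0 ?(ltW (Zn_gt0 R n)) // exprn_ge0 // ltW.
have n1R : 1 <= n%:R :> R by rewrite ler1n.
have r21 : 1 <= r ^+ 2 by rewrite expr_ge1 // ltW.
(* After dilation disks of radius [r * t] are free, but radius [t / r] is used: the exponent
   [2 * (r * M) * (t / r)] then stays equal to [2 * M * t]. *)
have := @gapdet_lower R n (scale_set r V) (fun i => sc r (y i)) (r * M) (t / r) (measurable_scale_set r0 mV) n0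
  (mulr_ge0 (ltW r0) M0) (divr_gt0 t0 r0).
have h1 : forall i z, sqmod (z - sc r (y i)) <= (t / r) ^+ 2 -> ~ scale_set r V z.
  move=> i z hz; rewrite scale_setE //= => Vz; apply: (yV i _ _ Vz).
  rewrite -[y i](@sc_scK r) ?gt_eqF // -scB sqmod_sc exprVn.
  move: hz; rewrite expr_div_n => hz; rewrite mulrC; apply: le_trans (_ : t ^+ 2 / r ^+ 2 / r ^+ 2 <= _).
    by rewrite ler_wpM2r ?invr_ge0 ?exprn_ge0 // ltW.
  rewrite -mulrA ler_piMr ?exprn_ge0 ?(ltW t0) //.
  by rewrite mulr_ile1 ?invr_ge0 ?(le_trans _ r21) ?invf_le1 ?(lt_le_trans _ r21).
have h2 : forall i, sqmod (sc r (y i)) <= (r * M) ^+ 2.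
  by move=> i; rewrite sqmod_sc exprMn ler_wpM2l ?exprn_ge0 // ltW.
move=> /(_ h1 h2); apply: le_trans.
rewrite nsq_det_sc mulrCA ler_wpM2l //.
have -> : - (n%:R ^+ 2 * (rho + e)) = - (n%:R ^+ 2 * (e / 3)) + (- (n%:R ^+ 2 * (e / 3)) - n%:R ^+ 2 * (rho + e / 3)) by field.
rewrite !expRD; apply: ler_pM; rewrite ?expR_ge0 ?mulr_ge0 ?expR_ge0 //.
- apply: le_trans (n2P n nn2 n0) _.
  have b0 : 0 <= pi * (t / r) ^+ 2 * expR (- (2 * (r * M) * (t / r) + (t / r) ^+ 2)) / n%:R.
    by rewrite divr_ge0 // mulr_ge0 ?expR_ge0 // mulr_ge0 ?pi_ge0 // exprn_ge0 // divr_ge0 // ltW.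
  have cn0 : 0 <= c / n%:R ^+ 2 by rewrite divr_ge0 ?exprn_ge0 // ltW.
  apply: lerXn2r => //.
  have -> : 2 * (r * M) * (t / r) = 2 * M * t by field; rewrite gt_eqF.
  have tr : (t / r) ^+ 2 <= t ^+ 2.
    by rewrite expr_div_n ler_pdivrMr ?exprn_gt0 // ler_peMr // exprn_ge0 // ltW.
  apply: (@le_trans _ _ (pi * (t / r) ^+ 2 * expR (- (2 * M * t + t ^+ 2)) / n%:R)); last first.
    have b1 : 0 <= pi * (t / r) ^+ 2 by rewrite mulr_ge0 ?pi_ge0 // exprn_ge0 // divr_ge0 // ltW.
    by rewrite ler_wpM2r ?invr_ge0 // ler_wpM2l // ler_expR lerN2 lerD2l.
  have -> : pi * (t / r) ^+ 2 * expR (- (2 * M * t + t ^+ 2)) / n%:R = 2 * c / r ^+ 2 / n%:R.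
    by rewrite /c; field; rewrite !gt_eqF ?(lt_le_trans _ n1R).
  rewrite [n%:R ^+ 2]expr2 invfM mulrA ler_wpM2r ?invr_ge0 //.
  have r20 : 0 < r ^+ 2 by rewrite exprn_gt0.
  have nR0 : 0 < n%:R :> R by rewrite ltr0n.
  rewrite ler_pdivrMr // mulrAC ler_pdivlMr //; nra.
(* The determinant carries the weight with exponent [r ^+ 2 <= n + 1] instead of [n]; the extra unit
   costs at most [expR (- M ^+ 2)] per point. *)
- rewrite mulrC; apply: (@le_trans _ _ (Wn y * expR (- \sum_i sqmod (y i)))).
    apply: ler_pM; rewrite ?expR_ge0 //.
    apply: le_trans (n3P n nn3 n0) _; rewrite expr0 divr1 -expRM_natl ler_expR -mulr_natl mulrN lerN2.
    apply: le_trans (_ : \sum_(i < n) M ^+ 2 <= _); first by apply: ler_sum => i _; exact: yM.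
    by rewrite sumr_const card_ord mulr1 mulr_natl.
  rewrite /Wn -mulrA -expRD ler_wpM2l ?vdm2_ge0 // ler_expR.
  by have := ler_wpM2r (sum_sqmod_ge0 y) rn; rewrite mulrDl mul1r; lra.
Qed.

(** Replaces [n ^+ 2] by [r ^+ 4] for [m = n] and [x = r ^+ 2]: the squares differ by at most
    [3 * m], and one margin [q] absorbs this once [m] is large. *)
Lemma up_arith (x m q a b : R) : m <= x -> x < m + 1 -> 3 * a <= m * q -> 1 <= m -> - a <= b -> 0 <= a -> 0 < q ->
  m ^+ 2 * (b + 2 * q) <= x ^+ 2 * (b + 3 * q).
Proof.
move=> mx xm mq m1 ab a0 q0.
have h0 : (x ^+ 2 - m ^+ 2) <= 3 * m by nra.
have h1 : (x ^+ 2 - m ^+ 2) * a <= m ^+ 2 * q.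
  apply: (@le_trans _ _ (3 * m * a)); first by apply: ler_wpM2r.
  have -> : 3 * m * a = m * (3 * a) by ring.
  have -> : m ^+ 2 * q = m * (m * q) by ring.
  by rewrite ler_wpM2l //; lra.
have h2 : 0 <= x ^+ 2 - m ^+ 2 by nra.
have h3 : m ^+ 2 * q <= x ^+ 2 * q by rewrite ler_wpM2r ?(ltW q0) //; lra.
have h4 : 0 <= (x ^+ 2 - m ^+ 2) * (b + a) by rewrite mulr_ge0 //; lra.
lra.
Qed.

Lemma low_arith (x m q e a b : R) : x <= m -> m <= (1 + 8 * q) * x -> - b <= a -> 0 <= a ->
  0 <= x * (q * e) -> 0 <= x -> 0 < q -> q <= 1 ->
  x * (b - q * (8 * a + 36 + e)) + m * q <= m * (b - 3 * q).
Proof.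
move=> xm mx ba a0 er x0 q0 q1.
have h1 : 0 <= (m - x) * (a + b) by rewrite mulr_ge0 //; lra.
have h2 : (m - x) * a <= 8 * q * x * a by rewrite ler_wpM2r //; lra.
have h0 : q * x <= x by rewrite ler_piMl.
have h3 : m * q <= 9 * x * q by rewrite ler_wpM2r ?(ltW q0) //; lra.
lra.
Qed.

Lemma ex_truncn_ge (x : R) : exists n0, forall n, (n0 <= n)%N -> x <= n%:R.
Proof.
by exists (Num.truncn `|x|).+1 => n nn; apply: le_trans (ler_norm x) (le_trans (ltW (truncnS_gt _)) _); rewrite ler_nat.
Qed.

(** The gap determinant of the empty set is 1, so its sampling bound becomes an estimate of the
    normalising factor itself. [upper_scale] gives the opposite one. *)
Lemma lower_scale (rho0 e : R) : lower_energy set0 rho0 -> 0 < e ->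
  exists n0, forall n, (n0 <= n)%N -> (0 < n)%N -> forall r, 1 <= r -> r ^+ 2 <= n%:R + 1 ->
    r ^+ (n * n.-1) / Zn R n <= expR (n%:R ^+ 2 * (rho0 + e)).
Proof.
move=> L0 e0; have [n0 n0P] := gapdet_scale_ge measurable0 L0 e0.
exists n0 => n nn np r r1 rn; have := n0P n nn np r r1 rn.
have -> : scale_set r set0 = set0 :> set (R * R) by rewrite -subset0 => z [].
by rewrite gapdet_set0 expRN -ler_pdivlMr ?invr_gt0 ?expR_gt0 // div1r invrK.
Qed.

Lemma upper_scale (rho0 e : R) : upper_energy set0 rho0 -> 0 < e ->
  exists n0, forall n, (n0 <= n)%N -> (0 < n)%N ->
    expR (n%:R ^+ 2 * (rho0 - e)) <= Num.sqrt n%:R ^+ (n * n.-1) / Zn R n.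
Proof.
move=> L0 e0; have [n0 n0P] := gapdet_scale_le measurable0 (@sub0set _ _) L0 e0.
exists n0 => n nn np; have := n0P n nn np (Num.sqrt n%:R).
have -> : scale_set (Num.sqrt n%:R) set0 = set0 :> set (R * R) by rewrite -subset0 => z [].
rewrite gapdet_set0 sqrtr_gt0 ltr0n sqr_sqrtr // => /(_ np (lexx _)).
by rewrite expRN -ler_pdivrMr ?invr_gt0 ?expR_gt0 // div1r invrK lerDl; apply.
Qed.

(** * The limit of the void probabilities *)

Section Limit.
Context (d : measure_display) (Omega : measurableType d) (P : probability Omega R) (S : Omega -> set (R * R)).
Hypothesis gin : is_infinite_ginibre P S.
Variables (V : set (R * R)) (rho rho0 : R).
Hypotheses (mV : measurable V) (V1 : V `<=` [set z | sqmod z < 1]).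
Local Notation hole r := (fine (P [set w | npts (S w) (scale_set r V) = 0%E])).

Let rV r : 0 < r -> scale_set r V `<=` [set z | sqmod z < r ^+ 2].
Proof.
move=> r0 _ [z Vz <-] /=; have := V1 Vz; rewrite -/(sc r z) sqmod_sc /= => z1.
by rewrite gtr_pMr // exprn_gt0.
Qed.

Let rVB r : 0 < r -> exists B : nat, forall z, scale_set r V z -> sqmod z <= B%:R ^+ 2.
Proof.
move=> r0; have [B BP] := ex_truncn_ge r; exists B => z /(rV r0) /= /ltW /le_trans; apply.
by apply: lerXn2r; rewrite ?nnegrE ?(ltW r0) // BP.
Qed.

Lemma hole_upper (e : R) : upper_energy V rho -> lower_energy set0 rho0 -> 0 < e ->
  exists r0, forall r, r0 <= r -> hole r <= expR (r ^+ 4 * (rho0 - rho + e)).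
Proof.
move=> UV L0 e0; have e30 : 0 < e / 3 by rewrite divr_gt0.
have [n1 n1P] := gapdet_scale_le mV V1 UV e30.
have [n2 n2P] := lower_scale L0 e30.
pose c := rho0 - rho.
have [n3 n3P] := ex_truncn_ge (3 * `|c| / (e / 3)).
exists (n1 + n2 + n3 + 1)%:R => r rn.
have r1 : 1 <= r by apply: le_trans rn; rewrite ler1n addn1.
have r0 : 0 < r by exact: lt_le_trans r1.
have r20 : 0 <= r ^+ 2 by rewrite exprn_ge0 // ltW.
(* The largest number of points allowed by [gapdet_upper], which asks for [n <= r ^+ 2]. *)
pose n := Num.truncn (r ^+ 2); have /andP[nr rn1] := truncn_itv r20.
have nn : (n1 + n2 + n3 + 1 <= n)%N.
  by rewrite /n truncn_ge_nat //; apply: le_trans rn _; rewrite expr2 ler_peMl // ltW.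
rewrite -/n in nr rn1; rewrite -natr1 in rn1.
have np : (0 < n)%N by lia.
have [B BP] := rVB r0.
have h1 := void_le gin (measurable_scale_set r0 mV) BP n (rV r0).
have nn1 : (n1 <= n)%N by clear -nn; lia.
have nn2 : (n2 <= n)%N by clear -nn; lia.
have nn3 : (n3 <= n)%N by clear -nn; lia.
have h2 := n1P n nn1 np r r0 nr (ltW rn1).
have h3 := n2P n nn2 np r r1 (ltW rn1).
apply: le_trans h1 (le_trans h2 _); apply: le_trans (ler_wpM2r (expR_ge0 _) h3) _.
rewrite -expRD ler_expR.
have n3R := n3P n nn3; rewrite ler_pdivrMr // in n3R.
have n1R : 1 <= n%:R :> R by rewrite ler1n.
have -> : r ^+ 4 = r ^+ 2 ^+ 2 by rewrite -exprM.
have cn : - `|c| <= c by rewrite lerNl -normrN ler_norm.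
have cn' := normr_ge0 c.
have -> : rho0 - rho + e = c + e by [].
have -> : n%:R ^+ 2 * (rho0 + e / 3) + - (n%:R ^+ 2 * (rho - e / 3)) = n%:R ^+ 2 * (c + 2 * (e / 3)) by rewrite /c; field.
have -> : c + e = c + 3 * (e / 3) by field.
exact: (@up_arith _ _ _ (`|c|)).
Qed.

Lemma hole_lower (e : R) : lower_energy V rho -> upper_energy set0 rho0 -> 0 < e ->
  exists r0, forall r, r0 <= r -> expR (r ^+ 4 * (rho0 - rho - e)) <= hole r.
Proof.
move=> LV U0 e0; pose c := rho0 - rho.
(* The total loss of [low_arith] per unit of [q]. *)
pose D : R := 8 * `|c| + 36 + e.
have D0 : 0 < D by rewrite /D addr_gt0 // ltr_wpDl // mulr_ge0.
have [q q0 qD] : exists2 q, 0 < q & q * D = e by exists (e / D); rewrite ?divr_gt0 // divfK // gt_eqF.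
have q1 : q <= 1.
  have : 0 <= q * (8 * `|c| + 36) by rewrite mulr_ge0 ?(ltW q0) // addr_ge0 // mulr_ge0.
  move: qD; rewrite /D mulrDr => qD h; rewrite -(ler_pM2r e0) mul1r; lra.
have [n1 n1P] := gapdet_scale_ge mV LV q0.
have [n2 n2P] := upper_scale U0 q0.
have [n3 n3P] := ex_truncn_ge (2 / q).
have [b0 b0P] := dk_prod_ge q0.
have [n4 n4P] := ex_truncn_ge (`|b0|).
exists (n1 + n2 + n3 + n4 + 1)%:R => r rn.
have r1 : 1 <= r by apply: le_trans rn; rewrite ler1n addn1.
have r0 : 0 < r by exact: lt_le_trans r1.
have r2r : r <= r ^+ 2 by rewrite expr2 ler_peMl // ltW.
have r20 : 0 < r ^+ 2 by rewrite exprn_gt0.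
have qr0 : 0 <= (1 + q) * r ^+ 2 by rewrite mulr_ge0 ?(ltW r20) // addr_ge0 // ltW.
(* The margin [q] over [r ^+ 2] makes the tail product of [dk_prod_ge] at least one half. *)
pose n := (Num.truncn ((1 + q) * r ^+ 2)).+1; have /andP[nr rn1] := truncn_itv qr0.
have {}nr : n%:R <= (1 + q) * r ^+ 2 + 1 by rewrite -natr1 lerD2r.
have {}rn1 : (1 + q) * r ^+ 2 <= n%:R by exact: ltW.
have qr : r ^+ 2 <= (1 + q) * r ^+ 2 by rewrite ler_peMl ?(ltW r20) // lerDl ltW.
have nn : (n1 + n2 + n3 + n4 + 1 <= n)%N.
  by rewrite -(ler_nat R); apply: le_trans rn (le_trans r2r (le_trans qr rn1)).
have np : (0 < n)%N by [].
have [B BP] := rVB r0.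
have b0r : b0 <= r ^+ 2.
  apply: le_trans (ler_norm b0) (le_trans (n4P n4 (leqnn _)) (le_trans _ (le_trans rn r2r))).
  by rewrite ler_nat; clear; lia.
have h1 := void_ge gin (measurable_scale_set r0 mV) BP (rV r0) (b0P _ b0r n rn1).
have rn2 : r ^+ 2 <= n%:R by exact: le_trans rn1.
have nn1 : (n1 <= n)%N by clear -nn; lia.
have nn2 : (n2 <= n)%N by clear -nn; lia.
have h2 := n1P n nn1 np r r1 ltac:(by apply: le_trans rn2 _; rewrite lerDl).
have h3 := n2P n nn2 np.
have n0R : 0 < n%:R :> R by rewrite ltr0n.
have n1R : 1 <= n%:R :> R by rewrite ler1n.
have Z0 := Zn_gt0 R n.
have qr1 : 2 <= q * r ^+ 2.
  have := n3P n3 (leqnn _); rewrite ler_pdivrMr // => h; apply: le_trans h _; rewrite mulrC.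
  by rewrite ler_wpM2l ?(ltW q0) //; apply: le_trans (le_trans rn r2r); rewrite ler_nat; clear; lia.
(* [upper_scale] speaks of radius [Num.sqrt n], slightly larger than [r]; since
   [ln (n / r ^+ 2) <= 2 * q], changing the radius costs [n ^+ 2 * q] in the exponent. *)
have key : expR (- (n%:R ^+ 2 * q)) * Num.sqrt n%:R ^+ (n * n.-1) <= r ^+ (n * n.-1).
  have s0 : 0 < Num.sqrt n%:R :> R by rewrite sqrtr_gt0.
  have rE : r = Num.sqrt n%:R * expR (- (ln (n%:R / r ^+ 2) / 2)).
    have lnE : ln (n%:R / r ^+ 2) / 2 = ln (Num.sqrt n%:R / r).
      by rewrite -{1}(sqr_sqrtr (ltW n0R)) -expr_div_n lnXn ?divr_gt0 // -[_ *+ 2]mulr_natr mulfK ?pnatr_eq0.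
    by rewrite lnE expRN lnK ?posrE ?divr_gt0 // invf_div mulrC divfK // gt_eqF.
  rewrite {1}rE exprMn mulrC ler_wpM2l ?exprn_ge0 ?(ltW s0) // -expRM_natl ler_expR mulrN lerN2.
  have lnq : ln (n%:R / r ^+ 2) <= 2 * q.
    apply: le_trans (ln_le_sub1 _) _; first by rewrite divr_gt0.
    by rewrite lerBlDl ler_pdivrMr //; lra.
  have ln0 : 0 <= ln (n%:R / r ^+ 2) by apply: ln_ge0; rewrite ler_pdivlMr // mul1r.
  apply: (@le_trans _ _ (n%:R ^+ 2 * (ln (n%:R / r ^+ 2) / 2))).
    by rewrite ler_wpM2r ?divr_ge0 // -natrX ler_nat expnS expn1 leq_mul2l leq_pred orbT.
  by rewrite ler_wpM2l ?exprn_ge0 //; lra.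
apply: le_trans h1; rewrite ler_pdivlMr //; apply: le_trans h2.
have h4 : expR (n%:R ^+ 2 * (rho0 - q) - n%:R ^+ 2 * q) <= r ^+ (n * n.-1) / Zn R n.
  rewrite expRD mulrC; apply: le_trans (ler_wpM2l (expR_ge0 _) h3) _.
  by rewrite mulrA ler_wpM2r // invr_ge0 ltW.
apply: le_trans (ler_wpM2r (expR_ge0 _) h4); rewrite -expRD.
(* Absorbs the factor one half of [void_ge]. *)
have two : 2 <= expR (n%:R ^+ 2 * q).
  apply: le_trans (expR_ge1Dx _); have : q * r ^+ 2 <= n%:R ^+ 2 * q by nra.
  by lra.
apply: (le_trans (ler_wpM2l (expR_ge0 _) two)); rewrite -expRD ler_expR.
have -> : n%:R ^+ 2 * (rho0 - q) - n%:R ^+ 2 * q - n%:R ^+ 2 * (rho + q) = n%:R ^+ 2 * (c - 3 * q) by rewrite /c; ring.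
have -> : rho0 - rho = c by [].
have -> : r ^+ 4 = r ^+ 2 ^+ 2 by rewrite -exprM.
have nr' : n%:R <= (1 + 2 * q) * r ^+ 2 by lra.
have cn : c <= `|c| by exact: ler_norm.
have cn' : - c <= `|c| by rewrite -normrN ler_norm.
have cn0 := normr_ge0 c.
rewrite -[in leLHS]qD /D.
have er : 0 <= r ^+ 2 ^+ 2 * (q * e) by rewrite !mulr_ge0 // ltW.
have nsq1 : r ^+ 2 ^+ 2 <= n%:R ^+ 2 by apply: lerXn2r; rewrite ?nnegrE ?(ltW r20).
have nsq2 : n%:R ^+ 2 <= (1 + 8 * q) * r ^+ 2 ^+ 2.
  apply: (@le_trans _ _ (((1 + 2 * q) * r ^+ 2) ^+ 2)); first by apply: lerXn2r; rewrite ?nnegrE //; apply: le_trans nr'; exact: ltW.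
  rewrite exprMn ler_wpM2r ?exprn_ge0 ?(ltW r20) //; nra.
have s0 : 0 <= r ^+ 2 ^+ 2 by rewrite exprn_ge0 // ltW.
exact: low_arith.
Qed.

Lemma hole_limit : upper_energy V rho -> lower_energy V rho -> upper_energy set0 rho0 -> lower_energy set0 rho0 ->
  ((fun r : R => elog (P [set w | npts (S w) (scale_set r V) = 0%E]) * ((r ^+ 4)^-1)%:E)%E @ +oo%R --> (rho0 - rho)%:E).
Proof.
move=> UV LV U0 L0.
have fP r : 0 < r -> elog (P [set w | npts (S w) (scale_set r V) = 0%E]) = elog (hole r)%:E.
  move=> r0; have [B BP] := rVB r0; have mr := measurable_scale_set r0 mV.
  by rewrite fineK // fin_num_measure // (voidE gin BP); exact: (measurable_void gin mr BP).
have lims : (ln (hole r) * (r ^+ 4)^-1 @[r --> +oo%R] --> rho0 - rho).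
  apply/cvgrPdist_le => e e0.
  have [r1 r1P] := hole_upper UV L0 e0; have [r2 r2P] := hole_lower LV U0 e0.
  near=> r; have r0 : 0 < r by near: r; exact: nbhs_pinfty_gt.
  have h1 : hole r <= expR (r ^+ 4 * (rho0 - rho + e)).
    by apply: r1P; near: r; apply: nbhs_pinfty_ge; exact: num_real.
  have h2 : expR (r ^+ 4 * (rho0 - rho - e)) <= hole r.
    by apply: r2P; near: r; apply: nbhs_pinfty_ge; exact: num_real.
  have hp : 0 < hole r by exact: lt_le_trans (expR_gt0 _) h2.
  have r40 : 0 < r ^+ 4 by rewrite exprn_gt0.
  rewrite -ler_ln ?posrE ?expR_gt0 // expRK in h1; rewrite -ler_ln ?posrE ?expR_gt0 // expRK in h2.
  rewrite [r ^+ 4 * _]mulrC -ler_pdivrMr // in h1; rewrite [r ^+ 4 * _]mulrC -ler_pdivlMr // in h2.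
  by rewrite ler_norml; apply/andP; split; lra.
have lime : ((ln (hole r) * (r ^+ 4)^-1)%:E @[r --> +oo%R] --> (rho0 - rho)%:E).
  by apply: cvg_EFin lims; exact: nearW.
apply: cvg_trans lime; apply: near_eq_cvg.
have [r2 r2P] := hole_lower LV U0 ltr01.
near=> r; have r0 : 0 < r by near: r; exact: nbhs_pinfty_gt.
have hp : 0 < hole r.
  apply: lt_le_trans (expR_gt0 _) (r2P _ _); near: r; apply: nbhs_pinfty_ge; exact: num_real.
by rewrite fP // /elog eqe gt_eqF // -EFinM.
Unshelve. all: end_near. Qed.

End Limit.

End Asymptotics.

(** * Positivity of the logarithmic kernel *)

Section LogSeries.
Variable R : realType.

Definition logser (n : nat) (y : R) : R := \sum_(k < n) k.+1%:R^-1 * y ^+ k.+1.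

Lemma is_derive_logser n (y : R) : is_derive y 1 (logser n) (\sum_(k < n) y ^+ k).
Proof.
elim: n => [|n IH].
  have -> : logser 0 = cst (0 : R) by apply/funext => x; rewrite /logser big_ord0.
  by rewrite big_ord0; exact: is_derive_cst.
have -> : logser n.+1 = (fun x => logser n x + n.+1%:R^-1 * x ^+ n.+1).
  by apply/funext => x; rewrite /logser big_ord_recr.
have dX : is_derive y 1 (fun t : R => t ^+ n.+1) (n.+1%:R * y ^+ n).
  by apply: DeriveDef; [exact: exprn_derivable | rewrite exp_derive /GRing.scale /= mulr1].
rewrite big_ord_recr /=; move: IH; move: (logser n) => G IH.
apply: is_derive_eq; rewrite /GRing.scale /=; congr (_ + _).
by rewrite mulrA mulVf ?mul1r ?pnatr_eq0.
Qed.

(** The remainder has derivative [x ^+ n / (1 - x)] and vanishes at 0; the mean value theorem bounds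
    it. *)
Lemma logser_bounds n (y : R) : 0 <= y -> y < 1 ->
  0 <= - ln (1 - y) - logser n y <= y ^+ n / (1 - y).
Proof.
rewrite le_eqVlt => /orP[/eqP <- _|y0 y1].
  rewrite subr0 ln1 oppr0 sub0r divr1 /logser big1 ?oppr0 ?lexx ?exprn_ge0 // => k _.
  by rewrite exprS mul0r mulr0.
pose g x := - ln (1 - x) - logser n x.
have dg (x : R) : x < 1 -> is_derive x 1 g (x ^+ n / (1 - x)).
  move=> xlt; have x1 : 0 < 1 - x by lra.
  have d1 : is_derive x 1 (fun x : R => 1 - x) (-1).
    have h := @is_deriveB R R R (cst 1) id x 1 0 1 (is_derive_cst _ _ _) (is_derive_id _ _).
    by rewrite sub0r in h.
  have d2 : is_derive x 1 (fun x : R => ln (1 - x)) ((1 - x)^-1 * -1).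
    have h := @is_derive1_comp R (@ln R) (fun x : R => 1 - x) x _ _ (is_derive1_ln x1) d1.
    by rewrite /GRing.scale /= in h; exact: h.
  have d3 := is_derive_logser n x; rewrite /g.
  move: d3; move: (logser n) => G d3; apply: is_derive_eq.
  rewrite mulrN1 opprK.
  have e : \sum_(k < n) x ^+ k = (1 - x ^+ n) / (1 - x).
    by apply: (mulIf (lt0r_neq0 x1)); rewrite divfK ?lt0r_neq0 // -[1 - x ^+ n]opprB subrX1 mulrC; ring.
  by rewrite e -[X in X - _]mul1r -mulrBl; congr (_ / _); ring.
have gc : {within `[0, y], continuous g}.
  apply: derivable_within_continuous => x; rewrite in_itv /= => /andP[_ xy].
  by have [] := dg x (le_lt_trans xy y1).
have dg' (x : R) : x \in `]0, y[%R -> is_derive x 1 g (x ^+ n / (1 - x)).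
  by rewrite in_itv /= => /andP[_ xy]; apply: dg; exact: lt_trans y1.
have [c] := MVT y0 dg' gc.
rewrite in_itv /= => /andP[c0 cy]; rewrite subr0.
have -> : g 0 = 0.
  rewrite /g subr0 ln1 oppr0 sub0r /logser big1 ?oppr0 // => k _.
  by rewrite exprS mul0r mulr0.
have c1 : 0 < 1 - c by lra.
have y10 : 0 < 1 - y by lra.
rewrite subr0 -/(g y) => ->; apply/andP; split.
  by rewrite mulr_ge0 ?(ltW y0) // divr_ge0 ?exprn_ge0 ?(ltW c0) // ltW.
apply: (@le_trans _ _ (c ^+ n / (1 - c))).
  by rewrite ler_piMr ?(ltW y1) // divr_ge0 ?exprn_ge0 ?(ltW c0) // ltW.
apply: ler_pM; rewrite ?exprn_ge0 ?invr_ge0 ?(ltW c0) ?(ltW c1) //.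
  by apply: lerXn2r; rewrite ?nnegrE ?ltW.
by rewrite lef_pV2 ?posrE //; lra.
Qed.

Lemma logser_ge0 n (y : R) : 0 <= y -> 0 <= logser n y.
Proof. by move=> y0; apply: sumr_ge0 => k _; rewrite mulr_ge0 ?exprn_ge0 ?invr_ge0. Qed.

Lemma logser_mono (y : R) : 0 <= y -> {homo (fun n => logser n y) : m n / (m <= n)%N >-> m <= n}.
Proof.
move=> y0; apply: homo_leq => [//|x z t|n]; first exact: le_trans.
by rewrite /logser [leRHS]big_ord_recr /= lerDl mulr_ge0 ?exprn_ge0 ?invr_ge0.
Qed.

Lemma logser_cvg (y : R) : 0 <= y -> y < 1 -> (logser n y)%:E @[n --> \oo] --> (- ln (1 - y))%:E.
Proof.
move=> y0 y1; apply: cvg_EFin; first exact: nearW.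
have h : y ^+ n / (1 - y) @[n --> \oo] --> 0 / (1 - y).
  by apply: cvgM; [apply: cvg_expr; rewrite ger0_norm|exact: cvg_cst].
rewrite mul0r in h.
have h2 : - ln (1 - y) - logser n y @[n --> \oo] --> (0 : R).
  apply: (squeeze_cvgr _ (cvg_cst 0) h); apply: nearW => n; exact: logser_bounds.
have h3 : - ln (1 - y) - (- ln (1 - y) - logser n y) @[n --> \oo] --> - ln (1 - y) - (0 : R).
  by apply: cvgB => //; exact: cvg_cst.
rewrite subr0 in h3; apply: cvg_trans h3; apply: near_eq_cvg; apply: nearW => n /=.
by rewrite subKr.
Qed.

(** Divergence of the harmonic series, which gives the infinite value on the diagonal. *)
Lemma logser1_cvg : (logser n 1)%:E @[n --> \oo] --> (+oo%E : \bar R).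
Proof.
have nd : nondecreasing_seq (fun n => (logser n 1)%:E : \bar R).
  by move=> m n mn; rewrite lee_fin; exact: logser_mono.
have cv := ereal_nondecreasing_cvgn nd.
suff e : ereal_sup (range (fun n => (logser n 1)%:E : \bar R)) = +oo%E by rewrite e in cv.
apply: contrapT => h; apply: (@dvg_harmonic R).
set l := ereal_sup _ in cv h.
have l0 : (0 <= l)%E by apply: ereal_sup_ubound; exists 0%N => //; rewrite /logser big_ord0.
have lf : l \is a fin_num by rewrite ge0_fin_numE // ltey; apply/eqP.
rewrite -(fineK lf) in cv; apply/cvg_ex; exists (fine l).
have /fine_cvgP[_] := cv; apply: cvg_trans; apply: near_eq_cvg; apply: nearW => n /=.
rewrite /logser /series /= big_mkord; apply: eq_bigr => k _; by rewrite expr1n mulr1.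
Qed.

End LogSeries.

(** * The logarithmic kernel as a limit of mixtures of Gaussians *)

Section Positivity.
Variable R : realType.
Local Notation prob := (probability (R * R)%type R).
Local Notation PP := ((R * R) * (R * R))%type.
Local Notation L2 := (@L2 R).

Definition iint2 (mu nu : prob) (f : R * R -> R * R -> \bar R) : \bar R := (\int[mu]_z \int[nu]_w f z w)%E.

Section TwoMeasures.
Variables mu nu : prob.

Lemma measurable_sect (f : R * R -> R * R -> \bar R) z : measurable_fun setT (fun p : PP => f p.1 p.2) ->
  measurable_fun setT (f z).
Proof.
move=> mf; have mz : measurable_fun setT (fun w : R * R => (z, w)) by exact: measurable_fun_pair.
by have := measurableT_comp mf mz.
Qed.

Lemma measurable_inner (f : R * R -> R * R -> \bar R) : measurable_fun setT (fun p : PP => f p.1 p.2) ->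
  (forall z w, (0 <= f z w)%E) -> measurable_fun setT (fun z => \int[nu]_w f z w)%E.
Proof.
move=> mf f0; apply: (@measurable_fun_fubini_tonelli_F _ _ _ _ _ nu (fun p => f p.1 p.2)) => // p; exact: f0.
Qed.

Lemma iint2D (f g : R * R -> R * R -> \bar R) : measurable_fun setT (fun p : PP => f p.1 p.2) ->
  measurable_fun setT (fun p : PP => g p.1 p.2) -> (forall z w, (0 <= f z w)%E) -> (forall z w, (0 <= g z w)%E) ->
  (iint2 mu nu (fun z w => f z w + g z w) = iint2 mu nu f + iint2 mu nu g)%E.
Proof.
move=> mf mg f0 g0; rewrite /iint2 -ge0_integralD //; try exact: measurable_inner; try by move=> z _; apply: integral_ge0.
apply: eq_integral => z _; rewrite ge0_integralD //; exact: measurable_sect.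
Qed.

Lemma iint2Z (f : R * R -> R * R -> \bar R) (c : R) : 0 <= c -> measurable_fun setT (fun p : PP => f p.1 p.2) ->
  (forall z w, (0 <= f z w)%E) -> (iint2 mu nu (fun z w => c%:E * f z w) = c%:E * iint2 mu nu f)%E.
Proof.
move=> c0 mf f0; rewrite /iint2 -ge0_integralZl //; last 2 first.
- exact: measurable_inner.
- by move=> z _; apply: integral_ge0.
apply: eq_integral => z _; rewrite ge0_integralZl //; exact: measurable_sect.
Qed.

Lemma iint2_le (f g : R * R -> R * R -> \bar R) : (forall z w, (0 <= f z w)%E) -> (forall z w, (f z w <= g z w)%E) ->
  (iint2 mu nu f <= iint2 mu nu g)%E.
Proof.
move=> f0 fg; apply: le_integral_nomeas => z _; rewrite integral_ge0 //=.
by apply: le_integral_nomeas => w _; rewrite f0 fg.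
Qed.

Lemma iint2_cst (c : R) : iint2 mu nu (fun _ _ => c%:E) = c%:E.
Proof. by rewrite /iint2; under eq_integral do rewrite int_cst_prob; exact: int_cst_prob. Qed.

Lemma iint2_sqmod (p q : R) : (\int[mu]_z (sqmod z)%:E = p%:E)%E -> (\int[nu]_z (sqmod z)%:E = q%:E)%E ->
  iint2 mu nu (fun z w => (sqmod z + sqmod w)%:E) = (p + q)%:E.
Proof.
move=> ip iq; rewrite /iint2.
have ms : measurable_fun setT (fun w : R * R => (sqmod w)%:E) by apply/measurable_EFinP; exact: measurable_sqmod.
have s0 (w : R * R) : (0 <= (sqmod w)%:E)%E by rewrite lee_fin sqmod_ge0.
have q0 : 0 <= q by rewrite -lee_fin -iq; apply: integral_ge0 => z _; exact: s0.
under eq_integral => z _.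
  under eq_integral => w _ do rewrite EFinD.
  rewrite ge0_integralD // int_cst_prob iq.
  over.
by rewrite ge0_integralD // ?int_cst_prob ?ip.
Qed.

End TwoMeasures.

Definition gk (t : R) (z w : R * R) : R := expR (- (t * sqmod (z - w))).

Lemma measurable_gk t : measurable_fun setT (fun p : PP => gk t p.1 p.2).
Proof.
apply: measurableT_comp => //; apply: measurableT_comp => //; apply: measurable_funM => //.
apply: (measurableT_comp (@measurable_sqmod R)).
have m1 : measurable_fun setT (fun p : PP => p.1.1 - p.2.1) by apply: measurable_funB; exact: measurableT_comp.
have m2 : measurable_fun setT (fun p : PP => p.1.2 - p.2.2) by apply: measurable_funB; exact: measurableT_comp.
exact: (measurable_fun_pair m1 m2).
Qed.

(** A Gaussian is a convolution square: the product of the two factors is [gk t z w] times a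
    Gaussian centred at the midpoint, of integral [pi / (4 * t)]. *)
Lemma gk_conv (t : R) z w : 0 < t ->
  ((gk t z w)%:E = (4 * t / pi)%:E * \int[L2]_x ((gk (2 * t) z x)%:E * (gk (2 * t) w x)%:E))%E.
Proof.
move=> t0; pose c : R * R := (- ((z.1 + w.1) / 2), - ((z.2 + w.2) / 2)).
have E x : ((gk (2 * t) z x)%:E * (gk (2 * t) w x)%:E = (gk t z w)%:E * (expR (- (4 * t * sqmod (x + c))))%:E)%E.
  rewrite -!EFinM /gk -!expRD; congr EFin; congr expR; rewrite /sqmod /c /=; by field.
under eq_integral do rewrite E.
have mh : measurable_fun setT (fun x : R * R => (expR (- (4 * t * sqmod x)))%:E).
  apply/measurable_EFinP; apply: measurableT_comp => //; apply: measurableT_comp => //.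
  by apply: measurable_funM => //; exact: measurable_sqmod.
have mc : measurable_fun setT (fun x : R * R => (expR (- (4 * t * sqmod (x + c))))%:E).
  by have [ms _] := mpres_shift c; have := measurableT_comp mh ms.
rewrite ge0_integralZl //; last by rewrite lee_fin expR_ge0.
have t40 : 0 < 4 * t by rewrite mulr_gt0.
have := mpres_int (A := setT) (mpres_shift c) measurableT mh (fun x _ => expR_ge0 _ : (0 <= (expR (- (4 * t * sqmod x)))%:E)%E).
rewrite preimage_setT => ->.
have := @L2_gauss_moment R (4 * t) 0 t40; under eq_integral do rewrite expr0 mul1r.
move=> ->; rewrite -!EFinM; congr EFin; rewrite fact0 expr1.
have p0 := lt0r_neq0 (pi_gt0 R); have t4 := lt0r_neq0 t40.
rewrite mulrCA (_ : 4 * t / pi * (pi * (1%:R / (4 * t))) = 1) ?mulr1 //.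
by rewrite mulrA divfK // mulr1n div1r divff.
Qed.

(** By [gk_conv] each double integral is an integral of [g mu * g nu], and [2xy <= x^2 + y^2]. This
    is positivity on the difference of [mu] and [nu], phrased without signed measures. *)
Lemma gk_psd (mu nu : prob) (t : R) : 0 < t ->
  (iint2 mu nu (fun z w => (gk t z w)%:E) *+ 2 <=
   iint2 mu mu (fun z w => (gk t z w)%:E) + iint2 nu nu (fun z w => (gk t z w)%:E))%E.
Proof.
move=> t0; pose g (a : prob) x := (\int[a]_z (gk (2 * t) z x)%:E)%E.
have gk0 s z w : (0 <= (gk s z w)%:E)%E by rewrite lee_fin expR_ge0.
have mgk s x : measurable_fun setT (fun z => (gk s z x)%:E).
  apply/measurable_EFinP; have mz : measurable_fun setT (fun z : R * R => (z, x)) by exact: measurable_fun_pair.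
  by have := measurableT_comp (measurable_gk s) mz.
have g0 a x : (0 <= g a x)%E by apply: integral_ge0.
have gf a x : g a x \is a fin_num.
  rewrite ge0_fin_numE //; apply: (@le_lt_trans _ _ (\int[a]_z 1)%E); last by rewrite int_cst_prob ltey.
  apply: le_integral_nomeas => z _; rewrite gk0 lee_fin -expR0 ler_expR oppr_le0.
  by rewrite mulr_ge0 ?sqmod_ge0 // mulr_ge0 // ltW.
have mg a : measurable_fun setT (g a).
  apply: (@measurable_fun_fubini_tonelli_G _ _ _ _ _ a (fun p => (gk (2 * t) p.1 p.2)%:E)) => [|p]; last exact: gk0.
  by apply/measurable_EFinP; exact: measurable_gk.
have c0 : 0 <= 4 * t / pi by rewrite divr_ge0 ?pi_ge0 // mulr_ge0 // ltW.
have GE (a b : prob) : (iint2 a b (fun z w => (gk t z w)%:E) = (4 * t / pi)%:E * \int[L2]_x (g a x * g b x))%E.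
  rewrite /iint2; under eq_integral do under eq_integral do rewrite gk_conv //.
  have h (z : R * R) : (\int[b]_w ((4 * t / pi)%:E * \int[L2]_x ((gk (2 * t) z x)%:E * (gk (2 * t) w x)%:E)) =
     (4 * t / pi)%:E * \int[L2]_x ((gk (2 * t) z x)%:E * g b x))%E.
    have mj : measurable_fun setT (fun p : PP => ((gk (2 * t) z p.2)%:E * (gk (2 * t) p.1 p.2)%:E)%E).
      apply: emeasurable_funM; apply/measurable_EFinP; last exact: measurable_gk.
      have mz : measurable_fun setT (fun p : PP => (z, p.2)) by exact: measurable_fun_pair.
      by have := measurableT_comp (measurable_gk (2 * t)) mz.
    have p0 (p : PP) : (0 <= (gk (2 * t) z p.2)%:E * (gk (2 * t) p.1 p.2)%:E)%E by rewrite mule_ge0.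
    rewrite ge0_integralZl //; last 2 first.
    - exact: (@measurable_fun_fubini_tonelli_F _ _ _ _ _ L2 (fun p => ((gk (2 * t) z p.2)%:E * (gk (2 * t) p.1 p.2)%:E)%E)).
    - by move=> w _; apply: integral_ge0 => x _; exact: (p0 (w, x)).
    congr (_ * _)%E.
    rewrite (@fubini_tonelli _ _ _ _ _ b L2 (fun p => ((gk (2 * t) z p.2)%:E * (gk (2 * t) p.1 p.2)%:E)%E)) //.
    by apply: eq_integral => x _ /=; rewrite ge0_integralZl.
  under eq_integral do rewrite h.
  have mj : measurable_fun setT (fun p : PP => ((gk (2 * t) p.1 p.2)%:E * g b p.2)%E).
    apply: emeasurable_funM; first by apply/measurable_EFinP; exact: measurable_gk.
    exact: (measurableT_comp (mg b) measurable_snd).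
  have p0 (p : PP) : (0 <= (gk (2 * t) p.1 p.2)%:E * g b p.2)%E by rewrite mule_ge0.
  rewrite ge0_integralZl //; last 2 first.
  - exact: (@measurable_fun_fubini_tonelli_F _ _ _ _ _ L2 (fun p => ((gk (2 * t) p.1 p.2)%:E * g b p.2)%E)).
  - by move=> w _; apply: integral_ge0 => x _; exact: (p0 (w, x)).
  congr (_ * _)%E.
  rewrite (@fubini_tonelli _ _ _ _ _ a L2 (fun p => ((gk (2 * t) p.1 p.2)%:E * g b p.2)%E)) //.
  by apply: eq_integral => x _ /=; rewrite ge0_integralZr.
rewrite !GE mule2n -!muleDr //; try by rewrite ge0_adde_def // inE; apply: integral_ge0 => x _; rewrite mule_ge0.
apply: lee_wpmul2l; first by rewrite lee_fin.
have mgg a b : measurable_fun setT (fun x => g a x * g b x)%E by exact: emeasurable_funM.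
rewrite -!ge0_integralD //; try by move=> x _; rewrite mule_ge0.
apply: le_integral_nomeas => x _; rewrite adde_ge0 ?mule_ge0 //=.
rewrite -(fineK (gf mu x)) -(fineK (gf nu x)) -!EFinM -!EFinD lee_fin.
by have := sqr_ge0 (fine (g mu x) - fine (g nu x)); nra.
Qed.

Local Notation measurable2 f := (measurable_fun setT (fun p : PP => f p.1 p.2)).
Local Notation psd2 mu nu f := ((iint2 mu nu f *+ 2 <= iint2 mu mu f + iint2 nu nu f)%E).

Lemma iint2_ge0 (mu nu : prob) f : (forall z w, (0 <= f z w)%E) -> (0 <= iint2 mu nu f)%E.
Proof. by move=> f0; apply: integral_ge0 => z _; exact: integral_ge0. Qed.

Lemma psd2D (mu nu : prob) (f g : R * R -> R * R -> \bar R) : measurable2 f -> measurable2 g ->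
  (forall z w, (0 <= f z w)%E) -> (forall z w, (0 <= g z w)%E) ->
  psd2 mu nu f -> psd2 mu nu g -> psd2 mu nu (fun z w => f z w + g z w)%E.
Proof. by move=> mf mg f0 g0 hf hg; rewrite !iint2D // mule2n addeACA [leRHS]addeACA leeD. Qed.

Lemma psd2Z (mu nu : prob) (f : R * R -> R * R -> \bar R) (c : R) : 0 <= c -> measurable2 f ->
  (forall z w, (0 <= f z w)%E) -> psd2 mu nu f -> psd2 mu nu (fun z w => c%:E * f z w)%E.
Proof.
move=> c0 mf f0 hf; have i0 a b := iint2_ge0 a b f0.
rewrite !iint2Z // mule2n -!ge0_muleDr //.
by apply: lee_wpmul2l; rewrite ?lee_fin.
Qed.

(** Partial sums of [- ln (1 - gk s z w)]. Powers of a Gaussian are Gaussians, so these are positive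
    combinations of kernels covered by [gk_psd]. *)
Definition lk (s : R) (n : nat) (z w : R * R) : R := logser n (gk s z w).

Lemma lkS s n z w : lk s n.+1 z w = lk s n z w + n.+1%:R^-1 * gk (n.+1%:R * s) z w.
Proof. by rewrite /lk /logser big_ord_recr /=; congr (_ + _ * _); rewrite -expRM_natl /gk mulrN mulrA. Qed.

Lemma lk_ge0 s n z w : 0 <= lk s n z w. Proof. by apply: logser_ge0; exact: expR_ge0. Qed.

Lemma measurable_lk s n : measurable_fun setT (fun p : PP => lk s n p.1 p.2).
Proof.
elim: n => [|n IH]; first by rewrite /lk /logser; under eq_fun do rewrite big_ord0; exact: measurable_cst.
under eq_fun do rewrite lkS; apply: measurable_funD => //; apply: measurable_funM => //; exact: measurable_gk.
Qed.

Lemma lk_psd (mu nu : prob) s n : 0 < s -> psd2 mu nu (fun z w => (lk s n z w)%:E).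
Proof.
move=> s0; elim: n => [|n IH].
  have e (a b : prob) : iint2 a b (fun z w => (lk s 0 z w)%:E) = 0%E.
    by rewrite -[RHS](iint2_cst a b 0); congr iint2; apply/funext => z; apply/funext => w; rewrite /lk /logser big_ord0.
  by rewrite !e mule2n adde0.
have -> : (fun z w => (lk s n.+1 z w)%:E) = (fun z w => (lk s n z w)%:E + (n.+1%:R^-1)%:E * (gk (n.+1%:R * s) z w)%:E)%E.
  by apply/funext => z; apply/funext => w; rewrite lkS EFinD EFinM.
have mg : measurable_fun setT (fun p : PP => (gk (n.+1%:R * s) p.1 p.2)%:E).
  by apply/measurable_EFinP; exact: measurable_gk.
have g0 z w : (0 <= (gk (n.+1%:R * s) z w)%:E)%E by rewrite lee_fin expR_ge0.
apply: psd2D.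
- by apply/measurable_EFinP; exact: measurable_lk.
- exact: emeasurable_funM.
- by move=> z w; rewrite lee_fin lk_ge0.
- by move=> z w; rewrite mule_ge0 // lee_fin invr_ge0.
- exact: IH.
- by apply: psd2Z; rewrite ?invr_ge0 //; apply: gk_psd; rewrite mulr_gt0.
Qed.

(** For small [s] this is close to [- ln (s * sqmod (z - w))], twice the logarithmic kernel up to
    the constant [- ln s]. *)
Definition lkoo (s : R) (z w : R * R) : \bar R :=
  if z == w then +oo%E else (- ln (1 - gk s z w))%:E.

Lemma gk_lt1 s z w : 0 < s -> z != w -> gk s z w < 1.
Proof. by move=> s0 zw; rewrite /gk expR_lt1 oppr_lt0 mulr_gt0 // sqmodB_gt0. Qed.

Lemma lk_cvg s z w : 0 < s -> (lk s n z w)%:E @[n --> \oo] --> lkoo s z w.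
Proof.
move=> s0; rewrite /lkoo /lk; have [->|zw] := eqVneq z w.
  have -> : gk s w w = 1 by rewrite /gk subrr /sqmod /= expr0n addr0 mulr0 oppr0 expR0.
  exact: logser1_cvg.
by apply: logser_cvg; [exact: expR_ge0|exact: gk_lt1].
Qed.

Lemma lk_mono s z w : {homo (fun n => lk s n z w) : m n / (m <= n)%N >-> m <= n}.
Proof. by apply: logser_mono; exact: expR_ge0. Qed.

Lemma lk_le s n z w : 0 < s -> ((lk s n z w)%:E <= lkoo s z w)%E.
Proof.
move=> s0; have h := @lk_cvg s z w s0; rewrite -(cvg_lim _ h) //.
apply: lime_ge; first by apply/cvg_ex; exists (lkoo s z w).
by exists n => // m nm; rewrite lee_fin; exact: lk_mono.
Qed.

Lemma lkoo_ge0 s z w : 0 < s -> (0 <= lkoo s z w)%E.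
Proof. by move=> s0; apply: le_trans (lk_le 0 z w s0); rewrite lee_fin lk_ge0. Qed.

Lemma measurable_lkoo s : 0 < s -> measurable2 (lkoo s).
Proof.
move=> s0; apply: (@emeasurable_fun_cvg _ _ R setT (fun n p => (lk s n p.1 p.2)%:E)) => [n|p _]; last exact: lk_cvg.
by apply/measurable_EFinP; exact: measurable_lk.
Qed.

Lemma half_le (x b : \bar R) : (x *+ 2 <= b)%E = (x <= 2^-1%:E * b)%E.
Proof.
apply/idP/idP => h.
  have := lee_wpmul2l (_ : (0 <= 2^-1%:E)%E) h; rewrite lee_fin invr_ge0 ler0n => /(_ isT).
  by rewrite -mule_natl muleA -EFinM mulVf ?mul1e ?pnatr_eq0.
have := lee_wpmul2l (_ : (0 <= 2%:E)%E) h; rewrite lee_fin ler0n => /(_ isT).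
by rewrite muleA -EFinM divff ?mul1e ?pnatr_eq0 // mule_natl.
Qed.

Lemma lkoo_psd (mu nu : prob) s : 0 < s -> psd2 mu nu (lkoo s).
Proof.
move=> s0.
have cv : iint2 mu nu (fun z w => (lk s n z w)%:E) @[n --> \oo] --> iint2 mu nu (lkoo s).
  by apply: mct2 => [n z w|n|z w|z w]; [exact: lk_ge0|exact: measurable_lk|exact: lk_mono|exact: lk_cvg].
have ub (n : nat) : (iint2 mu nu (fun z w => (lk s n z w)%:E) <=
    2^-1%:E * (iint2 mu mu (lkoo s) + iint2 nu nu (lkoo s)))%E.
  rewrite -half_le; apply: le_trans (lk_psd mu nu n s0) _.
  by apply: leeD; apply: iint2_le => z w; rewrite ?lee_fin ?lk_ge0 //; exact: lk_le.
rewrite half_le -(cvg_lim _ cv) //; apply: lime_le; first by apply/cvg_ex; exists (iint2 mu nu (lkoo s)).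
exact: nearW.
Qed.

Lemma gk_bounds s z w : 0 < s -> z != w ->
  - ln (s * sqmod (z - w)) <= - ln (1 - gk s z w) <= - ln (s * sqmod (z - w)) + s * sqmod (z - w).
Proof.
move=> s0 zw; have u0 : 0 < s * sqmod (z - w) by rewrite mulr_gt0 // sqmodB_gt0.
have g1 : 0 < 1 - gk s z w by rewrite subr_gt0 gk_lt1.
move: g1; rewrite /gk; move: (s * sqmod (z - w)) u0 => u u0 g1; apply/andP; split.
  rewrite lerN2 ler_ln ?posrE // lerBlDr -lerBlDl; apply: le_trans (expR_ge1Dx _); lra.
have h : u * expR (- u) <= 1 - expR (- u).
  have e1 := expR_ge1Dx u; have e2 : expR u * expR (- u) = 1 by rewrite -expRD subrr expR0.
  by have := expR_ge0 (- u); nra.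
have : ln u - u <= ln (1 - expR (- u)).
  by rewrite -[leLHS]expRK ler_ln ?posrE ?expR_gt0 // expRD lnK ?posrE.
lra.
Qed.

Lemma kk_lkoo_le s z w : 0 < s -> (kk z w + (- (ln s / 2))%:E <= 2^-1%:E * lkoo s z w + (pot z w)%:E)%E.
Proof.
move=> s0; rewrite /lkoo; have [->|zw] := eqVneq z w; first by rewrite gt0_muley ?lte_fin ?invr_gt0 // addye // leey.
rewrite kk_neq // -EFinM -!EFinD lee_fin; have /andP[+ _] := gk_bounds s0 zw.
by rewrite lnM ?posrE ?sqmodB_gt0 //; lra.
Qed.

Lemma lkoo_kk_le s z w : 0 < s ->
  (2^-1%:E * lkoo s z w + (pot z w)%:E <= kk z w + ((- (ln s / 2))%:E + s%:E * (sqmod z + sqmod w)%:E))%E.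
Proof.
move=> s0; rewrite /lkoo; have [->|zw] := eqVneq z w; first by rewrite kk_diag [leRHS]addye // leey.
rewrite kk_neq // -!EFinM -!EFinD lee_fin; have /andP[_] := gk_bounds s0 zw.
by rewrite lnM ?posrE ?sqmodB_gt0 //; have := sqmodB_le z w; nra.
Qed.

Lemma psd_arith (r a b p q jm jn L s e : R) : s * (2 * (p + q)) <= e ->
  a / 2 + ((q + q) / 2 + 1) <= jn + (L + s * (q + q)) ->
  b / 2 + ((p + p) / 2 + 1) <= jm + (L + s * (p + p)) ->
  r <= 2^-1 * (2^-1 * (b + a)) + ((p + q) / 2 + 1) - L -> r + r <= jm + jn + e.
Proof. lra. Qed.

Lemma J_psd (mu nu : prob) (p q : R) : (\int[mu]_z (sqmod z)%:E = p%:E)%E -> (\int[nu]_z (sqmod z)%:E = q%:E)%E ->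
  (J mu nu *+ 2 <= J mu mu + J nu nu)%E.
Proof.
move=> ip iq.
have JE (a b : prob) : J a b = iint2 a b (@kk R) by [].
have [/eqP ->|/eqP muf] := boolP (J mu mu == +oo%E); first by rewrite addye ?leey // gt_eqF // (lt_le_trans _ (J_ge0 _ _)).
have [/eqP ->|/eqP nuf] := boolP (J nu nu == +oo%E); first by rewrite addey ?leey // gt_eqF // (lt_le_trans _ (J_ge0 _ _)).
have fin (a : prob) : J a a <> +oo%E -> J a a \is a fin_num by move=> h; rewrite ge0_fin_numE ?J_ge0 // ltey; apply/eqP.
have [jm jmE] : exists j, J mu mu = j%:E by exists (fine (J mu mu)); rewrite fineK // fin.
have [jn jnE] : exists j, J nu nu = j%:E by exists (fine (J nu nu)); rewrite fineK // fin.
have p0 : 0 <= p by rewrite -lee_fin -ip; apply: integral_ge0 => z _; rewrite lee_fin sqmod_ge0.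
have q0 : 0 <= q by rewrite -lee_fin -iq; apply: integral_ge0 => z _; rewrite lee_fin sqmod_ge0.
apply/lee_addgt0Pr => e e0.
have [s [s0 s1 se]] : exists s, [/\ 0 < s, s <= 1 & s * (2 * (p + q)) <= e].
  exists (Num.min 1 (e / (2 * (p + q) + 1))).
  have D0 : 0 < 2 * (p + q) + 1 by rewrite ltr_wpDl // mulr_ge0 // addr_ge0.
  split; [by rewrite lt_min ltr01 divr_gt0|by rewrite ge_min lexx|].
  set m := Num.min _ _.
  have h : m * (2 * (p + q) + 1) <= e by rewrite -ler_pdivlMr // ge_min lexx orbT.
  have m0 : 0 <= m by rewrite le_min ler01 divr_ge0 // ltW.
  by apply: le_trans h; rewrite ler_wpM2l // lerDl.
pose L := - (ln s / 2); have L0 : 0 <= L by rewrite oppr_ge0 mulr_le0_ge0 ?invr_ge0 // ln_le0.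
have mkk : measurable2 (@kk R) by exact: measurable_kk.
have mlk := measurable_lkoo s0.
have mcst (c : R) : measurable2 (fun _ _ : R * R => c%:E) by exact: measurable_cst.
have mss : measurable2 (fun z w : R * R => (sqmod z + sqmod w)%:E).
  apply/measurable_EFinP; apply: measurable_funD.
    exact: (measurableT_comp (@measurable_sqmod R) measurable_fst).
  exact: (measurableT_comp (@measurable_sqmod R) measurable_snd).
have ss0 (z w : R * R) : (0 <= (sqmod z + sqmod w)%:E)%E by rewrite lee_fin addr_ge0 ?sqmod_ge0.
have potE : (fun z w : R * R => (pot z w)%:E) = (fun z w => 2^-1%:E * (sqmod z + sqmod w)%:E + 1%:E)%E.
  by apply/funext => z; apply/funext => w; rewrite /pot EFinD [in LHS]mulrC EFinM.
have mpot : measurable2 (fun z w : R * R => (pot z w)%:E).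
  by rewrite (_ : (fun p : PP => _) = fun p : PP => (2^-1%:E * (sqmod p.1 + sqmod p.2)%:E + 1%:E)%E);
    [apply: emeasurable_funD => //; exact: emeasurable_funM|apply/funext => x; exact: (congr1 (fun f => f x.1 x.2) potE)].
have pot0 (z w : R * R) : (0 <= (pot z w)%:E)%E.
  by rewrite lee_fin /pot addr_ge0 // divr_ge0 // addr_ge0 ?sqmod_ge0.
have ipot (a b : prob) (x y : R) : (\int[a]_z (sqmod z)%:E = x%:E)%E -> (\int[b]_z (sqmod z)%:E = y%:E)%E ->
    iint2 a b (fun z w => (pot z w)%:E) = ((x + y) / 2 + 1)%:E.
  move=> ix iy; rewrite potE iint2D //; last 2 first.
  - exact: emeasurable_funM.
  - by move=> z w; rewrite mule_ge0 // lee_fin invr_ge0.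
  by rewrite iint2Z ?invr_ge0 // (iint2_sqmod ix iy) iint2_cst -EFinM -EFinD mulrC.
have lk0 z w := lkoo_ge0 z w s0.
have half0 : 0 <= (2^-1 : R) by rewrite invr_ge0.
have hlk0 z w : (0 <= 2^-1%:E * lkoo s z w)%E by rewrite mule_ge0 // lee_fin.
have mhlk : measurable2 (fun z w => 2^-1%:E * lkoo s z w)%E by exact: emeasurable_funM.
have kk0 (z w : R * R) := kk_ge0 z w.
have L0' (z w : R * R) : (0 <= L%:E)%E by rewrite lee_fin.
have sc0 (z w : R * R) : (0 <= s%:E * (sqmod z + sqmod w)%:E)%E by rewrite mule_ge0 // lee_fin ltW.
have msc : measurable2 (fun z w : R * R => s%:E * (sqmod z + sqmod w)%:E)%E by exact: emeasurable_funM.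
have mLsc : measurable2 (fun z w : R * R => L%:E + s%:E * (sqmod z + sqmod w)%:E)%E by exact: emeasurable_funD.
have Lsc0 (z w : R * R) : (0 <= L%:E + s%:E * (sqmod z + sqmod w)%:E)%E by exact: adde_ge0.
have mid (a b : prob) (x y : R) : (\int[a]_z (sqmod z)%:E = x%:E)%E -> (\int[b]_z (sqmod z)%:E = y%:E)%E ->
    (iint2 a b (fun z w => 2^-1%:E * lkoo s z w + (pot z w)%:E) = 2^-1%:E * iint2 a b (lkoo s) + ((x + y) / 2 + 1)%:E)%E.
  by move=> ix iy; rewrite (iint2D a b mhlk mpot hlk0 pot0) (iint2Z a b half0 mlk lk0) (ipot a b x y).
have up (a b : prob) (x y : R) : (\int[a]_z (sqmod z)%:E = x%:E)%E -> (\int[b]_z (sqmod z)%:E = y%:E)%E ->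
    (J a b + L%:E <= 2^-1%:E * iint2 a b (lkoo s) + ((x + y) / 2 + 1)%:E)%E.
  move=> ix iy; rewrite -(mid a b x y ix iy) JE -(iint2_cst a b L) -(iint2D a b mkk (mcst L) kk0 L0').
  by apply: iint2_le => z w; [exact: adde_ge0|exact: kk_lkoo_le].
have lo (a : prob) (x : R) : (\int[a]_z (sqmod z)%:E = x%:E)%E ->
    (2^-1%:E * iint2 a a (lkoo s) + ((x + x) / 2 + 1)%:E <= J a a + (L + s * (x + x))%:E)%E.
  move=> ix; rewrite -(mid a a x x ix ix) JE EFinD -(iint2_cst a a L) EFinM -(iint2_sqmod ix ix).
  rewrite -(iint2Z a a (ltW s0) mss ss0) -(iint2D a a (mcst L) msc L0' sc0) -(iint2D a a mkk mLsc kk0 Lsc0).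
  by apply: iint2_le => z w; [exact: adde_ge0|exact: lkoo_kk_le].
have := up mu nu p q ip iq; have := lo mu p ip; have := lo nu q iq.
have := lkoo_psd mu nu s0; rewrite jmE jnE.
have F0 (a b : prob) : (0 <= iint2 a b (lkoo s))%E by exact: iint2_ge0.
have toR (X : \bar R) (x y : R) : (0 <= X)%E -> (2^-1%:E * X + x%:E <= y%:E)%E -> exists2 r, X = r%:E & r / 2 + x <= y.
  case: X => [r _||]; last 2 first.
  - by rewrite gt0_muley ?lte_fin ?invr_gt0.
  - by [].
  by rewrite -EFinM -EFinD lee_fin => h; exists r => //; rewrite mulrC.
rewrite -!EFinD => h1 /toR - /(_ (F0 _ _)) [a aE ah] /toR - /(_ (F0 _ _)) [b bE bh] h2.
rewrite aE bE -EFinD half_le -EFinM in h1.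
have h3 : (J mu nu + L%:E <= (2^-1 * (2^-1 * (b + a)) + ((p + q) / 2 + 1))%:E)%E.
  by apply: le_trans h2 _; rewrite (EFinD (2^-1 * _)) leeD2r // EFinM lee_wpmul2l // lee_fin.
have : (J mu nu <= (2^-1 * (2^-1 * (b + a)) + ((p + q) / 2 + 1) - L)%:E)%E by rewrite EFinB leeBrDr.
have := J_ge0 mu nu; case: (J mu nu) => [r||] //= _.
rewrite lee_fin => h4; change (r%:E *+ 2 <= (jm + jn + e)%:E)%E; rewrite mule2n -EFinD lee_fin.
exact: psd_arith se ah bh h4.
Qed.

End Positivity.

(** * Potential of the uniform measure on the disk *)

Section RadialIntegrals.
Variable R : realType.
Local Notation mu := (@lebesgue_measure R).

Definition logsing (a s : R) : \bar R := if a == s then +oo%E else (- ln `|a - s|)%:E.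

(** The singularity is dominated by the number of [j] with [|a - s| <= 2 ^- j]; these intervals have
    lengths [2 * 2 ^- j], of sum 4. *)
Lemma log_singularity (a : R) : 0 <= a <= 1 -> (\int[mu]_(s in `[0%R, 1%R]) logsing a s <= 4%:E)%E.
Proof.
move=> /andP[a0 a1].
pose E (j : nat) : set R := `[a - 2 ^- j, a + 2 ^- j]%classic.
have mE j : measurable (E j : set (measurableTypeR R)) by exact: measurable_itv.
have mf j : measurable_fun (`[0%R, 1%R]%classic : set (measurableTypeR R)) (fun s => (\1_(E j) s)%:E : \bar R).
  by apply/measurable_EFinP; apply: measurable_indic; exact: mE.
have f0 j s : (0 <= (\1_(E j) s)%:E :> \bar R)%E by rewrite lee_fin.
have m01 : measurable (`[0%R, 1%R]%classic : set (measurableTypeR R)) by exact: measurable_itv.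
apply: (@le_trans _ _ (\int[mu]_(s in `[0%R, 1%R]) \big[+%E/0%E]_(0 <= j <oo) (\1_(E j) s)%:E)%E).
  apply: le_integral_nomeas => s /=; rewrite in_itv /= => /andP[s0 s1].
  have ge n : (forall j, (j < n)%N -> `|a - s| <= 2 ^- j) ->
      (n%:R%:E <= \big[+%E/0%E]_(0 <= j <oo) (\1_(E j) s)%:E :> \bar R)%E.
    move=> H; apply: le_trans (nneseries_lim_ge n (fun j _ _ => f0 j s)).
    rewrite big_mkord (eq_bigr (fun=> 1%E)); last first.
      move=> j _; congr EFin; rewrite indicE mem_set // /E /= in_itv /=.
      by have := H j (ltn_ord j); rewrite ler_norml => /andP[h1 h2]; apply/andP; split; lra.
    by rewrite sumEFin lee_fin sumr_const card_ord.
  rewrite /logsing; have [sa|sa] := eqVneq a s.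
    rewrite leey /= leye_eq; apply/eqP/eqyP => r r0.
    have [n rn] : exists n : nat, r <= n%:R.
      by exists (Num.truncn r).+1; apply: ltW; exact: truncnS_gt.
    apply: (@le_trans _ _ (n%:R)%:E); first by rewrite lee_fin.
    by apply: ge => j _; rewrite -sa subrr normr0 invr_ge0.
  have x0 : 0 < `|a - s| by rewrite normr_gt0 subr_eq0.
  have x1 : `|a - s| <= 1 by rewrite ler_norml; apply/andP; split; lra.
  have l0 : 0 <= - ln `|a - s| by rewrite oppr_ge0 ln_le0.
  rewrite lee_fin l0 /=.
  apply: (@le_trans _ _ ((Num.truncn (- ln `|a - s|)).+1%:R)%:E); first by rewrite lee_fin; apply: ltW; exact: truncnS_gt.
  apply: ge => j; rewrite ltnS truncn_ge_nat // => jn.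
  rewrite -[leLHS]lnK ?posrE //; apply: (@le_trans _ _ (expR (- j%:R))); first by rewrite ler_expR; lra.
  rewrite expRN lef_pV2 ?posrE ?expR_gt0 ?exprn_gt0 //.
  rewrite -[j%:R]mulr1 expRM_natl; apply: lerXn2r; rewrite ?nnegrE ?expR_ge0 //.
  by apply: le_trans (expR_ge1Dx 1).
rewrite integral_nneseries //.
have vol j : (\int[mu]_(s in `[0%R, 1%R]) (\1_(E j) s)%:E <= (2 * 2 ^- j)%:E)%E.
  rewrite integral_indic //; apply: (@le_trans _ _ (mu (E j))).
    by apply: le_measure; rewrite ?inE //; exact: measurableI.
  rewrite lebesgue_measure_itv /= lte_fin; case: ifP => _; last by rewrite lee_fin mulr_ge0.
  by rewrite -EFinB lee_fin; lra.
apply: lime_le; first by apply: is_cvg_nneseries => j _ _; apply: integral_ge0 => s _; exact: f0.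
apply: nearW => n; apply: (@le_trans _ _ (\sum_(0 <= j < n) (2 * 2 ^- j)%:E)%E); first by apply: lee_sum => j _.
rewrite sumEFin lee_fin.
have -> : \sum_(0 <= j < n) (2 * 2 ^- j) = 4 - 4 * 2 ^- n :> R.
  elim: n => [|n IH]; first by rewrite big_nil expr0 invr1; lra.
  by rewrite big_nat_recr //= IH exprS; field; rewrite expf_neq0.
by rewrite gerBl.
Qed.

(** The mean of [kk z w] when [w] runs over a circle, in terms of the squared moduli [a] and [s]:
    the logarithm of the distance averages to that of the larger modulus. *)
Definition rad (a s : R) : R := - (ln (Num.max a s) / 2) + ((a + s) / 2 + 1).

Lemma rad_ge0 (a s : R) : 0 < a -> 0 <= s -> 0 <= rad a s.
Proof.
move=> a0 s0; rewrite /rad; have m0 : 0 < Num.max a s by rewrite lt_max a0.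
have := ln_le_sub1 m0; have : Num.max a s <= a + s by rewrite ge_max; apply/andP; split; lra.
lra.
Qed.

Lemma is_derive_sq (x : R) : is_derive x 1 (fun t : R => t ^+ 2) (2 * x).
Proof. by apply: DeriveDef; [exact: exprn_derivable|rewrite exp_derive /GRing.scale /= mulr1 expr1]. Qed.

Lemma int_affine (c b : R) : 0 < b ->
  (\int[mu]_(s in `[0%R, b]) (c + s / 2)%:E = (c * b + b ^+ 2 / 4)%:E)%E.
Proof.
move=> b0; pose F (s : R) := c * s + 4^-1 * s ^+ 2.
have dF (s : R) : is_derive s 1 F (c + s / 2).
  rewrite /F; have h := is_derive_sq s; apply: is_derive_eq; rewrite /GRing.scale /=; by field.
have cF : continuous F by move=> t; apply: differentiable_continuous; apply/derivable1_diffP; have [] := dF t.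
rewrite (@continuous_FTC2 R _ F) //.
- by rewrite -EFinB /F; congr EFin; rewrite expr0n /=; field.
- apply: continuous_subspaceT => x; apply: cvgD; first exact: cvg_cst.
  by apply: cvgM; [exact: cvg_id|exact: cvg_cst].
- by split; [by move=> x _; have [] := dF x| |]; [apply: cvg_at_right_filter | apply: cvg_at_left_filter]; exact: cF.
- by move=> t _; rewrite derive1E; have [_ ->] := dF t.
Qed.

Lemma int_log_affine (c a : R) : 0 < a < 1 ->
  (\int[mu]_(s in `[a, 1%R]) (- (ln s / 2) + (c + s / 2))%:E =
   (1 / 2 + c + 1 / 4 - (- (a * ln a - a) / 2 + c * a + a ^+ 2 / 4))%:E)%E.
Proof.
move=> /andP[a0 a1]; pose F (s : R) := - 2^-1 * (s * ln s - s) + (c * s + 4^-1 * s ^+ 2).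
have dF (s : R) : 0 < s -> is_derive s 1 F (- (ln s / 2) + (c + s / 2)).
  move=> s0; rewrite /F; have h := is_derive_sq s; have hl := is_derive1_ln s0.
  apply: is_derive_eq; rewrite /GRing.scale /=; field; by rewrite lt0r_neq0.
have cF (t : R) : 0 < t -> {for t, continuous F}.
  by move=> t0; apply: differentiable_continuous; apply/derivable1_diffP; have [] := dF t t0.
rewrite (@continuous_FTC2 R _ F) //.
- by rewrite -EFinB /F; congr EFin; rewrite ln1 expr1n; field.
- apply: continuous_in_subspaceT => x; rewrite inE /= in_itv /= => /andP[ax _].
  have x0 : 0 < x by exact: lt_le_trans ax.
  apply: cvgD; last by apply: cvgD; [exact: cvg_cst|apply: cvgM; [exact: cvg_id|exact: cvg_cst]].
  by apply: cvgN; apply: cvgM; [exact: continuous_ln|exact: cvg_cst].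
- split; [move=> x| |]; rewrite ?in_itv /=.
  + by move=> /andP[ax _]; have [] := dF x (lt_trans a0 ax).
  + by apply: cvg_at_right_filter; exact: cF.
  + by apply: cvg_at_left_filter; exact: cF.
- move=> t; rewrite in_itv /= => /andP[ta _]; rewrite derive1E.
  by have [_ ->] := dF t (lt_trans a0 ta).
Qed.

Lemma measurable_rad (a : R) : measurable_fun setT (rad a).
Proof.
apply: measurable_funD; last by apply: measurable_funD => //; apply: measurable_funM => //; exact: measurable_funD.
apply: measurableT_comp => //; apply: measurable_funM => //; apply: (measurableT_comp (@measurable_ln R)).
by apply: measurable_maxr.
Qed.

Lemma int_rad_ge1 (a : R) : 1 <= a ->
  (\int[mu]_(s in `[0%R, 1%R]) (rad a s)%:E = (- (ln a / 2) + (a / 2 + 1) + 1 / 4)%:E)%E.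
Proof.
move=> a1; have -> : - (ln a / 2) + (a / 2 + 1) + 1 / 4 = (- (ln a / 2) + (a / 2 + 1)) * 1 + 1 ^+ 2 / 4 by rewrite expr1n mulr1.
rewrite -int_affine //; apply: eq_integral => s; rewrite inE /= in_itv /= => /andP[s0 s1].
by rewrite /rad max_l ?(le_trans s1) //; congr EFin; by field.
Qed.

Lemma int_rad_lt1 (a : R) : 0 < a < 1 -> (\int[mu]_(s in `[0%R, 1%R]) (rad a s)%:E = (7 / 4)%:E)%E.
Proof.
move=> /andP[a0 a1].
have U : `[0%R, 1%R]%classic = `[0%R, a[%classic `|` `[a, 1%R]%classic :> set R.
  apply/seteqP; split=> s /=; rewrite !in_itv /=.
    by move=> /andP[-> ->]; case: (ltP s a); [left|right].
  by case=> /andP[h1 h2]; apply/andP; split; lra.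
have m1 : measurable (`[0%R, a[%classic : set (measurableTypeR R)) by exact: measurable_itv.
have m2 : measurable (`[a, 1%R]%classic : set (measurableTypeR R)) by exact: measurable_itv.
have mr (A : set R) : measurable_fun (A : set (measurableTypeR R)) (fun s => (rad a s)%:E).
  by apply/measurable_EFinP; apply: measurable_funTS; exact: measurable_rad.
rewrite U ge0_integral_setU //=; last 2 first.
- by move=> s [] /=; rewrite in_itv /= => /andP[h _]; rewrite lee_fin rad_ge0 //; apply: le_trans h; exact: ltW.
- by apply/disj_setPS => s [] /=; rewrite !in_itv /=; lra.
rewrite integral_itv_bndo_bndc; last exact: mr.
have -> : (\int[mu]_(s in `[0%R, a]) (rad a s)%:E = \int[mu]_(s in `[0%R, a]) ((- (ln a / 2) + (a / 2 + 1)) + s / 2)%:E)%E.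
  apply: eq_integral => s; rewrite inE /= in_itv /= => /andP[_ sa]; rewrite /rad max_l //; congr EFin; by field.
have -> : (\int[mu]_(s in `[a, 1%R]) (rad a s)%:E = \int[mu]_(s in `[a, 1%R]) (- (ln s / 2) + ((a / 2 + 1) + s / 2))%:E)%E.
  apply: eq_integral => s; rewrite inE /= in_itv /= => /andP[sa _]; rewrite /rad max_r //; congr EFin; by field.
rewrite int_affine // int_log_affine ?a0 // -EFinD; congr EFin; by field.
Qed.

(** Independent of [a]: the uniform measure is the equilibrium measure of the plane. The value is
    its energy [3 / 4] plus the 1 contained in [pot]. *)
Lemma int_rad (a : R) : 0 < a -> a <= 1 -> (\int[mu]_(s in `[0%R, 1%R]) (rad a s)%:E = (7 / 4)%:E)%E.
Proof.
move=> a0; rewrite le_eqVlt => /orP[/eqP ->|a1]; last by rewrite int_rad_lt1 ?a0.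
by rewrite int_rad_ge1 // ln1; congr EFin; by field.
Qed.

Lemma int_rad_ge (a : R) : 0 < a -> ((7 / 4)%:E <= \int[mu]_(s in `[0%R, 1%R]) (rad a s)%:E)%E.
Proof.
move=> a0; have [a1|a1] := leP a 1; first by rewrite int_rad.
by rewrite int_rad_ge1 ?(ltW a1) // lee_fin; have := ln_le_sub1 a0; lra.
Qed.

End RadialIntegrals.

(** * The disk potential by averaging over roots of unity *)

Section DiskPotential.
Variable R : realType.
Local Notation C := R[i].
Local Notation mu := (@lebesgue_measure R).
Local Notation L2 := (@L2 R).
Local Notation D := (@unit_disk R).

Definition lc (u v : C) : \bar R := if u == v then +oo%E else (- (ln (nsq (u - v)) / 2))%:E.

Lemma nsq_eq0 (u : C) : (nsq u == 0) = (u == 0).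
Proof. by case: u => a b; rewrite /nsq /= paddr_eq0 ?sqr_ge0 // !sqrf_eq0 eq_complex. Qed.

Lemma nsqB_gt0 (u v : C) : u != v -> 0 < nsq (u - v).
Proof. by move=> uv; rewrite lt_neqAle nsq_ge0 andbT eq_sym nsq_eq0 subr_eq0. Qed.

Lemma lc_cpx z w : lc (cpx z) (cpx w) = loginv z w.
Proof.
have [->|zw] := eqVneq z w; first by rewrite /lc /loginv !eqxx.
rewrite loginvE // /lc ifN //; apply: contra zw => /eqP; case: z w => a b [c d] [-> ->]; exact: eqxx.
Qed.

Lemma lc_square (u v : C) : (lc u v + lc u (- v)%R = lc (u ^+ 2)%R (v ^+ 2)%R)%E.
Proof.
have sq : (u ^+ 2 == v ^+ 2) = (u == v) || (u == - v) by rewrite eqf_sqr.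
rewrite /lc sq; case: eqVneq => [_|uv] /=; first by rewrite addye //; case: ifP.
case: eqVneq => [_|uv'] /=; first by rewrite addey.
rewrite -EFinD; congr EFin.
have -> : u ^+ 2 - v ^+ 2 = (u - v) * (u - - v) by rewrite opprK subr_sqr.
by rewrite nsqM lnM ?posrE ?nsqB_gt0 //; lra.
Qed.

(** The average of [kk z] over the rotations of [w] by the roots of unity of order [2 ^ k], written
    in closed form: the product of the differences is [z ^+ N - w ^+ N] with [N = 2 ^ k]. As [k]
    grows it approaches [rad]. *)
Definition Hk (z : R * R) (k : nat) (w : R * R) : \bar R :=
  ((2 ^- k)%:E * lc (cpx z ^+ (2 ^ k))%R (cpx w ^+ (2 ^ k))%R + (pot z w)%:E)%E.

Lemma Hk0 z w : Hk z 0 w = kk z w.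
Proof. by rewrite /Hk expr0 invr1 mul1e expn0 !expr1 lc_cpx. Qed.

Lemma average_identity (k : nat) (x y : \bar R) (p : R) : x != -oo%E -> y != -oo%E ->
  ((2 ^- k.+1)%:E * (x + y) + p%:E = 2^-1%:E * (((2 ^- k)%:E * x + p%:E) + ((2 ^- k)%:E * y + p%:E)))%E.
Proof.
have t0 j : (0 < (2 ^- j)%:E :> \bar R)%E by rewrite lte_fin invr_gt0 exprn_gt0.
have h0 : (0 < 2^-1%:E :> \bar R)%E by rewrite lte_fin invr_gt0.
have h (a b : R) : ((2 ^- k.+1)%:E * (a%:E + b%:E) + p%:E = 2^-1%:E * (((2 ^- k)%:E * a%:E + p%:E) + ((2 ^- k)%:E * b%:E + p%:E)))%E.
  apply: (congr1 EFin (x := 2 ^- k.+1 * (a + b) + p) (y := 2^-1 * ((2 ^- k * a + p) + (2 ^- k * b + p)))).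
  by rewrite exprS invfM; field; rewrite expf_neq0.
case: x y => [x||] [y||] // _ _.

- by rewrite addey // !gt0_muley // addye // addey // gt0_muley.
- by rewrite addye // !gt0_muley // addye // addye // gt0_muley.
- by rewrite addye // !gt0_muley // addye // addye // gt0_muley.
Qed.

Lemma lc_nN u v : lc u v != -oo%E. Proof. by rewrite /lc; case: ifP. Qed.

Lemma Hk_avg z k (rho : C) w : rho ^+ (2 ^ k) = -1 -> nsq rho = 1 ->
  (Hk z k.+1 w = 2^-1%:E * (Hk z k w + Hk z k (rotc rho w)))%E.
Proof.
move=> rN r1; rewrite /Hk /pot cpx_rotc [(rho * _) ^+ _]exprMn rN mulN1r sqmod_rotc //.
by rewrite -average_identity ?lc_nN // lc_square -!exprM expnS mulnC.
Qed.

Lemma Hk_ge0 z k w : (0 <= Hk z k w)%E.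
Proof.
elim: k w => [|k IH] w; first by rewrite Hk0 kk_ge0.
have [rho [rN r1]] := @exists_rotation R (2 ^ k)%N ltac:(by rewrite expn_gt0).
by rewrite (Hk_avg z w rN r1) mule_ge0 ?lee_fin ?invr_ge0 // adde_ge0.
Qed.

Lemma measurable_Hk z k : measurable_fun setT (Hk z k).
Proof.
elim: k => [|k IH]; first by rewrite (_ : Hk z 0 = kk z); [exact: measurable_kk1|apply/funext => w; exact: Hk0].
have [rho [rN r1]] := @exists_rotation R (2 ^ k)%N ltac:(by rewrite expn_gt0).
rewrite (_ : Hk z k.+1 = fun w => 2^-1%:E * (Hk z k w + Hk z k (rotc rho w)))%E; last by apply/funext => w; exact: Hk_avg.
apply: emeasurable_funM => //; apply: emeasurable_funD => //.
by have [mf _] := mpres_rotc r1; exact: (measurableT_comp IH mf).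
Qed.

Lemma measurable_unit_disk : measurable D.
Proof.
rewrite (_ : D = setT `&` (@sqmod R) @^-1` `]-oo, 1[%classic).
  exact: measurable_sqmod.
by apply/seteqP; split => z /=; rewrite /unit_disk /= in_itv /= => // -[].
Qed.

(** Rotations preserve the disk and its measure, so averaging over them does not change the
    integral. *)
Lemma int_Hk z k : (\int[L2]_(w in D) Hk z k w = \int[L2]_(w in D) kk z w)%E.
Proof.
have mD := measurable_unit_disk.
elim: k => [|k IH]; first by apply: eq_integral => w _; rewrite Hk0.
have [rho [rN r1]] := @exists_rotation R (2 ^ k)%N ltac:(by rewrite expn_gt0).
have mH := measurable_Hk z k; have [mf _] := mpres_rotc r1.
rewrite -IH; under eq_integral do rewrite (Hk_avg z _ rN r1).
have mHr : measurable_fun setT (fun w => Hk z k (rotc rho w)) by exact: (measurableT_comp mH mf).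
rewrite ge0_integralZl //; first last.
- by move=> w _; rewrite adde_ge0 ?Hk_ge0.
- by apply: emeasurable_funD; apply: measurable_funTS.
rewrite ge0_integralD //; first last.
- exact: measurable_funTS.
- by move=> w _; exact: Hk_ge0.
- exact: measurable_funTS.
- by move=> w _; exact: Hk_ge0.
have -> : (\int[L2]_(w in D) Hk z k (rotc rho w) = \int[L2]_(w in D) Hk z k w)%E.
  have {1}-> : D = rotc rho @^-1` D by apply/seteqP; split=> w; rewrite /unit_disk /= sqmod_rotc.
  apply: (mpres_int (mpres_rotc r1) mD) => [|w _]; [exact: measurable_funTS|exact: Hk_ge0].
have h0 : (0 <= \int[L2]_(w in D) Hk z k w)%E by apply: integral_ge0 => w _; exact: Hk_ge0.
rewrite ge0_muleDr // -ge0_muleDl ?lee_fin ?invr_ge0 // -EFinD.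
have -> : 2^-1 + 2^-1 = 1 :> R by field.
exact: mul1e.
Qed.

Lemma L2_disk_radial (h : R -> \bar R) : measurable_fun setT h -> (forall s, (0 <= h s)%E) ->
  (\int[L2]_(w in D) h (sqmod w) = pi%:E * \int[mu]_(s in `[0%R, 1%R]) h s)%E.
Proof.
move=> mh h0; pose B : set R := `]-oo, 1[%classic.
have mB : measurable B by exact: measurable_itv.
have mBt : measurable (B : set (measurableTypeR R)) by exact: measurable_itv.
have m0 : measurable (`[0%R, +oo[%classic : set (measurableTypeR R)) by exact: measurable_itv.
have mh' : measurable_fun setT (h \_ B) by apply/(measurable_restrictT _ _).1 => //; exact: measurable_funTS.
have h0' s : (0 <= (h \_ B) s)%E by rewrite /patch; case: ifP.
have := L2_radial mh' h0'.
have -> : (\int[L2]_z (h \_ B) (sqmod z) = \int[L2]_(w in D) h (sqmod w))%E.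
  rewrite [RHS]integral_mkcond; apply: eq_integral => z _; rewrite /patch.
  by congr (if _ then _ else _); apply/idP/idP => /set_mem H; apply/mem_set; move: H; rewrite /B /unit_disk /= in_itv.
move=> ->; congr (_ * _)%E.
have -> : (\int[mu]_(s in `[0%R, +oo[) (h \_ B) s = \int[mu]_(s in `[0%R, 1%R[) h s)%E.
  rewrite [LHS]integral_mkcond [RHS]integral_mkcond; apply: eq_integral => s _; rewrite /patch.
  have -> : (s \in `[0%R, 1%R[%classic) = (s \in `[0%R, +oo[%classic) && (s \in B).
    apply/idP/andP => [/set_mem /=|[/set_mem /= + /set_mem]]; rewrite ?in_itv /=.
      by move=> /andP[s0 s1]; split; apply/mem_set; rewrite /B /= in_itv /= ?s0.
    by rewrite /B /= in_itv andbT => s0 s1; apply/mem_set; rewrite /= in_itv /= s0.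
  by case: (s \in _).
by rewrite integral_itv_bndo_bndc //; have : measurable_fun (`[0%R, 1%R[%classic : set R) h by exact: measurable_funTS.
Qed.

Lemma nsqB_le (u v : C) : nsq (u - v) <= 2 * (nsq u + nsq v).
Proof.
case: u v => a b [c d]; rewrite /nsq /=; have := sqr_ge0 (a + c); have := sqr_ge0 (b + d).
by rewrite !sqrrB !sqrrD; lra.
Qed.

Lemma nsqB_ge (u v : C) (p q : R) : 0 <= p -> 0 <= q -> nsq u = p ^+ 2 -> nsq v = q ^+ 2 -> (p - q) ^+ 2 <= nsq (u - v).
Proof.
move=> p0 q0; case: u v => a b [c d]; rewrite /nsq /= => ab cd.
have cs : a * c + b * d <= p * q.
  apply: (le_trans (ler_norm _)); rewrite -(ler_pXn2r (n := 2)) ?nnegrE ?mulr_ge0 // real_normK ?num_real //.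
  rewrite exprMn -ab -cd; have := sqr_ge0 (a * d - b * c); rewrite -subr_ge0 => h.
  have -> : (a ^+ 2 + b ^+ 2) * (c ^+ 2 + d ^+ 2) - (a * c + b * d) ^+ 2 = (a * d - b * c) ^+ 2 by ring.
  exact: h.
have -> : (a - c) ^+ 2 + (b - d) ^+ 2 = (a ^+ 2 + b ^+ 2) + (c ^+ 2 + d ^+ 2) - 2 * (a * c + b * d) by ring.
have -> : (p - q) ^+ 2 = p ^+ 2 + q ^+ 2 - 2 * (p * q) by ring.
by rewrite ab cd; lra.
Qed.

Lemma Hk_lower z k w : 0 < sqmod z ->
  ((rad (sqmod z) (sqmod w))%:E <= Hk z k w + (2 ^- k * (ln 4 / 2))%:E)%E.
Proof.
move=> z0; rewrite /Hk /lc; set N := (2 ^ k)%N; have p0 : 0 < (2 ^- k : R) by rewrite invr_gt0 exprn_gt0.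
case: eqVneq => [_|uv]; first by rewrite gt0_muley ?lte_fin //; exact: leey.
apply: (@le_trans _ _ (2 ^- k * - (ln (nsq (cpx z ^+ N - cpx w ^+ N)) / 2) + pot z w + 2 ^- k * (ln 4 / 2))%:E); last by [].
rewrite lee_fin /rad /pot; set m := Num.max _ _.
have m0 : 0 < m by rewrite lt_max z0.
have le : nsq (cpx z ^+ N - cpx w ^+ N) <= 4 * m ^+ N.
  apply: le_trans (nsqB_le _ _) _; rewrite !nsqX !nsq_cpx.
  have h1 : sqmod z ^+ N <= m ^+ N by apply: lerXn2r; rewrite ?nnegrE ?sqmod_ge0 ?(ltW m0) // le_max lexx.
  have h2 : sqmod w ^+ N <= m ^+ N by apply: lerXn2r; rewrite ?nnegrE ?sqmod_ge0 ?(ltW m0) // le_max lexx orbT.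
  lra.
have : ln (nsq (cpx z ^+ N - cpx w ^+ N)) <= ln 4 + N%:R * ln m.
  rewrite mulr_natl -lnXn // -lnM ?posrE ?exprn_gt0 // ler_ln ?posrE ?nsqB_gt0 ?mulr_gt0 ?exprn_gt0 //.
move: (ln _) => l; rewrite /N natrX => h.
have : 2 ^- k * l <= 2 ^- k * ln 4 + ln m.
  by apply: le_trans (ler_wpM2l (ltW p0) h) _; rewrite mulrDr mulrA mulVf ?mul1r // expf_neq0.
lra.
Qed.

Lemma pow_diff_ge (a s : R) (m : nat) : 0 <= s -> s <= a -> a <= 1 -> (0 < m)%N -> a ^+ m * (a - s) <= a ^+ m - s ^+ m.
Proof.
move=> s0 sa a1; have a0 := le_trans s0 sa; case: m => // m _.
apply: (@le_trans _ _ (a ^+ m * (a - s))).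
  by rewrite ler_wpM2r ?subr_ge0 // exprS ler_piMl ?exprn_ge0.
by rewrite mulrBr -exprSr lerB // exprSr; apply: ler_pM; rewrite ?exprn_ge0 //; apply: lerXn2r; rewrite ?nnegrE.
Qed.

Lemma Hk_upper z k w : 0 < sqmod z -> sqmod z <= 1 -> sqmod w <= 1 ->
  (Hk z k.+1 w <= (rad (sqmod z) (sqmod w))%:E + (2 ^- k.+1)%:E * logsing (sqmod z) (sqmod w))%E.
Proof.
move=> z0 z1 w1; have p0 : 0 < (2 ^- k.+1 : R) by rewrite invr_gt0 exprn_gt0.
rewrite /logsing; case: eqVneq => [_|zw]; first by rewrite gt0_muley ?lte_fin // addey // leey.
set a := sqmod z in z0 z1 zw *; set s := sqmod w in w1 zw *; have s0 : 0 <= s by exact: sqmod_ge0.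
set m := Num.max a s; have m0 : 0 < m by rewrite lt_max z0.
pose M := (2 ^ k)%N; have M0 : (0 < M)%N by rewrite expn_gt0.
have NE : (2 ^ k.+1 = M * 2)%N by rewrite /M expnS mulnC.
have d0 : 0 < `|a - s| by rewrite normr_gt0 subr_eq0.
(* The order [2 ^ k.+1] is even, so the powers have moduli [a ^+ M] and [s ^+ M]; in the unit disk
   these differ by at least [m ^+ M * |a - s|]. *)
have ge : (m ^+ M * `|a - s|) ^+ 2 <= nsq (cpx z ^+ (2 ^ k.+1) - cpx w ^+ (2 ^ k.+1)).
  apply: (@le_trans _ _ ((a ^+ M - s ^+ M) ^+ 2)); last first.
    apply: nsqB_ge; rewrite ?exprn_ge0 ?(ltW z0) //; by rewrite nsqX nsq_cpx NE exprM.
  rewrite -[leRHS]real_normK ?num_real //; apply: lerXn2r; rewrite ?nnegrE ?mulr_ge0 ?exprn_ge0 ?(ltW m0) //.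
  rewrite /m; case: (leP a s) => h.
    rewrite distrC [leRHS]distrC ger0_norm ?subr_ge0 //.
    by apply: le_trans (pow_diff_ge (ltW z0) h w1 M0) _; exact: ler_norm.
  rewrite [`|a - s|]ger0_norm ?subr_ge0 ?(ltW h) //.
  by apply: le_trans (pow_diff_ge s0 (ltW h) z1 M0) _; exact: ler_norm.
have q0 : 0 < m ^+ M * `|a - s| by rewrite mulr_gt0 ?exprn_gt0.
have n0 := lt_le_trans (exprn_gt0 2 q0) ge.
have uv : cpx z ^+ (2 ^ k.+1) != cpx w ^+ (2 ^ k.+1).
  by apply/eqP => e; move: n0; rewrite e subrr (_ : nsq 0 = 0) ?ltxx //; apply/eqP; rewrite nsq_eq0.
rewrite /Hk /lc (negbTE uv) -!EFinM -!EFinD lee_fin /rad /pot -/a -/s -/m.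
have : 2 * (M%:R * ln m + ln `|a - s|) <= ln (nsq (cpx z ^+ (2 ^ k.+1) - cpx w ^+ (2 ^ k.+1))).
  rewrite mulr_natl -[M%:R * _]/(M%:R * ln m) mulr_natl -lnXn // -lnM ?posrE ?exprn_gt0 //.
  by rewrite -lnXn // ler_ln ?posrE // exprn_gt0.
move: (ln (nsq _)) => l h.
have := ler_wpM2l (ltW p0) h.
have -> : 2 ^- k.+1 * (2 * (M%:R * ln m + ln `|a - s|)) = ln m + 2 * (2 ^- k.+1 * ln `|a - s|).
  by rewrite /M natrX exprS; field; rewrite expf_neq0.
lra.
Qed.

Lemma measurable_logsing (a : R) : measurable_fun setT (logsing a).
Proof.
rewrite (_ : logsing a = fun s => if s \in [set a] then +oo%E else (- ln `|a - s|)%:E).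
  apply: measurable_fun_ifT => //.
    apply: (@measurable_fun_bool _ _ _ _ true); rewrite setTI (_ : _ @^-1` _ = [set a]); first exact: measurable_set1.
    by apply/seteqP; split=> s /=; [move/set_mem|move=> ->; apply/mem_set].
  apply/measurable_EFinP; apply: measurableT_comp => //; apply: (measurableT_comp (@measurable_ln R)).
  by apply: measurableT_comp => //; exact: measurable_funB.
apply/funext => s; rewrite /logsing eq_sym; case: eqVneq => [->|/eqP sa]; first by rewrite mem_set.
by rewrite memNset.
Qed.

Lemma logsing_ge0 (a s : R) : 0 <= a <= 1 -> 0 <= s <= 1 -> (0 <= logsing a s)%E.
Proof.
move=> /andP[a0 a1] /andP[s0 s1]; rewrite /logsing; case: eqVneq => // _; rewrite lee_fin oppr_ge0 ln_le0 //.
by rewrite ler_norml; apply/andP; split; lra.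
Qed.

Lemma measurable_radz (a : R) : measurable_fun setT (fun s : R => (rad a s)%:E).
Proof. by apply/measurable_EFinP; exact: measurable_rad. Qed.

Lemma int_disk_rad (a : R) : 0 < a ->
  (\int[L2]_(w in D) (rad a (sqmod w))%:E = pi%:E * \int[mu]_(s in `[0%R, 1%R]) (rad a s)%:E)%E.
Proof.
move=> a0; pose h (s : R) : \bar R := (rad a `|s|)%:E.
have mh : measurable_fun setT h by apply: (measurableT_comp (measurable_radz a)).
have := L2_disk_radial mh (fun s => _ : (0 <= h s)%E); rewrite /h => H.
transitivity (\int[L2]_(w in D) (rad a `|sqmod w|)%:E)%E.
  by apply: eq_integral => w _; rewrite ger0_norm ?sqmod_ge0.
rewrite H; last by move=> s; rewrite lee_fin rad_ge0.
by congr (_ * _)%E; apply: eq_integral => s; rewrite inE /= in_itv /= => /andP[s0 _]; rewrite ger0_norm.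
Qed.

Lemma L2_unit_disk : L2 D = pi%:E.
Proof.
have := @L2_disk_radial (fun=> 1%E) (measurable_cst _) (fun=> lee01).
rewrite !integral_cst ?mul1e /=; [|exact: measurable_itv|exact: measurable_unit_disk].
by rewrite lebesgue_measure_itv /= lte_fin ltr01 oppr0 adde0 mule1.
Qed.

Lemma int_disk_kk_ge z : 0 < sqmod z -> ((pi * (7 / 4))%:E <= \int[L2]_(w in D) kk z w)%E.
Proof.
move=> z0; have mD := measurable_unit_disk.
apply/lee_addgt0Pr => e e0.
pose c : R := ln 4 / 2; have c0 : 0 <= c by rewrite divr_ge0 // ln_ge0 // ler1n.
have [k ke] : exists k : nat, 2 ^- k * c * pi <= e.
  have h : `|2^-1 : R| < 1 by rewrite ger0_norm // invf_lt1 // ltr1n.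
  have h2 : (c * pi) * 2^-1 ^+ k @[k --> \oo] --> (c * pi) * (0 : R) by apply: cvgM; [exact: cvg_cst|exact: cvg_expr].
  rewrite mulr0 in h2; have /cvgr0Pnorm_lt /(_ e e0) [k _ kP] := h2; exists k.
  by apply: le_trans (ltW (kP k (leqnn k))); apply: le_trans (ler_norm _); rewrite exprVn mulrC mulrA [leRHS]mulrC; lra.
apply: (@le_trans _ _ (\int[L2]_(w in D) (rad (sqmod z) (sqmod w))%:E)%E).
  by rewrite int_disk_rad // EFinM lee_wpmul2l ?lee_fin ?pi_ge0 // int_rad_ge.
apply: (@le_trans _ _ (\int[L2]_(w in D) (Hk z k w + (2 ^- k * c)%:E))%E).
  by apply: le_integral_nomeas => w _; rewrite lee_fin rad_ge0 ?sqmod_ge0 //=; exact: Hk_lower.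
have kc0 : 0 <= 2 ^- k * c by rewrite mulr_ge0 // invr_ge0 exprn_ge0.
rewrite ge0_integralD //; first last.
- by apply: measurable_funTS; exact: measurable_Hk.
- by move=> w _; exact: Hk_ge0.
have ic : (\int[L2]_(w in D) (2 ^- k * c)%:E = (2 ^- k * c)%:E * pi%:E)%E.
  by rewrite integral_cst //; congr (_ * _)%E; exact: L2_unit_disk.
by rewrite int_Hk leeD2l // ic -EFinM lee_fin; exact: ke.
Qed.

Lemma int_disk_kk z : 0 < sqmod z -> sqmod z <= 1 -> (\int[L2]_(w in D) kk z w = (pi * (7 / 4))%:E)%E.
Proof.
move=> z0 z1; apply/eqP; rewrite eq_le int_disk_kk_ge // andbT.
have mD := measurable_unit_disk.
apply/lee_addgt0Pr => e e0; set a := sqmod z in z0 z1 *.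
have [k ke] : exists k : nat, 2 ^- k.+1 * (pi * 4) <= e.
  have h : `|2^-1 : R| < 1 by rewrite ger0_norm // invf_lt1 // ltr1n.
  have h2 : (pi * 4) * 2^-1 ^+ k @[k --> \oo] --> (pi * 4) * (0 : R) by apply: cvgM; [exact: cvg_cst|exact: cvg_expr].
  rewrite mulr0 in h2; have /cvgr0Pnorm_lt /(_ e e0) [k _ kP] := h2; exists k.
  by apply: le_trans (ltW (kP k.+1 (leqnSn k))); apply: le_trans (ler_norm _); rewrite exprVn mulrC.
have a01 : 0 <= a <= 1 by rewrite (ltW z0).
(* [logsing] becomes negative far from [a]; cut to the unit interval it is nonnegative
   everywhere. *)
pose h (s : R) : \bar R := if (0 <= s <= 1) then logsing a s else 0%E.
have mh : measurable_fun setT h.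
  apply: measurable_fun_ifT => //; last exact: measurable_logsing.
  by apply: measurable_and; exact: measurable_fun_ler.
have h0 s : (0 <= h s)%E by rewrite /h; case: ifP => // s01; exact: logsing_ge0.
rewrite -(int_Hk z k.+1).
apply: (@le_trans _ _ (\int[L2]_(w in D) ((rad a (sqmod w))%:E + (2 ^- k.+1)%:E * h (sqmod w)))%E).
  apply: le_integral_nomeas => w Dw; rewrite Hk_ge0 /=.
  have w1 : sqmod w <= 1 by exact: ltW.
  by rewrite /h sqmod_ge0 w1; exact: Hk_upper.
have p0 : 0 <= (2 ^- k.+1 : R) by rewrite invr_ge0 exprn_ge0.
have mr : measurable_fun D (fun w => (rad a (sqmod w))%:E).
  by apply: measurable_funTS; exact: (measurableT_comp (measurable_radz a) (@measurable_sqmod R)).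
have mhs : measurable_fun D (fun w => h (sqmod w)).
  by apply: measurable_funTS; exact: (measurableT_comp mh (@measurable_sqmod R)).
rewrite ge0_integralD //; first last.
- exact: emeasurable_funM.
- by move=> w _; rewrite mule_ge0 // lee_fin.
- by move=> w _; rewrite lee_fin rad_ge0 // sqmod_ge0.
rewrite int_disk_rad // int_rad // -EFinM leeD2l //.
rewrite ge0_integralZl //.
rewrite L2_disk_radial //; apply: (@le_trans _ _ ((2 ^- k.+1)%:E * (pi%:E * 4%:E))%E); last by rewrite -!EFinM lee_fin.
rewrite lee_wpmul2l ?lee_fin // lee_wpmul2l ?lee_fin ?pi_ge0 //.
apply: le_trans (log_singularity a01); apply: le_integral_nomeas => s /=; rewrite in_itv /= => s01.
by rewrite h0 /h s01 /=.
Qed.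

End DiskPotential.

(** * The uniform probability on the disk *)

Section Restriction.
Variable R : realType.
Local Notation prob := (probability (R * R)%type R).
Local Notation D := (@unit_disk R).
Local Notation L2 := (@L2 R).

Lemma int_mrestr d (T : measurableType d) (m : {measure set T -> \bar R}) (K : set T) (mK : measurable K)
  (f : T -> \bar R) : measurable_fun setT f -> (forall x, (0 <= f x)%E) ->
  (\int[mrestr m mK]_x f x = \int[m]_(x in K) f x)%E.
Proof.
move=> mf f0; rewrite (@ge0_negligible_integral _ _ _ _ setT (~` K)) //; last 2 first.
- exact: measurableC.
- by rewrite -[LHS]/(m (~` K `&` K)) setICl measure0.
rewrite setTD setCK; apply: eq_measure_integral => A mA AK.
by rewrite -[LHS]/(m (A `&` K)) setIidl.
Qed.

Lemma normalized_restriction (m : {measure set (R * R) -> \bar R}) (K : set (R * R)) (c : R) :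
  measurable K -> m K = c%:E -> 0 < c -> exists mu : prob,
    (forall A, mu A = (c^-1)%:E * m (A `&` K))%E /\
    (forall f, measurable_fun setT f -> (forall x, (0 <= f x)%E) ->
       \int[mu]_x f x = (c^-1)%:E * \int[m]_(x in K) f x)%E.
Proof.
move=> mK mKc c0; have c1 : 0 <= c^-1 by rewrite invr_ge0 ltW.
pose nu := mscale (NngNum c1) (mrestr m mK).
have nuE A : nu A = ((c^-1)%:E * m (A `&` K))%E by [].
have nuT : nu setT = 1%E by rewrite nuE setTI mKc -EFinM mulVf ?gt_eqF.
pose mu : prob := HB.pack (mscale (NngNum c1) (mrestr m mK)) (Measure_isProbability.Build _ _ R nu nuT).
exists mu; split=> [A|f mf f0]; first by rewrite -nuE.
rewrite -[LHS]/(\int[nu]_x f x)%E ge0_integral_mscale //.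
by rewrite int_mrestr.
Qed.

Lemma exists_uniform_disk : exists mu : prob,
    (forall A, mu A = (pi^-1)%:E * L2 (A `&` D))%E /\
    (forall f, measurable_fun setT f -> (forall x, (0 <= f x)%E) ->
       \int[mu]_x f x = (pi^-1)%:E * \int[L2]_(x in D) f x)%E.
Proof. exact: (normalized_restriction (@measurable_unit_disk R) (L2_unit_disk R) (pi_gt0 R)). Qed.

Definition lam : prob := projT1 (cid exists_uniform_disk).

Lemma lamE A : lam A = ((pi^-1)%:E * L2 (A `&` D))%E.
Proof. by rewrite /lam; case: cid => mu [] /=. Qed.

Lemma int_lam f : measurable_fun setT f -> (forall x, (0 <= f x)%E) ->
  (\int[lam]_x f x = (pi^-1)%:E * \int[L2]_(x in D) f x)%E.
Proof. by rewrite /lam; case: cid => mu [] /= _ H; exact: H. Qed.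

Lemma kpot_lam_ge z : 0 < sqmod z -> ((7 / 4)%:E <= kpot lam z)%E.
Proof.
move=> z0; have p0 := pi_gt0 R.
rewrite /kpot int_lam //; [|exact: measurable_kk1|exact: kk_ge0].
have -> : (7 / 4)%:E = ((pi^-1)%:E * (pi * (7 / 4))%:E)%E :> \bar R by rewrite -EFinM mulKf // gt_eqF.
by rewrite lee_wpmul2l ?lee_fin ?invr_ge0 ?(ltW p0) //; exact: int_disk_kk_ge.
Qed.

Lemma kpot_lam z : 0 < sqmod z -> sqmod z <= 1 -> kpot lam z = (7 / 4)%:E.
Proof.
move=> z0 z1; have p0 := pi_gt0 R.
rewrite /kpot int_lam //; [|exact: measurable_kk1|exact: kk_ge0].
by rewrite int_disk_kk // -EFinM mulKf // gt_eqF.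
Qed.

Lemma sqmod_eq0 (z : R * R) : sqmod z = 0 -> z = 0.
Proof.
by move=> z0; apply/eqP; rewrite -sqmodB_eq0 subr0 z0.
Qed.

Lemma sqmod_gt0 (z : R * R) : z <> 0 -> 0 < sqmod z.
Proof. by move=> z0; rewrite lt_neqAle sqmod_ge0 andbT eq_sym; apply/eqP => /sqmod_eq0. Qed.

Lemma measurable_zero : measurable [set (0 : R * R)].
Proof. by apply: closed_R2_measurable; apply: compact_closed; [exact: hausdorff_R2|exact: compact_set1]. Qed.

Lemma lam0 : lam [set 0] = 0%E.
Proof.
have m0 := measurable_zero.
have : (lam [set 0%R] <= (pi^-1)%:E * L2 [set z : R * R | (sqmod z <= 0)%R])%E.
  rewrite lamE lee_wpmul2l ?lee_fin ?invr_ge0 ?pi_ge0 //; apply: le_measure.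
  - by rewrite inE; apply: measurableI => //; exact: measurable_unit_disk.
  - by rewrite inE; exact: measurable_disc.
  - by move=> z [-> _] /=; rewrite /sqmod /= expr0n addr0.
by rewrite L2_disc // mulr0 mule0 measure_le0 => /eqP.
Qed.

Lemma null_setU (mu : {measure set (R * R) -> \bar R}) (A B : set (R * R)) : measurable A -> measurable B ->
  mu A = 0%E -> mu B = 0%E -> mu (A `|` B) = 0%E.
Proof.
by move=> mA mB A0 B0; exact: (etrans (measureU0 mA mB B0) A0).
Qed.

Lemma ae_int_le (mu : {measure set (R * R) -> \bar R}) (N : set (R * R)) (f g : R * R -> \bar R) : measurable N -> mu N = 0%E ->
  (forall z, (0 <= f z)%E) -> measurable_fun setT f -> measurable_fun setT g -> (forall z, (0 <= g z)%E) ->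
  (forall z, ~ N z -> (f z <= g z)%E) -> (\int[mu]_z f z <= \int[mu]_z g z)%E.
Proof.
move=> mN N0 f0 mf mg g0 fg.
rewrite (@ge0_negligible_integral _ _ _ _ setT N f) // (@ge0_negligible_integral _ _ _ _ setT N g) //.
by apply: le_integral_nomeas => z [_ Nz]; rewrite f0 fg.
Qed.

Lemma lamC : lam (~` D) = 0%E.
Proof. by rewrite lamE setICl measure0 mule0. Qed.

Lemma J_lam : (J lam lam <= (7 / 4)%:E)%E.
Proof.
rewrite -[leRHS](int_cst_prob lam (7 / 4)%:E) /J.
have m0 := measurable_zero.
have mN : measurable ([set (0 : R * R)] `|` ~` D).
  by apply: measurableU => //; apply: measurableC; exact: measurable_unit_disk.
apply: (ae_int_le mN) => //.
- by apply: null_setU => //; [apply: measurableC; exact: measurable_unit_disk|exact: lam0|exact: lamC].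
- by move=> z; exact: kpot_ge0.
- exact: measurable_kpot.
- move=> z /not_orP[z0 /contrapT zD]; rewrite kpot_lam //; first exact: sqmod_gt0.
  exact: ltW.
Qed.

Lemma int_lam_sqmod : (\int[lam]_z (sqmod z)%:E <= 1)%E.
Proof.
rewrite -[leRHS](int_cst_prob lam 1%E).
apply: (ae_int_le (measurableC (@measurable_unit_disk R))) => //; last by move=> z /contrapT; rewrite lee_fin; exact: ltW.
- exact: lamC.
- by move=> z; rewrite lee_fin sqmod_ge0.
- by apply/measurable_EFinP; exact: measurable_sqmod.
Qed.

Lemma compact_disk (t : R * R) (r : R) : compact [set z : R * R | sqmod (z - t) <= r].
Proof.
pose B := Num.sqrt r.
have sub : [set z : R * R | sqmod (z - t) <= r] `<=` `[t.1 - B, t.1 + B]%classic `*` `[t.2 - B, t.2 + B]%classic.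
  move=> z /= h; have r0 : 0 <= r by exact: le_trans (sqmod_ge0 _) h.
  have [] := @norm_le_sqmod R (z - t) B; rewrite ?sqr_sqrtr ?sqrtr_ge0 //.
  rewrite /= !ler_norml => /andP[a1 a2] /andP[b1 b2]; rewrite /= !in_itv /=.
  by split; apply/andP; split; lra.
apply: (subclosed_compact _ _ sub).
  have cs : continuous (fun z : R * R => sqmod (z - t)).
    move=> z; apply: (@continuous_comp _ _ _ (fun u : R * R => u - t) (@sqmod R)); last exact: continuous_sqmod.
    by apply: cvgB; [exact: cvg_id|exact: cvg_cst].
  by have := closed_comp (fun z _ => cs z) (@closed_le R r).
by apply: compact_setX; exact: segment_compact.
Qed.

(** Finite-energy measures exist in every unit disk. They serve as competitors away from the hole
    and show that no unit disk is contained in a polar set. *)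
Lemma uniform_translate (t : R * R) : exists mu : prob,
  (J mu mu < +oo)%E /\ cpt_supported_in mu [set z | sqmod (z - t) <= 1].
Proof.
pose T (z : R * R) := z + t; have [mT _] : mpres T := mpres_shift t.
pose Tm : {mfun (R * R)%type >-> (R * R)%type} := HB.pack T (isMeasurableFun.Build _ _ _ _ T mT).
pose mu : prob := distribution lam Tm.
have intmu (F : R * R -> \bar R) : measurable_fun setT F -> (forall z, (0 <= F z)%E) ->
    (\int[mu]_z F z = \int[lam]_z F (T z))%E.
  move=> mF F0; rewrite -[LHS]/(\int[pushforward lam T]_(z in setT) F z)%E.
  by rewrite (ge0_integral_pushforward mT) //= => z _; exact: F0.
exists mu; split; last first.
  exists [set z | sqmod (z - t) <= 1]; split => //; first exact: compact_disk.
  apply: (@subset_measure0 _ _ _ lam _ (~` D)); [| |by move=> z; rewrite /T /= addrK => h; apply: contra_not h => /ltW|exact: lamC].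
    have mK : measurable [set z : R * R | sqmod (z - t) <= 1].
      by apply: closed_R2_measurable; apply: compact_closed; [exact: hausdorff_R2|exact: compact_disk].
    by rewrite -[X in measurable X]setTI; exact: (mT measurableT _ (measurableC mK)).
  by apply: measurableC; exact: measurable_unit_disk.
(* Translation leaves the logarithm unchanged; the other terms bound the change of [pot]. *)
pose g (z w : R * R) := (kk z w + ((sqmod z + sqmod w)%:E + (2 * sqmod t)%:E))%E.
have kg z w : (kk (T z) (T w) <= g z w)%E.
  have [->|zw] := eqVneq z w; first by rewrite /g (kk_diag w) [leRHS]addye // leey.
  rewrite /g kk_neq; last by apply: contra zw => /eqP /addIr ->.
  rewrite kk_neq // -!EFinD lee_fin (_ : T z - T w = z - w); last by rewrite /T opprD addrACA subrr addr0.
  rewrite /pot /T; have h (u : R * R) : sqmod (u + t) <= 2 * (sqmod u + sqmod t).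
    by have := sqmodB_le u (- t); rewrite opprK sqmodN.
  by have := h z; have := h w; have := sqmod_ge0 z; have := sqmod_ge0 w; lra.
have -> : J mu mu = iint2 lam lam (fun z w => kk (T z) (T w)).
  rewrite /J intmu; [|exact: measurable_kpot|exact: kpot_ge0].
  by apply: eq_integral => z _; rewrite /kpot intmu //; [exact: measurable_kk1|exact: kk_ge0].
have [p ip] : exists p, (\int[lam]_z (sqmod z)%:E = p%:E)%E.
  exists (fine (\int[lam]_z (sqmod z)%:E)); rewrite fineK // ge0_fin_numE; last first.
    by apply: integral_ge0 => z _; rewrite lee_fin sqmod_ge0.
  by apply: le_lt_trans int_lam_sqmod _; rewrite ltry.
apply: (@le_lt_trans _ _ (iint2 lam lam g)).
  by apply: iint2_le => z w; [exact: kk_ge0|exact: kg].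
have ms : measurable_fun setT (fun p : (R * R) * (R * R) => (sqmod p.1 + sqmod p.2)%:E).
  apply/measurable_EFinP; apply: measurable_funD.
    exact: (measurableT_comp (@measurable_sqmod R) measurable_fst).
  exact: (measurableT_comp (@measurable_sqmod R) measurable_snd).
have c0 (z w : R * R) : (0 <= (2 * sqmod t)%:E)%E by rewrite lee_fin mulr_ge0 // sqmod_ge0.
have s0 (z w : R * R) : (0 <= (sqmod z + sqmod w)%:E)%E by rewrite lee_fin addr_ge0 ?sqmod_ge0.
have mc : measurable_fun setT (fun p : (R * R) * (R * R) => (2 * sqmod t)%:E) by exact: measurable_cst.
have g0 (z w : R * R) : (0 <= (sqmod z + sqmod w)%:E + (2 * sqmod t)%:E)%E by rewrite adde_ge0 ?s0 ?(c0 z w).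
rewrite (iint2D _ _ (@measurable_kk R) _ (@kk_ge0 R) g0); last exact: emeasurable_funD.
rewrite (iint2D _ _ ms mc s0 c0) (iint2_sqmod ip ip) iint2_cst -EFinD.
apply: (@le_lt_trans _ _ ((7 / 4)%:E + (p + p + 2 * sqmod t)%:E)%E); last by rewrite -EFinD ltry.
by rewrite leeD2r //; exact: J_lam.
Qed.

End Restriction.

(** * Balayage *)

Section Regularity.
Variable R : realType.
Local Notation prob := (probability (R * R)%type R).
Variable mu : prob.

Definition inner_closed (A : set (R * R)) := forall e : R, 0 < e -> exists F, [/\ closed F, F `<=` A & (mu (A `\` F) <= e%:E)%E].

Lemma inner_closed_self F : closed F -> inner_closed F.
Proof. by move=> cF e e0; exists F; split => //; rewrite setDv measure0 lee_fin ltW. Qed.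

Lemma inner_choice (A : nat -> set (R * R)) (e : R) : 0 < e -> (forall i, inner_closed (A i)) ->
  exists F : nat -> set (R * R), forall i, [/\ closed (F i), F i `<=` A i & (mu (A i `\` F i) <= (e / (2 ^ i.+1)%:R)%:E)%E].
Proof.
move=> e0 H; have /choice[F FP] : forall i, exists F, [/\ closed F, F `<=` A i & (mu (A i `\` F) <= (e / (2 ^ i.+1)%:R)%:E)%E].
  by move=> i; apply: H; rewrite divr_gt0 // ltr0n expn_gt0.
by exists F.
Qed.

Lemma measure_bigcup_le (B : nat -> set (R * R)) (A : set (R * R)) (e : R) : 0 <= e -> measurable A ->
  (forall i, measurable (B i)) -> A `<=` \bigcup_i B i -> (forall i, (mu (B i) <= (e / (2 ^ i.+1)%:R)%:E)%E) -> (mu A <= e%:E)%E.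
Proof.
move=> e0 mA mB AB Be; apply: (le_trans (@measure_sigma_subadditive _ R _ mu A B mB mA AB)).
apply: le_trans (epsilon_trick0 xpredT e0); apply: lee_nneseries => // i _; exact: Be.
Qed.

Lemma inner_closed_bigcap (A : nat -> set (R * R)) : (forall i, measurable (A i)) -> (forall i, inner_closed (A i)) ->
  inner_closed (\bigcap_i A i).
Proof.
move=> mA iA e e0; have [F FP] := inner_choice e0 iA.
have mF i : measurable (F i) by apply: closed_R2_measurable; case: (FP i).
exists (\bigcap_i F i); split.
- by apply: closed_bigI => i _; case: (FP i).
- by move=> z Fz i _; have [_ FA _] := FP i; apply: FA; exact: Fz.
- apply: (@measure_bigcup_le (fun i => A i `\` F i)) => //; first exact: ltW.
  + by apply: measurableD; apply: bigcapT_measurable.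
  + by move=> i; exact: measurableD.
  + move=> z [Az /existsNP[i /not_implyP[_ nF]]]; exists i => //; split => //; exact: Az.
  + by move=> i; case: (FP i).
Qed.

Lemma inner_closed_bigcup (A : nat -> set (R * R)) : (forall i, measurable (A i)) -> (forall i, inner_closed (A i)) ->
  inner_closed (\bigcup_i A i).
Proof.
move=> mA iA e e0; have e20 : 0 < e / 2 by rewrite divr_gt0.
have [F FP] := inner_choice e20 iA.
have mF i : measurable (F i) by apply: closed_R2_measurable; case: (FP i).
pose G n := \big[setU/set0]_(i < n) F i.
have mG n : measurable (G n) by apply: bigsetU_measurable.
have cG n : closed (G n).
  by rewrite /G; elim: n => [|n IH]; rewrite ?big_ord0 ?big_ord_recr /=; [exact: closed0|apply: closedU => //; case: (FP n)].
have mU : measurable (\bigcup_i A i) by exact: bigcupT_measurable.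
pose H n := \bigcup_i A i `\` G n.
have mH n : measurable (H n) by exact: measurableD.
have HI : \bigcap_n H n = \bigcup_i A i `\` \bigcup_i F i.
  apply/seteqP; split=> z.
    move=> Hz; split; first by have [] := Hz 0%N I.
    move=> [i _ Fz]; have [_] := Hz i.+1 I; apply; rewrite /G -bigcup_mkord; exists i => //=.
  move=> [Az nF] n _; split => //; rewrite /G -bigcup_mkord => -[i _ Fz]; apply: nF; by exists i.
have cv : (mu \o H) n @[n --> \oo] --> mu (\bigcap_n H n).
  apply: nonincreasing_cvg_mu => //.
  - by apply: le_lt_trans (probability_le1 _ _) _; rewrite ?ltry.
  - exact: bigcapT_measurable.
  - by move=> n m nm; apply/subsetPset; apply: setDS; rewrite /G -!bigcup_mkord; apply: bigcup_subset => i /= /leq_trans; exact.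
have le2 : (mu (\bigcap_n H n) <= (e / 2)%:E)%E.
  rewrite HI; apply: (@measure_bigcup_le (fun i => A i `\` F i)) => //; first exact: ltW.
  - by apply: measurableD => //; exact: bigcupT_measurable.
  - by move=> i; exact: measurableD.
  - move=> z [[i _ Az] nF]; exists i => //; split => // Fz; apply: nF; by exists i.
  - by move=> i; case: (FP i).
have lt : (mu (\bigcap_n H n) < e%:E)%E by apply: le_lt_trans le2 _; rewrite lte_fin; lra.
have [n nP] : exists n, (mu (H n) < e%:E)%E.
  apply: contrapT => nH; suff : (e%:E <= mu (\bigcap_n H n))%E by rewrite leNgt lt.
  rewrite -(cvg_lim _ cv) //; apply: lime_ge; first by apply/cvg_ex; exists (mu (\bigcap_n H n)).
  by apply: nearW => n /=; rewrite leNgt; apply/negP => h; apply: nH; exists n.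
exists (G n); split; [exact: cG| |exact: ltW nP].
by move=> z; rewrite /G -bigcup_mkord => -[i _ Fz]; exists i => //; have [_ FA _] := FP i; exact: FA.
Qed.

(** Symmetric under complements, so that the regular sets form a sigma-algebra. *)
Definition regular (A : set (R * R)) := [/\ measurable A, inner_closed A & inner_closed (~` A)].

Lemma regular_sigma : sigma_algebra setT regular.
Proof.
split.
- split; [exact: measurable0|apply: inner_closed_self; exact: closed0|].
  by rewrite setC0; apply: inner_closed_self; exact: closedT.
- by move=> A [mA i1 i2]; rewrite setTD; split; rewrite ?setCK //; exact: measurableC.
- move=> A RA; split.
  + by apply: bigcupT_measurable => i; case: (RA i).
  + by apply: inner_closed_bigcup => i; case: (RA i).
  + rewrite setC_bigcup; apply: inner_closed_bigcap => i; case: (RA i) => // mA _ _.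
    exact: measurableC.
Qed.

Lemma regular_ray (p : R * R -> R) (x : R) : continuous p -> regular (p @^-1` `]x, +oo[).
Proof.
move=> cp.
have cC (y : R) : closed (p @^-1` `[y, +oo[).
  have := closed_comp (fun z _ => cp z) (@closed_ge R y).
  by congr closed; apply/seteqP; split=> z; rewrite /= in_itv /= andbT.
have E : p @^-1` `]x, +oo[ = \bigcup_n (p @^-1` `[x + n.+1%:R^-1, +oo[).
  by rewrite itv_o_inftyEbigcup preimage_bigcup.
have C : closed (~` (p @^-1` `]x, +oo[)).
  have := closed_comp (fun z _ => cp z) (@closed_le R x).
  congr closed; apply/seteqP; split=> z; rewrite /= in_itv /= andbT; first by move=> h; apply/negP; rewrite -leNgt.
  by move=> /negP; rewrite -leNgt.
split; last exact: inner_closed_self.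
  by rewrite -[X in measurable X]setCK; apply: measurableC; exact: closed_R2_measurable.
rewrite E; apply: inner_closed_bigcup => i; first exact: closed_R2_measurable.
exact: inner_closed_self.
Qed.

Lemma regular_preimage (p : R * R -> R) (B : set R) : continuous p -> measurable B -> regular (p @^-1` B).
Proof.
move=> cp mB.
have h : <<s @RGenOInfty.G R >> `<=` [set B : set R | regular (p @^-1` B)].
  apply: smallest_sub; last by move=> _ [x ->]; exact: regular_ray.
  have [r0 rD rU] := regular_sigma; split => /=.
  - by rewrite preimage_set0.
  - by move=> A rA; rewrite setTD preimage_setC -setTD; exact: rD.
  - by move=> A rA; rewrite preimage_bigcup; exact: rU.
apply: h; have : ((@ocitv R).-sigma.-measurable : set (set R)) B by [].
by rewrite RGenOInfty.measurableE.
Qed.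

Lemma measurable_regular (A : set (R * R)) : measurable A -> regular A.
Proof.
have h : g_sigma_preimageU (@fst R R) (@snd R R) `<=` regular.
  apply: smallest_sub; first exact: regular_sigma.
  rewrite subUset; split=> _ [B mB <-]; rewrite setTI; apply: regular_preimage => //.
    by move=> z; exact: cvg_fst.
  by move=> z; exact: cvg_snd.
exact: h.
Qed.

Lemma compact_inner (A K0 : set (R * R)) : measurable A -> compact K0 -> mu (~` K0) = 0%E -> (0 < mu A)%E ->
  exists K, [/\ compact K, K `<=` A & (0 < mu K)%E].
Proof.
move=> mA cK0 K00 A0.
have mK0 : measurable K0 by apply: closed_R2_measurable; apply: compact_closed cK0; exact: hausdorff_R2.
have fA : mu A \is a fin_num by exact: fin_num_measure.
have [_ /(_ (fine (mu A) / 2)) H _] := measurable_regular mA.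
have a0 : 0 < fine (mu A) by rewrite fine_gt0 // A0 ltey_eq fA.
have [|F [cF FA FAe]] := H; first by rewrite divr_gt0.
have mF := closed_R2_measurable cF.
exists (K0 `&` F); split; [exact: compact_closedI|by move=> z [_ /FA]|].
rewrite lt_neqAle measure_ge0 andbT eq_sym; apply/eqP => K0F.
have : (mu A <= mu (A `\` F) + (mu (K0 `&` F) + mu (~` K0)))%E.
  apply: (@le_trans _ _ (mu ((A `\` F) `|` ((K0 `&` F) `|` ~` K0)))).
    apply: le_measure; rewrite ?inE //; first by apply: measurableU; [exact: measurableD|apply: measurableU; [exact: measurableI|exact: measurableC]].
    move=> z Az; have [Fz|nF] := pselect (F z); last by left.
    by have [Kz|nK] := pselect (K0 z); right; [left|right].
  apply: le_trans (measureU2 _ _ _) _; [exact: measurableD|apply: measurableU; [exact: measurableI|exact: measurableC]|].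
  by rewrite leeD2l // measureU2 //; [exact: measurableI|exact: measurableC].
rewrite K0F K00 !adde0 => /le_trans /(_ FAe); rewrite -(fineK fA) lee_fin; lra.
Qed.

(** Polarity is tested by compactly supported measures, hence the inner regularity: a charged polar
    set would contain a charged compact set, whose normalised restriction has finite energy. *)
Lemma energy_no_charge (E B : set (R * R)) : cpt_supported_in mu E -> (J mu mu < +oo)%E -> measurable B -> polar B -> mu B = 0%E.
Proof.
move=> [K0 [cK0 _ K00]] Jf mB pB; apply/eqP; rewrite -measure_le0 leNgt; apply/negP => B0.
have [K [cK KB K0']] := compact_inner mB cK0 K00 B0.
have mK : measurable K by apply: closed_R2_measurable; apply: compact_closed cK; exact: hausdorff_R2.
have fK : mu K \is a fin_num by exact: fin_num_measure.
have c0 : 0 < fine (mu K) by rewrite fine_gt0 // K0' ltey_eq fK.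
have [nu [nuE nuI]] := normalized_restriction mK (esym (fineK fK)) c0.
have sup : cpt_supported_in nu B.
  by exists K; split => //; rewrite nuE setICl measure0 mule0.
have := pB nu sup => le; have := Rmu_J sup; rewrite /Rmu le addye; last first.
  by rewrite gt_eqF // (lt_le_trans (ltNyr 0)) //; apply: integral_ge0 => z _; rewrite lee_fin sqmod_ge0.
rewrite addye // => JE.
have ci : 0 <= (fine (mu K))^-1 by rewrite invr_ge0 ltW.
have kle z : (kpot nu z <= (fine (mu K))^-1%:E * kpot mu z)%E.
  rewrite /kpot nuI; [|exact: measurable_kk1|exact: kk_ge0].
  rewrite lee_wpmul2l ?lee_fin //; apply: ge0_subset_integral => //; first exact: measurable_kk1.
  by move=> w _; exact: kk_ge0.
have : (J nu nu <= (fine (mu K))^-1%:E * ((fine (mu K))^-1%:E * J mu mu))%E.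
  rewrite /J nuI; [|exact: measurable_kpot|exact: kpot_ge0].
  rewrite lee_wpmul2l ?lee_fin //.
  rewrite -ge0_integralZl //; [|exact: measurable_kpot|by move=> z _; exact: kpot_ge0].
  apply: (@le_trans _ _ (\int[mu]_(z in K) ((fine (mu K))^-1%:E * kpot mu z))%E).
    by apply: le_integral_nomeas => z _; rewrite kpot_ge0 kle.
  apply: ge0_subset_integral => //; first by apply: emeasurable_funM => //; exact: measurable_kpot.
  by move=> z _; rewrite mule_ge0 ?lee_fin // kpot_ge0.
have Jfin : J mu mu \is a fin_num by rewrite ge0_fin_numE ?J_ge0.
by rewrite JE -(fineK Jfin) -!EFinM leye_eq.
Qed.

End Regularity.

Section Second_moment.
Variable R : realType.

Lemma adde_transfer (x y : \bar R) (c d : R) : (x + c%:E = y + d%:E)%E -> (x = y + (d - c)%:E)%E.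
Proof.
case: x => [x||]; case: y => [y||] //= [h]; congr EFin; lra.
Qed.

Lemma pull_factor (p q a d s : R) : p != 0 ->
  p^-1 * - (q * (p * a) + p * d / 2) - - (q * a + s / 2) = (s - d) / 2.
Proof. by move=> p0; field. Qed.

Lemma loginv_kk (m : {measure set (R * R) -> \bar R}) (A : set (R * R)) (a s : R) z : measurable A -> m A = a%:E ->
  (\int[m]_(w in A) (sqmod w)%:E = s%:E)%E ->
  (\int[m]_(w in A) loginv z w = \int[m]_(w in A) kk z w + (- ((sqmod z / 2 + 1) * a + s / 2))%:E)%E.
Proof.
move=> mA ma ms; pose q := sqmod z / 2 + 1.
have q0 : 0 <= q by have := sqmod_ge0 z; rewrite /q; lra.
have p0 w : (0 <= (pot z w)%:E)%E by rewrite lee_fin /pot; have := sqmod_ge0 z; have := sqmod_ge0 w; lra.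
have msq : measurable_fun setT (fun w : R * R => (sqmod w)%:E) by apply/measurable_EFinP; exact: measurable_sqmod.
have potE w : ((pot z w)%:E = q%:E + (2^-1)%:E * (sqmod w)%:E)%E.
  by rewrite -EFinM -EFinD /pot /q; congr EFin; lra.
have mpot : measurable_fun setT (fun w => (pot z w)%:E).
  apply: (eq_measurable_fun (fun w => (q%:E + (2^-1)%:E * (sqmod w)%:E)%E)) => [w _|]; first by rewrite potE.
  by apply: emeasurable_funD => //; apply: emeasurable_funM.
have ip : (\int[m]_(w in A) (pot z w)%:E = (q * a + s / 2)%:E)%E.
  under eq_integral do rewrite potE.
  rewrite ge0_integralD //; last 2 first.
  - by move=> w _; rewrite -EFinM lee_fin mulr_ge0 // sqmod_ge0.
  - by apply: measurable_funTS; exact: emeasurable_funM.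
  rewrite integral_cst // ge0_integralZl //; last 2 first.
  - exact: measurable_funTS.
  - by move=> w _; rewrite lee_fin sqmod_ge0.
  by rewrite ma ms -!EFinM -EFinD; congr EFin; lra.
pose g : R * R -> R := (fun w => - pot z w) \_ A.
have gE : (EFin \o g) = (fun w => (- (pot z w)%:E)%E) \_ A.
  by apply/funext => w; rewrite /g /= !patchE; case: ifP.
have ig : m.-integrable setT (EFin \o g).
  rewrite gE; apply/(integrable_mkcond _ mA); apply/integrableP; split.
    by apply: measurable_funTS; exact: measurableT_comp.
  under eq_integral do rewrite abseN gee0_abs //.
  by rewrite ip ltry.
have kA w : (((kk z) \_ A) w + (g w)%:E = (loginv z \_ A) w)%E.
  rewrite /g !patchE; case: ifP => _; last by rewrite adde0.
  by rewrite /kk -addeA -EFinD subrr adde0.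
rewrite integral_mkcond [in RHS]integral_mkcond.
under eq_integral do rewrite -kA.
rewrite integral_add_integrable //; last 2 first.
- by apply/(measurable_restrictT _ mA); apply: measurable_funTS; exact: measurable_kk1.
- by move=> w; rewrite patchE; case: ifP => // _; exact: kk_ge0.
congr (_ + _)%E.
rewrite -[LHS]/(\int[m]_w (EFin \o g) w)%E gE -integral_mkcond integral_ge0N //.
by rewrite ip EFinN.
Qed.

End Second_moment.

(** * Polar sets *)

Section Polar.
Variable R : realType.
Local Notation prob := (probability (R * R)%type R).

Lemma log_energy_pinfty (mu : prob) E : cpt_supported_in mu E -> (log_energy mu = +oo%E <-> J mu mu = +oo%E).
Proof.
move=> sup; have iS := integrable_sqmod sup; have fS := integrable_fin_num measurableT iS.
rewrite (Rmu_J sup) /Rmu; have -> : (\int[mu]_z (sqmod z)%:E)%E = (\int[mu]_z (EFin \o @sqmod R) z)%E by [].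
by rewrite -(fineK fS); case: (log_energy mu) => [r||] /=; split.
Qed.

Lemma polar_zero : polar [set (0 : R * R)].
Proof.
move=> mu sup; apply/(log_energy_pinfty sup).
have m0 := @measurable_zero R; have mC := measurableC m0.
have mu0 : mu (~` [set 0]) = 0%E.
  have [K [cK K0 muK]] := sup; apply: (subset_measure0 _ _ _ muK) => //; last exact: subsetC.
  by apply: measurableC; apply: closed_R2_measurable; apply: compact_closed cK; exact: hausdorff_R2.
have oo (F : R * R -> \bar R) : measurable_fun setT F -> (forall z, (0 <= F z)%E) -> F 0 = +oo%E -> (\int[mu]_z F z = +oo)%E.
  move=> mF F0 Foo; apply/eqP; rewrite -leye_eq -[leLHS](int_cst_prob mu).
  by apply: (ae_int_le mC mu0) => // z /contrapT ->; rewrite Foo.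
apply: (oo (kpot mu)); [exact: measurable_kpot|exact: kpot_ge0|].
by apply: oo; [exact: measurable_kk1|exact: kk_ge0|exact: kk_diag].
Qed.

(** The unit disk around [(T, 0)] carries a measure of finite energy, so it is not contained in [B].
    Balayage identities can thus be evaluated at arbitrarily distant points. *)
Lemma far_point (B : set (R * R)) (T : R) : polar B -> 4 <= T -> exists z, ~ B z /\
  forall w, sqmod w <= 1 -> (T - 2) ^+ 2 <= sqmod (z - w) <= (T + 2) ^+ 2.
Proof.
move=> pB T4; pose t : R * R := (T, 0).
have [mu [Jf [K [cK Kt muK]]]] := uniform_translate t.
have [z [zt zB]] : exists z, sqmod (z - t) <= 1 /\ ~ B z.
  apply: contrapT => H.
  have sup : cpt_supported_in mu B.
    by exists K; split => // z /Kt zt; apply: contrapT => nB; apply: H; exists z.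
  by have := pB mu sup => /(log_energy_pinfty sup) Joo; rewrite Joo in Jf.
exists z; split => // w w1.
pose n (u : R * R) := Num.sqrt (sqmod u).
have n1 u : sqmod u <= 1 -> n u <= 1 by move=> h; rewrite /n -sqrtr1; exact: ler_wsqrtr.
have nt : n t = T by rewrite /n /sqmod /t /= expr0n addr0 sqrtr_sqr ger0_norm //; lra.
have nC u v : n (u - v) = n (v - u) by rewrite /n sqmodBC.
have n0 u : 0 <= n u by exact: sqrtr_ge0.
have sE u : sqmod u = n u ^+ 2 by rewrite sqr_sqrtr // sqmod_ge0.
have w0 : n (0 - w) <= 1 by rewrite nC subr0; exact: n1.
have zt1 := n1 _ zt.
have h1 : n (z - w) <= T + 2.
  have := @sqrt_sqmodB_triangle R z t w; have := @sqrt_sqmodB_triangle R t 0 w; rewrite subr0 -!/(n _) nt; lra.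
have h2 : T - 2 <= n (z - w).
  have := @sqrt_sqmodB_triangle R t z 0; have := @sqrt_sqmodB_triangle R z w 0; rewrite !subr0 -!/(n _) nt.
  by have := n1 _ w1; have := nC t z; lra.
by rewrite sE; apply/andP; split; apply: lerXn2r; rewrite ?nnegrE //; lra.
Qed.

End Polar.

(** * Mass and energy of swept measures *)

Section Balayage.
Variable R : realType.
Local Notation prob := (probability (R * R)%type R).
Local Notation D := (@unit_disk R).
Local Notation L2 := (@L2 R).
Local Notation lam := (lam R).
Variables (V : set (R * R)) (nu : {measure set (R * R) -> \bar R}).
Hypotheses (oV : open V) (VD : V `<=` D) (bal : is_balayage V nu).
Let Dc := [set z : R * R | sqmod z <= 1].

Let mV : measurable V. Proof. exact: open_R2_measurable. Qed.
Let cDc : compact Dc.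
Proof.
have -> : Dc = [set z | sqmod (z - 0) <= 1] by apply/seteqP; split => z; rewrite /Dc /= subr0.
exact: compact_disk.
Qed.
Let clDc : closed Dc. Proof. by apply: compact_closed cDc; exact: hausdorff_R2. Qed.
Let mDc : measurable Dc. Proof. exact: closed_R2_measurable. Qed.
Let VDc : V `<=` Dc. Proof. by move=> z /VD; exact: ltW. Qed.

Let iV : V^° = V. Proof. by move: oV; rewrite interior_id. Qed.

Lemma bdry_sub : bdry V `<=` Dc `\` V.
Proof.
move=> z [cz iz]; rewrite iV in iz; split=> //.
by have := closure_subset VDc; rewrite -(closure_id Dc).1 //; exact.
Qed.

Let mN : measurable (~` (Dc `\` V)). Proof. by apply: measurableC; exact: measurableD. Qed.

Lemma balayage_null : nu (~` (Dc `\` V)) = 0%E.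
Proof.
have [b0 _ _] := bal; apply: (subset_measure0 _ _ _ b0) => //.
  apply: measurableC; apply: closed_R2_measurable; rewrite /bdry iV.
  by apply: closedI; [exact: closed_closure|rewrite closedC].
by apply: subsetC; exact: bdry_sub.
Qed.

Definition mass := fine (lam V).

Lemma lamVE : lam V = mass%:E.
Proof. by rewrite fineK // fin_num_measure. Qed.

Lemma L2VE : L2 V = (pi * mass)%:E.
Proof.
have := lamVE; rewrite lamE setIidl // => h; have p0 := pi_gt0 R.
by rewrite EFinM -h muleA -EFinM divff ?gt_eqF // mul1e.
Qed.

Lemma mass_ge0 : 0 <= mass. Proof. by rewrite /mass fine_ge0. Qed.

Lemma mass_le1 : mass <= 1. Proof. by rewrite -lee_fin -lamVE probability_le1. Qed.

(** Inactive for [w] in the disk and [z] a far point. With [1 <= a] it makes the logarithm bounded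
    and nonnegative everywhere, so it can be integrated against [nu] before [nu] is known to be
    finite. *)
Let clamp (a b : R) z w := Num.min (Num.max (sqmod (z - w)) a) b.
Let lnc (a b : R) z w := ln (clamp a b z w) / 2.

Let clamp_id a b z w : a <= sqmod (z - w) <= b -> clamp a b z w = sqmod (z - w).
Proof. by move=> /andP[h1 h2]; rewrite /clamp max_l // min_l. Qed.

Let measurable_lnc a b z : measurable_fun setT (lnc a b z).
Proof.
apply: measurable_funM => //; apply: (measurableT_comp (@measurable_ln R)).
apply: measurable_minr => //; apply: measurable_maxr => //.
apply: (measurableT_comp (@measurable_sqmod R)).
apply: (measurable_fun_pair (f := fun w : R * R => z.1 - w.1) (g := fun w => z.2 - w.2)); exact: measurable_funB.
Qed.

Let lnc_bounds (a b : R) z w : 0 < a -> a <= b -> ln a / 2 <= lnc a b z w <= ln b / 2.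
Proof.
move=> a0 ab; rewrite /lnc; have c0 : a <= clamp a b z w by rewrite le_min le_max lexx orbT.
have cb : clamp a b z w <= b by rewrite ge_min lexx orbT.
rewrite !ler_pM2r ?invr_gt0 // !ler_ln ?posrE ?c0 ?cb //; first exact: lt_le_trans c0.
  exact: lt_le_trans ab.
exact: lt_le_trans c0.
Qed.

(** At distance about [T] the two logarithmic potentials agree, and each is minus its mass times a
    number between [ln (T - 2)] and [ln (T + 2)]. *)
Lemma mass_compare (T : R) : 4 <= T ->
  ((ln (T - 2))%:E * nu setT <= (ln (T + 2) * mass)%:E)%E /\ ((ln (T - 2) * mass)%:E <= (ln (T + 2))%:E * nu setT)%E.
Proof.
move=> T4; have [_ _ [B [mB pB balE]]] := bal.
have [z [zB zd]] := far_point pB T4.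
have zV : ~ V z.
  move=> /VDc /zd; rewrite subrr /sqmod /= expr0n /= addr0 => /andP[+ _].
  by apply/negP; rewrite -ltNge exprn_gt0 //; lra.
pose a := (T - 2) ^+ 2; pose b := (T + 2) ^+ 2.
have a1 : 1 <= a by rewrite expr_ge1 //; lra.
have a0 : 0 < a by lra.
have ab : a <= b by apply: lerXn2r; rewrite ?nnegrE; lra.
have lna : ln a / 2 = ln (T - 2) by rewrite lnXn; [rewrite -[_ *+ 2]mulr_natr mulfK|lra].
have lnb : ln b / 2 = ln (T + 2) by rewrite lnXn; [rewrite -[_ *+ 2]mulr_natr mulfK|lra].
have lnE w : Dc w -> loginv z w = (- (lnc a b z w)%:E)%E.
  move=> Dw; have /andP[h1 h2] := zd w Dw.
  rewrite loginvE; last by apply/eqP => zw; move: h1; rewrite zw subrr /sqmod /= expr0n /= addr0 -/a => a0'; lra.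
  by rewrite /lnc clamp_id ?h1 // EFinN.
have h0 w : (0 <= (lnc a b z w)%:E)%E.
  by rewrite lee_fin; have /andP[+ _] := lnc_bounds z w a0 ab; apply: le_trans; rewrite divr_ge0 // ln_ge0.
have mh : measurable_fun setT (fun w => (lnc a b z w)%:E) by apply/measurable_EFinP; exact: measurable_lnc.
have mlog : measurable_fun setT (loginv z).
  rewrite (_ : loginv z = fun w => kk z w - (pot z w)%:E)%E.
    apply: emeasurable_funB; first exact: measurable_kk1.
    apply/measurable_EFinP; apply: measurable_funD => //; apply: measurable_funM => //; apply: measurable_funD => //.
    exact: measurable_sqmod.
  by apply/funext => w; rewrite /kk -addeA subee // adde0.
have e1 : (\int[nu]_w loginv z w = - \int[nu]_w (lnc a b z w)%:E)%E.
  rewrite -integral_ge0N //; apply: ae_eq_integral => //; first exact: measurableT_comp.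
  exists (~` (Dc `\` V)); split => //; first exact: balayage_null.
  by move=> w /= h; apply: contra_not h => -[Dw _] _; exact: lnE.
have e2 : (\int[@leb2 R]_(w in V) loginv z w = - \int[L2]_(w in V) (lnc a b z w)%:E)%E.
  rewrite L2_int_gen //; last exact: measurable_funTS.
  rewrite -integral_ge0N //; apply: eq_integral => w; rewrite inE => Vw; exact/lnE/VDc.
have := balE z zV zB; rewrite e1 e2 muleN => /oppe_inj E.
have p0 := pi_gt0 R.
have la0 : 0 <= ln a / 2 by rewrite divr_ge0 // ln_ge0.
have lb0 : 0 <= ln b / 2 by rewrite divr_ge0 // ln_ge0 //; lra.
have L2b (c : R) : ((pi^-1)%:E * \int[L2]_(w in V) c%:E = (c * mass)%:E)%E.
  transitivity ((pi^-1)%:E * (c%:E * L2 V))%E; first by congr (_ * _)%E; exact: integral_cst.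
  rewrite L2VE.
  by rewrite -!EFinM; congr EFin; rewrite mulrCA mulKf // gt_eqF.
have lnc1 w : (((ln a / 2)%:E <= (lnc a b z w)%:E) && ((lnc a b z w)%:E <= (ln b / 2)%:E))%E.
  by rewrite !lee_fin; exact: lnc_bounds.
rewrite -lna -lnb; split.
  rewrite -L2b -integral_cst //; apply: (@le_trans _ _ (\int[nu]_w (lnc a b z w)%:E)%E).
    by apply: le_integral_nomeas => w _; rewrite lee_fin la0 /=; have /andP[] := lnc1 w.
  rewrite E lee_wpmul2l ?lee_fin ?invr_ge0 ?(ltW p0) //.
  by apply: le_integral_nomeas => w _; rewrite h0 /=; have /andP[] := lnc1 w.
rewrite -L2b -integral_cst //; apply: (@le_trans _ _ (\int[nu]_w (lnc a b z w)%:E)%E).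
  rewrite E lee_wpmul2l ?lee_fin ?invr_ge0 ?(ltW p0) //.
  by apply: le_integral_nomeas => w _; rewrite lee_fin la0 /=; have /andP[] := lnc1 w.
by apply: le_integral_nomeas => w _; rewrite h0 /=; have /andP[] := lnc1 w.
Qed.

(** The case [T = 4] of [mass_compare] shows that the mass is finite; letting [T] grow identifies
    it, because [ln (T + 2) - ln (T - 2)] stays bounded while [ln (T - 2)] does not. *)
Lemma balayage_mass : nu setT = mass%:E.
Proof.
have m0 := mass_ge0; have m1 := mass_le1.
have fn : nu setT \is a fin_num.
  rewrite ge0_fin_numE //; have [+ _] := mass_compare (lexx 4).
  have l0 : 0 < ln (4 - 2) :> R by rewrite ln_gt0 //; lra.
  by case: (nu setT) => // [r|]; rewrite ?ltry // gt0_muley ?lte_fin // leye_eq.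
have [n nE] : exists n, nu setT = n%:E by exists (fine (nu setT)); rewrite fineK.
have n0 : 0 <= n by rewrite -lee_fin -nE.
have cmp (T : R) : 4 <= T -> ln (T - 2) * n <= ln (T + 2) * mass /\ ln (T - 2) * mass <= ln (T + 2) * n.
  by move=> T4; have [] := mass_compare T4; rewrite nE -!EFinM !lee_fin.
have lnT (T : R) : 4 <= T -> ln (T + 2) <= ln (T - 2) + 2.
  move=> T4; have d0 : 0 < T - 2 by lra.
  have q0 : 0 < (T + 2) / (T - 2) by rewrite divr_gt0 //; lra.
  have := ln_le_sub1 q0; rewrite ln_div ?posrE //; last by lra.
  have : (T + 2) / (T - 2) <= 3 by rewrite ler_pdivrMr //; lra.
  lra.
rewrite nE; congr EFin; apply/eqP; rewrite -subr_eq0 -normr_le0; apply/ler_addgt0Pr => e e0; rewrite add0r.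
pose X := 2 * (mass + n) / e; pose T := expR X + 4.
have T4 : 4 <= T by rewrite lerDr expR_ge0.
have XT : X <= ln (T - 2).
  by rewrite -[leLHS]expRK ler_ln ?posrE ?expR_gt0 // /T; have := expR_gt0 X; lra.
have [c1 c2] := cmp T T4; have l2 := lnT T T4.
have l0 : 0 < ln (T - 2) by rewrite ln_gt0 // /T; have := expR_gt0 X; lra.
have b1 : ln (T - 2) * (n - mass) <= 2 * (mass + n) by nra.
have b2 : ln (T - 2) * (mass - n) <= 2 * (mass + n) by nra.
have Xe : 2 * (mass + n) <= ln (T - 2) * e by rewrite -ler_pdivrMr.
rewrite ler_norml; apply/andP; split.
  by rewrite -(ler_pM2l l0); lra.
by rewrite -(ler_pM2l l0); lra.
Qed.

Let msq : measurable_fun setT (fun w : R * R => (sqmod w)%:E).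
Proof. by apply/measurable_EFinP; exact: measurable_sqmod. Qed.
Let sq0 (w : R * R) : (0 <= (sqmod w)%:E)%E. Proof. by rewrite lee_fin sqmod_ge0. Qed.

Definition smom := fine (\int[nu]_w (sqmod w)%:E)%E.
Definition dmom := fine (\int[lam]_(w in V) (sqmod w)%:E)%E.

Lemma smomE : (\int[nu]_w (sqmod w)%:E = smom%:E)%E.
Proof.
rewrite fineK // ge0_fin_numE; last by apply: integral_ge0.
apply: (@le_lt_trans _ _ (\int[nu]_w 1%:E)%E); last by rewrite integral_cst // mul1e balayage_mass ltry.
apply: (ae_int_le mN balayage_null) => // z /contrapT[Dz _]; rewrite lee_fin; exact: Dz.
Qed.

Lemma dmomE : (\int[lam]_(w in V) (sqmod w)%:E = dmom%:E)%E.
Proof.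
rewrite fineK // ge0_fin_numE; last by apply: integral_ge0.
apply: (@le_lt_trans _ _ (\int[lam]_w (sqmod w)%:E)%E); last by rewrite (le_lt_trans (int_lam_sqmod R)) ?ltry.
by apply: ge0_subset_integral.
Qed.

Lemma int_lamV (f : R * R -> \bar R) : measurable_fun setT f -> (forall x, (0 <= f x)%E) ->
  (\int[lam]_(w in V) f w = (pi^-1)%:E * \int[L2]_(w in V) f w)%E.
Proof.
move=> mf f0; rewrite integral_mkcond int_lam; last 2 first.
- by apply/(measurable_restrictT _ mV); exact: measurable_funTS.
- by move=> x; rewrite patchE; case: ifP.
by rewrite -integral_mkcondr setIidr.
Qed.

(** The logarithmic potentials and the masses agree; the quadratic part of [kk] leaves half the
    difference of the second moments. *)
Definition bal_const := (smom - dmom) / 2.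

Lemma balayage_kpot : exists B, [/\ measurable B, polar B & forall z, ~ V z -> ~ B z ->
  kpot nu z = (\int[lam]_(w in V) kk z w + bal_const%:E)%E].
Proof.
have [_ _ [B [mB pB balE]]] := bal; exists B; split=> // z zV zB.
have p0 := pi_gt0 R.
have mom : (\int[L2]_(w in V) (sqmod w)%:E = (pi * dmom)%:E)%E.
  by rewrite EFinM -dmomE int_lamV // muleA -EFinM divff ?gt_eqF // mul1e.
have mlog : measurable_fun setT (loginv z).
  rewrite (_ : loginv z = fun w => kk z w - (pot z w)%:E)%E.
    apply: emeasurable_funB; first exact: measurable_kk1.
    apply/measurable_EFinP; apply: measurable_funD => //; apply: measurable_funM => //; apply: measurable_funD => //.
    exact: measurable_sqmod.
  by apply/funext => w; rewrite /kk -addeA subee // adde0.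
have := balE z zV zB.
rewrite (loginv_kk z measurableT balayage_mass smomE).
rewrite L2_int_gen //; last exact: measurable_funTS.
have L2V : L2 V = (pi * mass)%:E by exact: L2VE.
rewrite (loginv_kk z mV L2V mom) muleDr //; last exact: fin_num_adde_defl.
rewrite -int_lamV; [|exact: measurable_kk1|exact: kk_ge0].
rewrite -EFinM => /adde_transfer E; rewrite /kpot E; congr (_ + _%:E)%E.
by rewrite pull_factor ?gt_eqF.
Qed.

Let mVC : measurable (~` V). Proof. exact: measurableC. Qed.

Lemma swept_measure : exists muV : prob,
  (forall A, muV A = lam (A `&` ~` V) + nu A)%E /\
  (forall f, measurable_fun setT f -> (forall x, (0 <= f x)%E) ->
    \int[muV]_w f w = \int[lam]_(w in ~` V) f w + \int[nu]_w f w)%E.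
Proof.
have tot : measure_add (mrestr lam mVC) nu setT = 1%E.
  rewrite measure_addE -[X in (X + _)%E]/(lam (setT `&` ~` V)) setTI balayage_mass.
  by rewrite -lamVE probability_setC // subeK // fin_num_measure.
have [muV [muVE muVint]] := normalized_restriction measurableT tot ltr01.
exists muV; split=> [A|f mf f0].
  by rewrite muVE invr1 mul1e setIT; exact: measure_addE.
by rewrite muVint // invr1 mul1e ge0_integral_measure_add // int_mrestr.
Qed.

Lemma lam_unit_disk_supp : cpt_supported_in lam Dc.
Proof.
exists Dc; split => //; apply: (subset_measure0 _ _ _ (lamC R)) => //.
- exact: measurableC.
- by apply: measurableC; exact: measurable_unit_disk.
- by apply: subsetC => z; exact: ltW.
Qed.

Definition bal_energy := 7 / 4 + bal_const.

(* The potential of [muV] exceeds that of [lam] by the constant [bal_const] off [V] up to a polar set, so [muV] is the equilibrium measure of the complement of [V]. *)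
Lemma swept_energy : exists muV : prob, [/\ muV (~` (Dc `\` V)) = 0%E, J muV muV = bal_energy%:E &
  forall mu : prob, cpt_supported_in mu (~` V) -> (J mu mu < +oo)%E -> (bal_energy%:E <= J mu mu)%E].
Proof.
have [muV [muVE muVint]] := swept_measure; exists muV.
have [B [mB pB Bpot]] := balayage_kpot.
have m0 := @measurable_zero R.
have supp0 : muV (~` (Dc `\` V)) = 0%E.
  rewrite muVE balayage_null adde0; apply: (subset_measure0 _ _ _ (lamC R)) => //.
  - by apply: measurableI => //; apply: measurableC; exact: measurableD.
  - by apply: measurableC; exact: measurable_unit_disk.
  - by move=> z [h Vz] Dz; apply: h; split => //; exact: ltW.
have potE z : ~ V z -> ~ B z -> kpot muV z = (kpot lam z + bal_const%:E)%E.
  move=> Vz Bz; rewrite /kpot muVint; [|exact: measurable_kk1|exact: kk_ge0].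
  have -> : (\int[nu]_w kk z w = \int[lam]_(w in V) kk z w + bal_const%:E)%E by exact: Bpot.
  rewrite addeA -ge0_integral_setU //.
  - by rewrite setUC setUv.
  - by rewrite setUC setUv; exact: measurable_kk1.
  - by move=> w _; exact: kk_ge0.
  - by apply/disj_setPS => w [].
have null (mu : prob) E : cpt_supported_in mu E -> (J mu mu < +oo)%E -> mu (B `|` [set 0]) = 0%E.
  move=> sE fJ; apply: null_setU => //; first exact: (energy_no_charge sE fJ).
  by apply: (energy_no_charge sE fJ) => //; exact: polar_zero.
have null2 : muV (B `|` [set 0]) = 0%E.
  have [_ bp _] := bal; rewrite muVE; have nB := bp B mB pB.
  have nz : nu [set 0] = 0%E by apply: bp => //; exact: polar_zero.
  rewrite (null_setU mB m0 nB nz) adde0.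
  have Jl : (J lam lam < +oo)%E by rewrite (le_lt_trans (J_lam R)) ?ltry.
  apply: (subset_measure0 _ _ _ (null lam Dc lam_unit_disk_supp Jl)) => //.
    by apply: measurableI => //; exact: measurableU.
  exact: measurableU.
have mN2 : measurable (B `|` [set 0]) by exact: measurableU.
have JV : J muV muV = bal_energy%:E.
  have mN1 : measurable (~` (Dc `\` V)) by apply: measurableC; exact: measurableD.
  rewrite -[RHS](int_cst_prob muV); apply: ae_eq_integral => //; first exact: measurable_kpot.
  exists (~` (Dc `\` V) `|` (B `|` [set 0])); split; [exact: measurableU|exact: null_setU|].
  move=> z /= h; apply: contrapT => /not_orP[/contrapT[Dz Vz] /not_orP[Bz z0]]; apply: h => _.
  by rewrite potE // kpot_lam // ?EFinD //; apply: sqmod_gt0.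
split=> // mu smu fJ.
have c0 : 0 <= bal_energy by rewrite -lee_fin -JV J_ge0.
(* The potential of [muV] is at least [bal_energy] off [V], up to a polar set, which [mu] does not
   charge. *)
have low : (bal_energy%:E <= J mu muV)%E.
  have [K [cK KV muK]] := smu.
  have muV0 : mu V = 0%E.
    apply: (subset_measure0 _ _ _ muK) => //; last by move=> z Vz Kz; exact: (KV z).
    by apply: measurableC; apply: closed_R2_measurable; apply: compact_closed cK; exact: hausdorff_R2.
  have n2 := null_setU mV mN2 muV0 (null mu _ smu fJ).
  rewrite -[leLHS](int_cst_prob mu); apply: (ae_int_le _ n2) => //.
  - exact: measurableU.
  - exact: measurable_kpot.
  - exact: kpot_ge0.
  move=> z /not_orP[Vz /not_orP[Bz z0]]; rewrite potE // /bal_energy EFinD leeD2r //.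
  by apply: kpot_lam_ge; apply: sqmod_gt0.
have iq (m : prob) E : cpt_supported_in m E -> exists p : R, (\int[m]_z (sqmod z)%:E = p%:E)%E.
  move=> sm; exists (fine (\int[m]_z (sqmod z)%:E)%E); rewrite fineK //.
  exact: (integrable_fin_num measurableT (integrable_sqmod sm)).
have smuV : cpt_supported_in muV (Dc `\` V).
  exists (Dc `\` V); split => //; rewrite setDE; apply: compact_closedI => //; rewrite closedC; exact: oV.
have [p pE] := iq _ _ smu; have [q qE] := iq _ _ smuV.
(* Positivity turns the bound on the mixed energy into one on [J mu mu]. *)
have := J_psd pE qE; rewrite JV.
move: fJ low (J_ge0 mu mu); case: (J mu mu) => [x||] // _; case: (J mu muV) => [y||] //.
by rewrite mule2n -!EFinD !lee_fin; lra.
Qed.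

Lemma swept_supp (muV : prob) : muV (~` (Dc `\` V)) = 0%E -> cpt_supported_in muV (Dc `\` V).
Proof.
by exists (Dc `\` V); split => //; rewrite setDE; apply: compact_closedI => //; rewrite closedC; exact: oV.
Qed.

End Balayage.

(** * The two geometric conditions *)

Section Final.
Variable R : realType.
Local Notation prob := (probability (R * R)%type R).
Local Notation D := (@unit_disk R).

Lemma RU_fin (V : set (R * R)) : V `<=` D -> exists rho : R, [/\ RU V = rho%:E,
  (forall mu : prob, cpt_supported_in mu (~` V) -> ((rho + 1)%:E <= J mu mu)%E) &
  forall e : R, 0 < e -> exists mu : prob, exists Jr : R,
    [/\ cpt_supported_in mu (~` V), J mu mu = Jr%:E & Jr <= rho + 1 + e]].
Proof.
move=> VD.
have RJ (mu : prob) E : cpt_supported_in mu E -> Rmu mu = (J mu mu + (-1)%:E)%E.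
  by move=> /Rmu_J ->; rewrite -addeA -EFinD subrr adde0.
have lb : ((-1)%:E <= RU V)%E.
  apply: le_ereal_inf_tmp => _ [mu smu <-]; rewrite (RJ _ _ smu) -[leLHS]add0e leeD2r //; exact: J_ge0.
(* The unit disk around [(3, 0)] misses the one containing [V], so the infimum is finite. *)
have [mu0 [Jf smu0]] := @uniform_translate R (3, 0).
have smu : cpt_supported_in mu0 (~` V).
  have [K [cK KE K0]] := smu0; exists K; split=> // z /KE; rewrite /sqmod /= => h /VD; rewrite /unit_disk /sqmod /=.
  by move: h; rewrite subr0 => h; nra.
have ub : (RU V < +oo)%E.
  apply: (@le_lt_trans _ _ (Rmu mu0)); first by apply: ereal_inf_lbound; exists mu0.
  by rewrite (RJ _ _ smu); move: Jf (J_ge0 mu0 mu0); case: (J mu0 mu0) => // r _ _; rewrite -EFinD ltry.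
have [rho rhoE] : exists rho : R, RU V = rho%:E.
  by exists (fine (RU V)); rewrite fineK //; move: lb ub; case: (RU V).
exists rho; split=> // [mu sm|e e0].
  rewrite (Rmu_J sm) EFinD leeD2r // -rhoE; apply: ereal_inf_lbound; by exists mu.
have fi : RU V \is a fin_num by rewrite rhoE.
have [_ [mu sm <-] lt] := lb_ereal_inf_adherent e0 fi.
move: lt; rewrite -/(RU V) rhoE (RJ _ _ sm) => lt; exists mu.
move: lt (J_ge0 mu mu); case: (J mu mu) => // r; rewrite -!EFinD lte_fin => lt _.
by exists r; split => //; lra.
Qed.

Lemma Rempty_RU : Rempty R = RU (set0 : set (R * R)).
Proof. by rewrite /RU setC0. Qed.

Lemma upper_energy_RU (V : set (R * R)) (rho : R) : open V ->
  (forall mu : prob, cpt_supported_in mu (~` V) -> ((rho + 1)%:E <= J mu mu)%E) -> upper_energy V rho.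
Proof.
move=> oV H e e0; pose K := [set z : R * R | sqmod (z - 0) <= 9] `&` ~` V.
have cK : compact K by apply: compact_closedI; [exact: compact_disk|rewrite closedC].
have HK (mu : prob) : mu (~` K) = 0%E -> ((rho + 1)%:E <= J mu mu)%E.
  by move=> muK; apply: H; exists K; split=> // z [].
have [n0 n0P] := high_energy cK HK e0; exists n0 => n nn y yV y9.
have := n0P n nn y; rewrite addrK; apply => i; split; [by rewrite /= subr0|exact: yV].
Qed.

(** The distance [2 * t] allows one [t] to reach the boundary and another to reach the centre of an
    exterior ball. *)
Definition accessible (V K : set (R * R)) (t0 : R) := forall t : R, 0 < t < t0 -> forall z, K z ->
  exists c, sqmod (c - z) <= (2 * t) ^+ 2 /\ forall u, sqmod (u - c) < t ^+ 2 -> ~ V u.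

Lemma lower_energy_of (V : set (R * R)) (rho : R) :
  (forall e : R, 0 < e -> exists mu : prob, exists Jr : R, exists K : set (R * R), exists t0 : R,
     [/\ compact K, mu (~` K) = 0%E, 0 < t0 & accessible V K t0] /\ (J mu mu = Jr%:E /\ Jr <= rho + 1 + e)) ->
  lower_energy V rho.
Proof.
move=> H e e0; have e2 : 0 < e / 2 by rewrite divr_gt0.
have [mu [Jr [K [t0 [[cK muK t00 acc] [JE Jle]]]]]] := H _ e2.
have [M M0 KM] := compact_sqmod cK.
have mK : measurable K by apply: closed_R2_measurable; apply: compact_closed cK; exact: hausdorff_R2.
have M1 : 0 <= M + 1 by lra.
have KM' z : K z -> sqmod z <= (M + 1) ^+ 2 by move=> /KM h; nra.
have [t [M' [n0 [tp M'0 P]]]] := low_energy mK muK M1 KM' JE t00 acc e2.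
exists t, M', n0; split=> // n nn; have [y [y1 y2 y3]] := P n nn; exists y; split=> //.
apply: le_trans y3; rewrite ler_expR lerN2 ler_wpM2l ?exprn_ge0 //; lra.
Qed.

Lemma lower_energy_set0 (rho : R) :
  (forall e : R, 0 < e -> exists mu : prob, exists Jr : R,
    [/\ cpt_supported_in mu (~` set0), J mu mu = Jr%:E & Jr <= rho + 1 + e]) -> lower_energy set0 rho.
Proof.
move=> H; apply: lower_energy_of => e /H[mu [Jr [[K [cK _ muK]] JE Jle]]].
exists mu, Jr, K, 1; split=> //; split=> // t /andP[t0 _] z _; exists z; split=> [|u _ []].
by rewrite subrr /sqmod /= expr0n /= addr0 sqr_ge0.
Qed.

Let nm (u : R * R) := Num.sqrt (sqmod u).
Let nm_ge0 u : 0 <= nm u. Proof. exact: sqrtr_ge0. Qed.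
Let nmE u : sqmod u = nm u ^+ 2. Proof. by rewrite sqr_sqrtr // sqmod_ge0. Qed.
Let nm_lt u (t : R) : 0 <= t -> (sqmod u < t ^+ 2) = (nm u < t).
Proof. by move=> t0; rewrite nmE ltr_pXn2r ?nnegrE. Qed.

(** The last point of the segment outside [U] is a limit of points of [U], and it is no farther from
    [z] than [u] is. *)
Lemma segment_bdry (U : set (R * R)) z u : open U -> ~ U z -> U u ->
  exists b, bdry U b /\ sqmod (b - z) <= sqmod (u - z).
Proof.
move=> oU Uz Uu; pose g (s : R) : R * R := (z.1 + s * (u.1 - z.1), z.2 + s * (u.2 - z.2)).
have cg : continuous g.
  move=> s; apply: (@cvg_pair R R R (nbhs s) (nbhs (g s).1) (nbhs (g s).2)) => /=;
  by apply: cvgD; [exact: cvg_cst|apply: cvgMl; exact: cvg_id].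
have g0 : g 0 = z by rewrite /g !mul0r !addr0 -surjective_pairing.
have g1 : g 1 = u by rewrite /g !mul1r !subrKC -surjective_pairing.
pose S := `[0, 1]%classic `&` g @^-1` (~` U).
have clS : closed S.
  apply: closedI; first exact: interval_closed.
  by apply: closed_comp; [move=> s _; exact: cg|rewrite closedC].
have S0 : S 0 by split; rewrite /= ?in_itv /= ?lexx ?ler01 // g0.
have hS : has_sup S by split; [exists 0|exists 1 => s [/=]; rewrite in_itv /= => /andP[]].
have Ss := closure_sup hS.1 hS.2; rewrite -(closure_id S).1 // in Ss.
pose s := sup S; have [/=] := Ss; rewrite in_itv /= -/s => /andP[s0 s1] Us.
have slt : s < 1 by rewrite lt_neqAle s1 andbT; apply/eqP => sE; apply: Us; rewrite sE g1.
exists (g s); split; last first.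
  have -> : sqmod (g s - z) = s ^+ 2 * sqmod (u - z) by rewrite /sqmod /g /=; ring.
  by rewrite ler_piMl ?sqmod_ge0 // expr_le1.
split; last by rewrite (interior_id U).1.
move=> B nB; have nG : nbhs s (g @^-1` B) := cg s B nB; move: nG; rewrite nbhs_ballP => -[r /= r0 rB].
pose s' := s + Num.min (r / 2) (1 - s).
have m0 : 0 < Num.min (r / 2) (1 - s) by rewrite lt_min divr_gt0 //=; lra.
have mr : Num.min (r / 2) (1 - s) <= r / 2 by rewrite ge_min lexx.
have ms : Num.min (r / 2) (1 - s) <= 1 - s by rewrite ge_min lexx orbT.
exists (g s'); split; last first.
  by apply: rB; rewrite /ball /= /s' opprD addNKr normrN gtr0_norm //; lra.
apply: contrapT => nU; have : S s' by split => //; rewrite /= in_itv /= /s'; apply/andP; split; lra.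
by move=> /(ub_le_sup hS.2); rewrite -/s /s'; lra.
Qed.

Lemma exterior_ball_accessible (U K : set (R * R)) (eps : R) : open U -> 0 < eps -> K `<=` ~` U ->
  (forall z, bdry U z -> exists eta, [/\ ~ U eta, open_ball2 eta eps `<=` ~` U & cdist z eta = eps]) ->
  accessible U K eps.
Proof.
move=> oU e0 KU H t /andP[t0 te] z /KU Uz.
have [h|h] := pselect (forall u, sqmod (u - z) < t ^+ 2 -> ~ U u).
  by exists z; split=> //; rewrite subrr /sqmod /= expr0n /= addr0 sqr_ge0.
have [u [ut Uu]] : exists u, sqmod (u - z) < t ^+ 2 /\ U u.
  by apply: contrapT => h'; apply: h => u ut Uu; apply: h'; exists u.
have [b [bU bz]] := segment_bdry oU Uz Uu.
have [eta [_ ball_eta beta]] := H b bU.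
have cdE p q : cdist p q = nm (p - q) by [].
(* The exterior ball shrunk to radius [t] while still touching [b]. *)
pose c : R * R := (b.1 + (eta.1 - b.1) * (t / eps), b.2 + (eta.2 - b.2) * (t / eps)).
have tq : 0 < t / eps by rewrite divr_gt0.
have tq1 : t / eps < 1 by rewrite ltr_pdivrMr // mul1r.
have nmZ p q (k : R) : 0 <= k -> sqmod p = k ^+ 2 * sqmod q -> nm p = k * nm q.
  by move=> k0 pq; rewrite /nm pq sqrtrM ?sqr_ge0 // sqrtr_sqr ger0_norm.
have cb : nm (c - b) = t.
  rewrite (nmZ _ (b - eta) (t / eps)) ?(ltW tq) //; first by rewrite -cdE beta divfK // gt_eqF.
  by rewrite /sqmod /c /=; ring.
have ce : nm (c - eta) = eps - t.
  rewrite (nmZ _ (b - eta) (1 - t / eps)) ?subr_ge0 ?(ltW tq1) //; first by rewrite -cdE beta mulrBl mul1r divfK // gt_eqF.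
  by rewrite /sqmod /c /=; ring.
have bzt : nm (b - z) < t by rewrite -nm_lt ?(ltW t0) // (le_lt_trans bz).
exists c; split.
  rewrite nmE; apply: lerXn2r; rewrite ?nnegrE ?nm_ge0 ?mulr_ge0 ?(ltW t0) //.
  by have := @sqrt_sqmodB_triangle R c b z; rewrite -!/(nm _) cb; lra.
move=> v; rewrite nm_lt ?(ltW t0) // => vt; apply: (ball_eta v).
rewrite /open_ball2 /= cdE /nm sqmodBC -/(nm _).
by have := @sqrt_sqmodB_triangle R v c eta; rewrite -!/(nm _) ce; lra.
Qed.

(** Compactness makes the distance to [U] uniform; each point of [K] is then its own centre. *)
Lemma compact_separated (U K : set (R * R)) : compact K -> (forall z, K z -> ~ closure U z) ->
  exists2 t0 : R, 0 < t0 & accessible U K t0.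
Proof.
move=> cK KU; pose P (t : R) (z : R * R) := forall u, sqmod (u - z) < t ^+ 2 -> ~ U u.
have : \forall t \near 0^'+, K `<=` P t.
  apply: (compact_near_coveringP K).1 => // x Kx.
  have : nbhs x (~` U).
    by have := KU x Kx; rewrite -[~ _]/((~` closure U) x) -interiorC.
  rewrite nbhs_ballP => -[r /= r0 rU].
  exists (ball x (r / 2), [set t | 0 < t < r / 2]) => /=.
    split; first by apply: nbhsx_ballx; rewrite divr_gt0.
    by near=> t => /=; apply/andP; split; near: t; [exact: nbhs_right_gt|apply: nbhs_right_lt; rewrite divr_gt0].
  move=> [x' t] /= [[x1 x2] /andP[t0 tr]] u ut; apply: rU.
  have [h1 h2] := @norm_le_sqmod R (u - x') t (ltW ut) (ltW t0).
  by split; rewrite /ball /=; [move: x1 h1|move: x2 h2]; rewrite /ball /= !ltr_norml !ler_norml => /andP[a1 a2] /andP[b1 b2]; apply/andP; split; lra.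
move=> near_t; have : \forall t \near 0^'+, 0 < t :> R /\ K `<=` P t.
  by near=> t; split; near: t; [exact: nbhs_right_gt|exact: near_t].
move=> near_t0; have pF : ProperFilter (0 : R)^'+ by exact: at_right_proper_filter.
have [t0 [t00 KP]] := @filter_ex _ _ pF _ near_t0; exists t0 => // t /andP[t1 t2] z Kz; exists z; split.
  by rewrite subrr /sqmod /= expr0n /= addr0 sqr_ge0.
by move=> u ut; apply: (KP z Kz); apply: lt_trans ut _; rewrite ltr_pXn2r ?nnegrE // ltW.
Unshelve. all: by end_near. Qed.

(** The equilibrium measure for [Un n] lives off the closure of [U]. Its energy exceeds that for [U]
    by half the change of [smom - dmom]: [dmom] does not decrease from [U] to [Un n], and weak
    convergence controls [smom]. *)
Lemma balayage_accessible (U : set (R * R)) (rho : R) (Un : nat -> set (R * R))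
    (nu : nat -> {measure set (R * R) -> \bar R}) (nu0 : {measure set (R * R) -> \bar R}) :
  open U -> U `<=` D -> (forall n, [/\ open (Un n), closure U `<=` Un n & Un n `<=` D]) ->
  (forall n, is_balayage (Un n) (nu n)) -> is_balayage U nu0 -> weak_cvg nu nu0 ->
  (forall e : R, 0 < e -> exists mu : prob, exists Jr : R,
    [/\ cpt_supported_in mu (~` U), J mu mu = Jr%:E & Jr <= rho + 1 + e]) -> lower_energy U rho.
Proof.
move=> oU UD HUn bn b0 wc near_opt; apply: lower_energy_of => e e0.
(* A bounded continuous test function equal to [sqmod] on the closed disk, where the balayage
   measures live. *)
pose f (z : R * R) := Num.min (sqmod z) 1.
have cf : continuous f.
  by move=> z; apply: (@continuous_min _ _ (@sqmod R) (fun=> 1)); [exact: continuous_sqmod|exact: cvg_cst].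
have fb : exists M, forall x, `|f x| <= M.
  by exists 1 => x; rewrite ger0_norm ?ge_min ?lexx ?orbT // le_min sqmod_ge0 ler01.
have intf V m : open V -> V `<=` D -> is_balayage V m -> (\int[m]_x (f x)%:E = (smom m)%:E)%E.
  move=> oV VD bal; rewrite -(smomE oV VD bal).
  have mV := open_R2_measurable oV.
  have mDc : measurable [set z : R * R | sqmod z <= 1].
    have -> : [set z : R * R | sqmod z <= 1] = [set z | sqmod (z - 0) <= 1] by apply/seteqP; split => z; rewrite /= subr0.
    by apply: closed_R2_measurable; apply: compact_closed; [exact: hausdorff_R2|exact: compact_disk].
  have msq := @measurable_sqmod R.
  apply: ae_eq_integral => //.
  - by apply/measurable_EFinP; apply: measurable_minr.
  - by apply/measurable_EFinP.
  exists (~` ([set z | sqmod z <= 1] `\` V)); split; [by apply: measurableC; exact: measurableD|exact: balayage_null|].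
  by move=> z /= h; apply: contra_not h => -[z1 _] _; rewrite /f min_l.
have cv := wc f cf fb.
have cvs : (smom (nu n) @[n --> \oo] --> smom nu0).
  apply: (@fine_cvg _ _ _ _ (fun n => (smom (nu n))%:E)).
  have <- : (fun n => \int[nu n]_x (f x)%:E)%E = (fun n => (smom (nu n))%:E).
    by apply/funext => n; have [oUn _ UnD] := HUn n; exact: (intf (Un n) (nu n)).
  by rewrite -(intf U nu0).
have : \forall n \near \oo, smom (nu n) <= smom nu0 + e.
  move/cvgrPdist_le : cvs => /(_ e e0); apply: filterS => n; rewrite ler_norml => /andP[]; lra.
move=> /filter_ex[n nP]; have [oUn clU UnD] := HUn n.
have [muV [supp0 JV _]] := swept_energy oUn UnD (bn n).
have [muU [_ _ minU]] := swept_energy oU UD b0.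
(* Nearly optimal measures are competitors in the minimality of the swept measure of [U]. *)
have bU : bal_energy U nu0 <= rho + 1.
  apply/ler_addgt0Pr => e' e'0; have [mu [Jr [sm JE Jle]]] := near_opt e' e'0.
  by have := minU mu sm; rewrite JE lee_fin => /(_ (ltry _)); lra.
have dm : dmom U <= dmom (Un n).
  rewrite -lee_fin -!dmomE //; apply: ge0_subset_integral => //.
  - exact: open_R2_measurable.
  - exact: open_R2_measurable.
  - by apply: measurable_funTS; apply/measurable_EFinP; exact: measurable_sqmod.
  - by move=> z _; rewrite lee_fin sqmod_ge0.
  - by move=> z Uz; apply: clU; exact: subset_closure.
have [K [cK KE muK]] := swept_supp oUn supp0.
have KU z : K z -> ~ closure U z by move=> /KE[_ Uz] /clU.
have [t0 t00 acc] := compact_separated cK KU.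
exists muV, (bal_energy (Un n) (nu n)), K, t0; split=> //; split=> //.
by move: bU; rewrite /bal_energy /bal_const; lra.
Unshelve. all: by end_near. Qed.

End Final.
Theorem theorem1p6 (R : realType) (U : set (R * R)) :
  open U -> U `<=` @unit_disk R ->
  ((exists Un : nat -> set (R * R),
      (forall n, [/\ open (Un n), closure U `<=` Un n & Un n `<=` @unit_disk R]) /\
      exists (nu : nat -> {measure set (R * R) -> \bar R})
             (nu0 : {measure set (R * R) -> \bar R}),
        [/\ forall n, is_balayage (Un n) (nu n), is_balayage U nu0 & weak_cvg nu nu0])
   \/
   (exists eps : R, 0 < eps /\
      forall z, bdry U z ->
        exists eta, [/\ ~ U eta, open_ball2 eta eps `<=` ~` U & cdist z eta = eps])) ->
  forall (d : measure_display) (Omega : measurableType d) (P : probability Omega R)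
         (S : Omega -> set (R * R)),
    is_infinite_ginibre P S ->
    ((fun r : R =>
        elog (P [set w | npts (S w) (scale_set r U) = 0%E]) * ((r ^+ 4)^-1)%:E)
       @ +oo%R --> @Rempty R - RU U)%E.

Proof.
move=> oU UD cases d Omega P S gin.
have [rho [rhoE rho_le rho_near]] := RU_fin UD.
have [rho0 [rho0E rho0_le rho0_near]] := RU_fin (sub0set (@unit_disk R)).
have mU := open_R2_measurable oU.
have low : lower_energy U rho.
  case: cases => [[Un [HUn [nu [nu0 [bn b0 wc]]]]]|[eps [e0 H]]].
    exact: balayage_accessible oU UD HUn bn b0 wc rho_near.
  apply: lower_energy_of => e /rho_near[mu [Jr [[K [cK KU muK]] JE Jle]]].
  exists mu, Jr, K, eps; split=> //; split=> //; exact: exterior_ball_accessible.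
rewrite Rempty_RU rhoE rho0E -EFinB.
apply: (hole_limit gin mU UD) => //.
- exact: upper_energy_RU.
- by apply: upper_energy_RU => //; exact: open0.
- exact: lower_energy_set0.
Qed.
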